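(* Let $E$ be a $k$-instanton bundle on $\mathbb{P}^3$ over $\mathbb{C}$. Then $\dim Z_k(E)\le1$. Moreover $E$ is special if and only if $\dim Z_k(E)=1$, and in this case $Z_k(E)$ is a smooth conic in $G(\mathbb{P}^1,\mathbb{P}^3)$.
   Context: A $k$-instanton bundle on $\mathbb{P}^3$ is a rank 2 algebraic vector bundle $E$ with $c_1(E)=0$, $c_2(E)=k$, which is stable (i.e. $h^0(E)=0$) and satisfies $h^1(E(-2))=0$; it is called special if $h^0(E(1))=2$. $G(\mathbb{P}^1,\mathbb{P}^3)$ is the Grassmannian of lines in $\mathbb{P}^3$, embedded as the Plücker quadric in $\mathbb{P}^5$. $Z_k(E)$ is the closed subscheme of $G(\mathbb{P}^1,\mathbb{P}^3)$ of lines $l$ with $E_{|l}\simeq\mathcal{O}_l(-i)\oplus\mathcal{O}_l(i)$ for some $i\ge k$. Its scheme structure: $E$ is the cohomology of a monad $\mathcal{O}(-1)^k\to\mathcal{O}^{2k+2}\xrightarrow{A}\mathcal{O}(1)^k$ whose first map is the transpose of $A=\sum_{i=0}^3A_ix_i$ with respect to a nondegenerate skew form $J$ (so $AJA^t=0$), and $Z_k(E)$ is cut out on the Plücker quadric by the linear equations $\sum_{i<j}p_{ij}A_iJA_j^t=0$.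
   Formalization: The formal theorem assumes k ≥ 2: for k = 1 the claim is false, since for a null-correlation bundle Z_1(E) is a hyperplane section of the Plücker quadric, of dimension 3; for k = 0 there is no stable bundle. *)

(* Defs.v *)
From HB Require Import structures.
From mathcomp Require Import all_boot all_order all_algebra.
From mathcomp Require Import mpoly.
From mathcomp Require Export reals complex.
Set Implicit Arguments.
Unset Strict Implicit.
Unset Printing Implicit Defensive.
Import GRing.Theory.
Local Open Scope ring_scope.

(* Algebraic vector bundles on P^3 are given by cocycles on an affine open
   cover by sets D_+(f).  All local sections live in the fraction field of the
   homogeneous coordinate ring S = C[x_0, .., x_3]. *)

Section Bundles.
Variable C : fieldType.
Local Notation S := {mpoly C[4]}.
Local Notation K := {fraction {mpoly C[4]}}.

Definition toK (p : S) : K := tofrac p.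
Definition cstK (c : C) : K := toK c%:MP.

(* loc f n x : x lies in the degree n part of S_f (f homogeneous, f <> 0);
   this part is Gamma(D_+(f), O(n)) when deg f > 0, and it is S_n for f = 1. *)
Definition loc (f : S) (n : int) (x : K) : Prop :=
  exists (N d e : nat) (p : S),
    [/\ f \is d.-homog, p \is e.-homog, (e%:Z = n + (N * d)%:Z)%R
      & x = toK p / toK (f ^+ N)].

Definition mloc (f : S) (n : int) (p q : nat) (M : 'M[K]_(p, q)) : Prop :=
  forall i j, loc f n (M i j).

(* A rank 2 algebraic vector bundle on P^3.  The sets D_+(fchart a) cover P^3
   as soon as the fchart a generate an ideal containing a power of each x_i.
   A section over an open subset of D_+(fchart a) is a column in the frame of
   chart a, and s_a = trans a b *m s_b changes frames. *)
Record bundle2 := Bundle2 {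
  ncharts : nat;
  fchart : 'I_ncharts -> S;
  trans : 'I_ncharts -> 'I_ncharts -> 'M[K]_2;
  fchart_neq0 : forall a, fchart a != 0;
  fchart_homog : forall a, exists2 d : nat, (0 < d)%N & fchart a \is d.-homog;
  fchart_cover : forall i : 'I_4, exists (N : nat) (h : 'I_ncharts -> S),
    'X_i ^+ N = \sum_a h a * fchart a;
  trans_loc : forall a b, mloc (fchart a * fchart b) 0 (trans a b);
  trans_id : forall a, trans a a = 1%:M;
  trans_cocycle : forall a b c, trans a b *m trans b c = trans a c
}.

(* The C-subspace Z modulo the subspace B has dimension d. *)
Definition quot_dim (V : lmodType K) (Z B : V -> Prop) (d : nat) : Prop :=
  exists b : 'I_d -> V,
    (forall i, Z (b i)) /\
    (forall z, Z z ->
       exists! c : 'rV[C]_d, B (z - \sum_i cstK (c 0 i) *: b i)).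

(* Cech cohomology of E(n) on the affine cover by the charts: it computes sheaf
   cohomology.  The value of a 1-cochain at (a, b) is written in the frame of
   chart a. *)
Section Cohomology.
Variables (E : bundle2) (n : int).
Local Notation I := 'I_(ncharts E).

Definition cochain0 (s : {ffun I -> 'cV[K]_2}) : Prop :=
  forall a, mloc (fchart a) n (s a).

Definition is_section (s : {ffun I -> 'cV[K]_2}) : Prop :=
  cochain0 s /\ (forall a b, s a = trans a b *m s b).

Definition cocycle1 (s : {ffun I * I -> 'cV[K]_2}) : Prop :=
  (forall a b, mloc (fchart a * fchart b) n (s (a, b))) /\
  (forall a b c, s (a, c) = s (a, b) + trans a b *m s (b, c)).

Definition coboundary1 (s : {ffun I * I -> 'cV[K]_2}) : Prop :=
  exists2 t, cochain0 t & forall a b, s (a, b) = trans a b *m t b - t a.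

Definition has_h0 (d : nat) : Prop := quot_dim is_section (fun s => s = 0) d.
Definition has_h1 (d : nat) : Prop := quot_dim cocycle1 coboundary1 d.
End Cohomology.

(* Chern classes of E by the Whitney formula, from a finite resolution
     0 -> F_{N-1} -> ... -> F_1 -> F_0 -> E -> 0,
   F_q = sum over j of O(deg q j), the Chow ring being Z[h]/(h^4).  The map
   F_{q+1} -> F_q has matrix D q, and F_0 -> E has matrix eps a in chart a. *)
Definition has_chern_classes (E : bundle2) (c1 c2 : int) : Prop :=
  exists (N : nat) (rk : nat -> nat) (deg : forall q, 'I_(rk q) -> int)
    (D : forall q, 'M[K]_(rk q, rk q.+1))
    (eps : 'I_(ncharts E) -> 'M[K]_(2, rk 0)),
  let Fsec (f : S) q n (v : 'cV[K]_(rk q)) :=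
    forall j, loc f (n + deg q j) (v j 0) in
  let ct q : {poly int} := \prod_j (1 + (deg q j)%:P * 'X) in
  [/\ (forall q, (N <= q)%N -> rk q = 0%N),
      (forall q i j, loc 1 (deg q i - deg q.+1 j) (D q i j)),
      (forall a i j, loc (fchart a) (- deg 0%N j) (eps a i j)) /\
      (forall a b, eps a = trans a b *m eps b),
      (forall a n,
        [/\ (forall s, mloc (fchart a) n s ->
               exists2 v, Fsec (fchart a) 0%N n v & s = eps a *m v),
            (forall v, Fsec (fchart a) 0%N n v ->
               (eps a *m v = 0 <->
                exists2 w, Fsec (fchart a) 1%N n w & v = D 0%N *m w))
          & (forall q v, Fsec (fchart a) q.+1 n v ->
               (D q *m v = 0 <->
                exists2 w, Fsec (fchart a) q.+2 n w & v = D q.+1 *m w))])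
    & take_poly 4 (\prod_(q < N | ~~ odd q) ct q) =
      take_poly 4 ((1 + c1%:P * 'X + c2%:P * 'X^2)
                   * \prod_(q < N | odd q) ct q)].

Definition instanton (k : nat) (E : bundle2) : Prop :=
  [/\ has_chern_classes E 0 k%:Z, has_h0 E 0 0 & has_h1 E (-2) 0].

Definition special (E : bundle2) : Prop := has_h0 E 1 2.

Section Monad.
Variables (k : nat) (A : 'I_4 -> 'M[C]_(k, 2 * k + 2)) (J : 'M[C]_(2 * k + 2)).

Definition monad_snd : 'M[K]_(k, 2 * k + 2) :=
  \sum_i toK 'X_i *: map_mx cstK (A i).
Definition monad_fst : 'M[K]_(2 * k + 2, k) :=
  map_mx cstK J *m monad_snd^T.

(* E is the cohomology ker(A) / im(J A^t) of the monad
     O(-1)^k --J A^t--> O^(2k+2) --A--> O(1)^k.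
   The columns of L a are lifts to ker(A) of the frame of E in chart a. *)
Definition monad_of (E : bundle2) : Prop :=
  [/\ J^T = - J /\ J \in unitmx,
      monad_snd *m monad_fst = 0,
      (forall x : 'rV[C]_4, x != 0 -> \rank (\sum_i x 0 i *: A i)%R = k)
    & exists L : 'I_(ncharts E) -> 'M[K]_(2 * k + 2, 2),
      [/\ (forall a, mloc (fchart a) 0 (L a) /\ monad_snd *m L a = 0),
          (forall a b, exists2 W : 'M[K]_(k, 2),
             mloc (fchart a * fchart b) (-1) W
             & L b = L a *m trans a b + monad_fst *m W)
        & (forall a n (v : 'cV[K]_(2 * k + 2)),
             mloc (fchart a) n v -> monad_snd *m v = 0 ->
             exists! sw : 'cV[K]_2 * 'cV[K]_k,
               [/\ mloc (fchart a) n sw.1, mloc (fchart a) (n - 1) sw.2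
                 & v = L a *m sw.1 + monad_fst *m sw.2])]].
End Monad.
End Bundles.

(* Closed subschemes of P^5 are given by a finite list of homogeneous
   generators of an ideal of C[p_01, p_02, p_03, p_12, p_13, p_23]. *)
Section Subschemes.
Variable C : fieldType.
Local Notation P := {mpoly C[6]}.

Definition in_ideal (s : seq P) (p : P) : Prop :=
  exists c : 'I_(size s) -> P, p = \sum_i c i * s`_i.

Definition in_sat (s : seq P) (p : P) : Prop :=
  exists N : nat, forall i : 'I_6, in_ideal s ('X_i ^+ N * p).

Definition same_subscheme (s t : seq P) : Prop :=
  forall p, in_sat s p <-> in_sat t p.

(* Points of the scheme Proj (C[p] / (s)). *)
Definition proj_point (s : seq P) (Q : P -> Prop) : Prop :=
  [/\ [/\ Q 0, (forall p q, Q p -> Q q -> Q (p + q))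
        & (forall p q, Q q -> Q (p * q))],
      ~ Q 1 /\ (forall p q, Q (p * q) -> Q p \/ Q q),
      (forall p d, Q p -> Q (pihomog mdeg d p)),
      ~ (forall i : 'I_6, Q 'X_i)
    & forall p, p \in s -> Q p].

Definition proj_chain (s : seq P) (d : nat) : Prop :=
  exists Q : nat -> P -> Prop,
    (forall i, (i <= d)%N -> proj_point s (Q i)) /\
    (forall i, (i < d)%N ->
       (forall p, Q i p -> Q i.+1 p) /\ exists2 p, Q i.+1 p & ~ Q i p).

(* Krull dimension; the empty scheme satisfies dim_le s d for all d. *)
Definition dim_le (s : seq P) (d : nat) : Prop := ~ proj_chain s d.+1.
Definition dim_eq (s : seq P) (d : nat) : Prop := proj_chain s d /\ dim_le s d.

(* A plane section of a quadric, smooth by the Jacobian criterion. *)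
Definition smooth_conic (s : seq P) : Prop :=
  exists (M : 'M[C]_(3, 6)) (q : P),
    let t := rcons [seq \sum_j M i j *: 'X_j | i <- enum 'I_3] q in
    [/\ \rank M = 3%N, q \is 2.-homog, same_subscheme s t
      & forall x : 'I_6 -> C, (exists i, x i != 0) ->
          (forall p, p \in t -> p.@[x] = 0) ->
          \rank (\matrix_(i < 4, j < 6) (mderiv j t`_i).@[x])%R = 4%N].

(* Position of p_ij, for i < j, in the list p_01, p_02, p_03, p_12, p_13, p_23;
   on the line through x and y, p_ij = x_i y_j - x_j y_i. *)
Definition pl_idx (i j : 'I_4) : 'I_6 :=
  inord (if i == 0%N :> nat then j.-1 else (i + j)%N).

Definition pl (i j : nat) : P := 'X_(pl_idx (inord i) (inord j)).

Definition pluecker : P := pl 0 1 * pl 2 3 - pl 0 2 * pl 1 3 + pl 0 3 * pl 1 2.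

Definition jump_entry (k : nat) (A : 'I_4 -> 'M[C]_(k, 2 * k + 2))
    (J : 'M[C]_(2 * k + 2)) (u v : 'I_k) : P :=
  \sum_(i < 4) \sum_(j < 4 | (i < j)%N)
    (A i *m J *m (A j)^T) u v *: 'X_(pl_idx i j).

Definition Zk (k : nat) (A : 'I_4 -> 'M[C]_(k, 2 * k + 2))
    (J : 'M[C]_(2 * k + 2)) : seq P :=
  pluecker :: [seq jump_entry A J u v | u <- enum 'I_k, v <- enum 'I_k].
End Subschemes.

(* Main.v *)
Require Import Defs.
From HB Require Import structures.
From mathcomp Require Import all_boot all_order all_algebra.
From mathcomp Require Import reals complex.
From mathcomp Require Import boolp perm spectral mpoly.
From mathcomp Require Import ring zify.
Set Implicit Arguments.
Unset Strict Implicit.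
Unset Printing Implicit Defensive.
Import GRing.Theory Num.Theory.
Local Open Scope ring_scope.

(* Write A(x) for the pencil of the monad, an isotropic family for J, and
   Lam(x, y) = A(x) J A(y)^t.  The linear span of Z_k is the jump space
   W = {p | sum p_ij A_i J A_j^t = 0}.

   - By the monad, the sections of E(1) are the linear maps x |-> x sg with values
     in A(x)^perp, modulo the trivial ones x |-> w A(x); this uses H^0(O(n)) and
     H^1(O) = 0 on P^3 only.  The vanishing of H^0(E) says that no nonzero vector
     lies in all the A(x)^perp.
   - No x, y, z independent satisfy Lam(x, y) = Lam(x, z) = 0.  Hence W contains
     no plane isotropic for the Pluecker form, so rank W <= 3, and when rank W = 3
     the Pluecker form is nondegenerate on W: Z_k is a smooth conic.  When
     rank W <= 2, Z_k is supported on finitely many points.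
   - Two sections s1, s2 define a quadratic form x |-> (x s1) J (x s2)^t on C^4.
     If they form a basis modulo the trivial ones, this form vanishes on no
     hyperplane.  Reducing A with respect to a hyperbolic pair for it gives
     commuting pencils, whose rigidity produces a conic frame: independent
     x0, x1, y0, y1 with Lam(x0, x1) = Lam(y0, y1) = 0 and
     Lam(x0, y1) + Lam(y0, x1) = 0.  Such a frame puts three independent vectors
     in W.
   - Conversely, rank W = 3 gives a conic frame, in which the isotropy equations
     can be solved explicitly, and the sections modulo the trivial ones have
     dimension 2. *)

(** * Pencils of matrices *)

(** The nondegeneracy at hand is pointwise: w A(x) = 0 with x nonzero forces w = 0. Contradictions
    are reached by producing such a w. In a degenerate configuration A(y) acts, through A(x), on a
    space of coefficient vectors, and an eigenvector w for the eigenvalue c satisfies w A(y - c x) =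
    0; the side conditions read w e = 0 for a fixed column e. Hence the eigenvector and
    observability lemmas on pencils.

    The difficult implication goes from two sections to jumping lines. A section s adjoins to A(x)
    the row x s, which turns isotropic spaces of dimension k into Lagrangian ones of dimension k +
    1. Two transversal Lagrangians serve as coordinates, in which isotropy of the family becomes
    commutation of square matrices, while the second section prescribes, through the quadratic form,
    how products of these matrices act on the column e marking the adjoined row.

    The bound k > 1 enters through sizes: a pencil of size k needs a nonconstant Krylov determinant,
    a k by k + 1 pencil must have no linear kernel vector, and k + 1 > 2 excludes a degenerate
    quadratic form. *)

Section DetDegree.
Variable F : fieldType.

Lemma prod_poly_top (I : finType) (P : I -> {poly F}) (d : I -> nat) :
  (forall i, (size (P i) <= (d i).+1)%N) ->
  (size (\prod_i P i)%R <= (\sum_i d i).+1)%N /\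
  (\prod_i P i)`_(\sum_i d i) = \prod_i (P i)`_(d i).
Proof.
move=> hP; rewrite -![index_enum I]/(index_enum I).
elim: (index_enum I) => [|i r [IH1 IH2]].
  by rewrite !big_nil size_poly1 coef1.
rewrite !big_cons; split.
  apply: leq_trans (size_polyMleq _ _) _.
  have := leq_add (hP i) IH1; rewrite addSn addnS => h.
  by rewrite -subn1 leq_subLR add1n.
rewrite coefM (bigD1 (inord (d i) : 'I_(d i + \sum_(j <- r) d j).+1)) //=.
rewrite inordK ?ltnS ?leq_addr // addKn IH2 [X in _ + X]big1 ?addr0 // => j hj.
have [lt|gt|eq] := ltngtP j (d i).
- rewrite [X in _ * X]nth_default ?mulr0 //.
  apply: leq_trans IH1 _; rewrite -addnBAC ?(ltnW lt) // -addn1 addnC leq_add2r.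
  by rewrite subn_gt0.
- by rewrite nth_default ?mul0r //; apply: leq_trans (hP i) gt.
- by case/eqP: hj; apply/val_inj; rewrite /= inordK ?ltnS ?leq_addr.
Qed.

(** All permutations give products with the same degree bound, the sum of all [r i] and [c j]. The
    coefficient at this bound is the value at infinity of the determinant, seen as a binary form of
    that degree. *)
Lemma det_poly_top n (M : 'M[{poly F}]_n) (r c : 'I_n -> nat) :
  (forall i j, (size (M i j) <= (r i + c j).+1)%N) ->
  (size (\det M) <= (\sum_i r i + \sum_i c i).+1)%N /\
  (\det M)`_(\sum_i r i + \sum_i c i)
    = \det (\matrix_(i, j) (M i j)`_(r i + c j)).
Proof.
move=> hM.
have hs (s : 'S_n) : (\sum_i (r i + c (s i)) = \sum_i r i + \sum_i c i)%N.
  rewrite big_split /=; congr addn.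
  by rewrite [RHS](reindex_inj (@perm_inj _ s)).
have hp (s : 'S_n) := @prod_poly_top _ (fun i => M i (s i)) _ (fun i => hM i (s i)).
have sg (s : 'S_n) (p : {poly F}) :
    (-1) ^+ s * p = ((-1) ^+ s : F) *: p.
  by case: (odd_perm s); rewrite ?(expr0, expr1) ?(mulN1r, scaleN1r) ?(mul1r, scale1r).
split.
  apply: (leq_trans (size_sum _ _ _)); apply/bigmax_leqP => s _.
  rewrite sg; apply: (leq_trans (size_scale_leq _ _)).
  by have [h _] := hp s; rewrite -(hs s).
rewrite /determinant coef_sum; apply: eq_bigr => s _.
rewrite sg coefZ; have [_] := hp s; rewrite (hs s) => ->.
by congr (_ * _); apply: eq_bigr => i _; rewrite mxE.
Qed.
End DetDegree.

(** * Common eigenvectors and Krylov determinants *)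

Section Eigen.
Variable F : numClosedFieldType.

(** The matrices commute only on [U], so they are first restricted to it: [X A] is the matrix of [A]
    in the basis [row_base U], and these restrictions do commute. *)
Lemma stable_common_eigenvector n m (U : 'M[F]_(m, n)) (As : seq 'M[F]_n) :
  U != 0 -> {in As, forall A, (U *m A <= U)%MS} ->
  {in As &, forall A B, U *m A *m B = U *m B *m A} ->
  exists w : 'rV_n, [/\ w != 0, (w <= U)%MS
    & {in As, forall A, exists l, w *m A = l *: w}].
Proof.
move=> U0 Ust Uco.
pose B := row_base U; have Bf : row_free B by exact: row_base_free.
have BU : (B <= U)%MS by rewrite eq_row_base.
pose X A := B *m A *m pinvmx B.
have XE A : A \in As -> X A *m B = B *m A.
  move=> hA; rewrite /X mulmxKpV // eq_row_base.
  by apply: submx_trans (Ust _ hA); apply: submxMr.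
have BC A C : A \in As -> C \in As -> B *m A *m C = B *m C *m A.
  move=> hA hC; have /submxP[Y ->] := BU.
  by rewrite -!mulmxA !(mulmxA U) Uco.
have rk : (0 < \rank U)%N by rewrite lt0n mxrank_eq0.
have [|v v0 /allP vP] := @common_eigenvector F _ [seq X A | A <- As] rk.
  move=> _ _ /mapP[A hA ->] /mapP[C hC ->].
  apply: (row_free_inj Bf) => /=.
  rewrite -(mulmxA (X A)) -(mulmxA (X C)) !XE // (mulmxA (X A)) (mulmxA (X C)).
  by rewrite !XE //; apply: BC.
exists (v *m B); split.
- by rewrite mulmx_free_eq0.
- exact: mulmx_sub.
- move=> A hA; have hX : X A \in [seq X A0 | A0 <- As] by apply/mapP; exists A.
  have /sub_rVP[l hl] : (v *m X A <= v)%MS := vP _ hX; exists l.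
  by rewrite -mulmxA -XE // mulmxA hl scalemxAl.
Qed.

Lemma stable_eigenvector n m (U : 'M[F]_(m, n)) (A : 'M[F]_n) :
  U != 0 -> (U *m A <= U)%MS ->
  exists (w : 'rV_n) l, [/\ w != 0, (w <= U)%MS & w *m A = l *: w].
Proof.
move=> U0 hU; have [||w [w0 wU /(_ A)]] :=
  @stable_common_eigenvector _ _ U [:: A] U0.
- by move=> B; rewrite inE => /eqP->.
- by move=> B C; rewrite !inE => /eqP-> /eqP->.
by rewrite mem_head => /(_ isT)[l wA]; exists w, l.
Qed.

(** Cayley-Hamilton: modulo the characteristic polynomial, every power of [M] is a combination of
    the first [n]. *)
Lemma iter_mulmx_comb n (M : 'M[F]_n) (l : 'cV[F]_n) (w : 'rV_n) :
  (forall i, (i < n)%N -> w *m iter i (mulmx M) l = 0) ->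
  forall i, w *m iter i (mulmx M) l = 0.
Proof.
case: n M l w => [|n] M l w hw; first by move=> i; rewrite thinmx0 mul0mx.
have itE i : iter i (mulmx M) l = M ^+ i *m l.
  by elim: i => [|i IH] /=; rewrite ?expr0 ?mul1mx // IH exprS mulmxA.
have hp (p : {poly F}) : (size p <= n.+1)%N -> w *m (horner_mx M p *m l) = 0.
  move=> sp; rewrite -[p]coefK poly_def rmorph_sum /= mulmx_suml mulmx_sumr.
  apply: big1 => j _; rewrite linearZ /= rmorphXn /= horner_mx_X.
  rewrite -scalemxAl -scalemxAr -itE hw ?scaler0 //.
  exact: leq_trans (ltn_ord j) sp.
move=> i; rewrite itE -[M](horner_mx_X M) -rmorphXn /=.
rewrite (divp_eq 'X^i (char_poly M)) rmorphD rmorphM /= Cayley_Hamilton mulr0.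
rewrite add0r hp // -ltnS -(size_char_poly M) ltn_modp.
by rewrite -size_poly_eq0 size_char_poly.
Qed.

(** The row vectors killing all [M ^+ i *m l] form an [M]-stable space, nonzero because of [w]; an
    eigenvector in it kills [l]. This is the Hautus test of observability. *)
Lemma krylov_eigenvector n (M : 'M[F]_n) (l : 'cV[F]_n) (w : 'rV_n) :
  w != 0 -> (forall i, (i < n)%N -> w *m iter i (mulmx M) l = 0) ->
  exists (v : 'rV_n) c, [/\ v != 0, v *m M = c *: v & v *m l = 0].
Proof.
move=> w0 hw; have {}hw := iter_mulmx_comb hw.
pose K : 'M[F]_n := \matrix_(i, j) iter j (mulmx M) l i 0.
have KE (v : 'rV_n) j : (v *m K) 0 j = (v *m iter j (mulmx M) l) 0 0.
  by rewrite !mxE; apply: eq_bigr => k _; rewrite !mxE.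
have K0 (v : 'rV_n) : v *m K = 0 <->
    forall i, (i < n)%N -> v *m iter i (mulmx M) l = 0.
  split=> [h i hi|h].
    apply/rowP => j; rewrite ord1 [RHS]mxE.
    by rewrite -(KE v (Ordinal hi)) h mxE.
  by apply/rowP => j; rewrite KE h // !mxE.
have ker (v : 'rV_n) : (v <= kermx K)%MS <->
    forall i, (i < n)%N -> v *m iter i (mulmx M) l = 0.
  by split=> [/sub_kermxP/K0//|h]; apply/sub_kermxP/K0.
have U0 : kermx K != 0.
  apply: contraNneq w0 => kz; have /ker : forall i, (i < n)%N ->
    w *m iter i (mulmx M) l = 0 by move=> i _.
  by rewrite kz submx0.
have [|v [c [v0 vU vM]]] := stable_eigenvector (A := M) U0.
  apply/row_subP => i; rewrite row_mul; apply/ker => j _.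
  rewrite -mulmxA -[M *m _]/(iter j.+1 (mulmx M) l).
  by apply: iter_mulmx_comb; apply/ker; apply: row_sub.
exists v, c; split=> //.
have [n0|n0] := posnP n; first by subst n; rewrite thinmx0 eqxx in v0.
exact: (iffLR (ker v) vU 0%N n0).
Qed.

(* The determinant of the columns [iter i (mulmx (s B + t C)) l] is a binary
   form of degree [n (n - 1) / 2] in [(s, t)]; it vanishes somewhere. *)
Lemma pencil_eigenvector n (B C : 'M[F]_n) (l : 'cV[F]_n) : (1 < n)%N ->
  exists (s t : F) (w : 'rV_n) c, [/\ (s != 0) || (t != 0), w != 0,
    w *m (s *: B + t *: C) = c *: w & w *m l = 0].
Proof.
move=> n1.
pose Mp := map_mx polyC B + 'X *: map_mx polyC C.
pose lp := map_mx (@polyC F) l.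
pose Kp : 'M[{poly F}]_n := \matrix_(i, j) iter j (mulmx Mp) lp i 0.
have kry (s t : F) : (s != 0) || (t != 0) ->
    \det (\matrix_(i, j < n) iter j (mulmx (s *: B + t *: C)) l i 0) = 0 ->
    exists (s t : F) (w : 'rV_n) c, [/\ (s != 0) || (t != 0), w != 0,
    w *m (s *: B + t *: C) = c *: w & w *m l = 0].
  move=> st /eqP/det0P[w w0 hw]; exists s, t.
  have [|v [c [v0 vM vl]]] := krylov_eigenvector (M := s *: B + t *: C) (l := l) w0.
    move=> i hi; apply/rowP => j; rewrite ord1.
    move/rowP/(_ (Ordinal hi)): hw; rewrite [RHS]mxE => hw.
    rewrite [RHS]mxE -[RHS]hw !mxE.
    by apply: eq_bigr => k _; rewrite !mxE.
  by exists v, c.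
have itE (t : F) i : map_mx (horner_eval t) (iter i (mulmx Mp) lp)
    = iter i (mulmx (1 *: B + t *: C)) l.
  elim: i => [|i IH] /=.
    by apply/matrixP => a b; rewrite !mxE /horner_eval hornerC.
  rewrite map_mxM IH; congr (_ *m _); apply/matrixP => a b.
  by rewrite !mxE /= /horner_eval !hornerE.
have szco i : forall a b, (size (iter i (mulmx Mp) lp a b) <= i.+1)%N /\
    (iter i (mulmx Mp) lp a b)`_i = iter i (mulmx C) l a b.
  elim: i => [|i IH] a b /=.
    by rewrite !mxE size_polyC coefC eqxx; split=> //; case: eqP.
  rewrite !mxE.
  have sM k : (size (Mp a k) <= 2)%N.
    rewrite !mxE; apply: leq_trans (size_polyD _ _) _.
    rewrite geq_max; apply/andP; split.
      by apply: leq_trans (size_polyC_leq1 _) _.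
    apply: leq_trans (size_polyMleq _ _) _; rewrite size_polyX /=.
    by rewrite ltnS size_polyC_leq1.
  split.
    apply: (leq_trans (size_sum _ _ _)); apply/bigmax_leqP => k _.
    apply: leq_trans (size_polyMleq _ _) _.
    by have := leq_add (sM k) (proj1 (IH k b)); rewrite -subn1 leq_subLR.
  rewrite coef_sum; apply: eq_bigr => k _.
  rewrite -(proj2 (IH k b)) !mxE mulrDl coefD.
  rewrite coefCM -mulrA coefXM /= coefCM.
  by rewrite [X in _ * X + _]nth_default ?(proj1 (IH k b)) // mulr0 add0r.
have [|sz top] := @det_poly_top _ _ Kp (fun=> 0%N) (fun j => val j).
  by move=> i j; rewrite !mxE add0n (proj1 (szco j i 0)).
(* The top coefficient of [\det Kp] is the Krylov determinant of [C]: if it vanishes, the zero of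
   the form is at infinity, (s, t) = (0, 1). *)
have [/eqP d0|d0] := boolP (\det (\matrix_(i, j < n) iter j (mulmx C) l i 0) == 0).
  apply: (kry 0 1); first by rewrite oner_eq0 orbT.
  rewrite -[RHS]d0; congr (\det _); apply/matrixP => i j; rewrite !mxE.
  by rewrite scale0r add0r scale1r.
(* Otherwise the determinant has degree exactly n (n - 1) / 2, positive since [1 < n], and there is
   a root. *)
have [|t /rootP rt] := closed_rootP (\det Kp) _.
  rewrite neq_ltn; apply/orP; right.
  apply: (leq_trans (n := (\sum_(i < n) 0 + \sum_(j < n) val j).+1)).
    rewrite ltnS big1 // add0n (bigD1 (Ordinal n1)) //=.
  rewrite ltnNge; apply/negP => /leq_sizeP/(_ _ (leqnn _)).
  rewrite top => hd; case/eqP: d0; rewrite -[RHS]hd.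
  by congr (\det _); apply/matrixP => i j; rewrite !mxE (proj2 (szco j i 0)).
apply: (kry 1 t); first by rewrite oner_eq0.
rewrite -rt -[_.[t]]/(horner_eval t _) -det_map_mx; congr (\det _).
apply/matrixP => i j; rewrite mxE -itE !mxE.
by [].
Qed.
End Eigen.

(** * Rigidity of commuting pencils *)

Section Rigidity.
Variable F : numClosedFieldType.

Lemma poly_nat_roots (P : {poly F}) : (forall n : nat, P.[n.+1%:R] = 0) -> P = 0.
Proof.
move=> h; apply: (@roots_geq_poly_eq0 _ P [seq i.+1%:R | i <- iota 0 (size P)]).
- by apply/allP => _ /mapP[i _ ->]; apply/rootP.
- rewrite map_inj_uniq ?iota_uniq // => i j /eqP.
  by rewrite eqr_nat eqSS => /eqP.
- by rewrite size_map size_iota.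
Qed.

(** A function regular at zero and at infinity is constant. Multiplying by the power m of t turns
    Q(1/t) into a polynomial of degree at most m, and the identity at all positive integers makes it
    an identity of polynomials. *)
Lemma poly_inv_const (P Q : {poly F}) :
  (forall t, t != 0 -> P.[t] = Q.[t^-1]) -> P = (P`_0)%:P.
Proof.
move=> h; apply: size1_polyC; rewrite leqNgt; apply/negP => hs.
pose m := size Q.
pose S := \sum_(j < m) Q`_j *: 'X^(m - j).
have /eqP : 'X^m * P - S = 0.
  apply: poly_nat_roots => n; set t : F := _%:R.
  have t0 : t != 0 by rewrite pnatr_eq0.
  rewrite !hornerE h // horner_coef mulr_sumr horner_sum -sumrB big1 // => j _.
  have -> : t ^+ m = t ^+ (m - j) * t ^+ j.
    by rewrite -exprD subnK // ltnW.
  rewrite !hornerE exprVn /= mulrAC mulfK ?expf_neq0 //.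
  by rewrite [X in _ - X]mulrC subrr.
rewrite subr_eq0 => /eqP E.
have P0 : P != 0 by rewrite -size_poly_gt0 (ltn_trans _ hs).
have : (size ('X^m * P)%R <= m.+1)%N.
  rewrite E; apply: leq_trans (size_sum _ _ _) _; apply/bigmax_leqP => j _.
  apply: leq_trans (size_scale_leq _ _) _; rewrite size_polyXn ltnS.
  exact: leq_subr.
rewrite mulrC size_mulXn // -[m.+1]addn1 leq_add2l leqNgt.
by rewrite hs.
Qed.

(** For commuting [a] and [b] this is the Hautus form of joint observability, equivalent to the
    words in [a], [b] applied to [e] spanning the space. *)
Definition observable n (a b : 'M[F]_n) (e : 'cV[F]_n) :=
  forall (w : 'rV_n) c d, w != 0 -> w *m a = c *: w -> w *m b = d *: w ->
    w *m e != 0.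

(** The row space of [X] is stable under [a] and [b]; if nonzero it contains a joint eigenvector w =
    y X, and w e = y X e = 0. *)
Lemma observable_comm_eq0 n (a b X : 'M[F]_n) e : observable a b e ->
  a *m b = b *m a -> X *m a = a *m X -> X *m b = b *m X -> X *m e = 0 -> X = 0.
Proof.
move=> obs ab Xa Xb Xe; apply/eqP; apply: contraT => X0.
have [||w [w0 /submxP[y wy] wE]] := @stable_common_eigenvector F n n X [:: a; b] X0.
- by move=> M; rewrite !inE => /orP[] /eqP->; rewrite ?Xa ?Xb submxMl.
- by move=> M M'; rewrite !inE => /orP[] /eqP-> /orP[] /eqP->;
    rewrite -?mulmxA ?ab.
have [c wa] := wE a (mem_head _ _).
have [|d wb] := wE b; first by rewrite !inE eqxx orbT.
by have := obs w c d w0 wa wb; rewrite wy -mulmxA Xe mulmx0 eqxx.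
Qed.

(** The row vectors killing all words form a stable space, where a joint eigenvector would
    contradict observability. Exponents below [n] suffice by Cayley-Hamilton, so the words are the
    rows of a finite matrix indexed by [l %/ n] and [l %% n], from which a basis is extracted. *)
Lemma observable_words n (a b : 'M[F]_n) e : observable a b e ->
  a *m b = b *m a ->
  exists i j : 'I_n -> nat,
    \det (\matrix_(r, l) iter (i l) (mulmx a) (iter (j l) (mulmx b) e) r 0) != 0.
Proof.
move=> obs ab.
pose K : 'M[F]_(n * n, n) :=
  \matrix_(l, r) iter (l %/ n) (mulmx a) (iter (l %% n) (mulmx b) e) r 0.
have KE (w : 'rV_n) l : (w *m K^T) 0 l =
    (w *m iter (l %/ n) (mulmx a) (iter (l %% n) (mulmx b) e)) 0 0.
  by rewrite !mxE; apply: eq_bigr => k _; rewrite !mxE.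
have kerP (w : 'rV_n) : (w <= kermx K^T)%MS <->
    forall i j, w *m iter i (mulmx a) (iter j (mulmx b) e) = 0.
  split=> [/sub_kermxP h|h]; last first.
    by apply/sub_kermxP/rowP => l; rewrite KE h !mxE.
  have h1 i j : (i < n)%N -> (j < n)%N ->
      w *m iter i (mulmx a) (iter j (mulmx b) e) = 0.
    move=> hi hj; have hl : (i * n + j < n * n)%N.
      apply: (@leq_trans (i.+1 * n)); last by rewrite leq_mul2r hi orbT.
      by rewrite mulSn addnC ltn_add2r.
    have n0 : (0 < n)%N by exact: leq_ltn_trans hj.
    apply/rowP => z; rewrite ord1 [RHS]mxE.
    have := KE w (Ordinal hl); rewrite h [LHS]mxE /= => ->.
    by rewrite divnMDl // divn_small // addn0 modnMDl modn_small.
  have itA i (v : 'cV_n) : iter i (mulmx a) v = iter i (mulmx a) 1%:M *m v.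
    by elim: i => [|i IH] /=; rewrite ?mul1mx // IH mulmxA.
  move=> i j; have h2 j' i' : (j' < n)%N ->
      w *m iter i' (mulmx a) (iter j' (mulmx b) e) = 0.
    by move=> hj; apply: iter_mulmx_comb => i'' hi; apply: h1.
  rewrite itA mulmxA; apply: iter_mulmx_comb => j' hj.
  by rewrite -mulmxA -itA h2.
have comm j v : b *m iter j (mulmx a) v = iter j (mulmx a) (b *m v) :> 'cV_n.
  by elim: j => //= j <-; rewrite !mulmxA ab.
have Kfree : row_free K^T.
  rewrite -kermx_eq0; apply: contraT => K0.
  have [||w [w0 /kerP wK wE]] :=
    @stable_common_eigenvector F n n (kermx K^T) [:: a; b] K0.
  - move=> M hM; apply/row_subP => r; rewrite row_mul; apply/kerP => i j.
    have /kerP hr : (row r (kermx K^T) <= kermx K^T)%MS by apply: row_sub.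
    move: hM; rewrite !inE => /orP[] /eqP->.
      by rewrite -mulmxA -iterS.
    by rewrite -mulmxA comm -iterS.
  - by move=> M M'; rewrite !inE => /orP[] /eqP-> /orP[] /eqP->;
      rewrite -?mulmxA ?ab.
  have [c wa] := wE a (mem_head _ _).
  have [|d wb] := wE b; first by rewrite !inE eqxx orbT.
  by have := obs w c d w0 wa wb; rewrite (wK 0%N 0%N) eqxx.
have Kfull : row_full K by rewrite /row_full -mxrank_tr.
exists (fun l => fullrankfun Kfull l %/ n)%N, (fun l => fullrankfun Kfull l %% n)%N.
have := fullrowsub_unit Kfull; rewrite unitmxE unitfE -det_tr.
by congr (_ != 0); congr (\det _); apply/matrixP => r l; rewrite !mxE.
Qed.
End Rigidity.

Section RigidityOfPencils.
Variable F : numClosedFieldType.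

Definition pencil m n (a a' : 'M[F]_(m, n)) : 'M[{poly F}]_(m, n) :=
  map_mx polyC a + 'X *: map_mx polyC a'.

Lemma pencil_eval m n (a a' : 'M[F]_(m, n)) t :
  map_mx (horner_eval t) (pencil a a') = a + t *: a'.
Proof. by apply/matrixP => i j; rewrite !mxE /= /horner_eval !hornerE. Qed.

Lemma polyC_eval m n (a : 'M[F]_(m, n)) t :
  map_mx (horner_eval t) (map_mx polyC a) = a.
Proof. by apply/matrixP => i j; rewrite !mxE /= /horner_eval hornerC. Qed.

Lemma map_polyC_inj m n : injective (map_mx (polyC (R := F)) : 'M_(m, n) -> _).
Proof.
move=> a b /matrixP h; apply/matrixP => i j.
by have := h i j; rewrite !mxE => /polyC_inj.
Qed.

Lemma scale_mx_inj m n (p : {poly F}) : p != 0 ->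
  injective (fun A : 'M[{poly F}]_(m, n) => p *: A).
Proof.
move=> p0 A B /matrixP h; apply/matrixP => i j.
by have := h i j; rewrite !mxE => /(mulfI p0).
Qed.

Lemma eval_eq0_factor m n (N : 'M[{poly F}]_(m, n)) t :
  map_mx (horner_eval t) N = 0 ->
  exists N', N = ('X - t%:P) *: N'.
Proof.
move=> /matrixP h; exists (map_mx (fun p => p %/ ('X - t%:P)) N).
apply/matrixP => i j; have := h i j; rewrite !mxE => /eqP hr.
by rewrite mulrC divpK // dvdp_XsubCl.
Qed.

(** The denominator [p] is removed root by root. At a root t the matrix N(t) commutes with both
    pencils and kills [e], so it is zero by observability and [N] is divisible by X - t. *)
Lemma rigid_descent n (a b a' b' : 'M[F]_n) (e v : 'cV[F]_n) :
  (forall t, observable (a + t *: a') (b + t *: b') e) ->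
  pencil a a' *m pencil b b' = pencil b b' *m pencil a a' ->
  forall m (p : {poly F}) (N : 'M[{poly F}]_n), (size p <= m)%N -> p != 0 ->
    N *m pencil a a' = pencil a a' *m N -> N *m pencil b b' = pencil b b' *m N ->
    N *m map_mx polyC e = p *: map_mx polyC v ->
  exists f, [/\ f *m pencil a a' = pencil a a' *m f,
    f *m pencil b b' = pencil b b' *m f & f *m map_mx polyC e = map_mx polyC v].
Proof.
move=> obs ab; elim=> [|m IH] p N sp p0 Na Nb Ne.
  by rewrite leqn0 size_poly_eq0 (negPf p0) in sp.
have [/closed_rootP[t rt]|] := boolP (size p != 1%N); last first.
  rewrite negbK => /size_poly1P[c c0 pc].
  exists (c^-1%:P *: N); split; rewrite -?scalemxAl -?scalemxAr ?Na ?Nb //.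
  by rewrite Ne pc scalerA -polyCM mulVf // scale1r.
have Nt : map_mx (horner_eval t) N = 0.
  apply: (observable_comm_eq0 (obs t)).
  - by rewrite -!pencil_eval -!map_mxM ab.
  - by rewrite -!pencil_eval -!map_mxM Na.
  - by rewrite -!pencil_eval -!map_mxM Nb.
  rewrite -(polyC_eval e t) -map_mxM Ne; apply/matrixP => i j.
  by rewrite !mxE /= /horner_eval !hornerE (rootP rt) mul0r.
have [N' NE] := eval_eq0_factor Nt.
have /factor_theorem[q pq] := rt.
have X0 : 'X - t%:P != 0 :> {poly F} by rewrite polyXsubC_eq0.
have q0 : q != 0 by apply: contraNneq p0 => q0; rewrite pq q0 mul0r.
apply: (IH q N') => //.
- by move: sp; rewrite pq size_Mmonic ?monicXsubC // size_XsubC addn2.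
- by apply: (scale_mx_inj X0); rewrite /= scalemxAl scalemxAr -NE.
- by apply: (scale_mx_inj X0); rewrite /= scalemxAl scalemxAr -NE.
- by apply: (scale_mx_inj X0); rewrite /= scalemxAl -NE Ne pq scalerA mulrC.
Qed.

(** Cramer's rule solves the problem with denominator [\det P], where [P] has the columns
    [W l *m e]: the combination of the words [W l] with coefficients [\adj P *m v] commutes with
    both pencils and sends [e] to [\det P *: v]. *)
Lemma rigid_section n (a b a' b' : 'M[F]_n) (e v : 'cV[F]_n) :
  (forall t, observable (a + t *: a') (b + t *: b') e) ->
  pencil a a' *m pencil b b' = pencil b b' *m pencil a a' ->
  exists f, [/\ f *m pencil a a' = pencil a a' *m f,
    f *m pencil b b' = pencil b b' *m f & f *m map_mx polyC e = map_mx polyC v].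
Proof.
move=> obs ab; set at' := pencil a a'; set bt := pencil b b'.
have [|i [j ij]] := observable_words (obs 0).
  by rewrite -!pencil_eval -!map_mxM ab.
pose W l := iter (i l) (mulmx at') (iter (j l) (mulmx bt) 1%:M).
pose P : 'M[{poly F}]_n := \matrix_(r, l) (W l *m map_mx polyC e) r 0.
pose c := \adj P *m map_mx polyC v.
have itM k (M X Y : 'M[{poly F}]_n) : M *m Y = Y *m M -> X *m Y = Y *m X ->
    iter k (mulmx M) X *m Y = Y *m iter k (mulmx M) X.
  move=> MY XY; elim: k => //= k IH; by rewrite -mulmxA IH !mulmxA MY.
have Wa l : W l *m at' = at' *m W l.
  by apply: (itM) => //; apply: (itM); rewrite ?mul1mx ?mulmx1 ?ab.
have Wb l : W l *m bt = bt *m W l.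
  by apply: (itM) => //; apply: (itM); rewrite ?mul1mx ?mulmx1.
have NE : (\sum_l c l 0 *: W l) *m map_mx polyC e = \det P *: map_mx polyC v.
  have -> : \det P *: map_mx polyC v = P *m c.
    by rewrite mulmxA mul_mx_adj mul_scalar_mx.
  rewrite mulmx_suml; apply/colP => r; rewrite summxE [RHS]mxE.
  by apply: eq_bigr => l _; rewrite -scalemxAl !mxE mulrC.
apply: (rigid_descent obs ab (p := \det P) (leqnn _) _ _ _ NE).
(* [\det P] is nonzero since its value at 0 is the determinant given by [observable_words]. *)
- apply: contraNneq ij => P0; apply/eqP.
  have h : \det (map_mx (horner_eval 0) P) = 0 by rewrite det_map_mx P0 rmorph0.
  rewrite -[RHS]h; congr (\det _); apply/matrixP => r l; rewrite !mxE.
  have itE k (x x' : 'M[F]_n) (u : 'M[{poly F}]_n) :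
      map_mx (horner_eval 0) (iter k (mulmx (pencil x x')) u) =
      iter k (mulmx (x + 0 *: x')) (map_mx (horner_eval 0) u).
    by elim: k => //= k IH; rewrite map_mxM pencil_eval IH.
  have itV k (x : 'M[F]_n) (u : 'M[F]_n) (w : 'cV_n) :
      iter k (mulmx x) (u *m w) = iter k (mulmx x) u *m w.
    by elim: k => //= k ->; rewrite mulmxA.
  rewrite -[e in LHS]mul1mx !itV.
  have -> : 1%:M = map_mx (horner_eval 0) (1%:M : 'M[{poly F}]_n).
    by rewrite map_mx1.
  rewrite -!itE -[e in LHS](polyC_eval e 0) -map_mxM.
  by rewrite mxE /W mxE.
- by rewrite mulmx_suml mulmx_sumr; apply: eq_bigr => l _;
    rewrite -scalemxAl -scalemxAr Wa.
- by rewrite mulmx_suml mulmx_sumr; apply: eq_bigr => l _;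
    rewrite -scalemxAl -scalemxAr Wb.
Qed.

(* For each [v], the matrix [f] commuting with [a + t a'], [b + t b'] and such
   that [f e = v] is polynomial in [t] and also in [1 / t]: it is constant. *)
Lemma rigidity n (a b a' b' : 'M[F]_n) (e : 'cV[F]_n) :
  a *m b = b *m a -> a' *m b' = b' *m a' ->
  a *m b' + a' *m b = b *m a' + b' *m a ->
  (forall s t, (s != 0) || (t != 0) ->
     observable (s *: a + t *: a') (s *: b + t *: b') e) ->
  (a *m a' = a' *m a /\ a *m b' = b' *m a) /\
  (b *m a' = a' *m b /\ b *m b' = b' *m b).
Proof.
move=> ab ab' mix obs.
have mulE (x y x' y' : 'M[F]_n) : pencil x x' *m pencil y y' =
    map_mx polyC (x *m y) + 'X *: map_mx polyC (x *m y' + x' *m y)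
    + ('X * 'X) *: map_mx polyC (x' *m y').
  rewrite /pencil !mulmxDl !mulmxDr -!scalemxAl -!scalemxAr !map_mxD !map_mxM.
  by rewrite scalerA scalerDr !addrA.
have comm (x y x' y' : 'M[F]_n) : x *m y = y *m x -> x' *m y' = y' *m x' ->
    x *m y' + x' *m y = y *m x' + y' *m x ->
    pencil x x' *m pencil y y' = pencil y y' *m pencil x x'.
  by move=> xy xy' h; rewrite !mulE xy xy' h.
have const v : exists f : 'M[F]_n, [/\ f *m a = a *m f, f *m b = b *m f,
    f *m a' = a' *m f, f *m b' = b' *m f & f *m e = v].
  have obs1 t : observable (a + t *: a') (b + t *: b') e.
    by have := obs 1 t; rewrite !scale1r oner_eq0; apply.
  have obs2 t : observable (a' + t *: a) (b' + t *: b) e.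
    by have := obs t 1; rewrite !scale1r oner_eq0 orbT !(addrC (t *: _)); apply.
  (* [f] solves the problem in the coordinate t and [g] in the coordinate 1 / t. Uniqueness at each
     nonzero t, again by observability, gives f(t) = g(1/t). *)
  have [f [fa fb fe]] := rigid_section v obs1 (comm _ _ _ _ ab ab' mix).
  have [|g [ga gb ge]] := rigid_section v obs2 (comm _ _ _ _ ab' ab _).
    by rewrite addrC mix addrC.
  have fcst : f = map_mx polyC (map_mx (fun p : {poly F} => p`_0) f).
    apply/matrixP => i j; rewrite !mxE; apply: (@poly_inv_const _ _ (g i j)) => t t0.
    suff /matrixP/(_ i j) : map_mx (horner_eval t) f = map_mx (horner_eval t^-1) g.
      by rewrite !mxE /= /horner_eval.
    apply/eqP; rewrite -subr_eq0; apply/eqP; apply: (observable_comm_eq0 (obs1 t)).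
    - by rewrite -!pencil_eval -!map_mxM comm.
    - have h : map_mx (horner_eval t^-1) g *m (a + t *: a') =
               (a + t *: a') *m map_mx (horner_eval t^-1) g.
        have -> : a + t *: a' = t *: (a' + t^-1 *: a).
          by rewrite scalerDr scalerA divff // scale1r addrC.
        by rewrite -scalemxAl -scalemxAr -pencil_eval -!map_mxM ga.
      by rewrite mulmxBl mulmxBr h -!pencil_eval -!map_mxM fa.
    - have h : map_mx (horner_eval t^-1) g *m (b + t *: b') =
               (b + t *: b') *m map_mx (horner_eval t^-1) g.
        have -> : b + t *: b' = t *: (b' + t^-1 *: b).
          by rewrite scalerDr scalerA divff // scale1r addrC.
        by rewrite -scalemxAl -scalemxAr -pencil_eval -!map_mxM gb.
      by rewrite mulmxBl mulmxBr h -!pencil_eval -!map_mxM fb.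
    have ev (h : 'M[{poly F}]_n) u : h *m map_mx polyC e = map_mx polyC v ->
        map_mx (horner_eval u) h *m e = v.
      by move=> hE; rewrite -[e in LHS](polyC_eval e u) -map_mxM hE polyC_eval.
    by rewrite mulmxBl !ev // subrr.
  move: fa fb fe; rewrite fcst; set h := map_mx _ f => fa fb fe.
  have split2 (x x' : 'M[F]_n) :
      map_mx polyC h *m pencil x x' = pencil x x' *m map_mx polyC h ->
      h *m x = x *m h /\ h *m x' = x' *m h.
    move=> E; have E0 t : h *m (x + t *: x') = (x + t *: x') *m h.
      by rewrite -pencil_eval -[h in LHS](polyC_eval _ t) -[h in RHS](polyC_eval _ t)
        -!map_mxM E.
    have h0 : h *m x = x *m h by have := E0 0; rewrite scale0r addr0.
    split=> //; have := E0 1; rewrite scale1r mulmxDl mulmxDr h0.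
    by move/addrI.
  have [[ha ha'] [hb hb']] := (split2 _ _ fa, split2 _ _ fb).
  by exists h; split=> //; apply: map_polyC_inj; rewrite map_mxM fe.
have obs1 : observable a b e.
  by have := obs 1 0; rewrite !scale1r !scale0r !addr0 oner_eq0; apply.
(* The solutions for the columns [a *m e] and [b *m e] are [a] and [b] themselves, which therefore
   commute with [a'] and [b']. *)
have [f [fa fb fa' fb' fe]] := const (a *m e).
have [g [ga gb ga' gb' ge]] := const (b *m e).
have fE : f - a = 0.
  apply: (observable_comm_eq0 obs1) => //.
  - by rewrite mulmxBl mulmxBr fa.
  - by rewrite mulmxBl mulmxBr fb ab.
  - by rewrite mulmxBl fe subrr.
have gE : g - b = 0.
  apply: (observable_comm_eq0 obs1) => //.
  - by rewrite mulmxBl mulmxBr ga ab.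
  - by rewrite mulmxBl mulmxBr gb.
  - by rewrite mulmxBl ge subrr.
move/eqP: fE; rewrite subr_eq0 => /eqP fE; move/eqP: gE; rewrite subr_eq0 => /eqP gE.
by rewrite -fE -gE.
Qed.
End RigidityOfPencils.

(** * Polynomial matrices singular at every point *)

Section FractionClear.
Variable R : idomainType.
Local Notation K := {fraction R}.
Local Notation toF := (@FracField.tofrac R).

Lemma fraction_clear (x : K) : exists n d : R, d != 0 /\ toF d * x = toF n.
Proof.
elim/quotW: x => r; exists (frac r).1, (frac r).2.
have dr := denom_ratioP r; split=> //.
unlock FracField.tofrac; rewrite -[LHS]FracField.pi_mul; apply/eqP.
rewrite FracField.equivf_def /FracField.mulf !numden_Ratio ?oner_eq0 ?mul1r //.
by rewrite mulr1 mulrC.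
Qed.

Lemma mx_fraction_clear m n (M : 'M[K]_(m, n)) :
  exists (d : R) (M' : 'M[R]_(m, n)), d != 0 /\ toF d *: M = map_mx toF M'.
Proof.
have /fin_all_exists[nd hnd] : forall ij : 'I_m * 'I_n, exists u : R * R,
    u.2 != 0 /\ toF u.2 * M ij.1 ij.2 = toF u.1.
  by move=> ij; have [x [y [y0 h]]] := fraction_clear (M ij.1 ij.2); exists (x, y).
exists (\prod_ij (nd ij).2).
exists (\matrix_(i, j) ((\prod_(ij | ij != (i, j)) (nd ij).2) * (nd (i, j)).1)).
split; first by apply/prodf_neq0 => ij _; case: (hnd ij).
apply/matrixP => i j; rewrite !mxE (bigD1 (i, j)) //= mulrC !rmorphM /=.
by rewrite mulrA mulrC -(proj2 (hnd (i, j))) /= [M i j * _]mulrC.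
Qed.
End FractionClear.

Section PolyKernel.
Variable F : numClosedFieldType.
Local Notation ev t M := (map_mx (horner_eval t) M).

Lemma row_freeP0 (K : fieldType) m n (M : 'M[K]_(m, n)) :
  reflect (forall w : 'rV_m, w *m M = 0 -> w = 0) (row_free M).
Proof.
rewrite -kermx_eq0; apply: (iffP eqP) => [h w /sub_kermxP|h].
  by rewrite h submx0 => /eqP.
apply/row_matrixP => i; rewrite row0; apply: h.
by apply/sub_kermxP; apply: row_sub.
Qed.

Lemma not_row_freeP (K : fieldType) m n (M : 'M[K]_(m, n)) : ~~ row_free M ->
  exists w : 'rV_m, w != 0 /\ w *m M = 0.
Proof.
rewrite -kermx_eq0 => /rowV0Pn[w wM w0]; exists w; split=> //.
exact/sub_kermxP.
Qed.

Lemma row_free_col_mx (K : fieldType) m n (M : 'M[K]_(m, n)) (v : 'rV_n) :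
  row_free M -> ~~ row_free (col_mx M v) -> (v <= M)%MS.
Proof.
move=> Mf /not_row_freeP[w [w0]]; rewrite -[w]hsubmxK mul_row_col => h.
have [r0|r0] := eqVneq (rsubmx w) 0.
  move: h; rewrite r0 mul0mx addr0 => /(row_freeP0 _ Mf) l0.
  by move: w0; rewrite -[w]hsubmxK r0 l0 row_mx0 eqxx.
have {}r0 : rsubmx w 0 0 != 0.
  by apply: contraNneq r0 => r0; apply/eqP/matrixP => i j; rewrite !ord1 r0 mxE.
move/eqP: h; rewrite addrC addr_eq0 [rsubmx w]mx11_scalar mul_scalar_mx => /eqP h.
rewrite -(scalerK r0 v) h; apply/scalemx_sub.
by rewrite -mulNmx submxMl.
Qed.

Lemma row_free_minor (K : fieldType) m n (M : 'M[K]_(m, n)) : row_free M ->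
  exists f : 'I_m -> 'I_n, \det (\matrix_(i, j) M i (f j)) != 0.
Proof.
move=> Mf; have fM : row_full M^T by rewrite /row_full mxrank_tr.
exists (fullrankfun fM); have := fullrowsub_unit fM.
rewrite unitmxE unitfE -det_tr; congr (_ != 0).
by congr (\det _); apply/matrixP => i j; rewrite !mxE.
Qed.

Lemma minor_row_free (K : fieldType) m n (M : 'M[K]_(m, n)) (f : 'I_m -> 'I_n) :
  \det (\matrix_(i, j) M i (f j)) != 0 -> row_free M.
Proof.
move=> dM; apply/row_freeP0 => w wM; apply/eqP; apply: contraNT dM => w0.
apply/det0P; exists w => //; apply/rowP => j.
have E : (w *m M) 0 (f j) = 0 by rewrite wM mxE.
by rewrite [RHS]mxE -[RHS]E !mxE; apply: eq_bigr => i _; rewrite !mxE.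
Qed.

Lemma poly_neq0_eval (p : {poly F}) : p != 0 -> exists t, p.[t] != 0.
Proof.
move=> p0; apply: contrapT => h; case/eqP: p0; apply: poly_nat_roots => n.
by apply/eqP; apply: contraT => hn; case: h; exists n.+1%:R.
Qed.

Lemma polymx_eq0 m n (M : 'M[{poly F}]_(m, n)) :
  (forall t, ev t M = 0) -> M = 0.
Proof.
move=> h; apply/matrixP => i j; rewrite mxE; apply: poly_nat_roots => k.
by have /matrixP/(_ i j) := h k.+1%:R; rewrite !mxE.
Qed.

Lemma det_eval n (M : 'M[{poly F}]_n) t : (\det M).[t] = \det (ev t M).
Proof. by rewrite det_map_mx. Qed.

(** A right inverse over the fraction field, with its denominator [d] cleared, would specialize to a
    right inverse wherever d(t) is nonzero. So [P] is singular over the fraction field, and a kernel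
    vector clears to a polynomial one. *)
Lemma polymx_kernel n p (P : 'M[{poly F}]_(n, p)) :
  (forall t, ~~ row_free (ev t P)) -> exists N : 'rV_n, N != 0 /\ N *m P = 0.
Proof.
move=> h; pose PK := map_mx (@FracField.tofrac _) P.
have scI m (d : {poly F}) (A B : 'M[{poly F}]_(m, p)) : map_mx (@FracField.tofrac _) A
    = map_mx (@FracField.tofrac _) B -> A = B.
  move/matrixP => E; apply/matrixP => i j; have := E i j; rewrite !mxE.
  by move/eqP; rewrite tofrac_eq => /eqP.
have [/row_freeP[Q PQ]|/not_row_freeP[v [v0 vP]]] := boolP (row_free PK).
  have [d [Q' [d0 dQ]]] := mx_fraction_clear Q.
  have [t dt] := poly_neq0_eval d0; case/negP: (h t).
  have PQ' : P *m Q' = d%:M.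
    apply/matrixP => i j; apply/eqP; rewrite -tofrac_eq; apply/eqP.
    have /matrixP/(_ i j) : PK *m map_mx (@FracField.tofrac _) Q'
        = map_mx (@FracField.tofrac _) d%:M.
      by rewrite -dQ -scalemxAr PQ map_scalar_mx scalemx1.
    by rewrite -map_mxM !mxE.
  apply/row_freeP; exists (d.[t]^-1 *: ev t Q').
  rewrite -scalemxAr -map_mxM PQ' map_scalar_mx /= /horner_eval.
  by rewrite -scalemx1 scalerA mulVf // scale1r.
have [d [N [d0 dN]]] := mx_fraction_clear v; exists N; split.
  apply: contraNneq v0 => N0; move: dN; rewrite N0 map_mx0 => /eqP.
  by rewrite scaler_eq0 tofrac_eq0 (negPf d0).
apply: (scI _ d); rewrite map_mxM -dN -scalemxAl vP scaler0 map_mx0 //.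
Qed.
End PolyKernel.

(** * Minimal bases of the kernel of a pencil *)

Section PencilKernel.
Variable F : numClosedFieldType.
Local Notation ev t M := (map_mx (horner_eval t) M).

Lemma iter_pencil_top n (B C : 'M[F]_n) (l : 'cV[F]_n) i a b :
  (size (iter i (mulmx (pencil B C)) (map_mx polyC l) a b) <= i.+1)%N /\
  (iter i (mulmx (pencil B C)) (map_mx polyC l) a b)`_i
    = iter i (mulmx C) l a b.
Proof.
elim: i a b => [|i IH] a b /=.
  by rewrite !mxE size_polyC coefC eqxx; split=> //; case: eqP.
rewrite !mxE.
have sM k : (size (pencil B C a k) <= 2)%N.
  rewrite !mxE; apply: leq_trans (size_polyD _ _) _.
  rewrite geq_max; apply/andP; split.
    by apply: leq_trans (size_polyC_leq1 _) _.
  apply: leq_trans (size_polyMleq _ _) _; rewrite size_polyX /=.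
  by rewrite ltnS size_polyC_leq1.
split.
  apply: (leq_trans (size_sum _ _ _)); apply/bigmax_leqP => k _.
  apply: leq_trans (size_polyMleq _ _) _.
  by have := leq_add (sM k) (proj1 (IH k b)); rewrite -subn1 leq_subLR.
rewrite coef_sum; apply: eq_bigr => k _.
rewrite -(proj2 (IH k b)) !mxE mulrDl coefD.
rewrite coefCM -mulrA coefXM /= coefCM.
by rewrite [X in _ * X + _]nth_default ?(proj1 (IH k b)) // mulr0 add0r.
Qed.

Lemma iter_pencil_eval n (B C : 'M[F]_n) (l : 'cV[F]_n) t i :
  ev t (iter i (mulmx (pencil B C)) (map_mx polyC l))
    = iter i (mulmx (B + t *: C)) l.
Proof. by elim: i => [|i IH] /=; rewrite ?polyC_eval // map_mxM IH pencil_eval. Qed.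

(** The Krylov test on the stable space spanned by [G]; [X] is the matrix of [a] in the basis
    [G]. *)
Lemma iter_sub_eigenvector n d (G : 'M[F]_(d, n)) (a : 'M[F]_n) (e : 'cV[F]_n) :
  row_free G -> (G *m a <= G)%MS ->
  \det (\matrix_(i, j < d) (G *m iter j (mulmx a) e) i 0) = 0 ->
  exists (w : 'rV_n) c, [/\ w != 0, (w <= G)%MS, w *m a = c *: w & w *m e = 0].
Proof.
move=> Gf /submxP[X GX] /eqP/det0P[w w0 hw].
have GE j : G *m iter j (mulmx a) e = iter j (mulmx X) (G *m e).
  by elim: j => //= j IH; rewrite mulmxA GX -mulmxA IH.
have [|v [c [v0 vX ve]]] := krylov_eigenvector (M := X) (l := G *m e) w0.
  move=> i hi; rewrite -GE; apply/rowP => j; rewrite ord1 [RHS]mxE.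
  move/rowP/(_ (Ordinal hi)): hw; rewrite [RHS]mxE => hw.
  by rewrite -[RHS]hw !mxE; apply: eq_bigr => k _; rewrite [in RHS]mxE GE.
exists (v *m G), c; split.
- by rewrite mulmx_free_eq0.
- exact: submxMl.
- by rewrite -mulmxA GX mulmxA vX scalemxAl.
- by rewrite -mulmxA.
Qed.

Lemma row_free_replace (K : fieldType) m n (G M : 'M[K]_(m, n)) (c : 'rV_m) j0 (a : K) :
  row_free G -> c 0 j0 != 0 -> a != 0 ->
  (forall i, row i M = if i == j0 then a *: (c *m G) else row i G) -> row_free M.
Proof.
move=> /row_freeP0 Gf c0 a0 hM; apply/row_freeP0 => w wM.
pose w' := \row_i (w 0 j0 * a * c 0 i + (if i == j0 then 0 else w 0 i)).
have : w' *m G = 0.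
  rewrite -[RHS]wM mulmx_sum_row [RHS]mulmx_sum_row.
  rewrite (eq_bigr (fun i => (w 0 j0 * a * c 0 i) *: row i G +
    (if i == j0 then 0 else w 0 i) *: row i G)); last first.
    by move=> i _; rewrite mxE scalerDl.
  rewrite big_split /= [RHS](bigD1 j0) //= hM eqxx; congr (_ + _).
    rewrite scalerA mulmx_sum_row scaler_sumr; apply: eq_bigr => i _.
    by rewrite scalerA.
  rewrite (bigD1 j0) //= eqxx scale0r add0r; apply: eq_bigr => i ij.
  by rewrite hM (negPf ij).
move/Gf => w'0; have wj : w 0 j0 = 0.
  move/rowP/(_ j0)/eqP: w'0; rewrite !mxE eqxx addr0 !mulf_eq0.
  by rewrite (negPf a0) (negPf c0) !orbF => /eqP.
apply/rowP => i; have [->|ij] := eqVneq i j0; first by rewrite wj mxE.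
by move/rowP/(_ i): w'0; rewrite !mxE wj !mul0r add0r (negPf ij).
Qed.

Variables (n p : nat) (P0 P1 : 'M[F]_(n, p)) (a0 a1 : 'M[F]_n) (e : 'cV[F]_n).

(** Minimizing the sum of the [eps i] for the largest [d] will give a minimal basis in the sense of
    Kronecker; [eps i] is only a bound for the degree of row i. *)
Definition kerfam d (G : 'M[{poly F}]_(d, n)) (eps : 'I_d -> nat) :=
  [/\ G *m pencil P0 P1 = 0, forall i j, (size (G i j) <= (eps i).+1)%N
    & exists t, row_free (ev t G)].

Hypothesis stab : forall (s t : F) (w : 'rV[F]_n), w *m (s *: P0 + t *: P1) = 0 ->
  w *m (s *: a0 + t *: a1) *m (s *: P0 + t *: P1) = 0.
Hypothesis obs : forall (s t : F) (w : 'rV[F]_n) (c : F), (s != 0) || (t != 0) -> w != 0 ->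
  w *m (s *: P0 + t *: P1) = 0 -> w *m (s *: a0 + t *: a1) = c *: w ->
  w *m e != 0.
Hypothesis sing : forall s t, ~~ row_free (s *: P0 + t *: P1).

Lemma pencil_maxfam : exists d : nat, [/\ (0 < d)%N,
  exists (G : 'M_(d, n)) eps, kerfam G eps
  & forall d' (G : 'M_(d', n)) eps, kerfam G eps -> (d' <= d)%N].
Proof.
pose Q d := `[< exists (G : 'M_(d, n)) eps, kerfam G eps >].
have Q1 : Q 1%N.
  have [|N [N0 NP]] := @polymx_kernel F _ _ (pencil P0 P1).
    by move=> t; rewrite pencil_eval -[P0]scale1r sing.
  apply/asboolP; exists N, (fun i => \max_j size (N i j))%N; split=> //.
    by move=> i j; apply: leqW; apply: (leq_bigmax_cond (F := fun j => size (N i j))).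
  have [j Nj] : exists j, N 0 j != 0.
    by have /rV0Pn[j] := N0; exists j.
  have [t Nt] := poly_neq0_eval Nj; exists t.
  apply/row_freeP0 => w wN; apply/rowP => i; rewrite ord1 [RHS]mxE.
  move/rowP/(_ j)/eqP: wN; rewrite mxE big_ord1 !mxE mulf_eq0 /= /horner_eval.
  by rewrite (negPf Nt) orbF => /eqP.
have bnd d : Q d -> (d <= n)%N.
  case/asboolP => G [eps [_ _ [t /eqP <-]]]; exact: rank_leq_col.
have exQ : exists d, Q d by exists 1%N.
case: (ex_maxnP exQ bnd) => d /asboolP Gd dmax; exists d; split=> //.
  by apply: dmax.
by move=> d' G eps kG; apply: dmax; apply/asboolP; exists G, eps.
Qed.

(** Exchange step: a kernel vector of degree below [eps j0], whose value at [t] involves row [j0],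
    replaces that row. *)
Lemma kerfam_improve d (G : 'M_(d, n)) eps (g : 'rV[{poly F}]_n) j0 (t a : F)
    (c : 'rV[F]_d) :
  kerfam G eps -> g *m pencil P0 P1 = 0 ->
  (forall j, (size (g 0%R j) <= eps j0)%N) ->
  row_free (ev t G) -> a != 0 -> c 0 j0 != 0 -> ev t g = a *: (c *m ev t G) ->
  exists (G' : 'M_(d, n)) eps', kerfam G' eps' /\ (\sum_i eps' i < \sum_i eps i)%N.
Proof.
move=> [GP Gs _] gP gs Gf an0 cj gE.
(* With [eps j0 = 0] the size bound would make [g] zero; positivity makes the passage to the
   predecessor a strict decrease. *)
have ej : (0 < eps j0)%N.
  rewrite lt0n; apply/eqP => e0; have g0 : g = 0.
    by apply/rowP => j; have := gs j; rewrite e0 leqn0 size_poly_eq0 mxE => /eqP.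
  move: gE; rewrite g0 map_mx0 => /esym/eqP; rewrite scaler_eq0 (negPf an0) /=.
  rewrite mulmx_free_eq0 // => /eqP c0; by rewrite c0 mxE eqxx in cj.
exists (\matrix_i (if i == j0 then g else row i G)).
exists (fun i => if i == j0 then (eps i).-1 else eps i); split; last first.
  rewrite (bigD1 j0) //= [X in (_ < X)%N](bigD1 j0) //= eqxx.
  rewrite -addSn prednK // leq_add2l; apply: leq_sum => i /negPf->; exact: leqnn.
split.
- apply/row_matrixP => i; rewrite row_mul rowK row0; case: ifP => // _.
  by rewrite -row_mul GP row0.
- move=> i j; rewrite mxE; case: eqP => [->|_]; first by rewrite prednK // gs.
  by rewrite mxE Gs.
exists t; apply: (row_free_replace Gf cj an0) => i.
rewrite -!map_row rowK; case: ifP => // _.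
Qed.

(** At minimal total degree, a dependency at a point t1 makes a combination of rows divisible by X -
    t1, and a dependency of the leading rows, which is one at infinity, lets the top degree cancel.
    Either way the row of largest degree [j0] in the dependency could be improved. *)
Lemma kerfam_minimal d : (exists (G : 'M_(d, n)) eps, kerfam G eps) ->
  exists (G : 'M_(d, n)) eps, [/\ kerfam G eps,
    forall t, row_free (ev t G)
    & row_free (\matrix_(i, j) (G i j)`_(eps i) : 'M_(d, n))].
Proof.
move=> hd; pose Q m := `[< exists (G : 'M_(d, n)) eps, kerfam G eps /\ (\sum_i eps i = m)%N >].
have exQ : exists m, Q m.
  by have [G [eps kG]] := hd; exists (\sum_i eps i)%N; apply/asboolP; exists G, eps.
case: (ex_minnP exQ) => m /asboolP[G [eps [kG <-]]] mmin.
have nimp (G' : 'M_(d, n)) eps' : kerfam G' eps' -> (\sum_i eps' i < \sum_i eps i)%N -> False.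
  move=> kG'; rewrite ltnNge mmin //; apply/asboolP; by exists G', eps'.
have [GP Gs [t0 Gt0]] := kG.
have pick (c : 'rV[F]_d) : c != 0 -> exists j0, c 0 j0 != 0 /\
    forall i, c 0 i != 0 -> (eps i <= eps j0)%N.
  move=> /rV0Pn[j cj]; case: (arg_maxnP (P := fun i => c 0 i != 0) eps cj) => j0 cj0 h.
  by exists j0.
exists G, eps; split=> //.
- move=> t1; apply: contrapT => /negP/not_row_freeP[c [c0 cG]].
  have [j0 [cj hj]] := pick _ c0.
  pose h := map_mx polyC c *m G.
  have ht : ev t1 h = 0 by rewrite map_mxM polyC_eval.
  have [g hg] := eval_eq0_factor ht.
  have X0 : 'X - t1%:P != 0 :> {poly F} by rewrite polyXsubC_eq0.
  have hs j : (size (h 0%R j) <= (eps j0).+1)%N.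
    rewrite mxE; apply: leq_trans (size_sum _ _ _) _; apply/bigmax_leqP => i _.
    rewrite mxE; have [->|ci] := eqVneq (c 0 i) 0; first by rewrite mul0r size_poly0.
    rewrite mul_polyC; apply: leq_trans (size_scale_leq _ _) _.
    by apply: leq_trans (Gs i j) _; rewrite ltnS hj.
  have tt : t0 - t1 != 0.
    rewrite subr_eq0; apply: contraNneq c0 => tt; move: cG; rewrite -tt => /eqP.
    by rewrite mulmx_free_eq0.
  have [||||||G' [eps' [kG' lt]]] :=
    @kerfam_improve d G eps g j0 t0 (t0 - t1)^-1 c kG; rewrite ?invr_eq0 //.
  + by apply: (scale_mx_inj X0); rewrite /= scalemxAl -hg -mulmxA GP mulmx0 scaler0.
  + move=> j; have := hs j; rewrite hg mxE; have [->|g0] := eqVneq (g 0 j) 0.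
      by rewrite size_poly0.
    by rewrite mulrC size_Mmonic ?monicXsubC // size_XsubC addn2.
  + have : ev t0 h = (t0 - t1) *: ev t0 g.
      by rewrite hg; apply/matrixP => i j; rewrite !mxE /= /horner_eval !hornerE.
    by rewrite map_mxM polyC_eval => ->; rewrite scalerA mulVf // scale1r.
  + exact: nimp kG' lt.
apply: contrapT => /negP/not_row_freeP[c [c0 cG]].
have [j0 [cj hj]] := pick _ c0.
(* The powers of X bring the rows to the common degree [eps j0], where the leading coefficients
   cancel. *)
pose cc : 'rV[{poly F}]_d := \row_i (c 0 i *: 'X^(eps j0 - eps i)).
have [||||||G' [eps' [kG' lt]]] :=
  @kerfam_improve d G eps (cc *m G) j0 t0 1 (ev t0 cc) kG.
- by rewrite -mulmxA GP mulmx0.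
- move=> j; apply/leq_sizeP => k hk.
  have cE i : ((c 0 i *: 'X^(eps j0 - eps i)) * G i j)`_k =
      if k == eps j0 then c 0 i * (G i j)`_(eps i) else 0.
    have [->|ci] := eqVneq (c 0 i) 0; first by rewrite scale0r mul0r coef0 mul0r if_same.
    rewrite -scalerAl coefZ coefXnM; case: ltnP => hk2.
      by move: hk; rewrite leqNgt (leq_trans hk2 (leq_subr _ _)).
    case: eqP => [->|hk3]; first by rewrite subKn ?hj.
    rewrite nth_default ?mulr0 //; apply: leq_trans (Gs i j) _.
    rewrite ltn_subRL subnK ?hj // ltn_neqAle hk andbT.
    by apply/eqP => /esym.
  rewrite mxE coef_sum (eq_bigr (fun i => if k == eps j0 then c 0 i * (G i j)`_(eps i) else 0)).
    case: eqP => _; last by rewrite big1.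
    move/rowP/(_ j): cG; rewrite !mxE => hc; rewrite -[RHS]hc.
    by apply: eq_bigr => i _; rewrite mxE.
  by move=> i _; rewrite mxE cE.
- exact: Gt0.
- exact: oner_neq0.
- by rewrite !mxE subnn expr0 /= /horner_eval !hornerE.
- by rewrite scale1r map_mxM.
exact: nimp kG' lt.
Qed.
End PencilKernel.

Section PencilKernelConst.
Variable F : numClosedFieldType.
Local Notation ev t M := (map_mx (horner_eval t) M).

Lemma coef_top2 (P Q : {poly F}) a b : (size P <= a.+1)%N -> (size Q <= b.+1)%N ->
  (size (P * Q)%R <= (a + b).+1)%N /\ (P * Q)`_(a + b) = P`_a * Q`_b.
Proof.
move=> sP sQ; have [|] := @prod_poly_top _ _ (fun i : bool => if i then P else Q)
  (fun i => if i then a else b); first by case.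
by rewrite !big_bool.
Qed.

Lemma minor_top_row_free d n (G : 'M[{poly F}]_(d, n)) (eps : 'I_d -> nat) :
  (forall i j, (size (G i j) <= (eps i).+1)%N) ->
  row_free (\matrix_(i, j) (G i j)`_(eps i) : 'M_(d, n)) ->
  exists t, row_free (ev t G).
Proof.
move=> Gs /row_free_minor[f fd].
have [|sz top] := @det_poly_top _ _ (\matrix_(i, j) G i (f j)) eps (fun=> 0%N).
  by move=> i j; rewrite mxE addn0.
have D0 : \det (\matrix_(i, j) G i (f j)) != 0.
  apply: contraNneq fd => D0; move: top; rewrite D0 coef0 => /esym top.
  rewrite -[X in _ == X]top; apply/eqP; congr (\det _).
  by apply/matrixP => i j; rewrite !mxE addn0.
have [t Dt] := poly_neq0_eval D0; exists t; apply: (@minor_row_free _ _ _ _ f).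
move: Dt; rewrite det_eval; congr (\det _ != 0).
by apply/matrixP => i j; rewrite !mxE.
Qed.

(* The kernels at all points of the projective line form a bundle with a basis
   of sections of degrees [eps i]; the observability of [(a, e)] makes the
   determinant of [row i G *m a^j *m e] a form without zeros, so that its degree
   [\sum_i eps i + d (d - 1) / 2] vanishes. *)
Lemma pencil_kernel_const n p (P0 P1 : 'M[F]_(n, p)) (a0 a1 : 'M[F]_n)
    (e : 'cV[F]_n) :
  (forall (s t : F) (w : 'rV[F]_n), w *m (s *: P0 + t *: P1) = 0 ->
    w *m (s *: a0 + t *: a1) *m (s *: P0 + t *: P1) = 0) ->
  (forall (s t : F) (w : 'rV[F]_n) (c : F), (s != 0) || (t != 0) -> w != 0 ->
    w *m (s *: P0 + t *: P1) = 0 -> w *m (s *: a0 + t *: a1) = c *: w ->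
    w *m e != 0) ->
  (forall s t : F, ~~ row_free (s *: P0 + t *: P1)) ->
  exists u : 'rV[F]_n, [/\ u *m P0 = 0, u *m P1 = 0, u *m e != 0
    & forall N : 'rV[{poly F}]_n, N *m pencil P0 P1 = 0 ->
      forall t, exists c, ev t N = c *: u].
Proof.
move=> stab obs sing.
have [d [d0 exG dmax]] := pencil_maxfam sing.
have [G [eps [[GP Gs Gt0] Gt]]] := kerfam_minimal exG.
set L : 'M_(d, n) := \matrix_(i, j) _ => Lf.
(* Maximality of [d]: the values of any polynomial kernel vector lie in the fibres spanned by
   [G]. *)
have noext (v : 'rV[{poly F}]_n) t : v *m pencil P0 P1 = 0 ->
    ~~ row_free (col_mx (ev t G) (ev t v)).
  move=> vP; apply/negP => hf; suff : (d + 1 <= d)%N by rewrite addn1 ltnn.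
  apply: (dmax _ (col_mx G v) (fun i => \max_j size (col_mx G v i j))%N); split.
  - by rewrite mul_col_mx GP vP col_mx0.
  - move=> i j; apply: leqW.
    exact: (leq_bigmax_cond (F := fun j => size (col_mx G v i j))).
  - by exists t; rewrite map_col_mx.
have inG (v : 'rV[{poly F}]_n) t : v *m pencil P0 P1 = 0 -> (ev t v <= ev t G)%MS.
  by move=> vP; apply: row_free_col_mx (Gt t) (noext _ _ vP).
have aE : G *m pencil a0 a1 *m pencil P0 P1 = 0.
  apply: polymx_eq0 => t; rewrite !map_mxM !pencil_eval.
  apply/row_matrixP => i; rewrite row0 !row_mul.
  have := stab 1 t (row i (ev t G)); rewrite !scale1r; apply.
  by rewrite -row_mul -pencil_eval -map_mxM GP map_mx0 row0.
have Ga t : (ev t G *m (a0 + t *: a1) <= ev t G)%MS.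
  apply/row_subP => i; rewrite -pencil_eval -map_mxM -map_row.
  by apply: inG; rewrite -row_mul aE row0.
have LP : L *m P1 = 0.
  apply/matrixP => i j.
  have E : (G *m pencil P0 P1) i j = 0 by rewrite GP mxE.
  rewrite [RHS]mxE -[RHS](coef0 _ (eps i).+1) -E [LHS]mxE [in RHS]mxE coef_sum.
  apply: eq_bigr => k _.
  rewrite !mxE mulrDr coefD coefMC mulrCA coefXM /= coefMC.
  by rewrite [X in X * _ + _]nth_default ?Gs // mul0r add0r.
(* Stability of the fibre at infinity. A row leaving [L] would be the leading row of a kernel vector
   of degree [(eps i).+1] independent of the rows of [G]. *)
have La : (L *m a1 <= L)%MS.
  apply/row_subP => i; apply: row_free_col_mx Lf _; apply/negP => hf.
  pose v := row i (G *m pencil a0 a1).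
  have vs j : (size (v 0%R j) <= (eps i).+2)%N /\ (v 0 j)`_(eps i).+1 = (L *m a1) i j.
    rewrite !mxE; split.
      apply: leq_trans (size_sum _ _ _) _; apply/bigmax_leqP => k _.
      apply: leq_trans (size_polyMleq _ _) _; rewrite !mxE.
      have h2 : (size ((a0 k j)%:P + 'X * (a1 k j)%:P)%R <= 2)%N.
        apply: leq_trans (size_polyD _ _) _; rewrite geq_max; apply/andP; split.
          by apply: leq_trans (size_polyC_leq1 _) _.
        apply: leq_trans (size_polyMleq _ _) _; rewrite size_polyX /=.
        by rewrite ltnS size_polyC_leq1.
      by have := leq_add (Gs i k) h2; rewrite addn2 -subn1 leq_subLR add1n.
    rewrite coef_sum; apply: eq_bigr => k _.
    rewrite !mxE mulrDr coefD coefMC mulrCA coefXM /= coefMC.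
    by rewrite [X in X * _ + _]nth_default ?Gs // mul0r add0r.
  have [||t] := @minor_top_row_free _ _ (col_mx G v)
      (fun r => match split r with inl r' => eps r' | inr _ => (eps i).+1 end).
  - move=> r j; rewrite mxE; case: split => r'; first exact: Gs.
    by rewrite ord1 (proj1 (vs j)).
  - move: hf; congr (is_true (row_free _)); apply/matrixP => r j.
    rewrite [LHS]mxE [RHS]mxE [in RHS]mxE; case: split => r'; first by rewrite mxE.
    by rewrite ord1 [LHS]mxE (proj2 (vs j)).
  by rewrite map_col_mx; apply/negP/noext; rewrite -row_mul aE row0.
(* The Krylov determinant on the fibres: a zero at t would give an eigenvector in the kernel
   annihilating [e], against [obs]. *)
pose D := \det (\matrix_(i, j < d)
  (G *m iter j (mulmx (pencil a0 a1)) (map_mx polyC e)) i 0).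
have Dt t : D.[t] != 0.
  rewrite det_eval; apply/eqP => Dt.
  have [|w [c [w0 wG wa we]]] := iter_sub_eigenvector (e := e) (Gt t) (Ga t).
    rewrite -[RHS]Dt; congr (\det _); apply/matrixP => i j.
    rewrite [LHS]mxE [RHS]mxE [in RHS]mxE -iter_pencil_eval -map_mxM.
    by rewrite [LHS]mxE.
  have := @obs 1 t w c; rewrite oner_eq0 !scale1r => /(_ isT w0 _ wa).
  rewrite we eqxx => h; suff : false by []; apply: h.
  have /submxP[x ->] := wG.
  by rewrite -mulmxA -pencil_eval -map_mxM GP map_mx0 mulmx0.
(* The coefficient at the degree bound is the same determinant for the fibre [L] at infinity,
   nonzero for the same reason. *)
have [|sD tD] := @det_poly_top _ _ (\matrix_(i, j < d)
  (G *m iter j (mulmx (pencil a0 a1)) (map_mx polyC e)) i 0) eps (fun j => val j).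
  move=> i j; rewrite !mxE; apply: leq_trans (size_sum _ _ _) _.
  apply/bigmax_leqP => k _; apply: leq_trans (size_polyMleq _ _) _.
  have := leq_add (Gs i k) (proj1 (iter_pencil_top a0 a1 e j k 0)).
  by rewrite addSn addnS -subn1 leq_subLR add1n.
have topE : \det (\matrix_(i, j < d) (L *m iter j (mulmx a1) e) i 0) != 0.
  apply/eqP => dt; have [w [c [w0 wG wa we]]] := iter_sub_eigenvector Lf La dt.
  have := @obs 0 1 w c; rewrite oner_eq0 orbT !scale0r !scale1r !add0r.
  move=> /(_ isT w0 _ wa); rewrite we eqxx => h; suff : false by []; apply: h.
  by have /submxP[x ->] := wG; rewrite -mulmxA LP mulmx0.
have {tD} tD : D`_(\sum_i eps i + \sum_(i < d) val i) != 0.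
  rewrite tD; move: topE; congr (\det _ != 0); apply/matrixP => i j.
  rewrite !mxE coef_sum; apply: eq_bigr => k _.
  have [s1 <-] := iter_pencil_top a0 a1 e j k 0; rewrite mxE.
  by have [_] := coef_top2 (Gs i k) s1.
have s1 : size D = 1%N.
  apply/eqP; apply: contraT => /closed_rootP[t /rootP rt].
  by have := Dt t; rewrite rt eqxx.
(* A polynomial without roots is constant, so the degree bound, which is attained, is 0: every
   [eps i] is 0, and [d] is 1. *)
have : (\sum_i eps i + \sum_(i < d) val i)%N == 0%N.
  rewrite -leqn0 -ltnS -s1 ltnNge; apply: contra tD => h.
  by rewrite nth_default.
rewrite addn_eq0 => /andP[/eqP epsS jS].
have eps0 i : eps i = 0%N.
  by apply/eqP; rewrite -leqn0 -epsS (bigD1 i) //= leq_addr.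
have d1 : d = 1%N.
  apply/eqP; rewrite eqn_leq d0 andbT leqNgt; apply/negP => d2.
  by move: jS; rewrite (bigD1 (Ordinal d2)).
subst d; pose u := ev 0 G; have GE : G = map_mx polyC u.
  apply/matrixP => i j; rewrite !mxE /= /horner_eval.
  have := Gs i j; rewrite eps0 => /size1_polyC->; by rewrite hornerC.
have uP t : u *m (P0 + t *: P1) = 0.
  by rewrite -(polyC_eval u t) -GE -pencil_eval -map_mxM GP map_mx0.
have uP0 : u *m P0 = 0 by have := uP 0; rewrite scale0r addr0.
exists u; split=> //.
- by have := uP 1; rewrite scale1r mulmxDr uP0 add0r.
- apply: contra_neq (Dt 0) => ue.
  rewrite det_eval (_ : ev 0 _ = 0) ?det0 //.
  apply/matrixP => i j; rewrite !ord1 !mxE.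
  transitivity ((ev 0 (G *m map_mx polyC e)) 0 0); first by rewrite !mxE.
  by rewrite map_mxM polyC_eval -/u ue mxE.
- move=> N NP t; have := inG N t NP; rewrite GE polyC_eval => /sub_rVP[c ->].
  by exists c.
Qed.
End PencilKernelConst.

(** * Isotropic families of linear systems *)

Section Symplectic.
Variable F : numClosedFieldType.

Definition lin m n (A : 'I_4 -> 'M[F]_(m, n)) (x : 'rV[F]_4) : 'M[F]_(m, n) :=
  \sum_i x 0 i *: A i.

Lemma linD m n (A : 'I_4 -> 'M[F]_(m, n)) x y : lin A (x + y) = lin A x + lin A y.
Proof. by rewrite /lin -big_split; apply: eq_bigr => i _; rewrite mxE scalerDl. Qed.

Lemma linZ m n (A : 'I_4 -> 'M[F]_(m, n)) c x : lin A (c *: x) = c *: lin A x.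
Proof. by rewrite /lin scaler_sumr; apply: eq_bigr => i _; rewrite mxE scalerA. Qed.

Lemma linN m n (A : 'I_4 -> 'M[F]_(m, n)) x : lin A (- x) = - lin A x.
Proof. by rewrite -scaleN1r linZ scaleN1r. Qed.

Lemma linB m n (A : 'I_4 -> 'M[F]_(m, n)) x y : lin A (x - y) = lin A x - lin A y.
Proof. by rewrite linD linN. Qed.

Lemma compl_rows m p n (U : 'M[F]_(m, n)) (P : 'M[F]_(p, n)) d : (U <= P)%MS ->
  (\rank P = \rank U + d)%N ->
  exists G : 'M[F]_(d, n), (G <= P)%MS /\ (P <= col_mx U G)%MS.
Proof.
move=> UP rP; have rd : \rank (P :\: U)%MS = d.
  have := mxrank_cap_compl P U; rewrite (capmx_idPr UP) rP.
  by move/addnI.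
subst d; exists (row_base (P :\: U)%MS); split; first by rewrite eq_row_base diffmxSl.
rewrite -addsmxE -{1}(addsmx_diff_cap_eq P U) addsmxC.
by apply: addsmxS; [apply: capmxSr|rewrite eq_row_base].
Qed.

Lemma proportional_columns k (p q : 'cV[F]_k) : p *m q^T = q *m p^T ->
  exists (l : 'cV[F]_k) a b, p = a *: l /\ q = b *: l.
Proof.
move=> pq; have [->|/cV0Pn[i pi]] := eqVneq p 0.
  by exists q, 0, 1; rewrite scale0r scale1r.
exists p, 1, (q i 0 / p i 0); rewrite scale1r; split=> //.
apply/colP => j; rewrite mxE mulrAC; apply: (canRL (mulfK pi)).
by have /matrixP/(_ j i) := pq; rewrite !mxE !big_ord1 !mxE => <-; rewrite mulrC.
Qed.

(** The three identities say that the k by 2 matrices with columns s p1 + t p2 and s q1 + t q2 have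
    rank at most 1 for all (s, t). Such a pencil has a common kernel vector (mu, nu) or a common
    image line [l]. *)
Lemma rank1_pencil k (p1 q1 p2 q2 : 'cV[F]_k) :
  p1 *m q1^T = q1 *m p1^T -> p2 *m q2^T = q2 *m p2^T ->
  p1 *m q2^T + p2 *m q1^T = q1 *m p2^T + q2 *m p1^T ->
  (exists mu nu, (mu != 0) || (nu != 0) /\
     mu *: p1 + nu *: q1 = 0 /\ mu *: p2 + nu *: q2 = 0) \/
  (exists l a1 b1 a2 b2, [/\ p1 = a1 *: l, q1 = b1 *: l, p2 = a2 *: l & q2 = b2 *: l]).
Proof.
move=> /proportional_columns[l1 [a [b [-> ->]]]].
move=> /proportional_columns[l2 [c [d [-> ->]]]].
rewrite !linearZ /= -!scalemxAl -?scalemxAr !scalerA => h.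
have {h} h : (a * d - b * c) *: (l1 *m l2^T) = (a * d - b * c) *: (l2 *m l1^T).
  apply/eqP; rewrite -subr_eq0; apply/eqP; move/eqP: h; rewrite -subr_eq0 => /eqP h.
  rewrite -[RHS]h; apply/matrixP => i j; rewrite !mxE; ring.
have [ad|ad] := eqVneq (a * d - b * c) 0.
  left; have [ab|ab] := boolP ((a != 0) || (b != 0)).
    exists b, (- a); rewrite oppr_eq0 orbC; split=> //.
    rewrite !scalerA -!scalerDl; split; apply/eqP; rewrite scaler_eq0; apply/orP; left.
      by apply/eqP; ring.
    by rewrite -[X in _ == X]oppr0 -[in X in _ == X]ad; apply/eqP; ring.
  move: ab; rewrite negb_or !negbK => /andP[/eqP a0 /eqP b0].
  have [cd|cd] := boolP ((c != 0) || (d != 0)).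
    exists d, (- c); rewrite oppr_eq0 orbC; split=> //.
    rewrite a0 b0 !scale0r !scaler0 addr0; split=> //.
    by rewrite !scalerA -!scalerDl (_ : _ + _ = 0) ?scale0r //; ring.
  move: cd; rewrite negb_or !negbK => /andP[/eqP c0 /eqP d0].
  exists 1, 0; rewrite oner_eq0; split=> //.
  by rewrite a0 b0 c0 d0 !scale0r !scaler0 addr0.
right; have {h} h : l1 *m l2^T = l2 *m l1^T by apply: (scalerI ad).
have [l [a' [b' [-> ->]]]] := proportional_columns h.
by exists l, (a * a'), (b * a'), (c * b'), (d * b'); rewrite !scalerA.
Qed.

Variables (N : nat) (J : 'M[F]_N).
Hypothesis Jskew : J^T = - J.
Hypothesis Junit : J \in unitmx.

Definition perp m (U : 'M[F]_(m, N)) := kermx (J *m U^T).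

Lemma perpP m p (U : 'M[F]_(m, N)) (V : 'M[F]_(p, N)) :
  reflect (V *m J *m U^T = 0) (V <= perp U)%MS.
Proof. by rewrite -mulmxA; apply: sub_kermxP. Qed.

Lemma skew_tr m p (U : 'M[F]_(m, N)) (V : 'M[F]_(p, N)) :
  (U *m J *m V^T)^T = - (V *m J *m U^T).
Proof. by rewrite !trmx_mul trmxK Jskew mulNmx mulmxN mulmxA. Qed.

Lemma skew_tr0 m p (U : 'M[F]_(m, N)) (V : 'M[F]_(p, N)) :
  U *m J *m V^T = 0 -> V *m J *m U^T = 0.
Proof. by move=> h; apply/eqP; rewrite -oppr_eq0 -skew_tr h trmx0. Qed.

Lemma rank_perp m (U : 'M[F]_(m, N)) : \rank (perp U) = (N - \rank U)%N.
Proof.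
rewrite mxrank_ker -mxrank_tr trmx_mul trmxK; congr (_ - _)%N.
by rewrite mxrankMfree // row_free_unit unitmx_tr.
Qed.

Lemma isotropic_rank m (U : 'M[F]_(m, N)) : U *m J *m U^T = 0 ->
  (\rank U <= N - \rank U)%N.
Proof. by move/perpP/mxrankS; rewrite rank_perp. Qed.

Lemma lagrangian m p (U : 'M[F]_(m, N)) (V : 'M[F]_(p, N)) :
  U *m J *m U^T = 0 -> row_free U -> N = (2 * m)%N ->
  V *m J *m U^T = 0 -> (V <= U)%MS.
Proof.
move=> iso /eqP rU Nm /perpP VU; apply: submx_trans VU _.
have /perpP UU := iso; have := (mxrank_leqif_sup UU); rewrite rank_perp.
by move=> [_ <-]; rewrite rU Nm mul2n -addnn addnK.
Qed.

Variables (k : nat) (A : 'I_4 -> 'M[F]_(k, N)).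
Hypothesis Nk : N = (2 * k + 2)%N.
Hypothesis Aiso : forall x y,
  lin A x *m J *m (lin A y)^T + lin A y *m J *m (lin A x)^T = 0.
Hypothesis Afree : forall x, x != 0 -> row_free (lin A x).

Lemma Aiso0 x : lin A x *m J *m (lin A x)^T = 0.
Proof.
have := Aiso x x; rewrite -mulr2n -scaler_nat => /eqP.
by rewrite scaler_eq0 pnatr_eq0 /= => /eqP.
Qed.

(** Let U = A(x). Its orthogonal contains it with a symplectic plane as quotient, of basis g0, g1.
    Both A(y) and A(z) lie in this orthogonal, and modulo U isotropy makes them a pencil of rank at
    most 1. In both cases of [rank1_pencil] some w kills the part along g0, g1 and is an eigenvector
    of the part along U, whence w A(s y + t z - c x) = 0. *)
Lemma no_pencil x y z : (1 < k)%N ->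
  (forall a b c : F, a *: x + b *: y + c *: z = 0 -> [/\ a = 0, b = 0 & c = 0]) ->
  lin A x *m J *m (lin A y)^T = 0 -> lin A x *m J *m (lin A z)^T = 0 -> False.
Proof.
move=> k1 free xy xz.
have x0 : x != 0.
  apply/eqP => x0; have [] := free 1 0 0.
    by rewrite x0 !scale0r scaler0 !addr0.
  by move/eqP; rewrite oner_eq0.
set U := lin A x in xy xz *.
have UU : U *m J *m U^T = 0 := Aiso0 x.
have Uf : row_free U := Afree x0.
have [G [GP PG]] : exists G : 'M_(2, N), (G <= perp U)%MS /\ (perp U <= col_mx U G)%MS.
  apply: compl_rows; first exact/perpP.
  by rewrite rank_perp (eqP Uf) Nk; lia.
have /perpP GU := GP; have UG := skew_tr0 GU.
have dec v : U *m J *m (lin A v)^T = 0 ->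
    exists (a : 'M_k) (p q : 'cV_k), lin A v = a *m U + p *m row 0 G + q *m row 1 G.
  move=> /skew_tr0/perpP/submx_trans/(_ PG)/submxP[Y YE].
  exists (lsubmx Y), (col 0 (rsubmx Y)), (col 1 (rsubmx Y)).
  rewrite YE -{1}[Y]hsubmxK mul_row_col -addrA; congr (_ + _).
  apply/matrixP => i j; rewrite !mxE big_ord_recl big_ord1 !big_ord1 !mxE.
  by congr (_ + _ * _); rewrite ?mxE; congr (_ _ _); apply: val_inj.
have [ay [p1 [q1 yE]]] := dec y xy; have [az [p2 [q2 zE]]] := dec z xz.
set g0 := row 0 G in yE zE; set g1 := row 1 G in yE zE.
have Ug0 : U *m J *m g0^T = 0.
  by apply: skew_tr0; rewrite /g0 -row_mul -row_mul GU row0.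
have Ug1 : U *m J *m g1^T = 0.
  by apply: skew_tr0; rewrite /g1 -row_mul -row_mul GU row0.
have g0U := skew_tr0 Ug0; have g1U := skew_tr0 Ug1.
have sk (g : 'rV_N) : g *m J *m g^T = 0.
  have /(congr1 (fun M : 'M[F]_1 => M 0 0)) := skew_tr g g.
  rewrite mxE [in RHS]mxE => /eqP; rewrite -addr_eq0 -mulr2n mulrn_eq0 /=.
  by move/eqP=> h; apply/matrixP => i j; rewrite !ord1 h mxE.
pose K := (g0 *m J *m g1^T) 0 0.
have K01 : g0 *m J *m g1^T = K%:M by rewrite [LHS]mx11_scalar.
have K10 : g1 *m J *m g0^T = - K%:M.
  by apply: oppr_inj; rewrite opprK -skew_tr K01 tr_scalar_mx.
(* Otherwise the orthogonal of U, of rank k + 2, would be isotropic in a space of dimension 2 k +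
   2. *)
have K0 : K != 0.
  apply/eqP => K0; have GE : G = col_mx g0 g1.
    apply/matrixP => i j; rewrite mxE; case: splitP => i' hi; rewrite mxE;
    by congr (G _ _); apply: val_inj; rewrite /= hi ord1.
  have GG' : col_mx g0 g1 *m J *m (col_mx g0 g1)^T = 0.
    rewrite mul_col_mx tr_col_mx mul_col_row !sk K01 K10 K0.
    by rewrite raddf0 oppr0 block_mx0.
  have GG : G *m J *m G^T = 0 by rewrite GE; exact: GG'.
  have : col_mx U G *m J *m (col_mx U G)^T = 0.
    by rewrite mul_col_mx tr_col_mx mul_col_row UU UG GU GG block_mx0.
  move/isotropic_rank; have := mxrankS PG; rewrite rank_perp (eqP Uf).
  by move: Nk; lia.
have pr m1 m2 m3 m4 (a : 'M_(m1, m2)) (X : 'M_(_, N)) (b : 'M_(m3, m4)) (Y : 'M_(_, N)) :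
    (a *m X) *m J *m (b *m Y)^T = a *m (X *m J *m Y^T) *m b^T.
  by rewrite trmx_mul !mulmxA.
have form a p q a' p' q' : (a *m U + p *m g0 + q *m g1 : 'M_(k, N)) *m J *m
    (a' *m U + p' *m g0 + q' *m g1)^T = K *: (p *m q'^T - q *m p'^T) :> 'M_k.
  rewrite !linearD /= !mulmxDl !pr.
  rewrite UU Ug0 Ug1 g0U g1U !sk K01 K10 !(mulmx0, mul0mx) !(add0r, addr0).
  by rewrite mulmxN mulNmx !mul_mx_scalar -!scalemxAl scalerN addrC.
have cancelK (M : 'M[F]_k) : K *: M = 0 -> M = 0.
  by move/eqP; rewrite scaler_eq0 (negPf K0) => /eqP.
have pq1 : p1 *m q1^T = q1 *m p1^T.
  apply/eqP; rewrite -subr_eq0; apply/eqP/cancelK.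
  by rewrite -(form ay p1 q1 ay) -yE Aiso0.
have pq2 : p2 *m q2^T = q2 *m p2^T.
  apply/eqP; rewrite -subr_eq0; apply/eqP/cancelK.
  by rewrite -(form az p2 q2 az) -zE Aiso0.
have pq12 : p1 *m q2^T + p2 *m q1^T = q1 *m p2^T + q2 *m p1^T.
  apply/eqP; rewrite -subr_eq0; apply/eqP/cancelK.
  rewrite opprD addrACA scalerDr -(form ay p1 q1 az) -(form az p2 q2 ay).
  by rewrite -yE -zE Aiso.
have contra (s t c : F) (w : 'rV_k) : (s != 0) || (t != 0) -> w != 0 ->
    w *m (s *: lin A y + t *: lin A z) = c *: (w *m U) -> False.
  move=> st w0 hw; have : w *m lin A (s *: y + t *: z - c *: x) = 0.
    by rewrite linB linD !linZ mulmxBr hw -scalemxAr subrr.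
  move=> h; have v0 : s *: y + t *: z - c *: x != 0.
    apply/eqP => v0; have [] := free (- c) s t; first by rewrite scaleNr -addrA addrC v0.
    by move=> _ s0 t0; move: st; rewrite s0 t0 eqxx.
  by have /row_freeP0/(_ w h) w0' := Afree v0; rewrite w0' eqxx in w0.
have [[mu [nu [mn [e1 e2]]]]|[l [a1 [b1 [a2 [b2 [h1 h2 h3 h4]]]]]]] :=
  rank1_pencil pq1 pq2 pq12.
- have [g [r1 [r2 [gy gz]]]] : exists (g : 'rV_N) (r1 r2 : 'cV_k),
      p1 *m g0 + q1 *m g1 = r1 *m g /\ p2 *m g0 + q2 *m g1 = r2 *m g.
    case/orP: mn => h.
      exists (g1 - (nu / mu) *: g0), q1, q2.
      have aux (p q : 'cV_k) : mu *: p + nu *: q = 0 ->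
          p *m g0 + q *m g1 = q *m (g1 - (nu / mu) *: g0).
        move=> E; have -> : p = - (nu / mu) *: q.
          apply: (scalerI h); rewrite scalerA mulrN mulrCA divff // mulr1 scaleNr.
          by apply/eqP; rewrite -addr_eq0 E.
        by rewrite mulmxBr -scalemxAr -scalemxAl scaleNr addrC.
      by split; apply: aux.
    exists (g0 - (mu / nu) *: g1), p1, p2.
    have aux (p q : 'cV_k) : mu *: p + nu *: q = 0 ->
        p *m g0 + q *m g1 = p *m (g0 - (mu / nu) *: g1).
      move=> E; have -> : q = - (mu / nu) *: p.
        apply: (scalerI h); rewrite scalerA mulrN mulrCA divff // mulr1 scaleNr.
        by apply/eqP; rewrite -addr_eq0 addrC E.
      by rewrite mulmxBr -scalemxAr -scalemxAl scaleNr.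
    by split; apply: aux.
  have k2 : (1 < k + 1)%N by lia.
  (* The block form encodes two conditions at once: the column forces the last coordinate of [w] to
     vanish, and the rest [u] satisfies u (s ay + t az) = c u and u (s r1 + t r2) = 0. *)
  have [s [t [w [c [st w0 hw we]]]]] := pencil_eigenvector
    (block_mx ay r1 0 0) (block_mx az r2 0 0) (col_mx (0 : 'cV_k) (1%:M : 'M_1)) k2.
  move: w0 hw we; rewrite -[w]hsubmxK; move: (lsubmx w) (rsubmx w) => u v.
  rewrite mul_row_col mulmx0 add0r mulmx1 => w0 + v0; rewrite v0 in w0 *.
  rewrite !scale_block_mx add_block_mx !scaler0 !addr0 mul_row_block.
  rewrite !mul0mx !addr0 scale_row_mx scaler0 => /eq_row_mx[hu hr].
  apply: (contra s t c u st).
    by apply: contraNneq w0 => ->; rewrite row_mx0.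
  rewrite yE zE -!addrA gy gz !scalerDr addrACA !scalemxAl -!mulmxDl mulmxDr !mulmxA.
  by rewrite hu hr mul0mx addr0.
- have [s [t [w [c [st w0 hw we]]]]] := pencil_eigenvector ay az l k1.
  apply: (contra s t c w st w0).
  rewrite yE zE h1 h2 h3 h4 -!addrA !scalerDr addrACA !scalemxAl -!mulmxDl mulmxDr.
  rewrite mulmxA hw [X in _ + X](_ : _ = 0) ?addr0 //.
  by rewrite !mulmxDr !mulmxA -!scalemxAr we !scaler0 !mul0mx !addr0.
Qed.
End Symplectic.

(** * Sections of E(1) as linear maps *)

Section Sections.
Variable F : numClosedFieldType.
Variables (N : nat) (J : 'M[F]_N).
Hypothesis Jskew : J^T = - J.
Hypothesis Junit : J \in unitmx.
Variables (k : nat) (A : 'I_4 -> 'M[F]_(k, N)).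
Hypothesis Nk : N = (2 * k + 2)%N.
Hypothesis Aiso : forall x y,
  lin A x *m J *m (lin A y)^T + lin A y *m J *m (lin A x)^T = 0.
Hypothesis Afree : forall x, x != 0 -> row_free (lin A x).
Hypothesis Ajoint : forall v : 'rV[F]_N,
  (forall x, lin A x *m J *m v^T = 0) -> v = 0.

Definition is_sec (sg : 'M[F]_(4, N)) :=
  forall x : 'rV[F]_4, lin A x *m J *m (x *m sg)^T = 0.

Definition triv_sec (w : 'rV[F]_k) : 'M[F]_(4, N) := \matrix_i (w *m A i).

Lemma triv_secE w (x : 'rV[F]_4) : x *m triv_sec w = w *m lin A x.
Proof.
rewrite mulmx_sum_row /lin mulmx_sumr; apply: eq_bigr => i _.
by rewrite rowK scalemxAr.
Qed.

Lemma is_sec_polar sg x y : is_sec sg ->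
  lin A x *m J *m (y *m sg)^T + lin A y *m J *m (x *m sg)^T = 0.
Proof.
move=> h; have := h (x + y).
rewrite linD (mulmxDl x y) linearD /= !mulmxDl !mulmxDr h h add0r addr0.
by rewrite addrC.
Qed.

Lemma triv_is_sec w : is_sec (triv_sec w).
Proof. by move=> x; rewrite triv_secE trmx_mul mulmxA (Aiso0 Aiso) mul0mx. Qed.

Lemma is_secD s1 s2 : is_sec s1 -> is_sec s2 -> is_sec (s1 + s2).
Proof. by move=> h1 h2 x; rewrite mulmxDr linearD /= mulmxDr h1 h2 addr0. Qed.

Lemma is_secZ c s : is_sec s -> is_sec (c *: s).
Proof. by move=> h x; rewrite -scalemxAr linearZ /= -scalemxAr h scaler0. Qed.

(** For z outside H, polarity makes [z *m sg] orthogonal to A(x) for x in H, and the definition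
    makes it orthogonal to A(z). It is orthogonal to the whole family, hence zero. *)
Lemma is_sec_hyperplane0 sg (H : 'M[F]_(3, 4)) : is_sec sg -> row_free H ->
  H *m sg = 0 -> sg = 0.
Proof.
move=> hs Hf Hs.
have [z [_ Hz]] : exists z : 'rV[F]_4, (z <= 1%:M)%MS /\ (1%:M <= col_mx H z)%MS.
  apply: compl_rows; first exact: submx1.
  by rewrite mxrank1 (eqP Hf).
have hz x : exists a b, x = a *m H + b *: z.
  have /submxP[Y ->] : (x <= col_mx H z)%MS by apply: submx_trans Hz; apply: submx1.
  exists (lsubmx Y), (rsubmx Y 0 0).
  by rewrite -{1}[Y]hsubmxK mul_row_col {1}[rsubmx Y]mx11_scalar mul_scalar_mx.
have zv : z *m sg = 0.
  apply: Ajoint => x; have [a [b ->]] := hz x.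
  have h1 : lin A z *m J *m (z *m sg)^T = 0 := hs z.
  have := is_sec_polar z (a *m H) hs.
  rewrite -(mulmxA a H) Hs mulmx0 trmx0 mulmx0 add0r => h2.
  by rewrite linD linZ !mulmxDl -!scalemxAl h1 h2 scaler0 addr0.
have : 1%:M *m sg = 0.
  have /submxP[Y ->] := Hz.
  by rewrite -mulmxA mul_col_mx Hs zv col_mx0 mulmx0.
by rewrite mul1mx.
Qed.

(** For a section [sg] these k + 1 rows remain isotropic, and k + 1 is half of [N]: wherever they
    are independent they span a Lagrangian space. *)
Definition ext_fam (sg : 'M[F]_(4, N)) (i : 'I_4) : 'M[F]_(k + 1, N) :=
  col_mx (A i) (row i sg).

Lemma lin_ext sg x : lin (ext_fam sg) x = col_mx (lin A x) (x *m sg).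
Proof.
rewrite /lin mulmx_sum_row; elim/big_rec3: _ => [|i u v w _ ->].
  by rewrite col_mx0.
by rewrite scale_col_mx add_col_mx.
Qed.

Lemma ext_iso sg x y : is_sec sg ->
  lin (ext_fam sg) x *m J *m (lin (ext_fam sg) y)^T
  + lin (ext_fam sg) y *m J *m (lin (ext_fam sg) x)^T = 0.
Proof.
move=> hs; rewrite !lin_ext !tr_col_mx !(mul_col_mx _ _ J) !mul_col_row add_block_mx.
rewrite Aiso is_sec_polar // -[0 in RHS](block_mx0 _ k 1 k 1); congr block_mx.
  apply: trmx_inj; rewrite linearD /= !(skew_tr Jskew) -opprD addrC is_sec_polar //.
  by rewrite oppr0 trmx0.
apply/eqP; rewrite addr_eq0; apply/eqP.
rewrite -(skew_tr Jskew); apply/matrixP => i j; rewrite [RHS]mxE !ord1.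
by [].
Qed.

Lemma ext_obs sg x (w : 'rV[F]_(k + 1)) : x != 0 -> w *m lin (ext_fam sg) x = 0 ->
  w *m col_mx 0 (1%:M : 'M_1) = 0 -> w = 0.
Proof.
move=> x0; rewrite lin_ext -[w]hsubmxK !mul_row_col mulmx0 add0r mulmx1 => h r0.
move: h; rewrite r0 mul0mx addr0 => /(row_freeP0 _ (Afree x0)) ->.
by rewrite row_mx0.
Qed.

(** If the rank dropped everywhere on H, [pencil_kernel_const] with zero operators would give a
    constant kernel vector on each line through r, that is x sg = w A(x) there. Freeness of A(r)
    makes [w] the same for all lines, so that [sg] minus a trivial section vanishes on H. *)
Lemma exists_ext_free sg (H : 'M[F]_(3, 4)) : is_sec sg ->
  (forall w, sg <> triv_sec w) -> row_free H ->
  exists r : 'rV_4, [/\ (r <= H)%MS & row_free (lin (ext_fam sg) r)].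
Proof.
move=> hs nt Hf; apply: contrapT => hr.
have {}hr r : (r <= H)%MS -> ~~ row_free (lin (ext_fam sg) r).
  by move=> rH; apply/negP => h; apply: hr; exists r.
have r0 : row 0 H != 0.
  apply/eqP => r0; have /row_freeP0/(_ (delta_mx 0 0)) := Hf.
  rewrite -rowE r0 => /(_ erefl)/rowP/(_ 0); rewrite !mxE !eqxx => /eqP.
  by rewrite oner_eq0.
set r := row 0 H in r0; have rH : (r <= H)%MS by apply: row_sub.
have main y : (y <= H)%MS -> row_free (col_mx r y) ->
    exists w, r *m sg = w *m lin A r /\ y *m sg = w *m lin A y.
  move=> yH /row_freeP0 ry.
  have vst (s t : F) : (s != 0) || (t != 0) -> s *: r + t *: y != 0.
    apply: contraTneq => h; have := ry (row_mx s%:M t%:M).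
    rewrite mul_row_col !mul_scalar_mx h => /(_ erefl).
    have sc (c : F) : c%:M = 0 :> 'M_1 -> c = 0.
      by move/matrixP/(_ 0 0); rewrite !mxE.
    by rewrite -row_mx0 => /eq_row_mx[/sc-> /sc->]; rewrite eqxx.
  have [|||u [u1 u2 ue _]] := @pencil_kernel_const F _ _
    (lin (ext_fam sg) r) (lin (ext_fam sg) y) 0 0 (col_mx 0 1%:M).
  - by move=> s t w _; rewrite !scaler0 addr0 mulmx0 mul0mx.
  - move=> s t w c st w0; rewrite -!linZ -linD => wP _.
    apply: contra_neq w0; apply: ext_obs wP; exact: vst.
  - move=> s t; rewrite -!linZ -linD; apply: hr.
    by rewrite addmx_sub ?scalemx_sub.
  move: u1 u2 ue; rewrite !lin_ext -[u]hsubmxK !mul_row_col mulmx0 add0r mulmx1.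
  move: (lsubmx u) (rsubmx u) => w c; rewrite [c]mx11_scalar !mul_scalar_mx => h1 h2 c0.
  have {}c0 : c 0 0 != 0 by apply: contraNneq c0 => ->; rewrite raddf0.
  exists (- (c 0 0)^-1 *: w); rewrite !scaleNr !mulNmx -!scalemxAl.
  by split; apply: (scalerI c0); rewrite scalerN scalerA divff // scale1r;
    apply/eqP; rewrite -addr_eq0 addrC; apply/eqP.
have [w0 hw0] : exists w0, r *m sg = w0 *m lin A r.
  by apply/submxP/row_free_col_mx; rewrite ?Afree // -lin_ext hr.
have all (y : 'rV_4) : (y <= H)%MS -> y *m sg = y *m triv_sec w0.
  move=> yH; rewrite triv_secE; have [ry|/row_free_col_mx nry] := boolP (row_free (col_mx r y)).
    have [w [h1 ->]] := main y yH ry; congr (_ *m _).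
    by apply: (row_free_inj (Afree r0)); rewrite -h1.
  have /sub_rVP[c ->] : (y <= r)%MS.
    apply: nry; apply/row_freeP0 => c; rewrite [c]mx11_scalar mul_scalar_mx => /eqP.
    by rewrite scaler_eq0 (negPf r0) orbF => /eqP->; rewrite raddf0.
  by rewrite linZ -scalemxAl -scalemxAr hw0.
apply: (nt w0); apply/eqP; rewrite -subr_eq0; apply/eqP.
apply: (is_sec_hyperplane0 (H := H)) => //.
  by rewrite -scaleN1r; apply: is_secD => //; apply/is_secZ/triv_is_sec.
apply/row_matrixP => i; rewrite row_mul row0 mulmxBr all ?subrr //.
exact: row_sub.
Qed.
End Sections.

(** * The quadratic form of two sections on a hyperplane *)

Section IsotropicHyperplane.
Variable F : numClosedFieldType.
Variables (N : nat) (J : 'M[F]_N).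
Hypothesis Jskew : J^T = - J.
Hypothesis Junit : J \in unitmx.
Variables (k : nat) (A : 'I_4 -> 'M[F]_(k, N)).
Hypothesis Nk : N = (2 * k + 2)%N.
Hypothesis Aiso : forall x y,
  lin A x *m J *m (lin A y)^T + lin A y *m J *m (lin A x)^T = 0.
Hypothesis Afree : forall x, x != 0 -> row_free (lin A x).
Hypothesis Ajoint : forall v : 'rV[F]_N,
  (forall x, lin A x *m J *m v^T = 0) -> v = 0.

Definition sec_form (s1 s2 : 'M[F]_(4, N)) (x y : 'rV[F]_4) : 'M[F]_1 :=
  (x *m s1) *m J *m (y *m s2)^T + (y *m s1) *m J *m (x *m s2)^T.

Lemma ext_sec s1 s2 x y : is_sec J A s2 ->
  lin (ext_fam A s1) x *m J *m (y *m s2)^T + lin (ext_fam A s1) y *m J *m (x *m s2)^T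
  = col_mx 0 (sec_form s1 s2 x y).
Proof.
move=> h2; rewrite !lin_ext !(mul_col_mx _ _ J) !mul_col_mx add_col_mx.
by rewrite is_sec_polar.
Qed.

Lemma mulr2_eq0 m n (M : 'M[F]_(m, n)) : M + M = 0 -> M = 0.
Proof.
rewrite -mulr2n -scaler_nat => /eqP; rewrite scaler_eq0 pnatr_eq0 /=.
by move/eqP.
Qed.

(** On H both sections are multiples of the one vector [v]. With h the equation of H and [xi p] the
    linear form extending p by zero at z, the section conditions give phi v = h c and phi (z s) = -
    (xi p) c. Then [xi p1 *m (z *m s2) - xi p2 *m (z *m s1)] is a third section, and expanding it on
    s1, s2 and a trivial section forces p2 = 0. *)
Lemma rank1_sections_false s1 s2 (H : 'M[F]_(3, 4)) (v : 'rV_N) (p1 p2 : 'cV_3)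
    (r : 'rV[F]_3) :
  is_sec J A s1 -> is_sec J A s2 -> s2 <> 0 -> v != 0 ->
  (forall s, is_sec J A s -> exists c1 c2 w, s = c1 *: s1 + c2 *: s2 + triv_sec A w) ->
  row_free H -> H *m s1 = p1 *m v -> H *m s2 = p2 *m v ->
  r *m p1 = 1%:M -> r *m p2 = 0 -> False.
Proof.
move=> hs1 hs2 s20 v0 span Hf H1 H2 rp1 rp2.
have [z [_ Hz]] : exists z : 'rV[F]_4, (z <= 1%:M)%MS /\ (1%:M <= col_mx H z)%MS.
  apply: compl_rows; first exact: submx1.
  by rewrite mxrank1 (eqP Hf).
have Mu : col_mx H z \in unitmx.
  by rewrite -row_full_unit -sub1mx.
have iH : H *m invmx (col_mx H z) = row_mx 1%:M 0.
  have := mulmxV Mu; rewrite {1}mul_col_mx scalar_mx_block.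
  by move/eq_col_mx => [].
have iz : z *m invmx (col_mx H z) = row_mx 0 1%:M.
  have := mulmxV Mu; rewrite {1}mul_col_mx scalar_mx_block.
  by move/eq_col_mx => [].
pose h : 'cV[F]_4 := invmx (col_mx H z) *m col_mx 0 1%:M.
pose xi (p : 'cV[F]_3) : 'cV[F]_4 := invmx (col_mx H z) *m col_mx p 0.
have Hh : H *m h = 0.
  by rewrite /h mulmxA iH mul_row_col mul1mx mul0mx addr0.
have zh : z *m h = 1%:M.
  by rewrite /h mulmxA iz mul_row_col mulmx1 mulmx0 add0r.
have Hxi p : H *m xi p = p.
  by rewrite /xi mulmxA iH mul_row_col mul1mx mul0mx addr0.
have xD (x : 'rV[F]_4) : exists y, x = y *m H + x *m h *m z.
  pose y := x *m invmx (col_mx H z).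
  have -> : x = lsubmx y *m H + rsubmx y *m z by rewrite -mul_row_col hsubmxK mulmxKV.
  exists (lsubmx y).
  by rewrite (mulmxDl (_ *m H)) -!(mulmxA _ _ h) Hh zh mulmx0 mulmx1 add0r.
have sE s p : H *m s = p *m v -> s = xi p *m v + h *m (z *m s).
  move=> Hs; rewrite /xi /h -!mulmxA -mulmxDr !mul_col_mx add_col_mx !mul0mx mul1mx.
  by rewrite addr0 add0r -Hs -mul_col_mx mulKmx.
pose phi (u : 'rV_N) x := lin A x *m J *m u^T.
have phiD u x y : phi u (x + y) = phi u x + phi u y by rewrite /phi linD !mulmxDl.
have phiZ u c x : phi u (c *: x) = c *: phi u x by rewrite /phi linZ -!scalemxAl.
have phiM (u : 'rV_N) (x : 'rV_4) (c : 'M_1) :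
    lin A x *m J *m (c *m u)^T = c 0 0 *: phi u x.
  by rewrite {1}[c]mx11_scalar mul_scalar_mx linearZ /= -scalemxAr.
have secE s p : is_sec J A s -> H *m s = p *m v -> forall x,
    (x *m xi p) 0 0 *: phi v x + (x *m h) 0 0 *: phi (z *m s) x = 0.
  move=> hs Hs x; have := hs x; rewrite {1}(sE s p Hs) mulmxDr linearD /= mulmxDr.
  by rewrite !(mulmxA x) !phiM.
have H0 (y : 'rV[F]_3) : ((y *m H) *m h) 0 0 = 0 by rewrite -mulmxA Hh mulmx0 mxE.
(* Where the form p1 takes the value 1 the section condition of s1 says phi v = 0; adding a multiple
   of [r] brings any y to this case. *)
have phiH y : phi v (y *m H) = 0.
  have one : phi v (r *m H) = 0.
    have := secE _ _ hs1 H1 (r *m H); rewrite H0 scale0r addr0 -mulmxA Hxi rp1.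
    by rewrite mxE scale1r.
  have := secE _ _ hs1 H1 ((y + (1 - (y *m p1) 0 0) *: r) *m H).
  rewrite H0 scale0r addr0 -!mulmxA Hxi (mulmxDl y) -scalemxAl rp1 !mxE mulr1.
  by rewrite addrCA subrr addr0 scale1r (mulmxDl y) phiD -scalemxAl phiZ one scaler0 addr0.
set c := phi v z.
have phiv x : phi v x = (x *m h) 0 0 *: c.
  have [y {1}->] := xD x; rewrite phiD phiH add0r {1}[x *m h]mx11_scalar.
  by rewrite mul_scalar_mx phiZ.
have c0 : c != 0.
  apply: contraNneq v0 => c0; apply/eqP/Ajoint => x.
  by rewrite -/(phi v x) phiv c0 scaler0.
have phi2 s p x : is_sec J A s -> H *m s = p *m v ->
    phi (z *m s) x = - (x *m xi p) 0 0 *: c.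
  move=> hs Hs; apply/eqP; rewrite scaleNr -addr_eq0.
  have key y : (y *m h) 0 0 *: (phi (z *m s) y + (y *m xi p) 0 0 *: c) = 0.
    by rewrite scalerDr scalerA mulrC -scalerA -phiv addrC secE.
  have nz y : (y *m h) 0 0 != 0 -> phi (z *m s) y + (y *m xi p) 0 0 *: c = 0.
    by move=> ny; apply: (scalerI ny); rewrite key scaler0.
  (* On H the relation carries the factor h = 0 and is empty; additivity recovers it from the points
     z and x + z, where h = 1. *)
  have [xh|/nz->//] := eqVneq ((x *m h) 0 0) 0.
  have zh1 : (z *m h) 0 0 = 1 by rewrite zh mxE.
  have xzD (q : 'cV_4) : ((x + z) *m q) 0 0 = (x *m q) 0 0 + (z *m q) 0 0.
    by rewrite mulmxDl mxE.
  have := nz (x + z); have := nz z; rewrite !xzD xh zh1 add0r oner_eq0.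
  move=> /(_ isT) e1 /(_ isT); rewrite phiD scalerDl addrACA.
  by rewrite e1 addr0 => /eqP.
pose s3 := xi p1 *m (z *m s2) - xi p2 *m (z *m s1).
have hs3 : is_sec J A s3.
  move=> x; rewrite /s3 mulmxBr linearB /= mulmxBr (mulmxA x (xi p1)) (mulmxA x (xi p2)) !phiM.
  rewrite (phi2 _ _ x hs1 H1) (phi2 _ _ x hs2 H2).
  by rewrite !scalerA !mulrN [_ * (x *m xi p1) 0 0]mulrC subrr.
have [d1 [d2 [w s3E]]] := span _ hs3.
(* Three linear forms on a space of dimension 4 have a common zero; s1, s2 and s3 vanish there, so w
   A(x) = 0. *)
have [x [x0 xh x1 x2]] : exists x : 'rV[F]_4,
    [/\ x != 0, x *m h = 0, x *m xi p1 = 0 & x *m xi p2 = 0].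
  pose M := row_mx h (row_mx (xi p1) (xi p2)).
  have : kermx M != 0.
    rewrite -mxrank_eq0 mxrank_ker -lt0n subn_gt0.
    by apply: leq_ltn_trans (rank_leq_col _) _.
  case/rowV0Pn => x /sub_kermxP; rewrite !mul_mx_row -(row_mx0 _ _ 1 2).
  move=> /eq_row_mx[xh]; rewrite -(row_mx0 _ _ 1 1) => /eq_row_mx[x1 x2] x0.
  by exists x.
have w0 : w = 0.
  apply: (row_freeP0 _ (Afree x0)); rewrite -triv_secE.
  have xs s p : H *m s = p *m v -> x *m xi p = 0 -> x *m s = 0.
    by move=> Hs xp; rewrite (sE s p Hs) mulmxDr (mulmxA x (xi p)) (mulmxA x h) xp xh !mul0mx addr0.
  have := congr1 (mulmx x) s3E; rewrite /s3 mulmxBr (mulmxA x (xi p1)) (mulmxA x (xi p2)).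
  rewrite x1 x2 !mul0mx subrr !mulmxDr -!scalemxAr (xs _ _ H1) // (xs _ _ H2) //.
  by rewrite !scaler0 !add0r.
have triv0 : triv_sec A w = 0.
  by apply/row_matrixP => i; rewrite rowK row0 w0 mul0mx.
have v2 : z *m s2 = d1 *: v.
  have e1 : r *m H *m s1 = v by rewrite -mulmxA H1 mulmxA rp1 mul1mx.
  have e2 : r *m H *m s2 = 0 by rewrite -mulmxA H2 mulmxA rp2 mul0mx.
  have f1 : r *m H *m xi p1 = 1%:M by rewrite -mulmxA Hxi.
  have f2 : r *m H *m xi p2 = 0 by rewrite -mulmxA Hxi.
  have := congr1 (mulmx (r *m H)) s3E; rewrite triv0 addr0.
  rewrite /s3 mulmxBr mulmxDr -!scalemxAr e1 e2 (mulmxA _ (xi p1)) (mulmxA _ (xi p2)).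
  by rewrite f1 f2 mul0mx mul1mx scaler0 addr0 subr0.
apply: s20; apply: (is_sec_hyperplane0 Ajoint hs2 Hf).
rewrite H2; suff -> : p2 = 0 by rewrite mul0mx.
apply/colP => i; rewrite mxE.
have := phi2 _ _ (delta_mx 0 i *m H) hs2 H2.
rewrite v2 /phi linearZ /= -scalemxAr -/(phi v _) phiH scaler0 -mulmxA Hxi -rowE.
by move/esym/eqP; rewrite scaler_eq0 (negPf c0) orbF oppr_eq0 mxE => /eqP.
Qed.

End IsotropicHyperplane.

Section NoIsotropicHyperplane.
Variable F : numClosedFieldType.
Variables (N : nat) (J : 'M[F]_N).
Hypothesis Jskew : J^T = - J.
Hypothesis Junit : J \in unitmx.
Variables (k : nat) (A : 'I_4 -> 'M[F]_(k, N)).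
Hypothesis Nk : N = (2 * k + 2)%N.
Hypothesis Aiso : forall x y,
  lin A x *m J *m (lin A y)^T + lin A y *m J *m (lin A x)^T = 0.
Hypothesis Afree : forall x, x != 0 -> row_free (lin A x).
Hypothesis Ajoint : forall v : 'rV[F]_N,
  (forall x, lin A x *m J *m v^T = 0) -> v = 0.

Lemma pencil_mul0 n p (i0 i1 : 'rV[F]_n) (P0 P1 : 'M[F]_(n, p)) :
  (forall s t : F, (s *: i0 + t *: i1) *m (s *: P0 + t *: P1) = 0) ->
  pencil i0 i1 *m pencil P0 P1 = 0.
Proof.
move=> h; apply: polymx_eq0 => t; rewrite map_mxM !pencil_eval.
by have := h 1 t; rewrite !scale1r.
Qed.

(** As s2 vanishes at r and the form on H, y s2 is orthogonal to the Lagrangian B(r), so y s2 = u(y)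
    B(r), and u(y) kills Th(y) = B(r) J B(y)^t. If Th is invertible at some y of the complementary
    line, s2 vanishes on H. Otherwise the kernel of Th is spanned by a constant [u], and both s2 and
    the section x -> u B(x) have rank one on H. *)
Lemma isotropic_hyperplane_core s1 s2 (H : 'M[F]_(3, 4)) (r : 'rV[F]_4) :
  is_sec J A s1 -> is_sec J A s2 -> s2 <> 0 ->
  (forall s, is_sec J A s -> exists c1 c2 w, s = c1 *: s1 + c2 *: s2 + triv_sec A w) ->
  row_free H -> (r <= H)%MS -> row_free (lin (ext_fam A s1) r) -> r *m s2 = 0 ->
  (forall x y : 'rV_4, (x <= H)%MS -> (y <= H)%MS -> sec_form J s1 s2 x y = 0) -> False.
Proof.
move=> hs1 hs2 s20 span Hf rH Lf rs2 G0.
set B := ext_fam A s1 in Lf *.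
have Biso x y : lin B x *m J *m (lin B y)^T + lin B y *m J *m (lin B x)^T = 0.
  exact: ext_iso.
have Biso0 x : lin B x *m J *m (lin B x)^T = 0 by apply: mulr2_eq0; apply: Biso.
have Bs x y : (x <= H)%MS -> (y <= H)%MS ->
    lin B x *m J *m (y *m s2)^T + lin B y *m J *m (x *m s2)^T = 0.
  by move=> xH yH; rewrite ext_sec // G0 // col_mx0.
have r0 : r != 0.
  apply: contraTneq Lf => ->; rewrite lin_ext mul0mx /lin big1 ?col_mx0.
    by rewrite /row_free mxrank0 addn1.
  by move=> i _; rewrite mxE scale0r.
have [Y [YH HY]] : exists Y : 'M_(2, 4), (Y <= H)%MS /\ (H <= col_mx r Y)%MS.
  by apply: compl_rows rH _; rewrite (eqP Hf) rank_rV r0.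
have ryf : row_free (col_mx r Y).
  by rewrite -row_leq_rank; have := mxrankS HY; rewrite (eqP Hf).
set y0 := row 0 Y; set y1 := row 1 Y.
have y0H : (y0 <= H)%MS := submx_trans (row_sub _ _) YH.
have y1H : (y1 <= H)%MS := submx_trans (row_sub _ _) YH.
have YE (c : 'rV_2) : c *m Y = c 0 0 *: y0 + c 0 1 *: y1.
  rewrite mulmx_sum_row big_ord_recl big_ord1; 
  by rewrite (_ : lift ord0 ord0 = 1) //; apply: val_inj.
have indep (a s t : F) : a *: r + s *: y0 + t *: y1 = 0 -> [/\ a = 0, s = 0 & t = 0].
  move=> h; move/row_freeP0 : ryf => /(_ (row_mx a%:M (\row_j if j == 0 then s else t))).
  rewrite mul_row_col mul_scalar_mx YE !mxE /= addrA h => /(_ erefl).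
  rewrite -row_mx0 => /eq_row_mx[/matrixP/(_ 0 0) h1 /rowP h2].
  have := h2 0; have := h2 1; rewrite !mxE /= => -> ->.
  by move: h1; rewrite !mxE.
have lag (v : 'rV_N) : v *m J *m (lin B r)^T = 0 -> (v <= lin B r)%MS.
  by move=> h; apply: (lagrangian Junit (Biso0 r) Lf _ h); rewrite [LHS]Nk mulnDr muln1.
have uex (y : 'rV[F]_4) : (y <= H)%MS -> exists u, y *m s2 = u *m lin B r.
  move=> yH; apply/submxP; apply: lag; apply: (skew_tr0 Jskew).
  by have := Bs r y rH yH; rewrite rs2 trmx0 mulmx0 addr0.
have [u0 u0E] := uex _ y0H; have [u1 u1E] := uex _ y1H.
have [R LR] : exists R, lin B r *m R = 1%:M by apply/row_freeP.
pose Th (s t : F) := lin B r *m J *m (lin B (s *: y0 + t *: y1))^T.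
have ThE s t : Th s t = s *: Th 1 0 + t *: Th 0 1.
  rewrite /Th !scale1r !scale0r addr0 add0r linD !linZ linearD /= !linearZ /=.
  by rewrite mulmxDr -!scalemxAr.
have sH (s t : F) : ((s *: y0 + t *: y1)%R <= H)%MS by rewrite addmx_sub ?scalemx_sub.
have uTh (s t : F) : (s *: u0 + t *: u1) *m Th s t = 0.
  rewrite /Th !mulmxA mulmxDl -!scalemxAl -u0E -u1E !scalemxAl -mulmxDl.
  apply: (skew_tr0 Jskew); apply: mulr2_eq0.
  by have := Bs _ _ (sH s t) (sH s t).
have s2H : (forall y : 'rV[F]_4, (y <= Y)%MS -> y *m s2 = 0) -> False.
  move=> h; apply: s20; apply: (is_sec_hyperplane0 Ajoint hs2 Hf).
  have /submxP[Z ->] := HY; rewrite -mulmxA mul_col_mx rs2.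
  rewrite (_ : Y *m s2 = 0) ?col_mx0 ?mulmx0 //.
  by apply/row_matrixP => i; rewrite row_mul row0 h // row_sub.
have [[s [t hst]]|sing] := pselect (exists s t, row_free (Th s t)).
  have ust : s *: u0 + t *: u1 = 0 by move/row_freeP0: hst; apply; apply: uTh.
  apply: s2H => y yY; have yH := submx_trans yY YH.
  have [u uE] := uex _ yH; rewrite uE.
  suff -> : u = 0 by rewrite mul0mx.
  move/row_freeP0: hst; apply; rewrite /Th !mulmxA -uE.
  have := Bs _ _ yH (sH s t).
  rewrite (mulmxDl (s *: y0)) -!scalemxAl u0E u1E !scalemxAl -mulmxDl ust.
  by rewrite mul0mx trmx0 mulmx0 add0r => /(skew_tr0 Jskew).
have stab (s t : F) (w : 'rV_(k + 1)) : w *m Th s t = 0 ->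
    w *m lin B (s *: y0 + t *: y1) = w *m lin B (s *: y0 + t *: y1) *m R *m lin B r.
  move=> h; have /submxP[v vE] : (w *m lin B (s *: y0 + t *: y1) <= lin B r)%MS.
    apply: lag; rewrite -!(mulmxA w) [X in w *m X](_ : _ = - Th s t) ?mulmxN ?h ?oppr0 //.
    by apply/eqP; rewrite -addr_eq0 addrC; apply/eqP/Biso.
  by rewrite vE -(mulmxA v) LR mulmx1.
(* For [w] in the kernel of Th(y), w B(y) lies in B(r) and w a(y) are its coefficients; thus an
   eigenvector of a(y) in the kernel gives w B(y - c r) = 0. *)
pose a (i : bool) := lin B (if i then y1 else y0) *m R.
have aE (s t : F) : s *: a false + t *: a true = lin B (s *: y0 + t *: y1) *m R.
  by rewrite /a linD !linZ mulmxDl -!scalemxAl.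
have astab (s t : F) (w : 'rV_(k + 1)) : w *m Th s t = 0 ->
    w *m (s *: a false + t *: a true) *m Th s t = 0.
  by move=> h; rewrite aE /Th !mulmxA -stab // -(mulmxA w) -(mulmxA w) Biso0 mulmx0.
have [|s t w c st w0 wT wa|s t|u [u1T u2T ue uN]] :=
  @pencil_kernel_const F _ _ (Th 1 0) (Th 0 1) (a false) (a true) (col_mx 0 1%:M).
- by move=> s t w; rewrite -!ThE; apply: astab.
- move: wT wa; rewrite -ThE aE mulmxA => wT wa; apply: contra_neq w0.
  apply: (ext_obs Afree (sg := s1) (x := s *: y0 + t *: y1 - c *: r)).
    apply: contraTneq st; rewrite addrC -scaleNr addrA => /indep[_ -> ->].
    by rewrite eqxx.
  rewrite -[ext_fam A s1]/B linB linZ mulmxBr. rewrite (stab s t) //. rewrite wa -scalemxAl -scalemxAr subrr. by [].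
- by rewrite -ThE; apply/negP => h; apply: sing; exists s, t.
have line (i0 i1 : 'rV_(k + 1)) :
    (forall s t : F, (s *: i0 + t *: i1) *m Th s t = 0) ->
    exists c0 c1, i0 = c0 *: u /\ i1 = c1 *: u.
  move=> h; have [] : exists c0, i0 = c0 *: u.
    have [|c0] := uN (pencil i0 i1) _ 0.
      by apply: pencil_mul0 => s t; rewrite -ThE.
    by rewrite pencil_eval scale0r addr0 => ->; exists c0.
  move=> c0 i0E; have [|c1] := uN (pencil i0 i1) _ 1.
    by apply: pencil_mul0 => s t; rewrite -ThE.
  rewrite pencil_eval scale1r => i1E; exists c0, (c1 - c0); split=> //.
  by rewrite scalerBl -i1E -i0E addrC addKr.
have [n0 [n1 [u0u u1u]]] := line _ _ uTh.
have uThst s t : u *m Th s t = 0 by rewrite ThE mulmxDr -!scalemxAr u1T u2T !scaler0 addr0.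
have [|l0 [l1 [ua0 ua1]]] := line (u *m a false) (u *m a true).
  move=> s t; rewrite (_ : _ + _ = u *m (s *: a false + t *: a true)) ?astab //.
  by rewrite mulmxDr -!scalemxAr.
set v := u *m lin B r.
have uy s t : u *m lin B (s *: y0 + t *: y1) = (s * l0 + t * l1) *: v.
  rewrite stab // -(mulmxA u) -aE mulmxDr -!scalemxAr ua0 ua1 !scalerA -scalerDl.
  by rewrite -scalemxAl.
have v0 : v != 0.
  apply: contraNneq ue => v0; have -> : u = 0 by move/row_freeP0: Lf; apply.
  by rewrite mul0mx.
(* The section x -> u B(x). The condition [ue] makes the coefficient of s1 nonzero, so it can
   replace s1 in the basis. *)
pose s1' := rsubmx u 0 0 *: s1 + triv_sec A (lsubmx u).
have s1E (x : 'rV_4) : x *m s1' = u *m lin B x.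
  rewrite lin_ext -{1}[u]hsubmxK mul_row_col /s1' mulmxDr triv_secE -scalemxAr addrC.
  by rewrite -mul_scalar_mx -mx11_scalar.
have c0 : rsubmx u 0 0 != 0.
  move: ue; rewrite -{1}[u]hsubmxK mul_row_col mulmx0 mulmx1 add0r.
  by apply: contraNneq => c0; rewrite [rsubmx u]mx11_scalar c0 raddf0.
have hs1' : is_sec J A s1' by apply/is_secD/triv_is_sec => //; apply: is_secZ.
have Mf : row_free (col_mx r Y) := ryf.
have rk3 : row_free (col_mx r Y) by [].
pose p1 : 'cV[F]_(1 + 2) := col_mx 1%:M (\col_i if i == 0 then l0 else l1).
pose p2 : 'cV[F]_(1 + 2) := col_mx 0 (\col_i if i == 0 then n0 else n1).
have YM (s : 'M_(4, N)) m0 m1 : y0 *m s = m0 *: v -> y1 *m s = m1 *: v ->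
    Y *m s = (\col_i if i == 0 then m0 else m1) *m v.
  move=> h0 h1; apply/row_matrixP => i; rewrite !row_mul.
  rewrite [row i (\col_j _)]mx11_scalar mul_scalar_mx !mxE.
  have : (i == 0) || (i == 1) by case: i => [[|[|]]].
  by case/orP => /eqP ->; [apply: h0|apply: h1].
have e1 : col_mx r Y *m s1' = p1 *m v.
  rewrite mul_col_mx s1E /p1 mul_col_mx mul1mx; congr col_mx.
  by apply: YM; rewrite s1E; [have := uy 1 0|have := uy 0 1];
    rewrite !(scale1r, scale0r, addr0, add0r, mul1r, mul0r).
have e2 : col_mx r Y *m s2 = p2 *m v.
  rewrite mul_col_mx rs2 /p2 mul_col_mx mul0mx; congr col_mx.
  by apply: YM; rewrite ?u0E ?u1E ?u0u ?u1u -scalemxAl.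
have f1 : row_mx 1%:M 0 *m p1 = 1%:M :> 'M_1.
  by rewrite mul_row_col mul1mx mul0mx addr0.
have f2 : row_mx 1%:M 0 *m p2 = 0 :> 'M_1.
  by rewrite mul_row_col mulmx0 mul0mx addr0.
apply: (@rank1_sections_false F N J k A Afree Ajoint s1' s2 (col_mx r Y) v p1 p2 (row_mx 1%:M 0)) => //.
move=> s hs; have [c1 [c2 [w ->]]] := span s hs.
  exists (c1 / rsubmx u 0 0), c2, (w - (c1 / rsubmx u 0 0) *: lsubmx u).
  have -> : triv_sec A (w - c1 / rsubmx u 0 0 *: lsubmx u) =
      triv_sec A w - c1 / rsubmx u 0 0 *: triv_sec A (lsubmx u).
    apply/row_matrixP => i; rewrite !rowE mulmxBr -scalemxAr !triv_secE.
    by rewrite (mulmxBl w) scalemxAl.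
  rewrite /s1' scalerDr scalerA divfK // [c1 *: s1 + _ *: triv_sec _ _ + _]addrAC -[RHS]addrA.
  by rewrite [X in _ = _ + X]addrC subrK.

Qed.
End NoIsotropicHyperplane.

(** * From sections to a frame *)

Section QuadraticForms.
Variable F : numClosedFieldType.

Lemma trmx11 (M : 'M[F]_1) : M^T = M.
Proof. by apply/matrixP => i j; rewrite mxE !ord1. Qed.

Lemma sym_formC n (S : 'M[F]_n) (c d : 'rV_n) : S^T = S ->
  c *m S *m d^T = d *m S *m c^T.
Proof. by move=> Ss; rewrite -[LHS]trmx11 !trmx_mul trmxK Ss mulmxA. Qed.

Lemma sym_anisotropic n (S : 'M[F]_n) : S^T = S -> S != 0 ->
  exists c : 'rV_n, (c *m S *m c^T) 0 0 != 0.
Proof.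
move=> Ss; apply: contra_neqP => h.
have {}h (c : 'rV_n) : c *m S *m c^T = 0.
  rewrite [LHS]mx11_scalar; have [->|hc] := eqVneq ((c *m S *m c^T) 0 0) 0.
    by rewrite raddf0.
  by case: h; exists c.
apply/matrixP => i j; rewrite mxE.
have hij (c d : 'rV_n) : c *m S *m d^T = 0.
  apply: mulr2_eq0; have := h (c + d).
  rewrite !mulmxDl linearD /= !mulmxDr !h add0r addr0.
  by rewrite (sym_formC d).
have /matrixP/(_ 0 0) := hij (delta_mx 0 i) (delta_mx 0 j).
by rewrite -rowE trmx_delta -colE !mxE.
Qed.

Lemma perp_rows (d m : nat) (M : 'M[F]_(4, m)) : (d + \rank M = 4)%N ->
  exists H : 'M[F]_(d, 4), row_free H /\ H *m M = 0.
Proof.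
move=> dM; have [|H [HK KH]] := @compl_rows F 1 4 4 0 (kermx M) d (sub0mx _ _).
  by rewrite mxrank0 mxrank_ker; move: dM (rank_leq_row M); lia.
exists H; split; last exact/sub_kermxP.
rewrite -row_leq_rank; have := mxrankS KH.
rewrite mxrank_ker -addsmxE adds0mx; move: dM (rank_leq_row M); lia.
Qed.

Lemma rank_col1 n (M : 'cV[F]_n) : M != 0 -> \rank M = 1%N.
Proof.
move=> M0; apply/eqP; rewrite eqn_leq rank_leq_col lt0n mxrank_eq0 //.
Qed.

Lemma binary_isotropic (a b c : F) : exists s t, ((s != 0) || (t != 0)) &&
  (s * s * a + (s * t * b) *+ 2 + t * t * c == 0).
Proof.
have [->|a0] := eqVneq a 0.
  by exists 1, 0; rewrite oner_eq0 !(mulr0, mul0r, mul0rn, addr0) eqxx.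
exists ((- b + sqrtC (b ^+ 2 - a * c)) / a), 1; rewrite oner_eq0 orbT /=.
have := sqrtCK (b ^+ 2 - a * c); move: (sqrtC _) => r rE; apply/eqP.
have -> : (- b + r) / a * ((- b + r) / a) * a + ((- b + r) / a * 1 * b) *+ 2 + 1 * 1 * c =
   (r ^+ 2 - (b ^+ 2 - a * c)) / a by field.
by rewrite rE subrr mul0r.
Qed.

Variable G : 'M[F]_4.
Hypothesis Gs : G^T = G.
Hypothesis Gh : forall H : 'M[F]_(3, 4), row_free H -> H *m G *m H^T = 0 -> False.

Definition qf (x y : 'rV[F]_4) : F := (x *m G *m y^T) 0 0.

Lemma qfE x y : x *m G *m y^T = (qf x y)%:M. Proof. exact: mx11_scalar. Qed.
Lemma qfD x x' y : qf (x + x') y = qf x y + qf x' y.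
Proof. by rewrite /qf !mulmxDl mxE. Qed.
Lemma qfZ c x y : qf (c *: x) y = c * qf x y.
Proof. by rewrite /qf -!scalemxAl mxE. Qed.
Lemma qfC x y : qf x y = qf y x. Proof. by rewrite /qf sym_formC. Qed.
Lemma qfDr x y y' : qf x (y + y') = qf x y + qf x y'.
Proof. by rewrite qfC qfD !(qfC _ x). Qed.
Lemma qfZr c x y : qf x (c *: y) = c * qf x y.
Proof. by rewrite qfC qfZ qfC. Qed.

(** The form is nonzero on the hyperplane orthogonal to an anisotropic x, which gives two orthogonal
    anisotropic vectors; once scaled to opposite squares, their sum and difference are isotropic. *)
Lemma hyperbolic_pair : exists x0 y0, [/\ qf x0 x0 = 0, qf y0 y0 = 0 & qf x0 y0 = 1].
Proof.
have [x gx] : exists x, qf x x != 0.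
  apply: (sym_anisotropic Gs); apply/eqP => G0.
  have [|H [Hf _]] := @perp_rows 3 1 (delta_mx 0 0).
    by rewrite mxrank_delta.
  by apply: (Gh Hf); rewrite G0 mulmx0 mul0mx.
have [|H [Hf HG]] := @perp_rows 3 1 (G *m x^T).
  rewrite rank_col1 //; apply: contraNneq gx => h.
  by rewrite /qf -mulmxA h mulmx0 mxE.
have [c gc] : exists c : 'rV_3, (c *m (H *m G *m H^T) *m c^T) 0 0 != 0.
  apply: sym_anisotropic; first by rewrite !trmx_mul trmxK Gs mulmxA.
  by apply/eqP => h; apply: (Gh Hf h).
set z := c *m H; have {}gc : qf z z != 0 by move: gc; rewrite /qf /z trmx_mul !mulmxA.
have xz : qf z x = 0 by rewrite /qf /z -!mulmxA HG mulmx0 mxE.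
have zx : qf x z = 0 by rewrite qfC.
pose a := sqrtC (qf x x)^-1; pose b := sqrtC (- (qf z z)^-1).
have a2 : a * a * qf x x = 1 by rewrite -expr2 sqrtCK mulVf.
have b2 : b * b * qf z z = -1 by rewrite -expr2 sqrtCK mulNr mulVf.
have two : (2 : F) != 0 by rewrite pnatr_eq0.
exists (a *: x + b *: z), (2^-1 *: (a *: x - b *: z)).
rewrite -scaleNr !(qfD, qfDr, qfZ, qfZr) xz zx; split.
- transitivity (a * a * qf x x + b * b * qf z z); first by ring.
  by rewrite a2 b2 subrr.
- transitivity (2^-1 * 2^-1 * (a * a * qf x x + b * b * qf z z)); first by field.
  by rewrite a2 b2 subrr mulr0.
- transitivity (2^-1 * (a * a * qf x x - b * b * qf z z)); first by field.
  by rewrite a2 b2; field.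
Qed.

Definition indep4 (x y z t : 'rV[F]_4) :=
  forall p q r s : F, p *: x + q *: y + r *: z + s *: t = 0 ->
    [/\ p = 0, q = 0, r = 0 & s = 0].

(** On the plane N orthogonal to x0, y0 the form has rank 2 or 1; if it were zero, x0 and N would
    span an isotropic hyperplane. The normalizations -1 and -2 are those that yield the coefficient
    1 of [e] in [pair_cases]. *)
Lemma hyperbolic_complement x0 y0 : qf x0 x0 = 0 -> qf y0 y0 = 0 -> qf x0 y0 = 1 ->
  exists z z', [/\ indep4 x0 y0 z z',
    [/\ qf x0 z = 0, qf x0 z' = 0, qf y0 z = 0 & qf y0 z' = 0], qf z z = 0
    & (qf z' z' = 0 /\ qf z z' = -1) \/ (qf z z' = 0 /\ qf z' z' = - 2)].
Proof.
move=> xx yy xy; have yx : qf y0 x0 = 1 by rewrite qfC.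
have [|N [Nf NG]] := @perp_rows 2 (1 + 1) (G *m (col_mx x0 y0)^T).
  suff -> : \rank (G *m (col_mx x0 y0)^T) = 2%N by [].
  apply/eqP; rewrite eqn_leq rank_leq_col /= -(mxrank_tr (_ *m _)) trmx_mul trmxK Gs.
  suff aux (w : 'rV_(1 + 1)) : w *m (col_mx x0 y0 *m G) = 0 -> w = 0.
    by rewrite row_leq_rank; apply/row_freeP0.
  move=> h; have := congr1 (mulmx^~ (row_mx y0^T x0^T)) h.
  rewrite !mulmxA mul0mx -{1}[w](@hsubmxK _ _ 1 1) mul_row_col !mulmxDl !mul_mx_row add_row_mx.
  rewrite -!mulmxA !(mulmxA _ G) !qfE xx yy xy yx !mul_mx_scalar.
  rewrite !scale0r !scale1r addr0 add0r -(row_mx0 _ _ 1 1) => /eq_row_mx[h1 h2].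
  by rewrite -[w](@hsubmxK _ _ 1 1) h1 h2 row_mx0.
have Nx (u : 'rV_4) : (u <= N)%MS -> qf u x0 = 0 /\ qf u y0 = 0.
  move=> /submxP[c ->].
  have := congr1 (mulmx c) NG; rewrite mulmx0 tr_col_mx mul_mx_row !mul_mx_row.
  rewrite -(row_mx0 _ _ 1 1) => /eq_row_mx[h1 h2].
  by rewrite /qf -!mulmxA h1 h2 mxE.
pose ind2 (z z' : 'rV[F]_4) := forall r s, r *: z + s *: z' = 0 -> r = 0 /\ s = 0.
have final z z' : (z <= N)%MS -> (z' <= N)%MS -> ind2 z z' ->
    indep4 x0 y0 z z' /\ [/\ qf x0 z = 0, qf x0 z' = 0, qf y0 z = 0 & qf y0 z' = 0].
  move=> /Nx[zx zy] /Nx[zx' zy'] hz; rewrite !(qfC x0) !(qfC y0); split=> // p q r s h.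
  have p0 : p = 0.
    have := congr1 (qf^~ y0) h; rewrite !(qfD, qfZ) zy zy' xy yy !mulr0 mulr1 !addr0.
    by move=> ->; rewrite /qf !mul0mx mxE.
  have q0 : q = 0.
    have := congr1 (qf^~ x0) h; rewrite !(qfD, qfZ) zx zx' xx yx !mulr0 mulr1 !addr0 add0r.
    by move=> ->; rewrite /qf !mul0mx mxE.
  by move: h; rewrite p0 q0 !scale0r !add0r => /hz[-> ->].
have [z [z0 [zN z0N zz0 zz]]] : exists z z0 : 'rV[F]_4,
    [/\ (z <= N)%MS, (z0 <= N)%MS, ind2 z z0 & qf z z = 0].
  pose u := row 0 N; pose v := row 1 N.
  have uN : (u <= N)%MS by apply: row_sub.
  have vN : (v <= N)%MS by apply: row_sub.
  have uv : ind2 u v.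
    move=> r s h; have := row_freeP0 _ Nf (\row_j if j == 0 then r else s).
    rewrite mulmx_sum_row big_ord_recl big_ord1 !mxE /=.
    rewrite (_ : lift ord0 ord0 = 1) ?h; last exact: val_inj.
    by move=> /(_ erefl)/rowP h'; split; [have := h' 0|have := h' 1]; rewrite !mxE.
  have [s [t /andP[st /eqP hst]]] := binary_isotropic (qf u u) (qf u v) (qf v v).
  have zz : qf (s *: u + t *: v) (s *: u + t *: v) = 0.
    by rewrite -[RHS]hst !(qfD, qfDr, qfZ, qfZr) (qfC v u); ring.
  have zN : ((s *: u + t *: v)%R <= N)%MS by rewrite addmx_sub ?scalemx_sub.
  have [s0|s0] := eqVneq s 0.
    exists (s *: u + t *: v), u; split=> // a b; rewrite s0 scale0r add0r addrC scalerA.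
    move=> /uv[-> /eqP]; rewrite mulf_eq0 => /orP[/eqP-> //|t0].
    by move: st; rewrite s0 (eqP t0) eqxx.
  exists (s *: u + t *: v), v; split=> // a b.
  rewrite scalerDr !scalerA -addrA -scalerDl => /uv[/eqP].
  by rewrite mulf_eq0 (negPf s0) orbF => /eqP->; rewrite mul0r add0r.
have comb a b : b != 0 -> ind2 z (a *: z + b *: z0).
  move=> b0 r s; rewrite scalerDr !scalerA addrA -scalerDl => /zz0[h /eqP].
  by move: h; rewrite mulf_eq0 (negPf b0) orbF => /[swap] /eqP->; rewrite mul0r addr0.
have combN a b : ((a *: z + b *: z0)%R <= N)%MS by rewrite addmx_sub ?scalemx_sub.
have two : (2 : F) != 0 by rewrite pnatr_eq0.
have [b0|b0] := eqVneq (qf z z0) 0; last first.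
  (* The coefficient of z0 fixes the product with z to -1, and that of z cancels the square. *)
  exists z, (qf z0 z0 / (2 * qf z z0 ^+ 2) *: z + (- (qf z z0)^-1) *: z0).
  have [|i4 p4] := final _ _ zN (combN (qf z0 z0 / (2 * qf z z0 ^+ 2)) (- (qf z z0)^-1)).
    by apply: comb; rewrite oppr_eq0 invr_eq0.
  split=> //; left; rewrite !(qfD, qfDr, qfZ, qfZr) zz (qfC z0 z).
  by move: (qf z0 z0) (qf z z0) b0 => c b b0; split; field; rewrite b0.
have z00 : qf z0 z0 != 0.
  apply/eqP => z00; have [zx zy] := Nx _ zN; have [zx0 zy0] := Nx _ z0N.
  have [i4 _] := final _ _ zN z0N zz0.
  apply: (Gh (H := col_mx x0 (col_mx z z0))).
    suff aux (w : 'rV_(1 + (1 + 1))) : w *m col_mx x0 (col_mx z z0) = 0 -> w = 0.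
      exact/row_freeP0.
    rewrite -[w]hsubmxK; move: (lsubmx w) (rsubmx w) => p {}w.
    rewrite -[w]hsubmxK; move: (lsubmx w) (rsubmx w) => r s.
    rewrite [p]mx11_scalar [r]mx11_scalar [s]mx11_scalar.
    rewrite !mul_row_col !mul_scalar_mx => h.
    have [] := i4 (p 0 0) 0 (r 0 0) (s 0 0); first by rewrite scale0r addr0 -addrA.
    by move=> -> _ -> ->; rewrite !raddf0 !row_mx0.
  suff : col_mx x0 (col_mx z z0) *m G *m (col_mx x0 (col_mx z z0))^T = 0 by [].
  rewrite !mul_col_mx !tr_col_mx !mul_mx_row !qfE.
  rewrite xx zx zx0 !(qfC x0) zx zx0 (qfC z0 z) b0 zz z00.
  by rewrite !raddf0 !row_mx0 !col_mx0.
exists z, (0 *: z + sqrtC (- 2 / qf z0 z0) *: z0).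
have [|i4 p4] := final _ _ zN (combN 0 (sqrtC (- 2 / qf z0 z0))).
  by apply: comb; rewrite sqrtC_eq0 mulf_neq0 ?invr_eq0 ?oppr_eq0.
split=> //; right; rewrite scale0r add0r !(qfZ, qfZr) b0 mulr0; split=> //.
by rewrite mulrA -expr2 sqrtCK divfK.
Qed.
End QuadraticForms.

(** * The Gram form of two sections *)

Section Gram.
Variable F : numClosedFieldType.
Variables (N : nat) (J : 'M[F]_N).
Hypothesis Jskew : J^T = - J.
Hypothesis Junit : J \in unitmx.
Variables (k : nat) (A : 'I_4 -> 'M[F]_(k, N)).
Hypothesis Nk : N = (2 * k + 2)%N.
Hypothesis Aiso : forall x y,
  lin A x *m J *m (lin A y)^T + lin A y *m J *m (lin A x)^T = 0.
Hypothesis Afree : forall x, x != 0 -> row_free (lin A x).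
Hypothesis Ajoint : forall v : 'rV[F]_N,
  (forall x, lin A x *m J *m v^T = 0) -> v = 0.

(** The symmetric matrix of x -> 2 (x s) J (x t)^t. As J is skew it alternates in (s, t), so it is
    unchanged by substitutions of determinant 1 in the pair of sections. *)
Definition gram (s t : 'M[F]_(4, N)) : 'M[F]_4 := s *m J *m t^T + (s *m J *m t^T)^T.

Lemma gram_sym s t : (gram s t)^T = gram s t.
Proof. by rewrite /gram linearD /= trmxK addrC. Qed.

Lemma gramC s t : gram t s = - gram s t.
Proof. by rewrite /gram !(skew_tr Jskew) opprB. Qed.

Lemma gramDr s t t' : gram s (t + t') = gram s t + gram s t'.
Proof. by rewrite /gram linearD /= mulmxDr linearD /= addrACA. Qed.

Lemma gramZr c s t : gram s (c *: t) = c *: gram s t.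
Proof. by rewrite /gram linearZ /= -scalemxAr linearZ /= -scalerDr. Qed.

Lemma gramss s : gram s s = 0.
Proof. by apply: mulr2_eq0; rewrite -{2}[gram s s]opprK -gramC subrr. Qed.

Lemma gramE s t x y : x *m gram s t *m y^T = sec_form J s t x y.
Proof.
rewrite /gram mulmxDr mulmxDl /sec_form !trmx_mul !mulmxA; congr (_ + _).
by rewrite -[LHS]trmx11 !trmx_mul !trmxK !mulmxA.
Qed.

Lemma gram_triv s w : is_sec J A s -> gram s (triv_sec A w) = 0.
Proof.
move=> hs; apply/eqP; apply: contraT => /(sym_anisotropic (gram_sym _ _))[c].
rewrite gramE /sec_form triv_secE trmx_mul mulmxA (skew_tr0 Jskew (hs c)) mul0mx addr0.
by rewrite mxE eqxx.
Qed.

Definition section_basis s1 s2 :=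
  [/\ is_sec J A s1, is_sec J A s2,
      forall c1 c2 w, c1 *: s1 + c2 *: s2 = triv_sec A w -> c1 = 0 /\ c2 = 0
    & forall s, is_sec J A s -> exists c1 c2 w, s = c1 *: s1 + c2 *: s2 + triv_sec A w].

Lemma triv_secB w w' c : triv_sec A (w - c *: w') = triv_sec A w - c *: triv_sec A w'.
Proof.
apply/row_matrixP => i; rewrite !rowE mulmxBr -scalemxAr !triv_secE.
by rewrite (mulmxBl w) scalemxAl.
Qed.

Lemma ext_triv (s : 'M[F]_(4, N)) (v : 'rV[F]_(k + 1)) (x : 'rV[F]_4) :
  v *m lin (ext_fam A s) x = x *m (rsubmx v 0 0 *: s + triv_sec A (lsubmx v)).
Proof.
rewrite lin_ext -{1}[v]hsubmxK mul_row_col mulmxDr triv_secE -scalemxAr addrC.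
by rewrite -mul_scalar_mx -mx11_scalar.
Qed.

Lemma ext_lagrangian s x (v : 'rV[F]_N) : is_sec J A s ->
  row_free (lin (ext_fam A s) x) -> v *m J *m (lin (ext_fam A s) x)^T = 0 ->
  (v <= lin (ext_fam A s) x)%MS.
Proof.
move=> hs Lf h; apply: (lagrangian Junit _ Lf _ h).
  by apply: mulr2_eq0; apply: ext_iso.
by rewrite [LHS]Nk mulnDr muln1.
Qed.

(* Subtracting a combination of [s1] and a trivial section makes [s2] vanish at [r]
   without changing the quadratic form. *)
Lemma vanish_at s1 s2 r : is_sec J A s1 -> is_sec J A s2 ->
  row_free (lin (ext_fam A s1) r) -> qf (gram s1 s2) r r = 0 ->
  exists c w, r *m (s2 - c *: s1 - triv_sec A w) = 0 /\
    gram s1 (s2 - c *: s1 - triv_sec A w) = gram s1 s2.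
Proof.
move=> hs1 hs2 Lf Grr.
have /submxP[v vE] : (r *m s2 <= lin (ext_fam A s1) r)%MS.
  apply: ext_lagrangian => //; apply: (skew_tr0 Jskew); apply: mulr2_eq0.
  by rewrite ext_sec // -gramE qfE Grr raddf0 col_mx0.
exists (rsubmx v 0 0), (lsubmx v); split.
  by rewrite -addrA -opprD mulmxBr vE ext_triv subrr.
rewrite -scaleNr -[- triv_sec _ _]scaleN1r !gramDr !gramZr gramss gram_triv //.
by rewrite !scaler0 !addr0.
Qed.

Lemma no_isotropic_hyperplane s1 s2 (H : 'M[F]_(3, 4)) : section_basis s1 s2 ->
  row_free H -> H *m gram s1 s2 *m H^T = 0 -> False.
Proof.
move=> [hs1 hs2 ind span] Hf HG.
have nt w : s1 <> triv_sec A w.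
  move=> h; have [] := ind 1 0 w; first by rewrite scale1r scale0r addr0.
  by move/eqP; rewrite oner_eq0.
have [r [rH Lf]] := exists_ext_free Aiso Afree Ajoint hs1 nt Hf.
have HG0 (x y : 'rV_4) : (x <= H)%MS -> (y <= H)%MS -> x *m gram s1 s2 *m y^T = 0.
  move=> /submxP[c ->] /submxP[d ->]; rewrite trmx_mul !mulmxA.
  by rewrite -(mulmxA c) -(mulmxA c) HG mulmx0 mul0mx.
have [|c [w [r0 gE]]] := vanish_at hs1 hs2 Lf.
  by rewrite /qf HG0 // mxE.
set s2' := s2 - _ - _ in r0 gE.
have hs2' : is_sec J A s2'.
  rewrite /s2' -scaleNr -[- triv_sec _ _]scaleN1r.
  by do ?[apply: is_secD|apply: is_secZ] => //; apply: triv_is_sec.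
apply: (isotropic_hyperplane_core Jskew Junit Nk Aiso Afree Ajoint hs1 hs2' _ _ Hf rH Lf r0).
- move=> h; have [] := ind (- c) 1 w.
    move/eqP: h; rewrite /s2' subr_eq0 scale1r scaleNr addrC => /eqP //.
  by move=> _ /eqP; rewrite oner_eq0.
- move=> s /span[c1 [c2 [w' ->]]]; exists (c1 + c2 * c), c2, (w' - (- c2) *: w).
  rewrite triv_secB /s2'; move: (triv_sec A w) (triv_sec A w') => T T'.
  by apply/matrixP => i j; rewrite !mxE; ring.
by move=> x y xH yH; rewrite -gramE gE HG0.
Qed.
End Gram.

(** * Two commuting pairs with prescribed products *)

Section CommutingPairs.
Variable F : numClosedFieldType.

(** By [rigidity] the four matrices commute, so observability turns each identity on [e] into an
    identity of matrices. In the second alternative b = - a b' b' and a a = 0; then a has rank at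
    most n / 2, and for n > 2 some row vector kills a, e and hence b, against [obs]. In the first, a
    b' and a' b are complementary idempotents, and one of them has to vanish. *)
Lemma pair_cases n (a b a' b' : 'M[F]_n) (e : 'cV[F]_n) : (2 < n)%N ->
  a *m b = b *m a -> a' *m b' = b' *m a' ->
  a *m b' + a' *m b = b *m a' + b' *m a ->
  (forall r s p q (w : 'rV_n), (r != 0) || (s != 0) ->
    w *m (r *: a + s *: a') = p *: w -> w *m (r *: b + s *: b') = q *: w ->
    w *m e = 0 -> w = 0) ->
  a *m b *m e = 0 ->
  (a' *m b' *m e = 0 /\ (b *m a' + b' *m a) *m e = e) \/
  ((b *m a' + b' *m a) *m e = 0 /\ a' *m b' *m e = e) ->
  [/\ b = 0, a' = 0 & a *m b' = 1%:M] \/ [/\ a = 0, b' = 0 & a' *m b = 1%:M].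
Proof.
move=> n2 cab ca'b' mix obs abe cases.
have pobs s t : (s != 0) || (t != 0) ->
    observable (s *: a + t *: a') (s *: b + t *: b') e.
  by move=> st w c d w0 wa wb; apply: contra_neq w0; apply: (obs s t c d).
have [[caa' cab'] [cba' cbb']] := rigidity cab ca'b' mix pobs.
have ob : observable a b e.
  have := pobs 1 0; rewrite oner_eq0 !scale1r !scale0r !addr0; exact.
have kill X : comm_mx a X -> comm_mx b X -> X *m e = 0 -> X = 0.
  by move=> aX bX; apply: (observable_comm_eq0 ob cab); apply: comm_mx_sym.
have [aa ab aa' ab'] : [/\ comm_mx a a, comm_mx a b, comm_mx a a' & comm_mx a b'] by [].
have [ba bb ba' bb'] : [/\ comm_mx b a, comm_mx b b, comm_mx b a' & comm_mx b b'] by [].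
have {ab} ab0 : a *m b = 0 by apply: kill => //; apply: comm_mxM.
have obs1 (w : 'rV_n) : w *m a = 0 -> w *m b = 0 -> w *m e = 0 -> w = 0.
  move=> wa wb; apply: (obs 1 0 0 0); first by rewrite oner_eq0.
    by rewrite !scale1r !scale0r addr0.
  by rewrite !scale1r !scale0r addr0.
have cD : comm_mx a (b *m a' + b' *m a) /\ comm_mx b (b *m a' + b' *m a).
  by split; apply: comm_mxD; apply: comm_mxM.
have cM : comm_mx a (a' *m b') /\ comm_mx b (a' *m b').
  by split; apply: comm_mxM.
case: cD cM => [aD bD] [aM bM].
case: cases => [[a'b'e se]|[se a'b'e]]; last first.
  exfalso.
  have sum0 : b *m a' + b' *m a = 0 by apply: kill.
  have a'b'1 : a' *m b' = 1%:M.
    apply/eqP; rewrite -subr_eq0; apply/eqP/kill; rewrite ?mulmxBl ?a'b'e ?mul1mx ?subrr //.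
      by apply: comm_mxB => //; apply: comm_mx1.
    by apply: comm_mxB => //; apply: comm_mx1.
  have bE : b = - (a *m b' *m b').
    rewrite -[b]mulmx1 -a'b'1 mulmxA; move/eqP: sum0; rewrite addr_eq0 => /eqP ->.
    by rewrite mulNmx -cab'.
  have aa0 : a *m a = 0.
    have := ab0; rewrite bE mulmxN !mulmxA => /(congr1 (fun M => - (M *m a' *m a'))).
    rewrite mulNmx mulNmx opprK -[_ *m b' *m a']mulmxA -ca'b' a'b'1 mulmx1.
    by rewrite -[_ *m b' *m a']mulmxA -ca'b' a'b'1 mulmx1 !mul0mx oppr0.
  have rk : (\rank a <= n - \rank a)%N.
    by rewrite -mxrank_ker; apply: mxrankS; apply/sub_kermxP.
  have : ~~ row_free (row_mx a e).
    rewrite /row_free -mxrank_tr tr_row_mx -addsmxE ltn_eqF //.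
    apply: leq_ltn_trans (mxrank_adds_leqif _ _) _; rewrite !mxrank_tr.
    by have := rank_leq_col e; move: rk n2; lia.
  move=> /not_row_freeP[w [w0]]; rewrite mul_mx_row -(row_mx0 _ _ n 1) => /eq_row_mx[wa we].
  case/eqP: w0; apply: (obs1) => //.
  by rewrite bE mulmxN !mulmxA wa !mul0mx oppr0.
have a'b'0 : a' *m b' = 0 by apply: kill.
have sum1 : b *m a' + b' *m a = 1%:M.
  apply/eqP; rewrite -subr_eq0; apply/eqP/kill; rewrite ?mulmxBl ?se ?mul1mx ?subrr //.
    by apply: comm_mxB => //; apply: comm_mx1.
  by apply: comm_mxB => //; apply: comm_mx1.
rewrite cba' -cab' in sum1.
have [ep0|ep0] := eqVneq (a *m b') 0.
  right; move: sum1; rewrite ep0 addr0 => de1; split=> //.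
    by rewrite -[a]mulmx1 -de1 mulmxA caa' -mulmxA ab0 mulmx0.
  by rewrite -[b']mul1mx -de1 -mulmxA cbb' mulmxA a'b'0 mul0mx.
have [de0|de0] := eqVneq (a' *m b) 0.
  left; move: sum1; rewrite de0 add0r => ep1; split=> //.
    by rewrite -[b]mulmx1 -ep1 mulmxA -cab ab0 mul0mx.
  by rewrite -[a']mul1mx -ep1 -mulmxA -ca'b' a'b'0 mulmx0.
(* Both idempotents are now nonzero. Joint eigenvectors [w] and [u] taken in their images get the
   same eigenvalues [x] and [q] at the point (1, x / p') of the pencils; a combination killing [e]
   then contradicts [obs]. *)
have ed : a *m b' *m (a' *m b) = 0.
  by rewrite mulmxA -(mulmxA a) -ca'b' a'b'0 mulmx0 mul0mx.
have de : a' *m b *m (a *m b') = 0.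
  by rewrite mulmxA -(mulmxA a') -cab ab0 mulmx0 mul0mx.
pose As := [:: a; b; a'; b'].
have [As1 As2 As3 As4] : [/\ a \in As, b \in As, a' \in As & b' \in As].
  by rewrite !inE !eqxx !orbT.
have Aco : {in As &, forall X Y, X *m Y = Y *m X}.
  move=> X Y; rewrite !inE => /or4P[] /eqP-> /or4P[] /eqP-> //.
have eig (E : 'M_n) : E != 0 -> {in As, forall X, comm_mx E X} ->
    exists (w : 'rV_n) x y x' y', [/\ w != 0, (w <= E)%MS,
      w *m a = x *: w /\ w *m b = y *: w & w *m a' = x' *: w /\ w *m b' = y' *: w].
  move=> E0 EX; have [||w [w0 wE wX]] := @stable_common_eigenvector F n n E As E0.
  - by move=> X hX; rewrite EX // submxMl.
  - by move=> X Y hX hY; rewrite -!mulmxA (Aco X Y).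
  have [[x wx] [y wy]] := (wX a As1, wX b As2).
  have [[x' wx'] [y' wy']] := (wX a' As3, wX b' As4).
  by exists w, x, y, x', y'.
have comE X Y : X \in As -> Y \in As -> {in As, forall Z, comm_mx (X *m Y) Z}.
  by move=> hX hY Z hZ; apply: comm_mx_sym; apply: comm_mxM; apply: Aco.
have [|w [x [y [x' [y' [w0 wE [wa wb] [wa' wb']]]]]]] := eig _ ep0.
  exact: (comE _ _ As1 As4).
have [|u [p [q [p' [q' [u0 uE [ua ub] [ua' ub']]]]]]] := eig _ de0.
  exact: (comE _ _ As3 As2).
have eigM (v : 'rV_n) X Y (c d : F) : v *m X = c *: v -> v *m Y = d *: v ->
    v *m (X *m Y) = (c * d) *: v.
  by move=> vX vY; rewrite mulmxA vX -scalemxAl vY scalerA.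
have sc0 (v : 'rV_n) (c : F) : v != 0 -> c *: v = 0 -> c = 0.
  by move=> v0 /eqP; rewrite scaler_eq0 (negPf v0) orbF => /eqP.
have wd : w *m (a' *m b) = 0.
  by move: wE => /submxP[z ->]; rewrite -mulmxA ed mulmx0.
have ue : u *m (a *m b') = 0.
  by move: uE => /submxP[z ->]; rewrite -mulmxA de mulmx0.
have we : w *m (a *m b') = w by rewrite -{2}[w]mulmx1 -sum1 mulmxDr wd add0r.
have ud : u *m (a' *m b) = u by rewrite -{2}[u]mulmx1 -sum1 mulmxDr ue addr0.
have xy' : x * y' = 1.
  apply/eqP; rewrite -subr_eq0; apply/eqP/(sc0 w) => //.
  by rewrite scalerBl -(eigM w a b') // we scale1r subrr.
have p'q : p' * q = 1.
  apply/eqP; rewrite -subr_eq0; apply/eqP/(sc0 u) => //.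
  by rewrite scalerBl -(eigM u a' b) // ud scale1r subrr.
have nz (c d : F) : c * d = 1 -> c != 0 /\ d != 0.
  by move=> cd; split; apply/eqP => c0; move/eqP: cd; rewrite c0 ?mul0r ?mulr0 eq_sym oner_eq0.
have [x0 y'0] := nz _ _ xy'; have [p'0 q0] := nz _ _ p'q.
have z0 (v : 'rV_n) X Y (c d : F) : v != 0 -> v *m X = c *: v -> v *m Y = d *: v ->
    X *m Y = 0 -> c * d = 0.
  by move=> v0 vX vY XY; apply: (sc0 v) => //; rewrite -(eigM v X Y) // XY mulmx0.
have y0 : y = 0.
  by apply/eqP; have /eqP := z0 w a b _ _ w0 wa wb ab0; rewrite mulf_eq0 (negPf x0).
have x'0 : x' = 0.
  by apply/eqP; have /eqP := z0 w a' b' _ _ w0 wa' wb' a'b'0; rewrite mulf_eq0 (negPf y'0) orbF.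
have p0 : p = 0.
  by apply/eqP; have /eqP := z0 u a b _ _ u0 ua ub ab0; rewrite mulf_eq0 (negPf q0) orbF.
have q'0 : q' = 0.
  by apply/eqP; have /eqP := z0 u a' b' _ _ u0 ua' ub' a'b'0; rewrite mulf_eq0 (negPf p'0).
subst y x' p q'; rewrite !scale0r in wb wa' ua ub'.
pose v := (u *m e) 0 0 *: w - (w *m e) 0 0 *: u.
have kil (t : 'rV_n) : t *m (1 *: a + (x / p') *: a') = x *: t ->
    t *m (1 *: b + (x / p') *: b') = q *: t -> t *m e = 0 -> t = 0.
  by apply: obs; rewrite oner_eq0.
have wA : w *m (1 *: a + (x / p') *: a') = x *: w.
  by rewrite mulmxDr -!scalemxAr wa wa' scaler0 scale1r addr0.
have uA : u *m (1 *: a + (x / p') *: a') = x *: u.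
  by rewrite mulmxDr -!scalemxAr ua ua' scaler0 add0r scalerA divfK.
have wB : w *m (1 *: b + (x / p') *: b') = q *: w.
  rewrite mulmxDr -!scalemxAr wb wb' scaler0 add0r scalerA; congr (_ *: _).
  by rewrite mulrAC xy' mul1r; apply: (mulfI p'0); rewrite divff.
have uB : u *m (1 *: b + (x / p') *: b') = q *: u.
  by rewrite mulmxDr -!scalemxAr ub ub' scaler0 scale1r addr0.
have v0 : v = 0.
  apply: kil.
  - by rewrite /v mulmxBl -!scalemxAl wA uA scalerBr !scalerA ![_ * x]mulrC.
  - by rewrite /v mulmxBl -!scalemxAl wB uB scalerBr !scalerA ![_ * q]mulrC.
  rewrite /v mulmxBl -!scalemxAl [u *m e]mx11_scalar [w *m e]mx11_scalar.
  by rewrite -!mul_scalar_mx -!scalar_mxM !mxE mulrC subrr.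
have := congr1 (mulmx^~ (a *m b')) v0; rewrite mul0mx mulmxBl -!scalemxAl we ue scaler0 subr0.
move=> /(sc0 _ _ w0) ue0; case/eqP: u0; apply: kil => //.
by rewrite [LHS]mx11_scalar ue0 raddf0.
Qed.
End CommutingPairs.

(** * From two sections to a conic frame *)

Section SpecialToFrame.
Variable F : numClosedFieldType.
Variables (N : nat) (J : 'M[F]_N).
Hypothesis Jskew : J^T = - J.
Hypothesis Junit : J \in unitmx.

(** The difference [d] of the two sides is orthogonal to the Lagrangian U, hence of the form c U,
    and orthogonality to V gives c = 0. *)
Lemma symplectic_coords m n (U V : 'M[F]_(n, N)) (v : 'M[F]_(m, N)) :
  U *m J *m U^T = 0 -> V *m J *m V^T = 0 -> V *m J *m U^T = - (U *m J *m V^T) ->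
  row_free U -> N = (2 * n)%N -> U *m J *m V^T \in unitmx ->
  v = (v *m J *m V^T *m invmx (U *m J *m V^T)) *m U
      - (v *m J *m U^T *m invmx (U *m J *m V^T)) *m V.
Proof.
move=> UU VV VU Uf N2; set g := U *m J *m V^T in VU * => gu.
set a := _ *m invmx g; set b := v *m J *m U^T *m invmx g.
pose d := v - (a *m U - b *m V); apply/eqP; rewrite -subr_eq0 -/d.
have dX p (X : 'M_(p, N)) : d *m J *m X^T =
    v *m J *m X^T - (a *m (U *m J *m X^T) - b *m (V *m J *m X^T)).
  by rewrite /d !mulmxBl !mulmxA.
have dV : d *m J *m V^T = 0 by rewrite dX VV mulmx0 subr0 -/g mulmxKV // subrr.
have dU : d *m J *m U^T = 0.
  by rewrite dX UU VU mulmx0 sub0r mulmxN opprK mulmxKV // subrr.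
have /submxP[c dE] := lagrangian Junit UU Uf N2 dU.
by move: dV; rewrite dE -!mulmxA (mulmxA U) -/g => /(congr1 (mulmx^~ (invmx g)));
  rewrite mul0mx mulmxK // => ->; rewrite mul0mx.
Qed.

Variables (k : nat) (A : 'I_4 -> 'M[F]_(k, N)).
Hypothesis Nk : N = (2 * k + 2)%N.
Hypothesis k1 : (1 < k)%N.
Hypothesis Aiso : forall x y,
  lin A x *m J *m (lin A y)^T + lin A y *m J *m (lin A x)^T = 0.
Hypothesis Afree : forall x, x != 0 -> row_free (lin A x).
Hypothesis Ajoint : forall v : 'rV[F]_N,
  (forall x, lin A x *m J *m v^T = 0) -> v = 0.

Definition Lam x y := lin A x *m J *m (lin A y)^T.

(** The equations say that Lam (s x0 + t y0) (s x1 + t y1) vanishes for all (s, t): the jumping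
    lines contain one ruling of a quadric surface, which is a conic of the Pluecker quadric. *)
Definition conic_frame := exists x0 x1 y0 y1 : 'rV[F]_4,
  [/\ indep4 x0 x1 y0 y1, Lam x0 x1 = 0, Lam y0 y1 = 0 & Lam x0 y1 + Lam y0 x1 = 0].

Lemma Lam_ext s x y : Lam x y =
  row_mx 1%:M 0 *m (lin (ext_fam A s) x *m J *m (lin (ext_fam A s) y)^T)
    *m (row_mx 1%:M 0)^T.
Proof.
have h z : lin A z = row_mx 1%:M (0 : 'cV_k) *m lin (ext_fam A s) z.
  by rewrite lin_ext mul_row_col mul1mx mul0mx addr0.
by rewrite /Lam (h x) (h y) trmx_mul !mulmxA.
Qed.

Let e : 'cV[F]_(k + 1) := col_mx 0 1%:M.

(** U = B(x0) and V = B(y0) are transversal Lagrangians, so that B(y) = ca(y) U + cb(y) V. Isotropy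
    of B says that ca(y) and cb(y) commute for every y, and the form prescribes products of these
    matrices on [e]. For the vectors z, z' of [hyperbolic_complement] this is the situation of
    [pair_cases]. *)
Lemma special_core s1 s2 x0 y0 : is_sec J A s1 -> is_sec J A s2 ->
  (forall H : 'M_(3, 4), row_free H -> H *m gram J s1 s2 *m H^T = 0 -> False) ->
  qf (gram J s1 s2) x0 x0 = 0 -> qf (gram J s1 s2) y0 y0 = 0 ->
  qf (gram J s1 s2) x0 y0 = 1 ->
  row_free (lin (ext_fam A s1) x0) -> row_free (lin (ext_fam A s1) y0) -> conic_frame.
Proof.
move=> hs1 hs2; wlog x0s : s2 hs2 / x0 *m s2 = 0.
  move=> wl Gh xx yy xy Uf Vf.
  have [c [w [s0 gE]]] := vanish_at Jskew Junit Nk Aiso hs1 hs2 Uf xx.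
  apply: (wl _ _ s0); rewrite ?gE //.
  rewrite -scaleNr -[- triv_sec _ _]scaleN1r.
  by do ?[apply: is_secD|apply: is_secZ] => //; apply: triv_is_sec.
move=> Gh xx yy xy; set B := ext_fam A s1; set U := lin B x0; set V := lin B y0 => Uf Vf.
set G := gram J s1 s2 in Gh xx yy xy *.
have Gs : G^T = G := gram_sym _ _ _.
have [z [z' [ind [xz xz' yz yz'] zz cases]]] := hyperbolic_complement Gs Gh xx yy xy.
have Biso x y : lin B x *m J *m (lin B y)^T = - (lin B y *m J *m (lin B x)^T).
  by apply/eqP; rewrite -addr_eq0; apply/eqP/ext_iso.
have Biso0 x : lin B x *m J *m (lin B x)^T = 0.
  by apply: mulr2_eq0; apply: ext_iso.
have Bsym x y : (lin B x *m J *m (lin B y)^T)^T = lin B x *m J *m (lin B y)^T.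
  by rewrite (skew_tr Jskew) -Biso.
have sec2 x y : lin B x *m J *m (y *m s2)^T + lin B y *m J *m (x *m s2)^T = qf G x y *: e.
  by rewrite ext_sec // -gramE qfE /e scale_col_mx scaler0 scalemx1.
have N2 : N = (2 * (k + 1))%N by rewrite [LHS]Nk mulnDr muln1.
set g := U *m J *m V^T.
have Uy y : U *m J *m (y *m s2)^T = qf G x0 y *: e.
  by rewrite -sec2 x0s trmx0 mulmx0 addr0.
have Vy0 : V *m J *m (y0 *m s2)^T = 0.
  by apply: mulr2_eq0; rewrite sec2 yy scale0r.
have Uy0 : U *m J *m (y0 *m s2)^T = e by rewrite Uy xy scale1r.
have comb0 (p q r s : F) : (r != 0) || (s != 0) || ((p != 0) || (q != 0)) ->
    p *: x0 + q *: y0 + r *: z + s *: z' != 0.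
  by apply: contraTneq => /ind[-> -> -> ->]; rewrite eqxx.
have obs (p q r s : F) (w : 'rV_(k + 1)) : (r != 0) || (s != 0) || ((p != 0) || (q != 0)) ->
    w *m lin B (p *: x0 + q *: y0 + r *: z + s *: z') = 0 -> w *m e = 0 -> w = 0.
  by move=> /comb0; apply: ext_obs.
(* On the kernel of g the rows of U are combinations of those of V, through U R; an eigenvector w
   there satisfies w B(x0 - l y0) = 0, and w e = 0 because e = g q^t. *)
have gu : g \in unitmx.
  rewrite -row_free_unit; apply/row_freeP0 => w0 wg0; apply/eqP.
  apply: contraT => w0n; exfalso.
  have /submxP[q y0q] : (y0 *m s2 <= V)%MS.
    apply: (ext_lagrangian Jskew Junit Nk Aiso hs1 Vf).
    exact: (skew_tr0 Jskew).
  have [R VR] : exists R, V *m R = 1%:M by apply/row_freeP.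
  have wU (w : 'rV_(k + 1)) : w *m g = 0 -> w *m U = w *m (U *m R) *m V.
    move=> wg; have /submxP[v wv] : (w *m U <= V)%MS.
      apply: (ext_lagrangian Jskew Junit Nk Aiso hs1 Vf).
      by rewrite -!mulmxA (mulmxA U).
    by rewrite (mulmxA w) wv -(mulmxA v) VR mulmx1.
  have [||w [l [wn wk wl]]] := @stable_eigenvector F _ _ (kermx g) (U *m R).
  - by rewrite kermx_eq0; apply: contra w0n => /row_freeP0 h; rewrite (h w0 wg0).
  - apply/row_subP => i; rewrite row_mul; apply/sub_kermxP.
    have wg : row i (kermx g) *m g = 0 by apply/sub_kermxP; apply: row_sub.
    rewrite {2}/g Biso mulmxN !mulmxA -(mulmxA _ U R) -wU //.
    by rewrite -!mulmxA (mulmxA U) Biso0 mulmx0 oppr0.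
  have wg : w *m g = 0 by apply/sub_kermxP.
  case/eqP: wn; apply: (obs 1 (- l) 0 0).
  - by rewrite oner_eq0 !orbT.
  - rewrite !scale0r !addr0 scale1r linD linZ -/U -/V mulmxDr wU // wl.
    by rewrite -scalemxAl -scalemxAr scaleNr subrr.
  - by rewrite -Uy0 y0q trmx_mul !mulmxA -(mulmxA w) -(mulmxA w) wg mul0mx.
have VU : V *m J *m U^T = - g by rewrite Biso.
pose ca y := lin B y *m J *m V^T *m invmx g.
pose cb y := - (lin B y *m J *m U^T *m invmx g).
have BE y : lin B y = ca y *m U + cb y *m V.
  rewrite mulNmx; apply: symplectic_coords => //; exact: Biso0.
have cag y : ca y *m g = g *m (ca y)^T.
  rewrite mulmxKV // -[LHS]Bsym -{1}[lin B y *m J *m V^T](mulmxKV gu) trmx_mul.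
  by rewrite Bsym.
have cbg y : cb y *m g = g *m (cb y)^T.
  rewrite mulNmx mulmxKV // linearN /= mulmxN; congr (- _).
  by rewrite -[LHS]Bsym -{1}[lin B y *m J *m U^T](mulmxKV gu) trmx_mul Bsym.
have caZ (r s : F) : r *: ca z + s *: ca z' = ca (r *: z + s *: z').
  by rewrite /ca linD !linZ !mulmxDl -!scalemxAl.
have cbZ (r s : F) : r *: cb z + s *: cb z' = cb (r *: z + s *: z').
  by rewrite /cb linD !linZ !mulmxDl -!scalemxAl !scalerN -opprD.
have cax0 : ca x0 = 1%:M by rewrite /ca mulmxV.
have cbx0 : cb x0 = 0 by rewrite /cb Biso0 mul0mx oppr0.
have cay0 : ca y0 = 0 by rewrite /ca Biso0 mul0mx.
have cby0 : cb y0 = 1%:M by rewrite /cb VU mulNmx opprK mulmxV.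
clearbody ca cb.
have X1 x m (X : 'M_(m, N)) : lin B x *m J *m X^T =
    ca x *m (U *m J *m X^T) + cb x *m (V *m J *m X^T).
  by rewrite (BE x) !mulmxDl !mulmxA.
have prod x y : lin B x *m J *m (lin B y)^T = (ca x *m cb y - cb x *m ca y) *m g.

  have X2 (X : 'M_(k + 1, N)) : X *m J *m (lin B y)^T =
      X *m J *m U^T *m (ca y)^T + X *m J *m V^T *m (cb y)^T.
    by rewrite (BE y) linearD /= !trmx_mul mulmxDr !mulmxA.
  rewrite X1 !X2. rewrite Biso0 VU Biso0 !mul0mx add0r addr0 (mulNmx g) -/g -cag -cbg.
  by rewrite mulmxBl (mulmxN (cb x)) (mulmxA (ca x)) (mulmxA (cb x)).
have ga_inj (X : 'M_(k + 1)) : X *m g = 0 -> X = 0.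
  by move=> h; rewrite -[X](mulmxK gu) h mul0mx.
have cab x : ca x *m cb x = cb x *m ca x.
  by apply/eqP; rewrite -subr_eq0; apply/eqP/ga_inj; rewrite -prod Biso0.
have mix : ca z *m cb z' + ca z' *m cb z = cb z *m ca z' + cb z' *m ca z.
  apply/eqP; rewrite -subr_eq0 opprD addrACA; apply/eqP/ga_inj.
  by rewrite mulmxDl -!prod Biso addNr.
have Vz y : qf G x0 y = 0 -> qf G y0 y = 0 -> V *m J *m (y *m s2)^T = - (ca y *m e).
  move=> xy0 yy0; apply/eqP; rewrite -addr_eq0; apply/eqP.
  rewrite -[RHS](scale0r e) -yy0 -sec2; congr (_ + _).
  by rewrite X1 Uy0 Vy0 mulmx0 addr0.
have quad x y : qf G x0 y = 0 -> qf G y0 y = 0 -> qf G x0 x = 0 -> qf G y0 x = 0 ->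
    (cb x *m ca y + cb y *m ca x) *m e = - qf G x y *: e.
  move=> y1 y2 x1 x2; rewrite scaleNr -sec2.
  have sg t u : qf G x0 u = 0 -> qf G y0 u = 0 ->
      lin B t *m J *m (u *m s2)^T = - (cb t *m ca u *m e).
    move=> u1 u2; rewrite X1 Uy u1 scale0r Vz // mulmx0 add0r mulmxN.
    by rewrite (mulmxA (cb t)).
  by rewrite !sg // opprD !opprK mulmxDl.
have k3 : (2 < k + 1)%N by rewrite addn1.
have [|||[b0 a'0 ab]|[a0 b'0 ab]] := pair_cases (e := e) k3 (cab z) (cab z') mix.
- move=> r s p q w rs; rewrite caZ cbZ => wa wb; apply: (obs (- p) (- q) r s).
    by rewrite rs.
  rewrite -addrA linD [lin B (r *: z + _)]BE linD !linZ -/U -/V.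
  rewrite !(mulmxDr w) (mulmxA w (ca _)) (mulmxA w (cb _)) wa wb.
  rewrite -!(scalemxAl _ w) -!(scalemxAr _ w) !scaleNr -opprD addNr //.
- have := quad z z xz yz xz yz; rewrite zz oppr0 scale0r -mulr2n -scaler_nat -scalemxAl.
  by rewrite cab => /eqP; rewrite scaler_eq0 pnatr_eq0 => /eqP.
- have q1 := quad z z' xz' yz' xz yz; have q2 := quad z' z' xz' yz' xz' yz'.
  have {}q2 : ca z' *m cb z' *m e = - (qf G z' z' / 2) *: e.
    have two : (2 : F) != 0 by rewrite pnatr_eq0.
    apply: (scalerI two); rewrite scalerA -mulNr mulrCA divff // mulr1 -q2.
    by rewrite cab scaler_nat mulmxDl.
  rewrite q1 q2; case: cases => [[-> ->]|[-> ->]]; [left|right].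
    by rewrite mul0r oppr0 scale0r opprK scale1r.
  by rewrite oppr0 scale0r mulNr opprK divff ?scale1r // pnatr_eq0.
(* By [prod], b = 0 annihilates Lam x0 z and a' = 0 annihilates Lam z' y0, while a b' = 1 makes Lam
   x0 y0 and Lam z' z opposite. *)
- exists x0, z, z', y0; split.
  + move=> p q r s h; have [] := ind p s q r => //.
    by rewrite -h -!addrA; congr (_ + _); rewrite addrC -!addrA.
  + by rewrite (Lam_ext s1) -/B prod cax0 cbx0 b0 mulmx0 mul0mx subr0 !(mul0mx, mulmx0).
  + by rewrite (Lam_ext s1) -/B prod cay0 cby0 a'0 mulmx0 mul0mx subr0 !(mul0mx, mulmx0).
  + rewrite !(Lam_ext s1) -/B !prod cax0 cbx0 cby0 a'0 !(mul0mx, mul1mx) subr0 sub0r.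
    by rewrite (mulmx1C ab) -mulmxDl -mulmxDr -(mulmxDl 1%:M) subrr !(mul0mx, mulmx0).
exists x0, z', z, y0; split.
+ move=> p q r s h; have [] := ind p s r q => //.
  by rewrite -h -!addrA; congr (_ + _); rewrite addrC [r *: z + _]addrC -!addrA.
+ by rewrite (Lam_ext s1) -/B prod cax0 cbx0 b'0 mulmx0 mul0mx subr0 !(mul0mx, mulmx0).
+ by rewrite (Lam_ext s1) -/B prod cay0 cby0 a0 mulmx0 mul0mx subr0 !(mul0mx, mulmx0).
rewrite !(Lam_ext s1) -/B !prod cax0 cbx0 cby0 a0 !(mul0mx, mul1mx) subr0 sub0r.
by rewrite (mulmx1C ab) -mulmxDl -mulmxDr -(mulmxDl 1%:M) subrr !(mul0mx, mulmx0).
Qed.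

(** The rank drops mean x s1 = w1 A(x) and x s2 = w2 A(x). Polarity then turns the form into - w1
    (Lam x y + Lam y x) w2^t, zero by isotropy. *)
Lemma rank_drop_combination s1 s2 x y : is_sec J A s1 -> is_sec J A s2 -> x != 0 ->
  ~~ row_free (lin (ext_fam A s1) x) -> ~~ row_free (lin (ext_fam A s2) x) ->
  qf (gram J s1 s2) x y = 0.
Proof.
move=> hs1 hs2 x0 f1 f2.
have wE s : ~~ row_free (lin (ext_fam A s) x) -> exists w, x *m s = w *m lin A x.
  by rewrite lin_ext => /(row_free_col_mx (Afree x0))/submxP.
have [w1 w1E] := wE _ f1; have [w2 w2E] := wE _ f2.
have e1 := is_sec_polar x y hs2; have e2 := is_sec_polar x y hs1.
have {e1} e1 : lin A x *m J *m (y *m s2)^T = - (lin A y *m J *m (lin A x)^T *m w2^T).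
  by apply/eqP; rewrite -addr_eq0 -[X in _ + X]mulmxA -trmx_mul -w2E; apply/eqP.
have {e2} e2 : y *m s1 *m J *m (lin A x)^T = - (w1 *m (lin A x *m J *m (lin A y)^T)).
  have -> : y *m s1 *m J *m (lin A x)^T = - (lin A x *m J *m (y *m s1)^T)^T.
    by rewrite (skew_tr Jskew) opprK.
  have -> : lin A x *m J *m (y *m s1)^T = - (lin A y *m J *m (lin A x)^T *m w1^T).
    by apply/eqP; rewrite -addr_eq0 -[X in _ + X]mulmxA -trmx_mul -w1E; apply/eqP.
  by rewrite linearN /= opprK trmx_mul trmxK (skew_tr Jskew) mulmxN.
rewrite /qf gramE /sec_form w1E w2E (trmx_mul w2) (mulmxA _ _ w2^T) e2.
rewrite -(mulmxA w1) -(mulmxA w1) e1 mulmxN (mulNmx (w1 *m _)) -opprD -(mulmxA w1 _ w2^T).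
by rewrite -mulmxDr -mulmxDl Aiso mul0mx mulmx0 oppr0 mxE.
Qed.

(** As the form is 1 on (x0, y0), at each of the two points at most one of s1, s2, s1 + s2 drops
    rank. Three candidates and two points leave one that is good at both; it completes to a pair
    with the same Gram form. *)
Lemma special_frame s1 s2 : section_basis J A s1 s2 -> conic_frame.
Proof.
move=> sb; have [hs1 hs2 _ _] := sb.
have Gh := no_isotropic_hyperplane Jskew Junit Nk Aiso Afree Ajoint sb.
have [x0 [y0 [xx yy xy]]] := hyperbolic_pair (gram_sym J s1 s2) (@Gh).
have qf0 : qf (gram J s1 s2) 0 0 = 0 by rewrite /qf !mul0mx mxE.
have x00 : x0 != 0.
  by apply/eqP => h; move/eqP: xy; rewrite h /qf !mul0mx mxE eq_sym oner_eq0.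
have y00 : y0 != 0.
  by apply/eqP => h; move/eqP: xy; rewrite h /qf trmx0 mulmx0 mxE eq_sym oner_eq0.
have yx : qf (gram J s1 s2) y0 x0 = 1 by rewrite qfC // gram_sym.
pose ok s := row_free (lin (ext_fam A s) x0) && row_free (lin (ext_fam A s) y0).
have step t1 t2 : is_sec J A t1 -> is_sec J A t2 -> gram J t1 t2 = gram J s1 s2 ->
    ok t1 -> conic_frame.
  move=> ht1 ht2 gE /andP[f1 f2]; apply: (special_core (x0 := x0) (y0 := y0) ht1 ht2).
  - by move=> H; rewrite gE; apply: Gh.
  - by rewrite gE.
  - by rewrite gE.
  - by rewrite gE.
  - exact: f1.
  - exact: f2.
have bad t1 t2 x : is_sec J A t1 -> is_sec J A t2 -> gram J t1 t2 = gram J s1 s2 ->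
    x = x0 \/ x = y0 -> row_free (lin (ext_fam A t1) x) || row_free (lin (ext_fam A t2) x).
  move=> ht1 ht2 gE xE; apply: contraT; rewrite negb_or => /andP[f1 f2].
  case: xE f1 f2 => -> f1 f2.
    by have /eqP := rank_drop_combination y0 ht1 ht2 x00 f1 f2; rewrite gE xy oner_eq0.
  by have /eqP := rank_drop_combination x0 ht1 ht2 y00 f1 f2; rewrite gE yx oner_eq0.
have hN : is_sec J A (- s1) by rewrite -scaleN1r; apply: is_secZ.
have hD : is_sec J A (s1 + s2) by apply: is_secD.
have gE2 : gram J s2 (- s1) = gram J s1 s2 by rewrite -scaleN1r gramZr gramC // scaleN1r opprK.
have gE3 : gram J (s1 + s2) s2 = gram J s1 s2.
  by rewrite gramC // gramDr gramss // addr0 -gramC.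
have gE4 : gram J s1 (s1 + s2) = gram J s1 s2 by rewrite gramDr gramss // add0r.
have [o1|n1] := boolP (ok s1); first exact: (step s1 s2).
have [o2|n2] := boolP (ok s2); first exact: (step s2 (- s1)).
have [o3|n3] := boolP (ok (s1 + s2)); first exact: (step (s1 + s2) s2).
exfalso; move: n1 n2 n3; rewrite /ok.
have := bad s1 s2 x0 hs1 hs2 erefl (or_introl erefl).
have := bad s1 s2 y0 hs1 hs2 erefl (or_intror erefl).
have := bad s1 _ x0 hs1 hD gE4 (or_introl erefl).
have := bad s1 _ y0 hs1 hD gE4 (or_intror erefl).
have := bad _ s2 x0 hD hs2 gE3 (or_introl erefl).
have := bad _ s2 y0 hD hs2 gE3 (or_intror erefl).
by do 6!case: (row_free _).
Qed.
End SpecialToFrame.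

(** * From a frame to sections *)

Section FramePencil.
Variable F : numClosedFieldType.

(** The equations say (s b0 + t b1) (s a + t b) = 0, a linear section of the kernel of a pencil of
    constant rank k; this kernel is O(-k), so k > 1 leaves only zero. Concretely, if b1 a is nonzero
    its left annihilator H has rank k - 1, and so has the left annihilator K of a and b. Both b0 and
    b1 send H into K, b0 isomorphically, and an eigenvector of their quotient on H violates the
    constant rank. *)
Lemma pencil_column_rigid k (b0 b1 : 'M[F]_(k, k + 1)) (a b : 'cV[F]_(k + 1)) :
  (1 < k)%N -> (forall s t, (s != 0) || (t != 0) -> row_free (s *: b0 + t *: b1)) ->
  (forall v : 'cV_(k + 1), b0 *m v = 0 -> b1 *m v = 0 -> v = 0) ->
  b0 *m a = 0 -> b1 *m b = 0 -> b0 *m b + b1 *m a = 0 -> a = 0 /\ b = 0.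
Proof.
move=> k1 pf inj a0 b1b mix.
have b0f : row_free b0.
  by have := pf 1 0; rewrite oner_eq0 scale1r scale0r addr0; apply.
have [aE|an] := eqVneq a 0.
  by split=> //; apply: inj b1b; move: mix; rewrite aE mulmx0 addr0.
exfalso; have b1a : b1 *m a != 0.
  by apply: contraNneq an => h; rewrite (inj a).
pose H := kermx (b1 *m a).
have Ha (w : 'rV_k) : (w <= H)%MS -> w *m (b1 *m a) = 0 by move/sub_kermxP.
have Hb (w : 'rV_k) : (w <= H)%MS -> w *m (b0 *m b) = 0.
  by move/Ha => h; move/eqP: mix; rewrite addr_eq0 => /eqP->; rewrite mulmxN h oppr0.
have rH : \rank H = k.-1 by rewrite mxrank_ker rank_col1 // subn1.
pose K := kermx (row_mx a b).
have rK : \rank K = k.-1.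
  have rab : \rank (row_mx a b) = 2%N.
    suff aux (w : 'rV_(1 + 1)) : w *m col_mx a^T b^T = 0 -> w = 0.
      apply/eqP; rewrite eqn_leq rank_leq_col -mxrank_tr tr_row_mx row_leq_rank.
      exact/row_freeP0.
    rewrite -[w]hsubmxK mul_row_col.
    move: (lsubmx w) (rsubmx w) => p q.
    rewrite [p]mx11_scalar [q]mx11_scalar !mul_scalar_mx => h.
    have q0 : q 0 0 = 0.
      have := congr1 (fun v => b0 *m v^T) h; rewrite linearD !linearZ /= !trmxK.
      rewrite trmx0 mulmx0 mulmxDr -!scalemxAr a0 scaler0 add0r => /eqP.
      rewrite scaler_eq0 => /orP[/eqP //|/eqP b0b]; move: mix; rewrite b0b add0r => h'.
      by rewrite h' eqxx in b1a.
    move: h; rewrite q0 scale0r addr0 => /eqP; rewrite scaler_eq0 trmx_eq0 (negPf an) orbF.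
    by move=> /eqP->; rewrite !raddf0 row_mx0.
  by rewrite mxrank_ker rab addn1 subSS subn1.
have sub i : (H *m (if i then b1 else b0) <= K)%MS.
  apply/row_subP => j; rewrite row_mul; apply/sub_kermxP.
  have jH : (row j H <= H)%MS by apply: row_sub.
  rewrite mul_mx_row -!mulmxA; case: i; rewrite ?a0 ?b1b ?mulmx0 ?Ha ?Hb //;
  exact: row_mx0.
have H0K : (K <= H *m b0)%MS.
  have := mxrank_leqif_sup (sub false) => /= -[_ <-].
  by rewrite mxrankMfree // rH rK.
have [R b0R] : exists R, b0 *m R = 1%:M by apply/row_freeP.
have wR (w : 'rV_k) : (w <= H)%MS ->
    (w *m (b1 *m R) <= H)%MS /\ w *m b1 = w *m (b1 *m R) *m b0.
  move=> wH; have : (w *m b1 <= H *m b0)%MS.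
    by apply: submx_trans H0K; apply: submx_trans (sub true); apply: submxMr.
  case/submxP => c cE; rewrite (mulmxA w) cE (mulmxA c) -(mulmxA _ b0) b0R mulmx1.
  by rewrite submxMl.
have [||w [l [w0 wH wl]]] := @stable_eigenvector F _ _ H (b1 *m R).
- by rewrite -mxrank_eq0 rH; case: (k) k1 => [|[]].
- by apply/row_subP => j; rewrite row_mul; have [] := wR _ (row_sub j H).
have [_ wb] := wR _ wH; case/eqP: w0; have := pf (- l) 1; rewrite oner_eq0 orbT.
move=> /(_ isT)/row_freeP0; apply; rewrite mulmxDr -!scalemxAr scale1r wb wl.
by rewrite -scalemxAl scaleNr addNr.
Qed.
End FramePencil.

(** * Coordinates and factorization along a frame *)

Section FrameToSections.
Variable F : numClosedFieldType.
Variables (N : nat) (J : 'M[F]_N).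
Hypothesis Jskew : J^T = - J.
Hypothesis Junit : J \in unitmx.
Variables (k : nat) (A : 'I_4 -> 'M[F]_(k, N)).
Hypothesis Nk : N = (2 * k + 2)%N.
Hypothesis k1 : (1 < k)%N.
Hypothesis Aiso : forall x y,
  lin A x *m J *m (lin A y)^T + lin A y *m J *m (lin A x)^T = 0.
Hypothesis Afree : forall x, x != 0 -> row_free (lin A x).
Hypothesis Ajoint : forall v : 'rV[F]_N,
  (forall x, lin A x *m J *m v^T = 0) -> v = 0.

Definition frame_mx (x0 x1 y0 y1 : 'rV[F]_4) : 'M[F]_4 :=
  col_mx (col_mx x0 x1) (col_mx y0 y1).

Lemma frame_unit x0 x1 y0 y1 : indep4 x0 x1 y0 y1 -> frame_mx x0 x1 y0 y1 \in unitmx.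
Proof.
move=> ind; rewrite -row_free_unit.
suff aux (w : 'rV_((1 + 1) + (1 + 1))) :
    w *m col_mx (col_mx x0 x1) (col_mx y0 y1) = 0 -> w = 0 by apply/row_freeP0.
rewrite -[w]hsubmxK; move: (lsubmx w) (rsubmx w) => u v.
rewrite -[u]hsubmxK -[v]hsubmxK.
move: (lsubmx u) (rsubmx u) (lsubmx v) (rsubmx v) => p q r s.
rewrite [p]mx11_scalar [q]mx11_scalar [r]mx11_scalar [s]mx11_scalar.
by rewrite !mul_row_col !mul_scalar_mx addrA => /ind[-> -> -> ->]; rewrite !raddf0 !row_mx0.
Qed.

Lemma frame_coords x0 x1 y0 y1 : indep4 x0 x1 y0 y1 ->
  forall x : 'rV[F]_4, exists p q r s, x = p *: x0 + q *: x1 + r *: y0 + s *: y1.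
Proof.
move=> /frame_unit fu x; pose w : 'rV_((1 + 1) + (1 + 1)) := x *m invmx (frame_mx x0 x1 y0 y1).
have : x = w *m col_mx (col_mx x0 x1) (col_mx y0 y1) by exact: esym (mulmxKV fu x).
rewrite -[w]hsubmxK; move: (lsubmx w) (rsubmx w) => u v.
rewrite -[u]hsubmxK -[v]hsubmxK.
move: (lsubmx u) (rsubmx u) (lsubmx v) (rsubmx v) => p q r s.
rewrite [p]mx11_scalar [q]mx11_scalar [r]mx11_scalar [s]mx11_scalar.
rewrite !mul_row_col !mul_scalar_mx addrA => ->.
by exists (p 0 0), (q 0 0), (r 0 0), (s 0 0).
Qed.

(* A pair of row vectors [mu] gives the section with values [mu_i G0] at the [x_i]
   and [mu_i G1] at the [y_i]. *)
Definition frame_sec x0 x1 y0 y1 n (G0 G1 : 'M[F]_(n, N)) (mu : 'rV[F]_(n + n)) :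
    'M[F]_(4, N) :=
  invmx (frame_mx x0 x1 y0 y1) *m
  (col_mx (col_mx (lsubmx mu *m G0) (rsubmx mu *m G0))
         (col_mx (lsubmx mu *m G1) (rsubmx mu *m G1)) : 'M_(1 + 1 + (1 + 1), N)).

Lemma frame_secE x0 x1 y0 y1 n (G0 G1 : 'M[F]_(n, N)) (mu : 'rV[F]_(n + n))
    (sg := frame_sec x0 x1 y0 y1 G0 G1 mu) : indep4 x0 x1 y0 y1 ->
  [/\ x0 *m sg = lsubmx mu *m G0, x1 *m sg = rsubmx mu *m G0,
      y0 *m sg = lsubmx mu *m G1 & y1 *m sg = rsubmx mu *m G1].
Proof.
move=> /frame_unit fu.
pose Z : 'M_(1 + 1 + (1 + 1), N) := col_mx (col_mx (lsubmx mu *m G0) (rsubmx mu *m G0))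
         (col_mx (lsubmx mu *m G1) (rsubmx mu *m G1)).
have h : col_mx (col_mx (x0 *m sg) (x1 *m sg)) (col_mx (y0 *m sg) (y1 *m sg)) = Z.
  by rewrite -!mul_col_mx; apply: (mulKVmx fu Z).
have [h1 h2] := eq_col_mx h.
by have [-> ->] := eq_col_mx h1; have [-> ->] := eq_col_mx h2.
Qed.

Lemma frame_eq x0 x1 y0 y1 (s t : 'M[F]_(4, N)) : indep4 x0 x1 y0 y1 ->
  x0 *m s = x0 *m t -> x1 *m s = x1 *m t -> y0 *m s = y0 *m t -> y1 *m s = y1 *m t ->
  s = t.
Proof.
move=> ind e0 e1 e2 e3; apply/row_matrixP => i; rewrite !rowE.
have [p [q [r [u ->]]]] := frame_coords ind (delta_mx 0 i).
rewrite !(mulmxDl _ (_ *: _)) -!scalemxAl.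
by rewrite e0 e1 e2 e3.
Qed.
End FrameToSections.

Section FrameToBasis.
Variable F : numClosedFieldType.
Variables (N : nat) (J : 'M[F]_N).
Hypothesis Jskew : J^T = - J.
Hypothesis Junit : J \in unitmx.
Variables (k : nat) (A : 'I_4 -> 'M[F]_(k, N)).
Hypothesis Nk : N = (2 * k + 2)%N.
Hypothesis k1 : (1 < k)%N.
Hypothesis Aiso : forall x y,
  lin A x *m J *m (lin A y)^T + lin A y *m J *m (lin A x)^T = 0.
Hypothesis Afree : forall x, x != 0 -> row_free (lin A x).
Hypothesis Ajoint : forall v : 'rV[F]_N,
  (forall x, lin A x *m J *m v^T = 0) -> v = 0.

Lemma Lam_anti x y : Lam J A x y = - Lam J A y x.
Proof. by apply/eqP; rewrite -addr_eq0; apply/eqP/Aiso. Qed.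

Lemma Lam_tr x y : (Lam J A x y)^T = Lam J A x y.
Proof. by rewrite /Lam (skew_tr Jskew) -/(Lam J A y x) -Lam_anti. Qed.

Lemma frame_joint x0 x1 y0 y1 (v : 'rV[F]_N) : indep4 x0 x1 y0 y1 ->
  v *m J *m (lin A x0)^T = 0 -> v *m J *m (lin A x1)^T = 0 ->
  v *m J *m (lin A y0)^T = 0 -> v *m J *m (lin A y1)^T = 0 -> v = 0.
Proof.
move=> ind e0 e1 e2 e3; apply: Ajoint => x; apply: (skew_tr0 Jskew).
have phiD z z' : v *m J *m (lin A (z + z'))^T =
    v *m J *m (lin A z)^T + v *m J *m (lin A z')^T.
  by rewrite linD [X in v *m J *m X]linearD mulmxDr.
have phiZ c z : v *m J *m (lin A (c *: z))^T = c *: (v *m J *m (lin A z)^T).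
  by rewrite linZ [X in v *m J *m X]linearZ -scalemxAr.
have [p [q [r [s ->]]]] := frame_coords ind x.
by rewrite !phiD !phiZ e0 e1 e2 e3 !scaler0 !addr0.
Qed.

(** The vector w0 A(y0) + w1 A(y1) is orthogonal to all four members of the family: to A(y0), A(y1)
    since Lam y0 y1 = 0, and to A(x0), A(x1) since Lam x0 y1 = Lam x1 y0 lets the given relation be
    used with x and y exchanged. *)
Lemma frame_kernel x0 x1 y0 y1 (w0 w1 : 'rV[F]_k) : indep4 x0 x1 y0 y1 ->
  Lam J A y0 y1 = 0 -> Lam J A x0 y1 + Lam J A y0 x1 = 0 ->
  w0 *m lin A x0 + w1 *m lin A x1 = 0 -> w0 *m lin A y0 + w1 *m lin A y1 = 0.
Proof.
move=> ind yy xy h; set v := _ + _.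
have vE y : v *m J *m (lin A y)^T = w0 *m Lam J A y0 y + w1 *m Lam J A y1 y.
  by rewrite /v /Lam !mulmxDl !mulmxA.
have hE y : w0 *m Lam J A x0 y + w1 *m Lam J A x1 y = 0.
  by rewrite /Lam !mulmxA -!mulmxDl h !mul0mx.
have Lz z : Lam J A z z = 0 := Aiso0 Aiso z.
have yx : Lam J A x0 y1 = Lam J A x1 y0.
  by apply/eqP; rewrite -subr_eq0 -(Lam_anti y0) xy.
apply: (frame_joint ind); rewrite vE.
- by rewrite (Lam_anti y0) (Lam_anti y1) yx !mulmxN -opprD hE oppr0.
- by rewrite (Lam_anti y0) (Lam_anti y1) -yx !mulmxN -opprD hE oppr0.
- by rewrite Lz (Lam_anti y1) yy oppr0 !mulmx0 addr0.
by rewrite Lz yy !mulmx0 addr0.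
Qed.

Lemma frame_kernel' x0 x1 y0 y1 (w0 w1 : 'rV[F]_k) : indep4 x0 x1 y0 y1 ->
  Lam J A x0 x1 = 0 -> Lam J A x0 y1 + Lam J A y0 x1 = 0 ->
  w0 *m lin A y0 + w1 *m lin A y1 = 0 -> w0 *m lin A x0 + w1 *m lin A x1 = 0.
Proof.
move=> ind xx xy; apply: frame_kernel => //; last by rewrite addrC.
move=> p q r s h; have [] := ind r s p q => //.
by rewrite -h -addrA addrC -!addrA.
Qed.

Definition frame_factor x0 x1 y0 y1 (b0 b1 : 'M[F]_(k, k + 1)) (G0 G1 : 'M[F]_(k + 1, N)) :=
  [/\ lin A x0 = b0 *m G0, lin A x1 = b1 *m G0, lin A y0 = b0 *m G1 & lin A y1 = b1 *m G1].

(** A(x0), A(x1) span an isotropic space, and so do A(y0), A(y1); together they span everything by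
    [frame_joint], so both have rank k + 1. By [frame_kernel] the relations of the first pair hold
    for the second, whence the same coefficients [b0], [b1] for both. *)
Lemma exists_frame_factor x0 x1 y0 y1 : indep4 x0 x1 y0 y1 ->
  Lam J A x0 x1 = 0 -> Lam J A y0 y1 = 0 -> Lam J A x0 y1 + Lam J A y0 x1 = 0 ->
  exists b0 b1 G0 G1, [/\ frame_factor x0 x1 y0 y1 b0 b1 G0 G1,
    row_free (col_mx G0 G1), \rank (col_mx b0 b1) = (k + 1)%N,
    G0 *m J *m G0^T = 0 & G1 *m J *m G1^T = 0].
Proof.
move=> ind xx yy xy.
have Lz z : Lam J A z z = 0 := Aiso0 Aiso z.
pose X := col_mx (lin A x0) (lin A x1); pose Y := col_mx (lin A y0) (lin A y1).
have iso z z' : Lam J A z z' = 0 ->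
    col_mx (lin A z) (lin A z') *m J *m (col_mx (lin A z) (lin A z'))^T = 0.
  move=> h; rewrite mul_col_mx tr_col_mx mul_col_row -/(Lam J A z z) -/(Lam J A z z').
  by rewrite -/(Lam J A z' z) -/(Lam J A z' z') !Lz (Lam_anti z') h oppr0 block_mx0.
have XX := iso _ _ xx; have YY := iso _ _ yy.
have rXY : (N <= \rank (col_mx X Y))%N.
  rewrite -subn_eq0 -(rank_perp Junit) mxrank_eq0; apply/eqP/row_matrixP => i.
  rewrite row0; have /perpP := row_sub i (perp J (col_mx X Y)).
  rewrite !tr_col_mx !mul_mx_row -(row_mx0 _ _ (k + k) (k + k)) => /eq_row_mx[].
  rewrite -(row_mx0 _ _ k k) => /eq_row_mx[e0 e1] /eq_row_mx[e2 e3].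
  exact: frame_joint ind e0 e1 e2 e3.
have rX := isotropic_rank Junit XX; have rY := isotropic_rank Junit YY.
have rs : (\rank (col_mx X Y) <= \rank X + \rank Y)%N.
  by rewrite -addsmxE mxrank_adds_leqif.
have [rX1 rY1] : \rank X = (k + 1)%N /\ \rank Y = (k + 1)%N.
  by move: (\rank X) (\rank Y) (\rank _) Nk rX rY rs rXY; clear => *; lia.
have [|G0 [G0X XG0]] := @compl_rows F 1 _ _ 0 X (k + 1) (sub0mx _ _).
  by rewrite mxrank0.
have {}XG0 : (X <= G0)%MS by move: XG0; rewrite -(addsmxE 0 G0) adds0mx.
have /submxP[b bE] := XG0; have /submxP[C CE] := G0X.
pose G1 := C *m Y.
have bYE : Y = b *m G1.
  have h : (1%:M - b *m C) *m X = 0 by rewrite mulmxBl mul1mx -mulmxA -CE -bE subrr.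
  apply/eqP; rewrite /G1 mulmxA -subr_eq0 -{1}[Y]mul1mx -mulmxBl; apply/eqP.
  apply/row_matrixP => i; rewrite row_mul row0.
  have := congr1 (row i) h; rewrite row_mul row0; move: (row i _) => w.
  rewrite -[w]hsubmxK !mul_row_col; exact: frame_kernel.
have rb : \rank b = (k + 1)%N.
  have h : (\rank X <= \rank b)%N by rewrite bE mxrankM_maxl.
  by apply/eqP; rewrite eqn_leq rank_leq_col; move: h; rewrite rX1.
have YG1 : (Y <= G1)%MS by rewrite bYE submxMl.
exists (usubmx b), (dsubmx b), G0, G1.
have [e0 e1] : lin A x0 = usubmx b *m G0 /\ lin A x1 = dsubmx b *m G0.
  by apply: eq_col_mx; rewrite -mul_col_mx vsubmxK.
have [e2 e3] : lin A y0 = usubmx b *m G1 /\ lin A y1 = dsubmx b *m G1.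
  by apply: eq_col_mx; rewrite -mul_col_mx vsubmxK.
have isoG m (M : 'M_(m, N)) C' : M *m J *m M^T = 0 -> (C' : 'M_(k + 1, m)) *m M *m J *m (C' *m M)^T = 0.
  by move=> h; rewrite trmx_mul !mulmxA -(mulmxA C') -(mulmxA C') h mulmx0 mul0mx.
split.
- by [].
- rewrite -row_leq_rank; have h : (k + 1 + (k + 1) <= N)%N by rewrite Nk; lia.
  by apply: (leq_trans h); apply: (leq_trans rXY); apply: mxrankS; rewrite -!addsmxE addsmxS.
- by rewrite vsubmxK.
- by rewrite {1 2}CE; apply: isoG.
- exact: isoG.
Qed.

(** The products b_i g b_j^t are values of Lam, which are symmetric matrices, and the stacked [b0],
    [b1] can be cancelled. A row vector w killing g would make w G0 orthogonal to both
    Lagrangians. *)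
Lemma frame_gamma x0 x1 y0 y1 b0 b1 G0 G1 :
  Lam J A x0 y1 + Lam J A y0 x1 = 0 ->
  frame_factor x0 x1 y0 y1 b0 b1 G0 G1 -> row_free (col_mx G0 G1) ->
  \rank (col_mx b0 b1) = (k + 1)%N -> G0 *m J *m G0^T = 0 ->
  G1 *m J *m G1^T = 0 ->
  (G0 *m J *m G1^T)^T = G0 *m J *m G1^T /\ G0 *m J *m G1^T \in unitmx.
Proof.
move=> xy [e0 e1 e2 e3] Gf rb g00 g11; set g := G0 *m J *m G1^T.
have cf (m : nat) (X : 'M_(k + 1, m)) : col_mx b0 b1 *m X = 0 -> X = 0.
  move=> h; apply: trmx_inj; rewrite trmx0; apply/row_matrixP => i; rewrite row0.
  have : row_free (col_mx b0 b1)^T by rewrite /row_free mxrank_tr rb.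
  move=> /row_freeP0; apply; rewrite -row_mul -trmx_mul h trmx0 row0 //.
have LE (a : 'M_(k, k + 1)) (c : 'M_(k, k + 1)) :
    a *m G0 *m J *m (c *m G1)^T = a *m g *m c^T by rewrite trmx_mul !mulmxA.
have yx : Lam J A x1 y0 = Lam J A x0 y1.
  by apply/eqP; rewrite eq_sym -subr_eq0 -(Lam_anti y0) xy.
have sym p q : b0 *m p = b0 *m q -> b1 *m p = b1 *m q -> p = q :> 'M_(k + 1).
  move=> h h'; apply/eqP; rewrite -subr_eq0; apply/eqP/cf.
  by rewrite mul_col_mx !mulmxBr h h' !subrr col_mx0.
split.
  have L00 : Lam J A x0 y0 = b0 *m g *m b0^T by rewrite /Lam e0 e2 LE.
  have L01 : Lam J A x0 y1 = b0 *m g *m b1^T by rewrite /Lam e0 e3 LE.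
  have L10 : Lam J A x1 y0 = b1 *m g *m b0^T by rewrite /Lam e1 e2 LE.
  have L11 : Lam J A x1 y1 = b1 *m g *m b1^T by rewrite /Lam e1 e3 LE.
  have t (a c : 'M_(k, k + 1)) : a *m g^T *m c^T = (c *m g *m a^T)^T.
    by rewrite (trmx_mul (c *m g)) (trmx_mul c) trmxK mulmxA.
  have t00 : b0 *m g^T *m b0^T = b0 *m g *m b0^T by rewrite t -L00 Lam_tr.
  have t11 : b1 *m g^T *m b1^T = b1 *m g *m b1^T by rewrite t -L11 Lam_tr.
  have t01 : b0 *m g^T *m b1^T = b0 *m g *m b1^T by rewrite t -L10 Lam_tr yx.
  have t10 : b1 *m g^T *m b0^T = b1 *m g *m b0^T by rewrite t -L01 Lam_tr -yx.
  have cancel (a : 'M_(k, k + 1)) (p q : 'M_(k + 1)) :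
      a *m p *m b0^T = a *m q *m b0^T -> a *m p *m b1^T = a *m q *m b1^T ->
      a *m p = a *m q.
    move=> h h'; apply: trmx_inj; apply/eqP; rewrite -subr_eq0; apply/eqP/cf.
    rewrite mul_col_mx !mulmxBr -[b0]trmxK -[b1]trmxK -!trmx_mul h h' !subrr.
    exact: col_mx0.
  by apply: sym; apply: cancel.
rewrite -row_free_unit; apply/row_freeP0 => w wg.
have : (w *m G0 <= perp J (col_mx G0 G1))%MS.
  apply/perpP; rewrite tr_col_mx mul_mx_row -!(mulmxA w).
  by rewrite g00 -/g wg mulmx0 row_mx0.
have : perp J (col_mx G0 G1) == 0.
  by rewrite -mxrank_eq0 rank_perp // (eqP Gf) subn_eq0 Nk; lia.
move=> /eqP->; rewrite submx0 => /eqP h; move/row_freeP0: Gf => /(_ (row_mx w 0)).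
rewrite mul_row_col mul0mx addr0 => /(_ h); rewrite -(row_mx0 _ _ (k + 1) (k + 1)).
by move=> /eq_row_mx[].
Qed.
End FrameToBasis.

(** * The sections carried by a frame *)

Section FrameBasis.
Variable F : numClosedFieldType.
Variables (N : nat) (J : 'M[F]_N).
Hypothesis Jskew : J^T = - J.
Hypothesis Junit : J \in unitmx.
Variables (k : nat) (A : 'I_4 -> 'M[F]_(k, N)).
Hypothesis Nk : N = (2 * k + 2)%N.
Hypothesis k1 : (1 < k)%N.
Hypothesis Aiso : forall x y,
  lin A x *m J *m (lin A y)^T + lin A y *m J *m (lin A x)^T = 0.
Hypothesis Afree : forall x, x != 0 -> row_free (lin A x).
Hypothesis Ajoint : forall v : 'rV[F]_N,
  (forall x, lin A x *m J *m v^T = 0) -> v = 0.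

Lemma mul_row2 n (c : 'rV[F]_2) (G : 'M[F]_(2, n)) :
  c *m G = c 0 0 *: row 0 G + c 0 1 *: row 1 G.
Proof.
by rewrite mulmx_sum_row big_ord_recl big_ord1 (_ : lift ord0 ord0 = 1) //; apply: val_inj.
Qed.

Lemma frame_section_basis : conic_frame J A -> exists s1 s2, section_basis J A s1 s2.
Proof.
move=> [x0 [x1 [y0 [y1 [ind xx yy xy]]]]].
have [b0 [b1 [G0 [G1 [ff Gf rb g00 g11]]]]] :=
  exists_frame_factor Jskew Junit Nk k1 Aiso Ajoint ind xx yy xy.
have [gs gu] := frame_gamma Jskew Junit Nk k1 Aiso xy ff Gf rb g00 g11.
set g := G0 *m J *m G1^T in gs gu; case: ff => e0 e1 e2 e3.
have g10 : G1 *m J *m G0^T = - g by rewrite -gs (skew_tr Jskew) opprK.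
have Gp (w0 w1 : 'rV_(k + 1)) : w0 *m G0 + w1 *m G1 = 0 -> w0 = 0 /\ w1 = 0.
  move=> h; move/row_freeP0: Gf => /(_ (row_mx w0 w1)); rewrite mul_row_col => /(_ h).
  by rewrite -(row_mx0 _ _ (k + 1) (k + 1)) => /eq_row_mx.
have Gc (v : 'rV_N) : exists w0 w1, v = w0 *m G0 + w1 *m G1.
  have : (v <= col_mx G0 G1)%MS.
    apply: submx_full; rewrite /row_full (eqP Gf) Nk; apply/eqP; lia.
  by case/submxP => w ->; exists (lsubmx w), (rsubmx w); rewrite -mul_row_col hsubmxK.
have pair m n (a c : 'M_(m, k + 1)) (a' c' : 'M_(n, k + 1)) :
    (a *m G0 + c *m G1) *m J *m (a' *m G0 + c' *m G1)^T
    = a *m g *m c'^T - c *m g *m a'^T.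
  have pr p1 p2 p3 p4 (a1 : 'M_(p1, p2)) (X : 'M_(_, N)) (a2 : 'M_(p3, p4)) (Y : 'M_(_, N)) :
    (a1 *m X) *m J *m (a2 *m Y)^T = a1 *m (X *m J *m Y^T) *m a2^T.
    by rewrite trmx_mul !mulmxA.
  rewrite linearD /= !mulmxDl !mulmxDr !pr g00 g11 g10 -/g !mulmx0 !mul0mx add0r addr0.
  by rewrite mulmxN mulNmx.
have pf s t : (s != 0) || (t != 0) -> row_free (s *: b0 + t *: b1).
  move=> st; apply/row_freeP0 => w h.
  have z0 : s *: x0 + t *: x1 != 0.
    apply: contraTneq st => h'; have [] := ind s t 0 0; first by rewrite h' !scale0r !addr0.
    by move=> -> ->; rewrite eqxx.
  move/row_freeP0: (Afree z0); apply.
  by rewrite linD !linZ e0 e1 !scalemxAl -mulmxDl mulmxA h mul0mx.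
have inj (v : 'cV_(k + 1)) : b0 *m v = 0 -> b1 *m v = 0 -> v = 0.
  move=> h0 h1; apply: trmx_inj; rewrite trmx0.
  have : row_free (col_mx b0 b1)^T by rewrite /row_free mxrank_tr rb.
  by move=> /row_freeP0; apply; rewrite -trmx_mul mul_col_mx h0 h1 col_mx0 trmx0.
have gcancel (q : 'rV_(k + 1)) : g *m q^T = 0 -> q = 0.
  by move=> h; apply: trmx_inj; rewrite trmx0 -[q^T](mulKmx gu) h mulmx0.
have yx : Lam J A x1 y0 = Lam J A x0 y1.
  by apply/eqP; rewrite eq_sym -subr_eq0 -(Lam_anti Aiso y0) xy.
have bgb : b1 *m g *m b0^T = b0 *m g *m b1^T.
  move: yx; rewrite /Lam e0 e1 e2 e3.
  have := pair _ _ b1 0 0 b0; rewrite !mul0mx addr0 add0r subr0 => ->.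
  by have := pair _ _ b0 0 0 b1; rewrite !mul0mx addr0 add0r subr0 => ->.
clearbody g.
have b0f : row_free b0.
  by have := pf 1 0; rewrite oner_eq0 scale1r scale0r addr0; apply.
(* [mu *m M = 0] is the condition for [frame_sec] to be a section. The kernel of M has rank (2 k +
   2) - k = k + 2 and contains the trivial sections U, of rank k; the two rows completing U are the
   basis. *)
pose M := col_mx (- (g *m b1^T)) (g *m b0^T).
pose U := row_mx b0 b1.
have UM : U *m M = 0 by rewrite mul_row_col mulmxN (mulmxA b0) (mulmxA b1) bgb addNr.
have rM : \rank M = k.
  have h1 : \rank (g *m b0^T) = k.
    by rewrite -mxrank_tr trmx_mul trmxK gs mxrankMfree ?row_free_unit //; apply/eqP.
  have h2 : (k <= \rank M)%N.
    by rewrite -[X in (X <= _)%N]h1 -addsmxE mxrankS // addsmxSr.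
  by apply/eqP; rewrite eqn_leq rank_leq_col h2.
have Uf : row_free U.
  apply/row_freeP0 => w; rewrite mul_mx_row -(row_mx0 _ _ (k + 1) (k + 1)).
  by move=> /eq_row_mx[/(row_freeP0 _ b0f)].
have [||G [GK KG]] := @compl_rows F _ _ _ U (kermx M) 2.
- exact/sub_kermxP.
- by rewrite mxrank_ker rM (eqP Uf); lia.
have UGf : row_free (col_mx U G).
  have := mxrankS KG; rewrite mxrank_ker rM -row_leq_rank; apply: leq_trans.
  lia.
pose fs := frame_sec x0 x1 y0 y1 G0 G1.
have fsE mu := @frame_secE F N x0 x1 y0 y1 _ G0 G1 mu ind.
have fs_eq mu s : x0 *m s = lsubmx mu *m G0 -> x1 *m s = rsubmx mu *m G0 ->
    y0 *m s = lsubmx mu *m G1 -> y1 *m s = rsubmx mu *m G1 -> s = fs mu.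
  by move=> h0 h1 h2 h3; have [f0 f1 f2 f3] := fsE mu; apply: (frame_eq ind);
    rewrite ?h0 ?h1 ?h2 ?h3 ?f0 ?f1 ?f2 ?f3.
have fs_inj mu nu : fs mu = fs nu -> mu = nu.
  move=> h; have [f0 f1 _ _] := fsE mu; have [f0' f1' _ _] := fsE nu.
  have G0i (p q : 'rV_(k + 1)) : p *m G0 = q *m G0 -> p = q.
    move=> pq; apply/eqP; rewrite -subr_eq0; have [] := Gp (p - q) 0.
      by rewrite mulmxBl pq subrr mul0mx addr0.
    by move=> ->.
  rewrite -[mu]hsubmxK -[nu]hsubmxK; congr row_mx; apply: G0i.
    by rewrite -f0 -f0' -/(fs _) h.
  by rewrite -f1 -f1' -/(fs _) h.
have fsD mu nu : fs (mu + nu) = fs mu + fs nu.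
  have [f0 f1 f2 f3] := fsE mu; have [f0' f1' f2' f3'] := fsE nu; apply/esym/fs_eq;
  by rewrite mulmxDr linearD mulmxDl /= -?f0 -?f0' -?f1 -?f1' -?f2 -?f2' -?f3 -?f3'.
have fsZ c mu : fs (c *: mu) = c *: fs mu.
  have [f0 f1 f2 f3] := fsE mu; apply/esym/fs_eq;
  by rewrite -scalemxAr linearZ -scalemxAl /= -?f0 -?f1 -?f2 -?f3.
have fsT w : fs (w *m U) = triv_sec A w.
  by apply/esym/fs_eq; rewrite triv_secE mul_mx_row ?row_mxKl ?row_mxKr -mulmxA
    ?e0 ?e1 ?e2 ?e3.
have condE mu : mu *m M = 0 ->
    b0 *m g *m (rsubmx mu)^T = b1 *m g *m (lsubmx mu)^T.
  rewrite -{1}[mu]hsubmxK mul_row_col mulmxN !mulmxA => /eqP.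
  rewrite addrC subr_eq0 => /eqP/(congr1 trmx).
  by rewrite !trmx_mul !trmxK gs !mulmxA.
have fs_sec mu : mu *m M = 0 -> is_sec J A (fs mu).
  move=> /condE cE x; have [p [q [r [s ->]]]] := frame_coords ind x.
  have [f0 f1 f2 f3] := fsE mu; rewrite !linD !linZ !(mulmxDl _ _ (fs mu)) -!scalemxAl.
  rewrite -/(fs mu) in f0 f1 f2 f3; rewrite f0 f1 f2 f3 e0 e1 e2 e3.
  have -> : p *: (b0 *m G0) + q *: (b1 *m G0) + r *: (b0 *m G1) + s *: (b1 *m G1) =
      (p *: b0 + q *: b1) *m G0 + (r *: b0 + s *: b1) *m G1.
    by rewrite !mulmxDl -!scalemxAl addrA.
  have -> : p *: (lsubmx mu *m G0) + q *: (rsubmx mu *m G0) + r *: (lsubmx mu *m G1) +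
      s *: (rsubmx mu *m G1) =
      (p *: lsubmx mu + q *: rsubmx mu) *m G0 + (r *: lsubmx mu + s *: rsubmx mu) *m G1.
    by rewrite !mulmxDl -!scalemxAl addrA.
  have tE (a c : F) (u v : 'rV_(k + 1)) : (a *: u + c *: v)^T = a *: u^T + c *: v^T.
    by rewrite linearD !linearZ.
  rewrite pair !tE !mulmxDl !mulmxDr -!scalemxAl -!scalemxAr.
  rewrite cE; move: (b0 *m g *m _) (b1 *m g *m _) (b1 *m g *m _) => X Y Z.
  by apply/matrixP => i j; rewrite !mxE; ring.
have MG i : row i G *m M = 0 by apply/sub_kermxP/submx_trans/GK/row_sub.
exists (fs (row 0 G)), (fs (row 1 G)); split; try by apply: fs_sec; apply: MG.
- move=> c1 c2 w; rewrite -!fsZ -fsD -fsT => /fs_inj h.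
  move/row_freeP0: UGf => /(_ (row_mx (- w) (\row_j if j == 0 then c1 else c2))).
  rewrite mul_row_col mulNmx mul_row2 !mxE /= h addNr => /(_ erefl).
  rewrite -(row_mx0 _ _ k 2) => /eq_row_mx[_ /rowP h'].
  by split; [have := h' 0|have := h' 1]; rewrite !mxE.
move=> s hs.
have [p0 [q0 s0E]] := Gc (x0 *m s); have [p1 [q1 s1E]] := Gc (x1 *m s).
have [p2 [q2 s2E]] := Gc (y0 *m s); have [p3 [q3 s3E]] := Gc (y1 *m s).
have pX (b : 'M_(k, k + 1)) p q : b *m G0 *m J *m (p *m G0 + q *m G1)^T = b *m (g *m q^T).
  by have := pair _ _ b 0 p q; rewrite !mul0mx addr0 subr0 mulmxA.
have pY (b : 'M_(k, k + 1)) p q : b *m G1 *m J *m (p *m G0 + q *m G1)^T = - (b *m (g *m p^T)).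
  by have := pair _ _ 0 b p q; rewrite !mul0mx add0r sub0r mulmxA.
have d0 := hs x0; have d1 := hs x1; have d2 := hs y0; have d3 := hs y1.
have m01 := is_sec_polar x0 x1 hs; have m23 := is_sec_polar y0 y1 hs.
have m02 := is_sec_polar x0 y0 hs; have m13 := is_sec_polar x1 y1 hs.
have m03 := is_sec_polar x0 y1 hs; have m12 := is_sec_polar x1 y0 hs.
move: d0 d1 d2 d3 m01 m23 m02 m13 m03 m12.
rewrite s0E s1E s2E s3E e0 e1 e2 e3 !pX !pY.
move=> d0 d1 /eqP; rewrite oppr_eq0 => /eqP d2 /eqP; rewrite oppr_eq0 => /eqP d3.
move=> m01 /eqP; rewrite -opprD oppr_eq0 => /eqP m23 m02 m13 m03 m12.
(* An arbitrary section has coordinates p_i, q_i in G0, G1. Rigidity is used three times, on (q0,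
   q1), (p2, p3) and (q2 - p0, q3 - p1), to show that the section comes from a pair mu. *)
have [/gcancel q00 /gcancel q10] := pencil_column_rigid k1 pf inj d0 d1 m01.
have [/gcancel p20 /gcancel p30] := pencil_column_rigid k1 pf inj d2 d3 m23.
have tB (u v : 'rV[F]_(k + 1)) : (u - v)^T = u^T - v^T by rewrite linearB.
have [/gcancel h0 /gcancel h1] : g *m (q2 - p0)^T = 0 /\ g *m (q3 - p1)^T = 0.
  apply: (pencil_column_rigid k1 pf inj); rewrite !tB !mulmxBr //.
  by rewrite addrACA [- _ - _]addrC addrACA m03 m12 addr0.
have e20 : q2 = p0 by apply/eqP; rewrite -subr_eq0 h0.
have e31 : q3 = p1 by apply/eqP; rewrite -subr_eq0 h1.
have sE : s = fs (row_mx p0 p1).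
  apply: fs_eq; rewrite ?row_mxKl ?row_mxKr ?s0E ?s1E ?s2E ?s3E ?q00 ?q10 ?p20 ?p30;
  by rewrite mul0mx ?addr0 ?add0r ?e20 ?e31.
have : (row_mx p0 p1 <= kermx M)%MS.
  apply/sub_kermxP; rewrite mul_row_col mulmxN; apply: trmx_inj.
  rewrite linearD linearN /= !trmx_mul !trmxK gs -!mulmxA trmx0 addrC.
  by move: m03; rewrite e31.
move=> /submx_trans/(_ KG)/submxP[c cE]; rewrite sE cE -[c]hsubmxK mul_row_col.
rewrite mul_row2 !fsD !fsZ fsT addrC.
by exists (rsubmx c 0 0), (rsubmx c 0 1), (lsubmx c).
Qed.
End FrameBasis.

(** * The jump space in the Pluecker coordinates *)

Section Wedge.
Variable F : numClosedFieldType.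

Definition row4 (a b c d : F) : 'rV[F]_4 := \row_i nth 0 [:: a; b; c; d] i.
Definition row6 (a b c d e f : F) : 'rV[F]_6 := \row_i nth 0 [:: a; b; c; d; e; f] i.
Definition cf n (p : 'rV[F]_n.+1) (i : nat) : F := p 0 (inord i).

Lemma cf4E a b c d i : (i < 4)%N -> cf (row4 a b c d) i = nth 0 [:: a; b; c; d] i.
Proof. by move=> hi; rewrite /cf mxE inordK. Qed.

Lemma cf6E a b c d e f i : (i < 6)%N ->
  cf (row6 a b c d e f) i = nth 0 [:: a; b; c; d; e; f] i.
Proof. by move=> hi; rewrite /cf mxE inordK. Qed.

Lemma cfD n (p q : 'rV[F]_n.+1) i : cf (p + q) i = cf p i + cf q i.
Proof. by rewrite /cf mxE. Qed.
Lemma cfZ n c (p : 'rV[F]_n.+1) i : cf (c *: p) i = c * cf p i.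
Proof. by rewrite /cf mxE. Qed.
Lemma cf0 n i : cf (0 : 'rV[F]_n.+1) i = 0.
Proof. by rewrite /cf mxE. Qed.

Lemma cf_eq n (p q : 'rV[F]_n.+1) : (forall i, (i < n.+1)%N -> cf p i = cf q i) -> p = q.
Proof. by move=> h; apply/rowP => i; have := h i (ltn_ord i); rewrite /cf inord_val. Qed.

Lemma cf6_eq (p q : 'rV[F]_6) : cf p 0 = cf q 0 -> cf p 1 = cf q 1 -> cf p 2 = cf q 2 ->
  cf p 3 = cf q 3 -> cf p 4 = cf q 4 -> cf p 5 = cf q 5 -> p = q.
Proof. by move=> *; apply: cf_eq => -[|[|[|[|[|[|]]]]]]. Qed.

Lemma cf4_eq (p q : 'rV[F]_4) : cf p 0 = cf q 0 -> cf p 1 = cf q 1 -> cf p 2 = cf q 2 ->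
  cf p 3 = cf q 3 -> p = q.
Proof. by move=> *; apply: cf_eq => -[|[|[|[|]]]]. Qed.

Definition wedge (x y : 'rV[F]_4) : 'rV[F]_6 :=
  let w i j := cf x i * cf y j - cf x j * cf y i in
  row6 (w 0 1) (w 0 2) (w 0 3) (w 1 2) (w 1 3) (w 2 3).

(** The polar form of the Pluecker quadric: [B6 p p] is twice the Pluecker polynomial, and distinct
    lines meet exactly when their coordinates are orthogonal. *)
Definition B6 (p q : 'rV[F]_6) : F :=
  cf p 0 * cf q 5 + cf p 5 * cf q 0 - (cf p 1 * cf q 4 + cf p 4 * cf q 1)
  + (cf p 2 * cf q 3 + cf p 3 * cf q 2).

Ltac wedge_ring := rewrite /wedge ?cf6E // /= ?(cfD, cfZ, cf0) //; ring.

Lemma wedgeDl x x' y : wedge (x + x') y = wedge x y + wedge x' y.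
Proof. by apply: cf6_eq; rewrite cfD; wedge_ring. Qed.
Lemma wedgeZl c x y : wedge (c *: x) y = c *: wedge x y.
Proof. by apply: cf6_eq; rewrite cfZ; wedge_ring. Qed.
Lemma wedgeC x y : wedge y x = - wedge x y.
Proof. by rewrite -scaleN1r; apply: cf6_eq; rewrite cfZ; wedge_ring. Qed.
Lemma wedgeDr x y y' : wedge x (y + y') = wedge x y + wedge x y'.
Proof. by rewrite !(wedgeC _ x) wedgeDl opprD. Qed.
Lemma wedgeZr c x y : wedge x (c *: y) = c *: wedge x y.
Proof. by rewrite !(wedgeC _ x) wedgeZl scalerN. Qed.
Lemma wedgexx x : wedge x x = 0.
Proof. by apply: cf6_eq; rewrite cf0; wedge_ring. Qed.

Lemma B6C p q : B6 p q = B6 q p. Proof. by rewrite /B6; ring. Qed.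
Lemma B6D p p' q : B6 (p + p') q = B6 p q + B6 p' q.
Proof. by rewrite /B6 !cfD; ring. Qed.
Lemma B6Z c p q : B6 (c *: p) q = c * B6 p q.
Proof. by rewrite /B6 !cfZ; ring. Qed.
Lemma B6Dr p q q' : B6 p (q + q') = B6 p q + B6 p q'.
Proof. by rewrite !(B6C p) B6D. Qed.
Lemma B6Zr c p q : B6 p (c *: q) = c * B6 p q.
Proof. by rewrite !(B6C p) B6Z. Qed.

Lemma B6_wedge_meet x y z : B6 (wedge x y) (wedge x z) = 0.
Proof. by rewrite /B6 /wedge !cf6E //=; ring. Qed.

Lemma B6_nondeg p : (forall q, B6 p q = 0) -> p = 0.
Proof.
move=> h; apply: cf6_eq; rewrite cf0.
- by have := h (row6 0 0 0 0 0 1); rewrite /B6 !cf6E //= => <-; ring.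
- by apply: oppr_inj; have := h (row6 0 0 0 0 1 0); rewrite /B6 !cf6E //= oppr0 => <-; ring.
- by have := h (row6 0 0 0 1 0 0); rewrite /B6 !cf6E //= => <-; ring.
- by have := h (row6 0 0 1 0 0 0); rewrite /B6 !cf6E //= => <-; ring.
- by apply: oppr_inj; have := h (row6 0 1 0 0 0 0); rewrite /B6 !cf6E //= oppr0 => <-; ring.
- by have := h (row6 1 0 0 0 0 0); rewrite /B6 !cf6E //= => <-; ring.
Qed.

Definition e4 i : 'rV[F]_4 := \row_j (i == j :> nat)%:R.

Lemma wedge_std p : p = cf p 0 *: wedge (e4 0) (e4 1) + cf p 1 *: wedge (e4 0) (e4 2)
  + cf p 2 *: wedge (e4 0) (e4 3) + cf p 3 *: wedge (e4 1) (e4 2)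
  + cf p 4 *: wedge (e4 1) (e4 3) + cf p 5 *: wedge (e4 2) (e4 3).
Proof.
have cfe i j : (j < 4)%N -> cf (e4 i) j = (i == j)%:R.
  by move=> hj; rewrite /cf mxE inordK.
by apply: cf6_eq; rewrite !cfD !cfZ /wedge !cf6E //= !cfe //=; ring.
Qed.

Lemma wedge_span x y z t : indep4 x y z t -> forall p, exists a b c d e f,
  p = a *: wedge x y + b *: wedge x z + c *: wedge x t + d *: wedge y z
    + e *: wedge y t + f *: wedge z t.
Proof.
move=> ind.
pose S p := exists a b c d e f,
  p = a *: wedge x y + b *: wedge x z + c *: wedge x t + d *: wedge y z
    + e *: wedge y t + f *: wedge z t.
have SD p q : S p -> S q -> S (p + q).
  move=> [a [b [c [d [e [f ->]]]]]] [a' [b' [c' [d' [e' [f' ->]]]]]].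
  exists (a + a'), (b + b'), (c + c'), (d + d'), (e + e'), (f + f').
  by apply/rowP => i; rewrite !mxE; ring.
have SZ l p : S p -> S (l *: p).
  move=> [a [b [c [d [e [f ->]]]]]]; exists (l * a), (l * b), (l * c), (l * d), (l * e), (l * f).
  by apply/rowP => i; rewrite !mxE; ring.
have SW u v : S (wedge u v).
  have [u0 [u1 [u2 [u3 ->]]]] := frame_coords ind u.
  have [v0 [v1 [v2 [v3 ->]]]] := frame_coords ind v.
  exists (u0 * v1 - u1 * v0), (u0 * v2 - u2 * v0), (u0 * v3 - u3 * v0),
    (u1 * v2 - u2 * v1), (u1 * v3 - u3 * v1), (u2 * v3 - u3 * v2).
  rewrite !(wedgeDl, wedgeDr, wedgeZl, wedgeZr) !wedgexx.
  rewrite (wedgeC x y) (wedgeC x z) (wedgeC x t) (wedgeC y z) (wedgeC y t) (wedgeC z t).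
  by apply/rowP => i; rewrite !mxE; ring.
by move=> p; rewrite (wedge_std p); do ?apply: (SD); exact/SZ/SW.
Qed.

Lemma wedge_eq0 x y : wedge x y = 0 -> x != 0 -> exists c, y = c *: x.
Proof.
move=> h /rV0Pn[i xi]; exists (y 0 i / x 0 i).
have key (a b : 'I_4) : x 0 a * y 0 b = x 0 b * y 0 a.
  suff main (m n : nat) : (m < n)%N -> (n < 4)%N -> cf x m * cf y n = cf x n * cf y m.
    have := main a b; have := main b a; rewrite /cf !inord_val !ltn_ord.
    by case: (ltngtP a b) => [_ _ ->|_ -> //|/val_inj-> //].
  move=> mn n4; apply/eqP; rewrite -subr_eq0; apply/eqP.
  have e l : cf (wedge x y) l = 0 by rewrite h cf0.
  move: (e 0%N) (e 1%N) (e 2%N) (e 3%N) (e 4%N) (e 5%N); rewrite /wedge !cf6E //=.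
  by move: m n mn n4 => [|[|[|m]]] [|[|[|[|n]]]] //.
apply/rowP => j; rewrite mxE mulrAC; apply: (canRL (mulfK xi)).
by rewrite mulrC key mulrC.
Qed.

(** Every other product of two basis vectors shares a factor with x or y, so a zero here would put
    [wedge x y] in the radical of the nondegenerate form. *)
Lemma B6_indep x y z t : indep4 x y z t -> B6 (wedge x y) (wedge z t) != 0.
Proof.
move=> ind; apply/eqP => h.
have w0 : wedge x y = 0.
  apply: B6_nondeg => q; have [a [b [c [d [e [f ->]]]]]] := wedge_span ind q.
  rewrite !(B6Dr, B6Zr) h !B6_wedge_meet (wedgeC y x) -scaleN1r !B6Z.
  by rewrite !B6_wedge_meet !mulr0 !addr0.
have x0 : x != 0.
  apply/eqP => x0; have [] := ind 1 0 0 0; first by rewrite x0 scaler0 !scale0r !addr0.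
  by move/eqP; rewrite oner_eq0.
have [c yE] := wedge_eq0 w0 x0; have [] := ind c (- 1) 0 0.
  by rewrite yE scaleN1r subrr !scale0r !addr0.
by move=> _ /eqP; rewrite oppr_eq0 oner_eq0.
Qed.

(** The [P0], .., [P3] are the rows of the skew 4 by 4 matrix of p. On the quadric the wedge of rows
    i and j is p_ij p, so a nonzero coordinate gives a factorization. *)
Lemma decomposable p : p != 0 -> B6 p p = 0 -> exists x y, p = wedge x y.
Proof.
move=> p0 hq; move E0: (cf p 0) => p1; move E1: (cf p 1) => p2; move E2: (cf p 2) => p3.
move E3: (cf p 3) => p12; move E4: (cf p 4) => p13; move E5: (cf p 5) => p23.
have q0 : p1 * p23 - p2 * p13 + p3 * p12 = 0.
  have two : (2 : F) != 0 by rewrite pnatr_eq0.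
  by apply: (mulfI two); rewrite mulr0 -hq /B6 E0 E1 E2 E3 E4 E5; ring.
pose P0 := row4 0 p1 p2 p3; pose P1 := row4 (- p1) 0 p12 p13.
pose P2 := row4 (- p2) (- p12) 0 p23; pose P3 := row4 (- p3) (- p13) (- p23) 0.
have wE : [/\ wedge P0 P1 = p1 *: p, wedge P0 P2 = p2 *: p & wedge P0 P3 = p3 *: p] /\
    [/\ wedge P1 P2 = p12 *: p, wedge P1 P3 = p13 *: p & wedge P2 P3 = p23 *: p].
  (* The coordinates that do not agree identically differ by the Pluecker relation, with one sign or
     the other. *)
  have q1 : - (p1 * p23 - p2 * p13 + p3 * p12) = 0 by rewrite q0 oppr0.
  split; split; apply: cf6_eq; rewrite cfZ ?E0 ?E1 ?E2 ?E3 ?E4 ?E5 /wedge !cf6E // !cf4E //=;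
  first [ring | apply/eqP; rewrite -subr_eq0 -[X in _ == X]q0; apply/eqP; ring
        | apply/eqP; rewrite -subr_eq0 -[X in _ == X]q1; apply/eqP; ring].
have fin c x y : c != 0 -> wedge x y = c *: p -> exists x y, p = wedge x y.
  by move=> c0 h; exists (c^-1 *: x), y; rewrite wedgeZl h scalerK.
case: wE => [[h1 h2 h3] [h4 h5 h6]].
have [z1|/fin/(_ h1)//] := eqVneq p1 0; have [z2|/fin/(_ h2)//] := eqVneq p2 0.
have [z3|/fin/(_ h3)//] := eqVneq p3 0; have [z4|/fin/(_ h4)//] := eqVneq p12 0.
have [z5|/fin/(_ h5)//] := eqVneq p13 0; have [z6|/fin/(_ h6)//] := eqVneq p23 0.
by case/eqP: p0; apply: cf6_eq; rewrite cf0 ?E0 ?E1 ?E2 ?E3 ?E4 ?E5.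
Qed.
End Wedge.

(** * The linear equations of the jumping lines *)

Section JumpSpace.
Variable F : numClosedFieldType.
Variables (N : nat) (J : 'M[F]_N).
Hypothesis Jskew : J^T = - J.
Hypothesis Junit : J \in unitmx.
Variables (k : nat) (A : 'I_4 -> 'M[F]_(k, N)).
Hypothesis Nk : N = (2 * k + 2)%N.
Hypothesis k1 : (1 < k)%N.
Hypothesis Aiso : forall x y,
  lin A x *m J *m (lin A y)^T + lin A y *m J *m (lin A x)^T = 0.
Hypothesis Afree : forall x, x != 0 -> row_free (lin A x).

Lemma LamDl x x' y : Lam J A (x + x') y = Lam J A x y + Lam J A x' y.
Proof. by rewrite /Lam linD !mulmxDl. Qed.
Lemma LamZl c x y : Lam J A (c *: x) y = c *: Lam J A x y.
Proof. by rewrite /Lam linZ -!scalemxAl. Qed.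

(** The linear map on the exterior square induced by the alternating map Lam. *)
Definition LamP (p : 'rV[F]_6) : 'M[F]_k :=
  let L i j := Lam J A (e4 F i) (e4 F j) in
  cf p 0 *: L 0 1 + cf p 1 *: L 0 2 + cf p 2 *: L 0 3
  + cf p 3 *: L 1 2 + cf p 4 *: L 1 3 + cf p 5 *: L 2 3.

Lemma LamPD p q : LamP (p + q) = LamP p + LamP q.
Proof. by rewrite /LamP !cfD; apply/matrixP => i j; rewrite !mxE; ring. Qed.
Lemma LamPZ c p : LamP (c *: p) = c *: LamP p.
Proof. by rewrite /LamP !cfZ; apply/matrixP => i j; rewrite !mxE; ring. Qed.

Lemma e4_std (x : 'rV[F]_4) : x = cf x 0 *: e4 F 0 + cf x 1 *: e4 F 1 + cf x 2 *: e4 F 2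
  + cf x 3 *: e4 F 3.
Proof.
have cfe i j : (j < 4)%N -> cf (e4 F i) j = (i == j)%:R.
  by move=> hj; rewrite /cf mxE inordK.
by apply: cf4_eq; rewrite !cfD !cfZ !cfe //=; ring.
Qed.

Lemma LamP_wedge x y : LamP (wedge x y) = Lam J A x y.
Proof.
have an u v := Lam_anti Aiso u v; have Lz z : Lam J A z z = 0 := Aiso0 Aiso z.
have LDr u v w : Lam J A u (v + w) = Lam J A u v + Lam J A u w.
  by rewrite an LamDl opprD -!an.
have LZr u c v : Lam J A u (c *: v) = c *: Lam J A u v by rewrite an LamZl -scalerN -an.
rewrite [in RHS](e4_std x) [in RHS](e4_std y) !(LamDl, LamZl, LDr, LZr) !Lz.
rewrite (an (e4 F 1) (e4 F 0)) (an (e4 F 2) (e4 F 0)) (an (e4 F 3) (e4 F 0)).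
rewrite (an (e4 F 2) (e4 F 1)) (an (e4 F 3) (e4 F 1)) (an (e4 F 3) (e4 F 2)).
rewrite /LamP /wedge !cf6E //=; apply/matrixP => i j; rewrite !mxE; ring.
Qed.

(** Orthogonal decomposable vectors represent meeting lines: p = u v and p' = u v' as wedges, with
    u, v, v' independent, which is what [no_pencil] forbids. *)
Lemma no_isotropic_line p p' : LamP p = 0 -> LamP p' = 0 ->
  B6 p p = 0 -> B6 p' p' = 0 -> B6 p p' = 0 ->
  (forall a b, a *: p + b *: p' = 0 -> a = 0 /\ b = 0) -> False.
Proof.
move=> Lp Lp' q q' b ind.
have nz a c : (a != 0) || (c != 0) -> a *: p + c *: p' != 0.
  by apply: contraTneq => /ind[-> ->]; rewrite eqxx.
have p0 : p != 0 by have := nz 1 0; rewrite oner_eq0 scale1r scale0r addr0; apply.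
have p'0 : p' != 0 by have := nz 0 1; rewrite oner_eq0 orbT scale1r scale0r add0r; apply.
have [x [y pE]] := decomposable p0 q; have [z [t p'E]] := decomposable p'0 q'.
have wind u v (r s : F) : wedge u v != 0 -> r *: u + s *: v = 0 -> r = 0 /\ s = 0.
  move=> w0 h; split; apply/eqP; apply: contraT => n0; case/eqP: w0.
    apply: (scalerI n0); rewrite scaler0 -wedgeZl.
    have -> : r *: u = - (s *: v) by apply/eqP; rewrite -addr_eq0 h.
    by rewrite -scaleNr wedgeZl wedgexx scaler0.
  apply: (scalerI n0); rewrite scaler0 -wedgeZr.
  have -> : s *: v = - (r *: u) by apply/eqP; rewrite -addr_eq0 addrC h.
  by rewrite -scaleNr wedgeZr wedgexx scaler0.
have pick u v (r s : F) : (r != 0) || (s != 0) -> exists v', wedge u v = wedge (r *: u + s *: v) v'.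
  have [r0|r0] := eqVneq r 0 => [/=|_].
    move=> s0; exists (- s^-1 *: u); rewrite r0 scale0r add0r wedgeZl wedgeZr scalerA.
    by rewrite mulrN divff // (wedgeC u v) scaleN1r opprK.
  exists (r^-1 *: v); rewrite wedgeDl !wedgeZl !wedgeZr wedgexx !scaler0 addr0.
  by rewrite scalerA divff // scale1r.
apply: contrapT => _.
have [ind4|] := pselect (indep4 x y z t).
  by have := B6_indep ind4; rewrite -pE -p'E b eqxx.
move=> nind; apply: nind => a c d e h.
apply: contrapT => nall.
have hu : a *: x + c *: y = (- d) *: z + (- e) *: t.
  by apply/eqP; rewrite !scaleNr -opprD -subr_eq0 opprK addrA h.
have ac : (a != 0) || (c != 0).
  apply: contraT; rewrite negb_or !negbK => /andP[/eqP a0 /eqP c0].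
  case: nall; rewrite a0 c0; move: hu; rewrite a0 c0 !scale0r addr0 => /esym.
  by move=> /(wind z t) []; rewrite -?p'E // => /eqP + /eqP; rewrite !oppr_eq0 => /eqP-> /eqP->.
have de : (- d != 0) || (- e != 0).
  apply: contraT; rewrite negb_or !negbK => /andP[/eqP d0 /eqP e0].
  move: hu; rewrite d0 e0 !scale0r addr0 => /(wind x y) [].
    by rewrite -pE.
  by move=> a0 c0; rewrite a0 c0 eqxx in ac.
have [v vE] := pick x y _ _ ac; have [v' v'E] := pick z t _ _ de.
rewrite -pE in vE; rewrite -p'E -hu in v'E; set u := _ + _ in vE v'E.
apply: (no_pencil Jskew Junit Nk Aiso Afree k1 (x := u) (y := v) (z := v')).
- move=> r s w hr; have [] := ind s w.
    have := congr1 (wedge u) hr; rewrite !wedgeDr !wedgeZr wedgexx scaler0 add0r -vE -v'E => ->.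
    by rewrite -[0 in LHS](scale0r 0) wedgeZr scale0r.
  move=> s0 w0; split=> //; move: hr; rewrite s0 w0 !scale0r !addr0 => /eqP.
  rewrite scaler_eq0 => /orP[/eqP //|/eqP u0]; case/eqP: p0.
  by rewrite vE u0 -[0 in LHS](scale0r 0) wedgeZl scale0r.
- by rewrite -/(Lam J A u v) -LamP_wedge -vE.
- by rewrite -/(Lam J A u v') -LamP_wedge -v'E.
Qed.

Definition jump_mx : 'M[F]_(6, k * k) := \matrix_i mxvec (LamP (delta_mx 0 i)).
Definition jump_space := kermx jump_mx.

Lemma jump_mxE p : p *m jump_mx = mxvec (LamP p).
Proof.
rewrite mulmx_sum_row {2}(row_sum_delta p).
have mD q r : mxvec (LamP (q + r)) = mxvec (LamP q) + mxvec (LamP r).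
  by rewrite LamPD linearD.
have m0 : mxvec (LamP 0) = 0 by rewrite -(scale0r 0) LamPZ scale0r linear0.
rewrite (big_morph _ mD m0); apply: eq_bigr => i _.
by rewrite rowK LamPZ linearZ.
Qed.

Lemma jump_spaceP p : reflect (LamP p = 0) (p <= jump_space)%MS.
Proof.
apply: (iffP sub_kermxP); rewrite jump_mxE; last by move->; rewrite linear0.
by move/eqP; rewrite mxvec_eq0 => /eqP.
Qed.
End JumpSpace.

(** * The Pluecker form on the jump space *)

Section JumpConic.
Variable F : numClosedFieldType.
Variables (N : nat) (J : 'M[F]_N).
Hypothesis Jskew : J^T = - J.
Hypothesis Junit : J \in unitmx.
Variables (k : nat) (A : 'I_4 -> 'M[F]_(k, N)).
Hypothesis Nk : N = (2 * k + 2)%N.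
Hypothesis k1 : (1 < k)%N.
Hypothesis Aiso : forall x y,
  lin A x *m J *m (lin A y)^T + lin A y *m J *m (lin A x)^T = 0.
Hypothesis Afree : forall x, x != 0 -> row_free (lin A x).

Local Notation W := (jump_space J A).

Definition indep3 (x y z : 'rV[F]_6) :=
  forall a b c : F, a *: x + b *: y + c *: z = 0 -> [/\ a = 0, b = 0 & c = 0].

Lemma no_isotropic_line_mx p p' : (p <= W)%MS -> (p' <= W)%MS ->
  B6 p p = 0 -> B6 p' p' = 0 -> B6 p p' = 0 ->
  (forall a b, a *: p + b *: p' = 0 -> a = 0 /\ b = 0) -> False.
Proof.
move=> /jump_spaceP h /jump_spaceP h'.
exact: (no_isotropic_line Jskew Junit Nk k1 Aiso Afree h h').
Qed.

Lemma indep3_row_free x y z : indep3 x y z -> row_free (col_mx x (col_mx y z)).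
Proof.
move=> ind; apply/row_freeP0 => w; rewrite -[w]hsubmxK mul_row_col.
move: (lsubmx w) (rsubmx w) => a {}w; rewrite -[w]hsubmxK mul_row_col.
move: (lsubmx w) (rsubmx w) => b c.
rewrite [a]mx11_scalar [b]mx11_scalar [c]mx11_scalar !mul_scalar_mx addrA.
by move=> /ind[-> -> ->]; rewrite !raddf0 !row_mx0.
Qed.

Lemma indep3_rank x y z : indep3 x y z -> (x <= W)%MS -> (y <= W)%MS -> (z <= W)%MS ->
  (3 <= \rank W)%N.
Proof.
move=> ind xW yW zW; rewrite -[X in (X <= _)%N](eqP (indep3_row_free ind)).
by apply: mxrankS; rewrite !col_mx_sub xW yW zW.
Qed.

Lemma indep3_span x y z p : indep3 x y z ->
  (x <= W)%MS -> (y <= W)%MS -> (z <= W)%MS -> \rank W = 3%N -> (p <= W)%MS ->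
  exists a b c, p = a *: x + b *: y + c *: z.
Proof.
move=> ind xW yW zW rW pW.
have sub : (col_mx x (col_mx y z) <= W)%MS by rewrite !col_mx_sub xW yW zW.
have : (W <= col_mx x (col_mx y z))%MS.
  have := mxrank_leqif_sup sub => -[_ <-].
  by rewrite rW (eqP (indep3_row_free ind)).
move/(submx_trans pW) => /submxP[w ->]; rewrite -[w]hsubmxK mul_row_col.
move: (lsubmx w) (rsubmx w) => a {}w; rewrite -[w]hsubmxK mul_row_col.
move: (lsubmx w) (rsubmx w) => b c.
rewrite [a]mx11_scalar [b]mx11_scalar [c]mx11_scalar !mul_scalar_mx addrA.
by exists (a 0 0), (b 0 0), (c 0 0).
Qed.

Definition B6_mx : 'M[F]_6 := \matrix_(i, j) B6 (delta_mx 0 i) (delta_mx 0 j).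

Lemma B6_mxE p q : (p *m B6_mx *m q^T) 0 0 = B6 p q.
Proof.
rewrite -mulmxA mxE; under eq_bigr do rewrite mxE big_distrr /=.
have B6r u : B6 u q = \sum_j q 0 j * B6 u (delta_mx 0 j).
  rewrite {1}(row_sum_delta q).
  rewrite (big_morph (B6 u) (@B6Dr F u) (_ : B6 u 0 = 0)); last first.
    by rewrite -(scale0r 0) B6Zr mul0r.
  by apply: eq_bigr => j _; rewrite B6Zr.
rewrite [in RHS](row_sum_delta p).
rewrite (big_morph (fun x => B6 x q) (fun x y => @B6D F x y q) (_ : B6 0 q = 0)); last first.
  by rewrite -(scale0r 0) B6Z mul0r.
apply: eq_bigr => i _; rewrite B6Z B6r big_distrr /=.
by apply: eq_bigr => j _; rewrite !mxE [q 0 j * _]mulrC.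
Qed.

Lemma B6_mx_sym : B6_mx^T = B6_mx.
Proof. by apply/matrixP => i j; rewrite !mxE B6C. Qed.

(** A quadratic form in four variables always has two independent orthogonal isotropic vectors:
    inside a hyperplane where it vanishes, or else x0 of a hyperbolic pair with z of its
    complement. *)
Lemma rank_jump_space : (\rank W <= 3)%N.
Proof.
rewrite leqNgt; apply/negP => r4.
have [s rs] : exists s, \rank W = (4 + s)%N by exists (\rank W - 4)%N; lia.
have [|D [DW WD]] := @compl_rows F 1 _ _ 0 W (4 + s) (sub0mx _ _).
  by rewrite mxrank0 rs.
have Df : row_free D.
  rewrite -row_leq_rank -[X in (X <= _)%N]rs; apply: mxrankS.
  by move: WD; rewrite -(addsmxE 0 D) adds0mx.
pose H := usubmx D.
have HW : (H <= W)%MS by apply: submx_trans DW; rewrite -[X in (_ <= X)%MS](vsubmxK D) -addsmxE addsmxSl.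
have Hf (w : 'rV_4) : w *m H = 0 -> w = 0.
  move=> h; move/row_freeP0: Df => /(_ (row_mx w 0)).
  rewrite -{1}[D]vsubmxK mul_row_col mul0mx addr0 => /(_ h).
  by rewrite -(row_mx0 _ _ 4 s) => /eq_row_mx[].
pose G := H *m B6_mx *m H^T.
have Gs : G^T = G by rewrite /G !trmx_mul trmxK B6_mx_sym mulmxA.
have GE x y : qf G x y = B6 (x *m H) (y *m H).
  by rewrite -B6_mxE /qf /G trmx_mul !mulmxA.
have main x z : qf G x x = 0 -> qf G z z = 0 -> qf G x z = 0 ->
    (forall a b : F, a *: x + b *: z = 0 -> a = 0 /\ b = 0) -> False.
  rewrite !GE => xx zz xz ind; apply: (no_isotropic_line_mx _ _ xx zz xz).
  - by apply: submx_trans HW; apply: submxMl.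
  - by apply: submx_trans HW; apply: submxMl.
  by move=> a b; rewrite !scalemxAl -mulmxDl => /Hf/ind.
have Gh (T : 'M_(3, 4)) : row_free T -> T *m G *m T^T = 0 -> False.
  move=> Tf TG; have rowE0 i j : qf G (row i T) (row j T) = 0.
    have e : (T *m G *m T^T) i j = 0 by rewrite TG mxE.
    rewrite /qf -row_mul mxE -[RHS]e [RHS]mxE; apply: eq_bigr => l _.
    by rewrite !mxE.
  apply: (main (row 0 T) (row 1 T)) => // a b h.
  move/row_freeP0: Tf => /(_ (a *: delta_mx 0 0 + b *: delta_mx 0 1)).
  rewrite mulmxDl -!scalemxAl -!rowE => /(_ h)/rowP e.
  by have := e 0; have := e 1; rewrite !mxE /= !(mulr0, mulr1, add0r, addr0).
have [x0 [y0 [xx yy xy]]] := hyperbolic_pair Gs Gh.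
have [z [z' [ind [xz _ _ _] zz _]]] := hyperbolic_complement Gs Gh xx yy xy.
apply: (main x0 z) => // a b h; have [] := ind a 0 b 0; last by move=> -> _ ->.
by rewrite !scale0r !addr0.
Qed.

(* In the coordinates of such a basis the Pluecker form of the jump space is
   [2 (x z - y ^ 2)]. *)
Definition conic_basis l0 m l1 :=
  [/\ [/\ (l0 <= W)%MS, (m <= W)%MS & (l1 <= W)%MS],
      [/\ B6 l0 l0 = 0, B6 l1 l1 = 0 & B6 l0 l1 = 1]
    & [/\ B6 l0 m = 0, B6 m l1 = 0 & B6 m m = - 2]].

Lemma conic_basis_indep l0 m l1 : conic_basis l0 m l1 -> indep3 l0 m l1.
Proof.
move=> [_ [h00 h11 h01] [h0m hm1 hmm]] a b c h.
have h10 : B6 l1 l0 = 1 by rewrite B6C.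
have hm0 : B6 m l0 = 0 by rewrite B6C.
have z q : B6 0 q = 0 by rewrite -(scale0r 0) B6Z mul0r.
have := congr1 (fun x => B6 x l0) h; have := congr1 (fun x => B6 x m) h; have := congr1 (fun x => B6 x l1) h.
rewrite !(B6D, B6Z) !z h00 h01 h10 h11 h0m hm0 hm1 hmm (B6C l1 m) hm1.
rewrite !(mulr0, mulr1, addr0, add0r) => -> /eqP.
by rewrite mulf_eq0 oppr_eq0 pnatr_eq0 orbF => /eqP -> ->.
Qed.

(** An isotropic [l] exists in any plane of W. If [l] were orthogonal to W, an isotropic vector of a
    complementary plane would complete it to an isotropic plane. So there are m orthogonal to [l],
    necessarily anisotropic, and t not orthogonal to it; t is then made orthogonal to m and
    isotropic by corrections along m and [l]. *)
Lemma exists_conic_basis : \rank W = 3%N -> exists l0 m l1, conic_basis l0 m l1.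
Proof.
move=> rW.
have [l [u [v [[lW uW vW] ind ll]]]] : exists l u v,
    [/\ [/\ (l <= W)%MS, (u <= W)%MS & (v <= W)%MS], indep3 l u v & B6 l l = 0].
  have [|D [DW WD]] := @compl_rows F 1 _ _ 0 W 3 (sub0mx _ _); first by rewrite mxrank0.
  have Df : row_free D.
    rewrite -row_leq_rank -[X in (X <= _)%N]rW; apply: mxrankS.
    by move: WD; rewrite -(addsmxE 0 D) adds0mx.
  have rowW i : (row i D <= W)%MS by apply: submx_trans DW; apply: row_sub.
  have ind : indep3 (row 0 D) (row 1 D) (row (lift 0 1) D).
    move=> a b c h; move/row_freeP0: Df.
    move=> /(_ (a *: delta_mx 0 0 + b *: delta_mx 0 1 + c *: delta_mx 0 (lift 0 1))).
    rewrite !mulmxDl -!scalemxAl -!rowE => /(_ h)/rowP e.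
    have := e 0; have := e 1; have := e (lift 0 1); rewrite !mxE /=.
    by rewrite !(mulr0, mulr1, add0r, addr0).
  move: (row 0 D) (row 1 D) (row (lift 0 1) D) (rowW 0) (rowW 1) (rowW (lift 0 1)) ind.
  move=> x y z xW yW zW ind.
  have [s [t /andP[st /eqP hst]]] := binary_isotropic (B6 x x) (B6 x y) (B6 y y).
  have qq : B6 (s *: x + t *: y) (s *: x + t *: y) = 0.
    by rewrite -[RHS]hst !(B6D, B6Dr, B6Z, B6Zr) (B6C y x); ring.
  have qW : ((s *: x + t *: y)%R <= W)%MS by rewrite addmx_sub ?scalemx_sub.
  have [s0|s0] := eqVneq s 0.
    have t0 : t != 0 by move: st; rewrite s0 eqxx.
    exists (s *: x + t *: y), x, z; split=> // a b c.
    rewrite s0 scale0r add0r scalerA [a * t *: y + _]addrC => /ind[-> /eqP + ->].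
    by rewrite mulf_eq0 (negPf t0) orbF => /eqP.
  exists (s *: x + t *: y), y, z; split=> // a b c.
  rewrite scalerDr !scalerA -[_ + b *: y]addrA -scalerDl => /ind[/eqP + + ->].
  by rewrite mulf_eq0 (negPf s0) orbF => /eqP->; rewrite mul0r add0r.
have two : (2 : F) != 0 by rewrite pnatr_eq0.
have [m [t [mW tW ind' [lm lt]]]] : exists m t, [/\ (m <= W)%MS, (t <= W)%MS, indep3 l m t
    & B6 l m = 0 /\ B6 l t != 0].
  have comb (a b : F) : ((a *: u + b *: v)%R <= W)%MS by rewrite addmx_sub ?scalemx_sub.
  have [lu|lu] := eqVneq (B6 l u) 0; last first.
    exists (- (B6 l v / B6 l u) *: u + 1 *: v), u; split=> //.
      move=> a b c h; have [] := ind a (b * - (B6 l v / B6 l u) + c) b.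
        by rewrite -[RHS]h; apply/rowP => i; rewrite !mxE; ring.
      by move=> -> + b0; rewrite b0 mul0r add0r.
    by rewrite B6Dr !B6Zr mul1r mulNr divfK // addNr.
  have [lv|lv] := eqVneq (B6 l v) 0; last by exists u, v.
  exfalso; have [s [t /andP[st /eqP hst]]] := binary_isotropic (B6 u u) (B6 u v) (B6 v v).
  apply: (@no_isotropic_line_mx l (s *: u + t *: v)) => //.
  - by rewrite -[RHS]hst !(B6D, B6Dr, B6Z, B6Zr) (B6C v u); ring.
  - by rewrite !(B6Dr, B6Zr) lu lv !mulr0 addr0.
  move=> a b; rewrite scalerDr !scalerA addrA => /ind[-> /eqP hs /eqP ht]; split=> //.
  move: hs ht; rewrite !mulf_eq0; case: eqVneq => //= _ s0 t0.
  by move: st; rewrite s0 t0.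
have mm : B6 m m != 0.
  apply/eqP => mm; apply: (no_isotropic_line_mx lW mW ll mm lm) => a b h.
  by have [] := ind' a b 0; [rewrite h scale0r addr0|move=> -> -> _].
pose c := sqrtC (- 2 / B6 m m).
have cc : c * c * B6 m m = - 2 by rewrite -expr2 sqrtCK divfK.
pose m' := c *: m; pose t' := t + (B6 t m' / 2) *: m'.
have lm' : B6 l m' = 0 by rewrite B6Zr lm mulr0.
have m'm' : B6 m' m' = - 2 by rewrite B6Z B6Zr mulrA.
have t'm' : B6 m' t' = 0 by rewrite B6C B6D B6Z m'm'; field.
have lt' : B6 l t' = B6 l t by rewrite B6Dr B6Zr lm' mulr0 addr0.
have m'W : (m' <= W)%MS by rewrite scalemx_sub.
have t'W : (t' <= W)%MS by rewrite addmx_sub ?scalemx_sub.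
clearbody t' m'; pose d := B6 l t.
exists l, m', (d^-1 *: t' + (- (B6 t' t' / (2 * d ^+ 2))) *: l); split.
- by split=> //; rewrite addmx_sub ?scalemx_sub.
- split=> //.
    by rewrite !(B6D, B6Dr, B6Z, B6Zr) ll (B6C t' l) lt' -/d; field; rewrite lt.
  by rewrite !(B6Dr, B6Zr) ll lt' -/d mulr0 addr0 mulVf.
split=> //; rewrite !(B6Dr, B6Zr) t'm' (B6C m' l) lm' !mulr0 addr0 //.
Qed.
End JumpConic.

(** * Frames and conic bases *)

Section FrameConic.
Variable F : numClosedFieldType.

(** Replacing one of the four vectors by the vanishing combination multiplies the value by the
    corresponding coefficient. *)
Lemma B6_indep4 (x y z t : 'rV[F]_4) : B6 (wedge x y) (wedge z t) != 0 -> indep4 x y z t.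
Proof.
move=> h p q r s e.
have w0l (v : 'rV[F]_4) : wedge 0 v = 0 by rewrite -(scale0r 0) wedgeZl scale0r.
have w0r (v : 'rV[F]_4) : wedge v 0 = 0 by rewrite wedgeC w0l oppr0.
have b0l (v : 'rV[F]_6) : B6 0 v = 0 by rewrite -(scale0r 0) B6Z mul0r.
have b0r (v : 'rV[F]_6) : B6 v 0 = 0 by rewrite B6C b0l.
set v := (_ + _ + _ + _) in e.
have fin c : c * B6 (wedge x y) (wedge z t) = 0 -> c = 0.
  by move/eqP; rewrite mulf_eq0 (negPf h) orbF => /eqP.
split; apply: fin.
- rewrite -[RHS](b0l (wedge z t)) -[in RHS](w0l y) -e /v /B6 /wedge !cf6E //= !(cfD, cfZ).
  by ring.
- rewrite -[RHS](b0l (wedge z t)) -[in RHS](w0r x) -e /v /B6 /wedge !cf6E //= !(cfD, cfZ).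
  by ring.
- rewrite -[RHS](b0r (wedge x y)) -[in RHS](w0l t) -e /v /B6 /wedge !cf6E //= !(cfD, cfZ).
  by ring.
- rewrite -[RHS](b0r (wedge x y)) -[in RHS](w0r z) -e /v /B6 /wedge !cf6E //= !(cfD, cfZ).
  by ring.
Qed.

Variables (N : nat) (J : 'M[F]_N).
Variables (k : nat) (A : 'I_4 -> 'M[F]_(k, N)).
Hypothesis Aiso : forall x y,
  lin A x *m J *m (lin A y)^T + lin A y *m J *m (lin A x)^T = 0.

Local Notation W := (jump_space J A).

Lemma frame_rank : conic_frame J A -> (3 <= \rank W)%N.
Proof.
move=> [x0 [x1 [y0 [y1 [ind xx yy xy]]]]].
have nz : B6 (wedge x0 x1) (wedge y0 y1) != 0 := B6_indep ind.
pose m := wedge x0 y1 + wedge y0 x1.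
have b0 (v : 'rV[F]_6) : B6 0 v = 0 by rewrite -(scale0r 0) B6Z mul0r.
apply: (indep3_rank (x := wedge x0 x1) (y := m) (z := wedge y0 y1)); last first.
- by apply/jump_spaceP; rewrite LamP_wedge.
- by apply/jump_spaceP; rewrite LamPD !LamP_wedge.
- by apply/jump_spaceP; rewrite LamP_wedge.
move=> a b c e.
have fin d : d * B6 (wedge x0 x1) (wedge y0 y1) = 0 -> d = 0.
  by move/eqP; rewrite mulf_eq0 (negPf nz) orbF => /eqP.
have ev v := congr1 (fun u => B6 u v) e.
split; apply: fin.
- rewrite -[RHS](b0 (wedge y0 y1)) -ev !(B6D, B6Z) /B6 /wedge !cf6E //= ?cfD ?cf6E //=.
  by ring.
- rewrite -[RHS](b0 (wedge x1 y0)) -ev !(B6D, B6Z) /B6 /wedge !cf6E //= ?cfD ?cf6E //=.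
  by ring.
- rewrite -[RHS](b0 (wedge x0 x1)) -ev !(B6D, B6Z) /B6 /wedge !cf6E //= ?cfD ?cf6E //=.
  by ring.
Qed.

(** Write l0 and l1 as wedges of x0, x1 and of z, t. Orthogonality of m to both leaves only its
    mixed terms, which regroup as [wedge x0 y1 + wedge y0 x1] with y0, y1 in the span of z, t. The
    normalization [B6 m m = - 2] makes [B6 (wedge x0 x1) (wedge y0 y1)] equal to 1, hence
    independence. *)
Lemma conic_basis_frame l0 m l1 : conic_basis J A l0 m l1 -> conic_frame J A.
Proof.
move=> [[l0W mW l1W] [h00 h11 h01] [h0m hm1 hmm]].
have nz (p q : 'rV[F]_6) : B6 p q = 1 -> p != 0.
  apply: contra_eq_neq => ->; rewrite -(scale0r 0) B6Z mul0r eq_sym; exact: oner_neq0.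
have [x0 [x1 l0E]] := decomposable (nz _ _ h01) h00.
have h10 : B6 l1 l0 = 1 by rewrite B6C.
have [z [t l1E]] := decomposable (nz _ _ h10) h11.
have ind : indep4 x0 x1 z t by apply: B6_indep4; rewrite -l0E -l1E h01 oner_eq0.
have [a [b [c [d [e [f mE]]]]]] := wedge_span ind m.
have f0 : f = 0.
  rewrite -[RHS]h0m mE l0E !(B6Dr, B6Zr) -l1E -l0E h00 h01 l0E !B6_wedge_meet.
  rewrite (wedgeC x1 x0) -scaleN1r !B6Z !B6_wedge_meet; ring.
have a0 : a = 0.
  rewrite -[RHS]hm1 mE !(B6D, B6Z) -l1E -l0E h11 h01 f0 l1E.
  by rewrite /B6 /wedge !cf6E //=; ring.
pose y1 := b *: z + c *: t; pose y0 := (-1) *: (d *: z + e *: t).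
have {}mE : m = wedge x0 y1 + wedge y0 x1.
  rewrite mE f0 a0 !scale0r add0r addr0 (wedgeC x1 y0) /y1 /y0.
  rewrite !(wedgeDr, wedgeZr).
  by apply/rowP => i; rewrite !mxE; ring.
have Lzt : Lam J A z t = 0 by rewrite -LamP_wedge // -l1E; apply/jump_spaceP.
exists x0, x1, y0, y1; split.
- apply: B6_indep4; have two : (2 : F) != 0 by rewrite pnatr_eq0.
  suff -> : B6 (wedge x0 x1) (wedge y0 y1) = 1 by apply: oner_neq0.
  apply: (mulfI two); rewrite mulr1; apply: oppr_inj; rewrite -hmm mE.
  by rewrite /B6 !cfD /wedge !cf6E //=; ring.
- by rewrite -LamP_wedge // -l0E; apply/jump_spaceP.
- rewrite -LamP_wedge // (_ : wedge y0 y1 = (e * b - d * c) *: wedge z t).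
    by rewrite LamPZ LamP_wedge // Lzt scaler0.
  by apply: cf6_eq; rewrite cfZ /wedge !cf6E //= !(cfD, cfZ); ring.
- by rewrite -!LamP_wedge // -LamPD -mE; apply/jump_spaceP.
Qed.
End FrameConic.

(** * Points of subschemes of P^5 *)

Section HomogeneousInduction.
Variables (F : fieldType) (n : nat).

Lemma dhomog_ind (P : nat -> {mpoly F[n]} -> Prop) :
  (forall d, P d 0) -> (forall d p q, P d p -> P d q -> P d (p + q)) ->
  (forall d c p, P d p -> P d (c *: p)) -> P 0%N 1 ->
  (forall d i p, P d p -> P d.+1 ('X_i * p)) ->
  forall d f, f \is d.-homog -> P d f.
Proof.
move=> P0 PD PZ P1 PX d f /dhomogP fd; rewrite (mpolyE f) big_seq.
have PM e m : mdeg m = e -> P e ('X_[m] : {mpoly F[n]}).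
  elim: e m => [|e IH] m me.
    by move/eqP: me; rewrite mdeg_eq0 => /eqP->; rewrite mpolyX0.
  have [i mi] : exists i, (0 < m i)%N.
    apply: contrapT => h; have : mdeg m = 0%N.
      rewrite mdegE big1 // => i _; apply/eqP; rewrite -leqn0 leqNgt.
      by apply/negP => hi; apply: h; exists i.
    by rewrite me.
  have mE : m = (U_(i) + (m - U_(i)))%MM.
    apply/mnmP => j; rewrite mnmDE mnmBE mnm1E; case: eqVneq => [<-|_] //=.
      by rewrite subnKC.
    by rewrite subn0.
  rewrite mE mpolyXD; apply: (PX); apply: IH.
  by move: me; rewrite {1}mE mdegD mdeg1 => -[].
elim/big_ind: _ => //; first exact: PD.
by move=> m mf; apply: PZ; apply: PM; apply: fd.
Qed.

End HomogeneousInduction.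

Section ProjPoints.
Variable F : numClosedFieldType.
Local Notation P := {mpoly F[6]}.

Definition lf (c : 'rV[F]_6) : P := \sum_j c 0 j *: 'X_j.

Lemma lfD c d : lf (c + d) = lf c + lf d.
Proof. by rewrite /lf -big_split; apply: eq_bigr => j _; rewrite mxE scalerDl. Qed.
Lemma lfZ a c : lf (a *: c) = a *: lf c.
Proof. by rewrite /lf scaler_sumr; apply: eq_bigr => j _; rewrite mxE scalerA. Qed.
Lemma lfB c d : lf (c - d) = lf c - lf d.
Proof. by rewrite lfD -scaleN1r lfZ scaleN1r. Qed.
Lemma lf_delta i : lf (delta_mx 0 i) = 'X_i.
Proof.
rewrite /lf (bigD1 i) //= mxE !eqxx scale1r big1 ?addr0 // => j ji.
by rewrite mxE (negPf ji) andbF scale0r.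
Qed.
Lemma lf_sum I (r : seq I) (c : I -> 'rV[F]_6) : lf (\sum_(i <- r) c i) = \sum_(i <- r) lf (c i).
Proof.
apply: (big_morph lf lfD); rewrite -(scale0r 0) lfZ scale0r //.
Qed.

Definition is_ideal (Q : P -> Prop) :=
  [/\ Q 0, forall p q, Q p -> Q q -> Q (p + q) & forall p q, Q q -> Q (p * q)].

Section Ideal.
Variable Q : P -> Prop.
Hypothesis hQ : is_ideal Q.

Lemma idealD p q : Q p -> Q q -> Q (p + q). Proof. by have [_ h _] := hQ; apply: h. Qed.
Lemma idealM p q : Q q -> Q (p * q). Proof. by have [_ _ h] := hQ; apply: h. Qed.
Lemma idealMr p q : Q p -> Q (p * q). Proof. by rewrite mulrC; apply: idealM. Qed.
Lemma idealZ c p : Q p -> Q (c *: p). Proof. by rewrite -mul_mpolyC; apply: idealM. Qed.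
Lemma idealN p : Q p -> Q (- p). Proof. by rewrite -mulN1r; apply: idealM. Qed.
Lemma idealB p q : Q p -> Q q -> Q (p - q).
Proof. by move=> hp hq; apply: idealD => //; apply: idealN. Qed.
Lemma ideal_sum I (r : seq I) (p : pred I) (G : I -> P) :
  (forall i, p i -> Q (G i)) -> Q (\sum_(i <- r | p i) G i).
Proof. by move=> h; apply: big_ind => //; [case: hQ|apply: idealD]. Qed.
Lemma ideal_sub p q : Q (p - q) -> Q q -> Q p.
Proof. by move=> h hq; rewrite -[p](subrK q); apply: idealD. Qed.
Lemma ideal_sub' p q : Q (p - q) -> Q p -> Q q.
Proof. by move=> h hp; rewrite -[q](subKr p); apply: idealB. Qed.

Lemma dual_forms r (D : 'M[F]_(r, 6)) : row_free D ->
  (forall c : 'rV_6, D *m c^T = 0 -> Q (lf c)) ->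
  exists T : 'I_r -> P, forall c, Q (lf c - \sum_j (D *m c^T) j 0 *: T j).
Proof.
move=> /row_freeP[R DR] hD; exists (fun j => lf (row j R^T)) => c.
have -> : \sum_j (D *m c^T) j 0 *: lf (row j R^T) = lf ((D *m c^T)^T *m R^T).
  by rewrite mulmx_sum_row lf_sum; apply: eq_bigr => j _; rewrite lfZ [in RHS]mxE.
rewrite -lfB; apply: hD; rewrite linearB /= mulmxBr trmx_mul !trmxK mulmxA DR.
by rewrite mul1mx subrr.
Qed.
End Ideal.

Lemma proj_point_ideal (s : seq P) Q : proj_point s Q -> is_ideal Q.
Proof. by case. Qed.

Lemma proj_point_pow (s : seq P) Q p d : proj_point s Q -> Q (p ^+ d) -> Q p.
Proof.
case=> _ [n1 pr] _ _ _; elim: d => [|d IH]; first by rewrite expr0.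
by rewrite exprS => /pr[].
Qed.

Lemma proj_point_homog (s : seq P) Q f : proj_point s Q ->
  (forall d, Q (pihomog mdeg d f)) -> Q f.
Proof.
move=> hQ h; rewrite (@pihomog_partitionE _ _ mdeg (mmeasure mdeg f) f) //.
by apply: (ideal_sum (proj_point_ideal hQ)) => i _; apply: h.
Qed.

(** For a point Q of Proj this means that Q is the ideal of the closed point v. *)
Definition point_type (Q : P -> Prop) (v : 'rV[F]_6) :=
  v != 0 /\ forall c : 'rV_6, v *m c^T = 0 -> Q (lf c).

(** Modulo Q a form f of degree d is f(v) times the power d of a coordinate t normalized at v. A
    form of Q' with f(v) nonzero would put t, and then all coordinates, in Q'. *)
Lemma point_max (s : seq P) Q Q' v : proj_point s Q -> proj_point s Q' ->
  (forall p, Q p -> Q' p) -> point_type Q v -> forall p, Q' p -> Q p.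
Proof.
move=> hQ hQ' QQ' [v0 vQ] p Q'p.
have iQ := proj_point_ideal hQ; have iQ' := proj_point_ideal hQ'.
have [i0 vi] := rV0Pn _ v0; set t : P := (v 0 i0)^-1 *: 'X_i0.
have Xt i : Q ('X_i - v 0 i *: t).
  rewrite /t -!lf_delta -!lfZ -lfB; apply: vQ.
  have tE (a b : 'rV[F]_6) c : (a - c *: b)^T = a^T - c *: b^T.
    by rewrite linearB linearZ.
  rewrite scalerA tE mulmxBr -scalemxAr !trmx_delta -!colE.
  by apply/matrixP => a b; rewrite !mxE !ord1 divfK // subrr.
have key d f : f \is d.-homog -> Q (f - f.@[fun i => v 0 i] *: t ^+ d).
  move: d f; apply: dhomog_ind => [d|d f g hf hg|d c f hf| |d i f hf].
  - by rewrite meval0 scale0r subr0; case: iQ.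
  - by rewrite mevalD scalerDl opprD addrACA; apply: idealD.
  - by rewrite mevalZ -scalerA -scalerBr; apply: idealZ.
  - by rewrite meval1 scale1r expr0 subrr; case: iQ.
  rewrite mevalM mevalXU.
  have -> : 'X_i * f - (v 0 i * f.@[fun i => v 0 i]) *: t ^+ d.+1 =
      ('X_i - v 0 i *: t) * f + (v 0 i *: t) * (f - f.@[fun i => v 0 i] *: t ^+ d).
    rewrite mulrBl mulrBr addrA subrK; congr (_ - _).
    by rewrite -scalerAl -scalerAr scalerA -exprS.
  by apply: (idealD iQ); [apply: (idealMr iQ)|apply: (idealM iQ)].
apply: (proj_point_homog hQ) => d.
have hd := pihomogP mdeg d p; have hk := key _ _ hd.
have [fv|fv] := eqVneq ((pihomog mdeg d p).@[fun i => v 0 i]) 0.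
  by move: hk; rewrite fv scale0r subr0.
have Q't : Q' t.
  apply: (proj_point_pow (d := d) hQ').
  have -> : t ^+ d = ((pihomog mdeg d p).@[fun i => v 0 i])^-1 *:
     ((pihomog mdeg d p).@[fun i => v 0 i] *: t ^+ d) by rewrite scalerK.
  apply: (idealZ iQ'); apply: (ideal_sub' iQ' (QQ' _ hk)).
  by case: hQ' => _ _ h _ _; apply: h.
exfalso; case: hQ' => _ _ _ na _; apply: na => i.
apply: (ideal_sub iQ' (QQ' _ (Xt i))); exact: idealZ.
Qed.
End ProjPoints.

(** * The ideal of the jumping scheme *)

Section ZkIdeal.
Variable F : numClosedFieldType.
Local Notation P := {mpoly F[6]}.

Lemma in_ideal_is_ideal (s : seq P) : is_ideal (in_ideal s).
Proof.
split.
- by exists (fun=> 0); rewrite big1 // => i _; rewrite mul0r.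
- move=> p q [c ->] [d ->]; exists (fun i => c i + d i).
  by rewrite -big_split; apply: eq_bigr => i _; rewrite mulrDl.
- move=> p q [c ->]; exists (fun i => p * c i).
  by rewrite big_distrr; apply: eq_bigr => i _; rewrite /= mulrA.
Qed.

Lemma in_ideal_mem (s : seq P) p : p \in s -> in_ideal s p.
Proof.
move=> /(nthP 0)[i hi <-]; exists (fun j => (j == Ordinal hi)%:R).
rewrite (bigD1 (Ordinal hi)) //= eqxx mul1r big1 ?addr0 // => j /negPf->.
by rewrite mul0r.
Qed.

Lemma in_ideal_min (s : seq P) Q p : is_ideal Q -> (forall q, q \in s -> Q q) ->
  in_ideal s p -> Q p.
Proof.
move=> iQ h [c ->]; apply: (ideal_sum iQ) => i _; apply: (idealM iQ); apply: h.
exact: mem_nth.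
Qed.

Local Notation X i := ('X_(inord i) : P).

Lemma sum_nat_ord (R : nmodType) n (G : 'I_n.+1 -> R) :
  \sum_(i < n.+1) G i = \sum_(0 <= i < n.+1) G (inord i).
Proof. by rewrite big_mkord; apply: eq_bigr => i _; rewrite inord_val. Qed.

Lemma big_ord4 (R : nmodType) (G : 'I_4 -> R) : \sum_(i < 4) G i =
  G (inord 0) + G (inord 1) + G (inord 2) + G (inord 3).
Proof. by rewrite sum_nat_ord !big_nat_recr //= big_geq // add0r. Qed.

Lemma big_ord6 (R : nmodType) (G : 'I_6 -> R) : \sum_(i < 6) G i =
  G (inord 0) + G (inord 1) + G (inord 2) + G (inord 3) + G (inord 4) + G (inord 5).
Proof. by rewrite sum_nat_ord !big_nat_recr //= big_geq // add0r. Qed.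

Lemma big_ord_pairs (R : nmodType) (G : 'I_4 -> 'I_4 -> R) :
  \sum_(i < 4) \sum_(j < 4 | (i < j)%N) G i j =
  G (inord 0) (inord 1) + G (inord 0) (inord 2) + G (inord 0) (inord 3)
  + G (inord 1) (inord 2) + G (inord 1) (inord 3) + G (inord 2) (inord 3).
Proof.
under eq_bigr do rewrite big_mkcond big_ord4.
by rewrite big_ord4 !inordK //= !(addr0, add0r) !addrA.
Qed.

Lemma plueckerE : pluecker F = X 0 * X 5 - X 1 * X 4 + X 2 * X 3.
Proof. by rewrite /pluecker /pl /pl_idx !inordK. Qed.

Lemma meval_lf (v c : 'rV[F]_6) : (lf c).@[fun i => v 0 i] = (v *m c^T) 0 0.
Proof.
rewrite /lf raddf_sum mxE; apply: eq_bigr => i _.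
by rewrite /= mevalZ mevalXU mxE mulrC.
Qed.

Variables (k : nat) (A : 'I_4 -> 'M[F]_(k, 2 * k + 2)) (J : 'M[F]_(2 * k + 2)).

Lemma lin_e4 i : (i < 4)%N -> lin A (e4 F i) = A (inord i).
Proof.
move=> hi; rewrite /lin (bigD1 (inord i)) //= mxE inordK // eqxx scale1r big1 ?addr0 //.
move=> j ji; rewrite mxE; case: eqP => [ij|_]; last by rewrite scale0r.
by move: ji; rewrite ij inord_val eqxx.
Qed.

Lemma jump_entryE u v :
  jump_entry A J u v = lf (row (mxvec_index u v) (jump_mx J A)^T).
Proof.
have cE c : lf c = cf c 0 *: X 0 + cf c 1 *: X 1 + cf c 2 *: X 2 + cf c 3 *: X 3
    + cf c 4 *: X 4 + cf c 5 *: X 5.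
  by rewrite /lf big_ord6.
have cj i : (i < 6)%N -> cf (row (mxvec_index u v) (jump_mx J A)^T) i =
    LamP J A (delta_mx 0 (inord i)) u v.
  by move=> hi; rewrite /cf mxE mxE /jump_mx mxE mxvecE.
have dE i j : (i < 6)%N -> (j < 6)%N -> cf (delta_mx 0 (inord i) : 'rV[F]_6) j = (i == j)%:R.
  move=> hi hj; rewrite /cf mxE eqxx /=.
  by rewrite -val_eqE /= !inordK // eq_sym.
have LE i : (i < 6)%N -> LamP J A (delta_mx 0 (inord i)) = 
    nth 0 [:: Lam J A (e4 F 0) (e4 F 1); Lam J A (e4 F 0) (e4 F 2); Lam J A (e4 F 0) (e4 F 3);
      Lam J A (e4 F 1) (e4 F 2); Lam J A (e4 F 1) (e4 F 3); Lam J A (e4 F 2) (e4 F 3)] i.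
  move=> hi; rewrite /LamP !dE //; case: i hi => [|[|[|[|[|[|]]]]]] //= _;
  by rewrite !(scale0r, scale1r, addr0, add0r).
rewrite cE !cj // !LE //= /Lam !lin_e4 //.
rewrite /jump_entry (big_ord_pairs (fun i j => (A i *m J *m (A j)^T) u v *: 'X_(pl_idx i j))).
by rewrite /pl_idx !inordK.
Qed.

Local Notation W := (jump_space J A).

(** Double annihilator: the forms vanishing on W contain the columns of [jump_mx], and the ranks
    agree. *)
Lemma jump_space_perp (c : 'rV_6) : W *m c^T = 0 -> (c <= (jump_mx J A)^T)%MS.
Proof.
move=> h; have sub : ((jump_mx J A)^T <= kermx W^T)%MS.
  by apply/sub_kermxP; rewrite -trmx_mul mulmx_ker trmx0.
have : (c <= kermx W^T)%MS by apply/sub_kermxP; rewrite -[c]trmxK -trmx_mul h trmx0.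
move/submx_trans; apply; have := mxrank_leqif_sup sub => -[_ <-].
by rewrite mxrank_ker !mxrank_tr mxrank_ker subKn // rank_leq_row.
Qed.

Lemma Zk_forms Q : is_ideal Q -> (forall p, p \in Zk A J -> Q p) ->
  forall c, W *m c^T = 0 -> Q (lf c).
Proof.
move=> iQ hQ c /jump_space_perp/submxP[y ->].
rewrite mulmx_sum_row lf_sum; apply: (ideal_sum iQ) => i _; rewrite lfZ.
apply: (idealZ iQ); case/mxvec_indexP: i => u v; rewrite -jump_entryE; apply: hQ.
by rewrite inE; apply/orP; right; apply/allpairsP; exists (u, v); rewrite !mem_enum.
Qed.

Lemma Zk_pluecker Q : (forall p, p \in Zk A J -> Q p) -> Q (pluecker F).
Proof. by apply; rewrite inE eqxx. Qed.

(* Modulo an ideal containing the equations of Z_k every linear form is a combination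
   of the coordinate forms of a basis of the jump space. *)
Lemma Zk_coords Q r (D : 'M[F]_(r, 6)) : is_ideal Q -> (forall p, p \in Zk A J -> Q p) ->
  row_free D -> (W <= D)%MS -> exists T : 'I_r -> P,
    forall c, Q (lf c - \sum_j (D *m c^T) j 0 *: T j).
Proof.
move=> iQ hQ Df WD; apply: (dual_forms Df) => c Dc; apply: (Zk_forms iQ hQ).
by have /submxP[E ->] := WD; rewrite -mulmxA Dc mulmx0.
Qed.
End ZkIdeal.

(** * Points of Proj given by parametrized curves *)

Section Parametrizations.
Variable F : numClosedFieldType.
Local Notation P := {mpoly F[6]}.

Definition Bk (K : comNzRingType) (a b : 'I_6 -> K) : K :=
  let i n : 'I_6 := inord n in
  a (i 0%N) * b (i 5%N) + a (i 5%N) * b (i 0%N)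
  - (a (i 1%N) * b (i 4%N) + a (i 4%N) * b (i 1%N))
  + (a (i 2%N) * b (i 3%N) + a (i 3%N) * b (i 2%N)).

Lemma Bk_expand (K : comNzRingType) (a b c : 'I_6 -> K) X Y Z :
  Bk (fun i => a i * X + b i * Y + c i * Z) (fun i => a i * X + b i * Y + c i * Z) =
  Bk a a * X ^+ 2 + Bk b b * Y ^+ 2 + Bk c c * Z ^+ 2
  + (Bk a b * (X * Y)) *+ 2 + (Bk a c * (X * Z)) *+ 2 + (Bk b c * (Y * Z)) *+ 2.
Proof. by rewrite /Bk; ring. Qed.

Lemma Bk_morph (K : comNzRingType) (f : {rmorphism F -> K}) (p q : 'rV[F]_6) :
  Bk (fun i => f (p 0 i)) (fun i => f (q 0 i)) = f (B6 p q).
Proof. by rewrite /Bk /B6 /cf !(rmorphD, rmorphN, rmorphM). Qed.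

Variable h : 'I_6 -> {poly F}.

Definition param (f : P) : {poly F} := mmap (@polyC F) h f.
(** Parametrizes the affine cone over the curve: the outer variable records the degree, so that the
    kernel is a homogeneous ideal, and it is prime because the target is a domain. *)
Definition param_cone (f : P) : {poly {poly F}} :=
  mmap (polyC \o @polyC F) (fun i => (h i)%:P * 'X) f.

Lemma param_coneX i : param_cone 'X_i = (h i)%:P * 'X.
Proof. by rewrite /param_cone mmapX mmap1U. Qed.

Lemma param_cone_homog d f : f \is d.-homog -> param_cone f = (param f)%:P * 'X^d.
Proof.
move: d f; apply: dhomog_ind => [d|d p q hp hq|d c p hp| |d i p hp].
- by rewrite /param /param_cone !raddf0 mul0r.
- by rewrite /param /param_cone !raddfD /= mulrDl -hp -hq.
- by rewrite /param /param_cone !mmapZ /= polyCM -mulrA -hp.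
- by rewrite /param /param_cone !rmorph1 mul1r expr0.
rewrite /param /param_cone !rmorphM /= !mmapX !mmap1U ?polyCM exprS mulrACA.
by congr (_ * _).
Qed.

Lemma param_coneE f d : (param_cone f)`_d = param (pihomog mdeg d f).
Proof.
have [K hK] := ubnP (maxn (mmeasure mdeg f) d.+1).
have fE := @pihomog_partitionE _ _ mdeg K f (leq_trans (leq_maxl _ _) (ltnW hK)).
have dK : (d < K)%N by apply: leq_trans (leq_maxr _ _) (ltnW hK).
rewrite {1}fE /param_cone raddf_sum coef_sum (bigD1 (Ordinal dK)) //=.
rewrite -/(param_cone _) (param_cone_homog (pihomogP _ _ _)) coefCM coefXn eqxx mulr1.
rewrite big1 ?addr0 // => i id; rewrite -/(param_cone _).
rewrite (param_cone_homog (pihomogP _ _ _)) coefCM coefXn.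
by rewrite eq_sym (_ : (i == d :> nat) = false) ?mulr0 //; apply: contraNF id => /eqP id;
   apply/eqP/val_inj.
Qed.

Variables (k : nat) (A : 'I_4 -> 'M[F]_(k, 2 * k + 2)) (J : 'M[F]_(2 * k + 2)).

Lemma param_lf c : param_cone (lf c) = (\sum_i (c 0 i)%:P * h i)%:P * 'X.
Proof.
rewrite /lf /param_cone raddf_sum rmorph_sum big_distrl; apply: eq_bigr => i _ /=.
by rewrite mmapZ mmapX mmap1U /= polyCM mulrA.
Qed.

Lemma param_point : (forall j, \sum_i (jump_mx J A i j)%:P * h i = 0) ->
  Bk h h = 0 -> (exists i, h i != 0) ->
  proj_point (Zk A J) (fun f => param_cone f = 0).
Proof.
move=> hL hB [i0 hi0].
have two : (2%:P : {poly F}) != 0 by rewrite polyC_eq0 pnatr_eq0.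
split.
- split; first by rewrite /param_cone raddf0.
  + by move=> p q; rewrite /param_cone raddfD /= => -> ->; rewrite addr0.
  + by move=> p q; rewrite /param_cone rmorphM /= => ->; rewrite mulr0.
- split; first by rewrite /param_cone rmorph1; apply/eqP; rewrite oner_eq0.
  move=> p q; rewrite /param_cone rmorphM /= => /eqP; rewrite mulf_eq0.
  by case/orP => /eqP; [left|right].
- move=> p d hp; rewrite (param_cone_homog (pihomogP _ _ _)) -param_coneE hp.
  by rewrite coef0 mul0r.
- move=> /(_ i0); rewrite param_coneX => /eqP; rewrite mulf_eq0 polyX_eq0 orbF polyC_eq0.
  by rewrite (negPf hi0).
move=> p; rewrite inE => /orP[/eqP->|].
  apply: (mulfI (_ : (2%:P)%:P != 0)); first by rewrite polyC_eq0.
  rewrite mulr0 plueckerE /param_cone !(rmorphD, rmorphN, rmorphM) /= !mmapX !mmap1U.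
  transitivity ((Bk h h)%:P * 'X ^+ 2); last by rewrite hB mul0r.
  by rewrite /Bk !(polyCD, polyCN, polyCM); ring.
case/allpairsP => -[u v] [_ _ ->] /=; rewrite jump_entryE param_lf.
set j := mxvec_index u v; rewrite (eq_bigr (fun i => (jump_mx J A i j)%:P * h i)).
  by rewrite hL mul0r.
by move=> i _; rewrite !mxE.
Qed.
End Parametrizations.

(** * Binary forms in a prime ideal *)

Section BinaryForms.
Variable F : numClosedFieldType.
Local Notation P := {mpoly F[6]}.
Variables X Y : P.

(** The degree n homogenization of p, formally the power n of X times p(Y / X). *)
Definition bform n (p : {poly F}) : P := \sum_(j < n.+1) p`_j *: (X ^+ (n - j) * Y ^+ j).

Lemma bformD n p q : bform n (p + q) = bform n p + bform n q.
Proof. by rewrite /bform -big_split; apply: eq_bigr => j _; rewrite coefD scalerDl. Qed.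
Lemma bformZ n c p : bform n (c *: p) = c *: bform n p.
Proof. by rewrite /bform scaler_sumr; apply: eq_bigr => j _; rewrite coefZ scalerA. Qed.
Lemma bform0 n : bform n 0 = 0.
Proof. by rewrite -(scale0r 0) bformZ scale0r. Qed.

Lemma bformX n (p : {poly F}) : (size p <= n.+1)%N -> bform n.+1 p = X * bform n p.
Proof.
move=> sp; rewrite /bform big_ord_recr /= nth_default // scale0r addr0 big_distrr.
apply: eq_bigr => j _ /=; rewrite -scalerAr mulrA -exprS -subSn //.
by rewrite -ltnS.
Qed.

Lemma bformY n p : bform n.+1 ('X * p) = Y * bform n p.
Proof.
rewrite /bform big_ord_recl coefXM /= scale0r add0r big_distrr.
by apply: eq_bigr => j _ /=; rewrite coefXM /= -scalerAr mulrCA -exprS.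
Qed.

Lemma bform_quad n (p : {poly F}) a b c : (size p <= n.+1)%N ->
  bform n.+2 ((a%:P + b *: 'X + c *: 'X^2) * p) =
  (a *: X ^+ 2 + b *: (X * Y) + c *: Y ^+ 2) * bform n p.
Proof.
move=> sp; rewrite !mulrDl mul_polyC -!scalerAl !bformD !bformZ (expr2 'X) -(mulrA 'X).
have sp1 : (size p <= n.+2)%N by apply: leq_trans sp _.
rewrite !bformY !bformX // !expr2 -!mulrA; congr (_ + _ *: _ + _).
exact: mulrCA.
Qed.

(** A prime containing a product of linear forms contains one of them: each root r of p gives a
    factor Y - r X, and each degree missing to n a factor X. *)
Lemma bform_split Q n (p : {poly F}) : is_ideal Q -> ~ Q 1 ->
  (forall p q, Q (p * q) -> Q p \/ Q q) -> p != 0 -> (size p <= n.+1)%N -> Q (bform n p) ->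
  Q X \/ exists r, Q (Y - r *: X).
Proof.
move=> iQ n1 pr; elim: n p => [|n IH] p p0 sp.
  have [c c0 ->] : exists2 c, c != 0 & p = c%:P.
    by apply/size_poly1P; rewrite eqn_leq sp lt0n size_poly_eq0.
  rewrite /bform big_ord1 coefC /= expr0 mulr1 => h; case: n1.
  by rewrite -(scalerK c0 1); apply: idealZ.
have [s1|s1] := leqP (size p) 1.
  rewrite bformX; last by apply: leq_trans s1 _.
  move=> /pr[|/IH]; first by left.
  by apply=> //; apply: leq_trans s1 _.
have [r /factor_theorem[q pE]] : exists r, root p r.
  by apply/closed_rootP; rewrite neq_ltn s1 orbT.
have q0 : q != 0 by apply: contraNneq p0 => q0; rewrite pE q0 mul0r.
have sq : (size q <= n.+1)%N.
  by move: sp; rewrite pE size_Mmonic ?monicXsubC // size_XsubC addn2.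
rewrite pE mulrC mulrBl mul_polyC -scaleN1r scalerA mulN1r bformD bformZ bformY bformX //.
rewrite scaleNr scalerAl -mulrBl => /pr[h|/IH]; first by right; exists r.
by apply.
Qed.
End BinaryForms.

(** * Points of the conic *)

Section ConicPoints.
Variable F : numClosedFieldType.
Local Notation P := {mpoly F[6]}.

Definition ev (p c : 'rV[F]_6) : F := (p *m c^T) 0 0.

Lemma ev_delta p i : ev p (delta_mx 0 i) = p 0 i.
Proof. by rewrite /ev trmx_delta -colE mxE. Qed.

Lemma evDl p q c : ev (p + q) c = ev p c + ev q c.
Proof. by rewrite /ev mulmxDl mxE. Qed.
Lemma evZl a p c : ev (a *: p) c = a * ev p c.
Proof. by rewrite /ev -scalemxAl mxE. Qed.
Lemma ev_eq0 p c : (p *m c^T = 0) <-> ev p c = 0.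
Proof.
split=> [h|h]; first by rewrite /ev h mxE.
by rewrite [LHS]mx11_scalar -/(ev p c) h raddf0.
Qed.

Lemma Bk_ideal (Q : P -> Prop) (h : 'I_6 -> P) : is_ideal Q -> Q (pluecker F) ->
  (forall i, Q ('X_i - h i)) -> Q (Bk h h).
Proof.
move=> iQ Qp Qh; pose X i : P := 'X_i.
apply: (ideal_sub' iQ (p := Bk X X)).
  have -> : Bk X X - Bk h h = Bk (fun i => X i - h i) (fun i => X i + h i).
    by rewrite /Bk; ring.
  have Qu i q : Q ((X i - h i) * q) by apply: (idealMr iQ); apply: Qh.
  rewrite /Bk; apply: (idealD iQ); [apply: (idealB iQ)|];
  by apply: (idealD iQ); apply: Qu.
have -> : Bk X X = 2 * pluecker F by rewrite plueckerE /Bk /X; ring.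
exact: idealM.
Qed.

Variables (k : nat) (A : 'I_4 -> 'M[F]_(k, 2 * k + 2)) (J : 'M[F]_(2 * k + 2)).
Local Notation W := (jump_space J A).
Local Notation s := (Zk A J).

Lemma proj_point_Zk Q : proj_point s Q -> forall p, p \in s -> Q p.
Proof. by case. Qed.

Lemma Zk_coords2 Q a b : is_ideal Q -> (forall p, p \in s -> Q p) ->
  row_free (col_mx a b) -> (W <= col_mx a b)%MS ->
  exists X Y, forall c, Q (lf c - (ev a c *: X + ev b c *: Y)).
Proof.
move=> iQ hQ Df WD; have [T hT] := Zk_coords iQ hQ Df WD.
exists (T (lshift 1 0)), (T (rshift 1 0)) => c; have := hT c.
by rewrite big_split_ord !big_ord1 mul_col_mx col_mxEu col_mxEd.
Qed.

Lemma Zk_coords3 Q a b d : is_ideal Q -> (forall p, p \in s -> Q p) ->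
  row_free (col_mx a (col_mx b d)) -> (W <= col_mx a (col_mx b d))%MS ->
  exists X Y Z, forall c, Q (lf c - (ev a c *: X + ev b c *: Y + ev d c *: Z)).
Proof.
move=> iQ hQ Df WD; have [T hT] := Zk_coords iQ hQ Df WD.
exists (T (lshift (1 + 1) 0)), (T (rshift 1 (lshift 1 0))), (T (rshift 1 (rshift 1 0))) => c.
have := hT c; rewrite big_split_ord big_ord1 big_split_ord !big_ord1 !mul_col_mx.
by rewrite !col_mxEu !col_mxEd ?col_mxEu /= addrA.
Qed.

Section Conic.
Variables l0 m l1 : 'rV[F]_6.
Hypothesis cb : conic_basis J A l0 m l1.
Hypothesis rW : \rank W = 3%N.

Let h (i : 'I_6) : {poly F} := (l0 0 i)%:P + (m 0 i) *: 'X + (l1 0 i) *: 'X^2.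

Definition conic_coords (Q : P -> Prop) X Y Z :=
  (forall c, Q (lf c - (ev l0 c *: X + ev m c *: Y + ev l1 c *: Z))) /\ Q (X * Z - Y ^+ 2).

Lemma exists_conic_coords Q : is_ideal Q -> (forall p, p \in s -> Q p) ->
  exists X Y Z, conic_coords Q X Y Z.
Proof.
move=> iQ hQ; have [[l0W mW l1W] [h00 h11 h01] [h0m hm1 hmm]] := cb.
have Df := indep3_row_free (conic_basis_indep cb).
have WD : (W <= col_mx l0 (col_mx m l1))%MS.
  have sub : (col_mx l0 (col_mx m l1) <= W)%MS by rewrite !col_mx_sub l0W mW l1W.
  by have := mxrank_leqif_sup sub => -[_ <-]; rewrite rW (eqP Df).
have [X [Y [Z hc]]] := Zk_coords3 iQ hQ Df WD; exists X, Y, Z; split=> //.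
have Qh i : Q ('X_i - ((l0 0 i)%:MP * X + (m 0 i)%:MP * Y + (l1 0 i)%:MP * Z)).
  by have := hc (delta_mx 0 i); rewrite lf_delta !ev_delta !mul_mpolyC.
have := Bk_ideal iQ (Zk_pluecker hQ) Qh; rewrite Bk_expand.
have mor (p q : 'rV[F]_6) : Bk (fun i => (p 0 i)%:MP : P) (fun i => (q 0 i)%:MP) = (B6 p q)%:MP.
  exact: (Bk_morph (@mpolyC 6 F)).
rewrite !mor h00 h11 h01 h0m hm1 hmm.
have -> : (0%:MP * X ^+ 2 + (- 2)%:MP * Y ^+ 2 + 0%:MP * Z ^+ 2 + (0%:MP * (X * Y)) *+ 2 +
   (1%:MP * (X * Z)) *+ 2 + (0%:MP * (Y * Z)) *+ 2 : P) = 2%:MP * (X * Z - Y ^+ 2).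
  by rewrite mpolyC0 mpolyC1 mpolyCN -[2%:MP]/((2%:R)%:MP : P) mpolyCMn mpolyC1; ring.
rewrite mul_mpolyC => h2.
have two : (2 : F) != 0 by rewrite pnatr_eq0.
by rewrite -(scalerK two (X * Z - _)); apply: (idealZ iQ).
Qed.

(** If Q contains X it contains the square of Y, hence Y, and is the point [l1]. If it contains Y -
    r X it contains X (Z - r^2 X), and off X = 0 it is the point of parameter r. *)
Lemma conic_line Q X Y Z : proj_point s Q -> conic_coords Q X Y Z ->
  Q X \/ (exists r, Q (Y - r *: X)) -> exists v, point_type Q v.
Proof.
move=> hQ [hc hq]; have iQ := proj_point_ideal hQ.
have [_ [_ pr] _ _ _] := hQ.
have [_ [h00 h11 h01] [h0m hm1 hmm]] := cb.
have B0 (q : 'rV[F]_6) : B6 0 q = 0 by rewrite -(scale0r 0) B6Z mul0r.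
have QX : Q X -> exists v, point_type Q v.
  move=> hX; have hY : Q Y.
    apply: (proj_point_pow (d := 2) hQ); apply: (ideal_sub' iQ (p := X * Z)) => //.
    exact: idealMr.
  exists l1; split.
    by apply/eqP => l10; move/eqP: h01; rewrite l10 B6C B0 eq_sym oner_eq0.
  move=> c /ev_eq0 c0; apply: (ideal_sub iQ (hc c)); rewrite c0 scale0r addr0.
  by apply: (idealD iQ); apply: (idealZ iQ).
move=> [//|[r hr]].
have : Q (X * (Z - r ^+ 2 *: X)).
  have -> : X * (Z - r ^+ 2 *: X) = (X * Z - Y ^+ 2) + (Y + r *: X) * (Y - r *: X).
    by rewrite -!mul_mpolyC (expr2 r) mpolyCM; ring.
  by apply: (idealD iQ) => //; apply: (idealM iQ).
case/pr => // hz; exists (l0 + r *: m + r ^+ 2 *: l1); split.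
  apply/eqP => v0; have := B0 l1; rewrite -v0 !B6D !B6Z h01 hm1 h11 !mulr0 !addr0.
  by move/eqP; rewrite oner_eq0.
move=> c /ev_eq0; rewrite !evDl !evZl => c0; apply: (ideal_sub iQ (hc c)).
have -> : ev l0 c *: X + ev m c *: Y + ev l1 c *: Z =
    ev m c *: (Y - r *: X) + ev l1 c *: (Z - r ^+ 2 *: X) +
    (ev l0 c + r * ev m c + r ^+ 2 * ev l1 c) *: X.
  by rewrite -!mul_mpolyC (expr2 r) !(mpolyCD, mpolyCM); ring.
rewrite c0 scale0r addr0; apply: (idealD iQ); exact: (idealZ iQ).
Qed.

(** The relation X Z = Y^2 eliminates Z at the cost of one factor X per degree: X^d f becomes a
    binary form of degree 2 d in X and Y, whose dehomogenization is f along the parametrization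
    [h]. *)
Lemma bform_param Q X Y Z d f : is_ideal Q -> conic_coords Q X Y Z ->
  f \is d.-homog -> (size (param h f) <= d.*2.+1)%N /\
    Q (X ^+ d * f - bform X Y d.*2 (param h f)).
Proof.
move=> iQ [hc hq]; have Q0 : Q 0 by case: iQ.
move: d f; apply: dhomog_ind => [d|d f g [sf hf] [sg hg]|d c f [sf hf]| |d i f [sf hf]].
- by rewrite /param raddf0 size_poly0 bform0 mulr0 subr0.
- rewrite {1 2}/param raddfD /= -!/(param _ _); split.
    by apply: leq_trans (size_polyD _ _) _; rewrite geq_max sf sg.
  by rewrite bformD mulrDr opprD addrACA; apply: idealD.
- rewrite {1 2}/param mmapZ /= mul_polyC -!/(param _ _); split.
    by apply: leq_trans (size_scale_leq _ _) sf.
  by rewrite bformZ -scalerAr -scalerBr; apply: idealZ.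
- rewrite /param rmorph1 size_poly1; split=> //.
  by rewrite /bform big_ord1 coef1 /= !expr0 !mulr1 scale1r subrr.
have pE : param h ('X_i * f) = h i * param h f.
  by rewrite /param rmorphM /= mmapX mmap1U.
have sh : (size (h i) <= 3)%N.
  rewrite /h; apply: leq_trans (size_polyD _ _) _; rewrite geq_max; apply/andP; split.
    apply: leq_trans (size_polyD _ _) _; rewrite geq_max; apply/andP; split.
      by apply: leq_trans (size_polyC_leq1 _) _.
    by apply: leq_trans (size_scale_leq _ _) _; rewrite size_polyX.
  by apply: leq_trans (size_scale_leq _ _) _; rewrite size_polyXn.
rewrite pE doubleS; split.
  apply: leq_trans (size_polyMleq _ _) _; move: sh sf; lia.
rewrite bform_quad //; set bf := bform _ _ _ _ in hf *.
have Qi : Q ('X_i - ((l0 0 i)%:MP * X + (m 0 i)%:MP * Y + (l1 0 i)%:MP * Z)).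
  by have := hc (delta_mx 0 i); rewrite lf_delta !ev_delta !mul_mpolyC.
have -> : X ^+ d.+1 * ('X_i * f) - (l0 0 i *: X ^+ 2 + m 0 i *: (X * Y) + l1 0 i *: Y ^+ 2) * bf =
   (X ^+ d * f * X) * ('X_i - ((l0 0 i)%:MP * X + (m 0 i)%:MP * Y + (l1 0 i)%:MP * Z))
   + (X ^+ d * f * (l1 0 i)%:MP) * (X * Z - Y ^+ 2)
   + (l0 0 i *: X ^+ 2 + m 0 i *: (X * Y) + l1 0 i *: Y ^+ 2) * (X ^+ d * f - bf).
  by rewrite exprS -!mul_mpolyC; ring.
apply: (idealD iQ); last exact: (idealM iQ).
by apply: (idealD iQ); apply: (idealM iQ).
Qed.

(** A homogeneous f in Q1 but not in Q0 puts a binary form in Q1. If that form is nonzero, Q1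
    contains one of its linear factors; if it is zero, X^d f lies in the prime Q0, hence so does
    X. *)
Lemma conic_nonminimal Q0 Q1 f : proj_point s Q0 -> proj_point s Q1 ->
  (forall p, Q0 p -> Q1 p) -> Q1 f -> ~ Q0 f -> exists v, point_type Q1 v.
Proof.
move=> h0 h1 sub f1 f0.
have [i0 i1] := (proj_point_ideal h0, proj_point_ideal h1).
have [d fd0] : exists d, ~ Q0 (pihomog mdeg d f).
  apply: contrapT => hn; apply: f0; apply: (proj_point_homog h0) => d.
  by apply: contrapT => hd; apply: hn; exists d.
have fd1 : Q1 (pihomog mdeg d f) by case: h1 => _ _ hh _ _; apply: hh.
have [X [Y [Z hc]]] := exists_conic_coords i0 (proj_point_Zk h0).
have hc1 : conic_coords Q1 X Y Z by case: hc => hc hq; split=> [c|]; apply: sub.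
have [sg hg] := bform_param i0 hc (pihomogP mdeg d f).
apply: (conic_line h1 hc1).
have [g0|g0] := eqVneq (param h (pihomog mdeg d f)) 0.
  left; apply: sub; move: hg; rewrite g0 bform0 subr0.
  by have [_ [_ pr0] _ _ _] := h0; case/pr0 => [/(proj_point_pow h0)|].
have [_ [n1 pr] _ _ _] := h1.
apply: (bform_split i1 n1 pr g0 sg); apply: (ideal_sub' i1 (sub _ hg)).
exact: idealM.
Qed.

(** The chain is the generic point of the conic followed by the point [l0], of parameter 0. The
    polar linear form of [l0] separates them: it vanishes at [l0] and restricts to the square of the
    parameter on the conic. *)
Lemma conic_chain : proj_chain s 1.
Proof.
have [[l0W mW l1W] [h00 h11 h01] [h0m hm1 hmm]] := cb.
have [l00 [l10 _]] : l0 != 0 /\ (l1 != 0 /\ True).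
  have B0 (q : 'rV[F]_6) : B6 0 q = 0 by rewrite -(scale0r 0) B6Z mul0r.
  split; [|split=> //]; apply/eqP => e; move/eqP: h01; rewrite e ?(B6C l0) B0 eq_sym;
  by rewrite oner_eq0.
have ker0 (p : 'rV_6) j : (p <= W)%MS -> \sum_i jump_mx J A i j * p 0 i = 0.
  move=> /sub_kermxP/matrixP/(_ 0 j); rewrite !mxE => e; rewrite -[RHS]e.
  by apply: eq_bigr => i _; rewrite mulrC.
pose h0 (i : 'I_6) : {poly F} := (l0 0 i)%:P.
have [i0 li0] := rV0Pn _ l00.
have mor (p q : 'rV[F]_6) : Bk (fun i => (p 0 i)%:P) (fun i => (q 0 i)%:P) = (B6 p q)%:P.
  exact: (Bk_morph (@polyC F)).
have hh0 i : (h i).[0] = l0 0 i by rewrite /h !(hornerD, hornerC, hornerZ, hornerX, hornerXn) expr0n /= !mulr0 !addr0.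
have p0 : proj_point s (fun f => param_cone h f = 0).
  apply: param_point; last first.
  - exists i0; apply: contraNneq li0 => e.
    by rewrite -hh0 e horner0.
  - have -> : Bk h h = Bk (fun i => (l0 0 i)%:P * 1 + (m 0 i)%:P * 'X + (l1 0 i)%:P * 'X^2)
        (fun i => (l0 0 i)%:P * 1 + (m 0 i)%:P * 'X + (l1 0 i)%:P * 'X^2).
      by rewrite /Bk /h -!mul_polyC !mulr1.
    rewrite Bk_expand !mor h00 h11 h01 h0m hm1 hmm !polyC0 polyC1 polyCN polyCMn polyC1.
    by ring.
  move=> j; rewrite /h; under eq_bigr do rewrite -!mul_polyC !mulrDr.
  rewrite !big_split /=.
  have t (p : 'rV_6) (q : {poly F}) : (p <= W)%MS ->
      \sum_i (jump_mx J A i j)%:P * ((p 0 i)%:P * q) = 0.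
    move=> pW; under eq_bigr do rewrite mulrA -polyCM.
    by rewrite -big_distrl /= -rmorph_sum /= ker0 // mul0r.
  rewrite !t // !addr0; under eq_bigr do rewrite -[(l0 0 _)%:P]mulr1.
  by rewrite t.
have p1 : proj_point s (fun f => param_cone h0 f = 0).
  apply: param_point; last by exists i0; rewrite polyC_eq0.
  - move=> j; rewrite /h0; under eq_bigr do rewrite -polyCM.
    by rewrite -rmorph_sum /= ker0.
  - by rewrite mor h00.
exists (fun n => if n == 0%N then (fun f => param_cone h f = 0) else (fun f => param_cone h0 f = 0)).
split=> [[|i] _ //|[|i] // _].
have ev0 d f : f \is d.-homog -> param h0 f = ((param h f).[0])%:P.
  move: d f; apply: dhomog_ind => [d|d p q hp hq|d c p hp| |d i p hp].
  - by rewrite /param !raddf0 horner0.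
  - by rewrite /param !raddfD /= hornerD polyCD -!/(param _ _) hp hq.
  - by rewrite /param !mmapZ /= hornerM hornerC polyCM -!/(param _ _) hp.
  - by rewrite /param !rmorph1 hornerC.
  by rewrite /param !rmorphM /= !mmapX !mmap1U hornerM polyCM -!/(param _ _) hp hh0.
split=> [p hp /=|].
  apply/polyP => d; rewrite coef0 param_coneE (ev0 _ _ (pihomogP mdeg d p)) -param_coneE hp.
  by rewrite coef0 horner0.
pose c : 'rV[F]_6 := l0 *m B6_mx F.
have ec p : ev p c = B6 p l0.
  by rewrite /ev /c trmx_mul B6_mx_sym (mulmxA p) B6_mxE.
have ecE (p : 'rV_6) : \sum_i c 0 i * p 0 i = B6 p l0.
  by rewrite -ec /ev mxE; apply: eq_bigr => i _; rewrite [X in _ = _ * X]mxE mulrC.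
exists (lf c) => /=.
  rewrite param_lf /h0; under eq_bigr do rewrite -polyCM.
  rewrite -rmorph_sum /= ecE h00 !polyC0. by rewrite mul0r.
rewrite param_lf => /eqP; rewrite mulf_eq0 polyX_eq0 orbF polyC_eq0 => /eqP.
rewrite /h; under eq_bigr do rewrite -!mul_polyC !mulrDr !mulrA -!polyCM.
rewrite !big_split /= -!big_distrl /= -!rmorph_sum /= !ecE h00 (B6C m) h0m (B6C l1) h01.
rewrite !polyC0 polyC1 mul0r !add0r mul1r => /eqP.
by rewrite mulf_eq0 polyX_eq0.
Qed.
End Conic.

End ConicPoints.

(** * Dimension and smoothness of the jumping scheme *)

Section ZkDimension.
Variable F : numClosedFieldType.
Local Notation P := {mpoly F[6]}.
Variables (k : nat) (A : 'I_4 -> 'M[F]_(k, 2 * k + 2)) (J : 'M[F]_(2 * k + 2)).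
Hypothesis Jskew : J^T = - J.
Hypothesis Junit : J \in unitmx.
Hypothesis k1 : (1 < k)%N.
Hypothesis Aiso : forall x y,
  lin A x *m J *m (lin A y)^T + lin A y *m J *m (lin A x)^T = 0.
Hypothesis Afree : forall x, x != 0 -> row_free (lin A x).
Local Notation W := (jump_space J A).
Local Notation s := (Zk A J).

Lemma basis_rows d (M : 'M[F]_6) : \rank M = d ->
  exists D : 'M[F]_(d, 6), [/\ row_free D, (D <= M)%MS & (M <= D)%MS].
Proof.
move=> rM; have [|D [DM MD]] := @compl_rows F 1 _ _ 0 M d (sub0mx _ _).
  by rewrite mxrank0.
have {}MD : (M <= D)%MS by move: MD; rewrite -(addsmxE 0 D) adds0mx.
by exists D; split=> //; rewrite -row_leq_rank -[X in (X <= _)%N]rM mxrankS.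
Qed.

Lemma Zk_coords1 Q (D : 'rV[F]_6) : proj_point s Q -> D != 0 -> (W <= D)%MS ->
  exists v, point_type Q v.
Proof.
move=> hQ D0 WD; exists D; split=> // c Dc.
by apply: (Zk_forms (proj_point_ideal hQ) (proj_point_Zk hQ)); have /submxP[y ->] := WD;
  rewrite -mulmxA Dc mulmx0.
Qed.

(** In rank 2, with p isotropic in W, the Pluecker equation becomes Y (2 b X + c Y) where b = B6 p q
    and c = B6 q q, not both zero since W has no isotropic plane. A prime contains one factor, and
    is the point p or the point c p - 2 b q. *)
Lemma small_jump_point Q : (\rank W <= 2)%N -> proj_point s Q -> exists v, point_type Q v.
Proof.
move=> rW hQ; have iQ := proj_point_ideal hQ; have hs := proj_point_Zk hQ.
have [_ [n1 pr] _ na _] := hQ.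
have [r0|[r1|r2]] : \rank W = 0%N \/ (\rank W = 1%N \/ \rank W = 2%N) by lia.
- exfalso; apply: na => i; rewrite -lf_delta; apply: (Zk_forms iQ hs).
  by move/eqP: r0; rewrite mxrank_eq0 => /eqP->; rewrite mul0mx.
- have [D [Df _ WD]] := basis_rows r1; apply: (Zk_coords1 hQ _ WD).
  by rewrite -mxrank_eq0 (eqP Df).
have [D [Df DW WD]] := basis_rows r2.
pose u := row 0 D; pose v := row 1 D.
have uW : (u <= W)%MS := submx_trans (row_sub _ _) DW.
have vW : (v <= W)%MS := submx_trans (row_sub _ _) DW.
have uv (a b : F) : a *: u + b *: v = 0 -> a = 0 /\ b = 0.
  move=> e; move/row_freeP0: Df => /(_ (\row_j if j == 0 then a else b)).
  rewrite mul_row2 !mxE /= => /(_ e)/rowP h.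
  by split; [have := h 0|have := h 1]; rewrite !mxE.
have [p [q [pW qW pq pp]]] : exists p q : 'rV[F]_6, [/\ (p <= W)%MS, (q <= W)%MS,
    forall a b, a *: p + b *: q = 0 -> a = 0 /\ b = 0 & B6 p p = 0].
  have [a [b /andP[ab /eqP hab]]] := binary_isotropic (B6 u u) (B6 u v) (B6 v v).
  have qq : B6 (a *: u + b *: v) (a *: u + b *: v) = 0.
    by rewrite -[RHS]hab !(B6D, B6Dr, B6Z, B6Zr) (B6C v u); ring.
  have cW : ((a *: u + b *: v)%R <= W)%MS by rewrite addmx_sub ?scalemx_sub.
  have [a0|a0] := eqVneq a 0.
    exists (a *: u + b *: v), u; split=> // c d; rewrite a0 scale0r add0r addrC scalerA.
    move=> /uv[-> /eqP]; rewrite mulf_eq0 => /orP[/eqP-> //|b0].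
    by move: ab; rewrite a0 (eqP b0) eqxx.
  exists (a *: u + b *: v), v; split=> // c d.
  rewrite scalerDr !scalerA -addrA -scalerDl => /uv[/eqP].
  by rewrite mulf_eq0 (negPf a0) orbF => /eqP->; rewrite mul0r add0r.
have Ef : row_free (col_mx p q).
  apply/row_freeP0 => w; rewrite -[w]hsubmxK mul_row_col.
  move: (lsubmx w) (rsubmx w) => a b; rewrite [a]mx11_scalar [b]mx11_scalar !mul_scalar_mx.
  by move=> /pq[-> ->]; rewrite !raddf0 row_mx0.
have WE : (W <= col_mx p q)%MS.
  have sub : (col_mx p q <= W)%MS by rewrite col_mx_sub pW qW.
  by have := mxrank_leqif_sup sub => -[_ <-]; rewrite r2 (eqP Ef).
have [X [Y hc]] := Zk_coords2 iQ hs Ef WE.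
have Qh i : Q ('X_i - ((p 0 i)%:MP * X + (q 0 i)%:MP * Y + 0 * 0)).
  by have := hc (delta_mx 0 i); rewrite lf_delta !ev_delta mul0r addr0 !mul_mpolyC.
have := Bk_ideal iQ (Zk_pluecker hs) Qh; rewrite Bk_expand.
have mor (x y : 'rV[F]_6) : Bk (fun i => (x 0 i)%:MP : P) (fun i => (y 0 i)%:MP) = (B6 x y)%:MP.
  exact: (Bk_morph (@mpolyC 6 F)).
rewrite !mor pp; move bE: (B6 p q) => b; move cE: (B6 q q) => c.
have -> : (0%:MP * X ^+ 2 + c%:MP * Y ^+ 2 + Bk (fun=> 0) (fun=> 0) * 0 ^+ 2
    + (b%:MP * (X * Y)) *+ 2
    + (Bk (fun i => (p 0 i)%:MP) (fun=> 0) * (X * 0)) *+ 2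
    + (Bk (fun i => (q 0 i)%:MP) (fun=> 0) * (Y * 0)) *+ 2 : P) =
    Y * ((2 * b) *: X + c *: Y).
  by rewrite -!mul_mpolyC mpolyC0 [2 * b]mulr_natl mpolyCMn; ring.
have nz (x : 'rV[F]_6) (a d : F) : (a != 0) || (d != 0) -> a *: p + d *: q != 0.
  by apply: contraTneq => /pq[-> ->]; rewrite eqxx.
case/pr => hY.
  exists p; split; first by have := nz p 1 0; rewrite oner_eq0 scale1r scale0r addr0; apply.
  move=> e /ev_eq0 e0; apply: (ideal_sub iQ (hc e)); rewrite e0 scale0r add0r.
  exact: (idealZ iQ).
have two : (2 : F) != 0 by rewrite pnatr_eq0.
have bc : (c != 0) || (- (2 * b) != 0).
  rewrite oppr_eq0 mulf_eq0 (negPf two) /=; apply: contraT; rewrite negb_or !negbK.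
  move=> /andP[/eqP c0 /eqP b0].
  exfalso; apply: (no_isotropic_line_mx Jskew Junit (erefl _) k1 Aiso Afree pW qW pp _ _ pq).
    by rewrite cE c0.
  by rewrite bE b0.
exists (c *: p + (- (2 * b)) *: q); split; first exact: nz.
move=> e /ev_eq0; rewrite evDl !evZl => e0; apply: (ideal_sub iQ (hc e)).
have [c0|c0] := eqVneq c 0.
  move: bc hY e0; rewrite c0 eqxx /= oppr_eq0 => b0; rewrite scale0r addr0 mul0r add0r => hX.
  move=> /eqP; rewrite mulf_eq0 oppr_eq0 (negPf b0) /= => /eqP->; rewrite scale0r addr0.
  by rewrite -(scalerK b0 X) scalerA; apply: (idealZ iQ).
have -> : ev p e = ev q e * (2 * b) / c.
  apply: (canRL (mulfK c0)); apply/eqP; rewrite -subr_eq0 -[X in _ == X]e0; apply/eqP; ring.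
have -> : (ev q e * (2 * b) / c) *: X + ev q e *: Y = (ev q e / c) *: ((2 * b) *: X + c *: Y).
  by rewrite scalerDr !scalerA divfK // mulrAC.
exact: (idealZ iQ).
Qed.

Lemma point_no_chain Q Q' v : proj_point s Q -> proj_point s Q' -> point_type Q v ->
  (forall p, Q p -> Q' p) -> ~ (exists2 p, Q' p & ~ Q p).
Proof. by move=> hQ hQ' hv sub [p hp]; apply; apply: (point_max hQ hQ' sub hv). Qed.

Lemma rank3_of_chain : proj_chain s 1 -> \rank W = 3%N.
Proof.
move=> [Q [hQ hs]].
have rW := rank_jump_space Jskew Junit (erefl _) k1 Aiso Afree.
apply/eqP; rewrite eqn_leq rW /= leqNgt; apply/negP => r2.
have [v hv] := small_jump_point r2 (hQ 0%N isT).
have [sub ex] := hs 0%N isT.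
exact: (point_no_chain (hQ 0%N isT) (hQ 1%N isT) hv sub ex).
Qed.

(** A chain of length 2 forces rank 3. Its middle term is then a nonminimal prime on a conic, hence
    a closed point, which has no proper specialization. *)
Lemma Zk_dim_le1 : dim_le s 1.
Proof.
move=> [Q [hQ hs]].
have [sub0 [f f1 f0]] := hs 0%N isT; have [sub1 ex1] := hs 1%N isT.
have [q0 [q1 q2]] := (hQ 0%N isT, (hQ 1%N isT, hQ 2%N isT)).
have r3 : \rank W = 3%N.
  by apply: rank3_of_chain; exists Q; split=> [i i1|i i1]; [apply: hQ|apply: hs]; lia.
have [l0 [m [l1 cb]]] := exists_conic_basis Jskew Junit (erefl _) k1 Aiso Afree r3.
have [v hv] := conic_nonminimal cb r3 q0 q1 sub0 f1 f0.
exact: (point_no_chain q1 q2 hv sub1 ex1).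
Qed.

Lemma dim_eq1_rank3 : dim_eq s 1 <-> \rank W = 3%N.
Proof.
split=> [[/rank3_of_chain //]|r3]; split; last exact: Zk_dim_le1.
have [l0 [m [l1 cb]]] := exists_conic_basis Jskew Junit (erefl _) k1 Aiso Afree r3.
exact: (conic_chain cb).
Qed.

Lemma mderiv_lf (c : 'rV[F]_6) j : (lf c)^`M(j) = (c 0 j)%:MP.
Proof.
rewrite /lf (linear_sum (mderiv j)) (bigD1 j) //= mderivZ mderivX mnm1E eqxx /=.
rewrite (_ : (U_(j) - U_(j) = 0)%MM) ?mpolyX0; last by apply/mnmP => i; rewrite mnmBE subnn mnm0E.
rewrite scale1r -mul_mpolyC mulr1 big1 ?addr0 // => i ij.
by rewrite mderivZ mderivX mnm1E (negPf ij) scale0r scaler0.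
Qed.

Lemma mderiv_pluecker (x : 'I_6 -> F) (j : 'I_6) :
  ((pluecker F)^`M(j)).@[x] = (\row_i x i *m B6_mx F) 0 j.
Proof.
have -> : (\row_i x i *m B6_mx F) 0 j = B6 (\row_i x i) (delta_mx 0 j).
  by rewrite -B6_mxE trmx_delta -colE [RHS]mxE.
have XU (i : nat) : (i < 6)%N -> ('X_(inord i) : P)^`M(j) = (((j : nat) == i)%:R)%:MP.
  move=> hi; rewrite -lf_delta mderiv_lf mxE eqxx /=; congr (_ %:R)%:MP.
  by rewrite -val_eqE /= inordK.
rewrite plueckerE !(mderivD, mderivN, mderivM) !XU //.
rewrite !(mevalD, mevalN, mevalM, mevalC, mevalXU) /B6 /cf !mxE /= -!val_eqE /= !inordK //.
clear XU; case: j => n hn /=.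
by case: n hn => [|[|[|[|[|[|//]]]]]] hn /=; ring.
Qed.

(** The three linear equations [M] are the annihilator of W. A rank drop of the Jacobian at x would
    place the gradient [xr *m B6_mx] in the span of [M], so that x in W is orthogonal to W, against
    the nondegeneracy seen on a conic basis. *)
Lemma Zk_smooth_conic : \rank W = 3%N -> smooth_conic s.
Proof.
move=> r3; have [l0 [m [l1 cb]]] := exists_conic_basis Jskew Junit (erefl _) k1 Aiso Afree r3.
have rK : \rank (kermx W^T) = 3%N by rewrite mxrank_ker mxrank_tr r3.
have [M [Mf MK KM]] := basis_rows rK.
exists M, (pluecker F) => t.
have tE : t = rcons [seq lf (row i M) | i <- enum 'I_3] (pluecker F).
  congr rcons; apply: eq_map => i; rewrite /lf; apply: eq_bigr => j _; by rewrite mxE.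
have WM : M *m W^T = 0 by apply/sub_kermxP.
have perp (c : 'rV_6) : W *m c^T = 0 -> (c <= M)%MS.
  move=> h; apply: submx_trans KM; apply/sub_kermxP.
  by rewrite -[c]trmxK -trmx_mul h trmx0.
have tp : pluecker F \in t by rewrite tE mem_rcons inE eqxx.
have tM i : lf (row i M) \in t.
  by rewrite tE mem_rcons inE; apply/orP; right; apply/mapP; exists i; rewrite ?mem_enum.
have t_forms Q (c : 'rV_6) : is_ideal Q -> (forall q, q \in t -> Q q) -> W *m c^T = 0 -> Q (lf c).
  move=> iQ hQ /perp/submxP[y ->]; rewrite mulmx_sum_row lf_sum.
  by apply: (ideal_sum iQ) => i _; rewrite lfZ; apply: (idealZ iQ); apply: hQ.
have s_in_t q : q \in s -> in_ideal t q.
  have it := in_ideal_is_ideal t.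
  rewrite inE => /orP[/eqP->|/allpairsP[[u v] [_ _ ->]] /=]; first exact: in_ideal_mem.
  rewrite jump_entryE; apply: (t_forms _ _ it); first by move=> *; apply: in_ideal_mem.
  apply: trmx_inj; rewrite trmx_mul trmxK trmx0 -row_mul -trmx_mul mulmx_ker.
  by rewrite trmx0 row0.
have t_in_s q : q \in t -> in_ideal s q.
  have is_ := in_ideal_is_ideal s.
  have hs p : p \in s -> in_ideal s p by apply: in_ideal_mem.
  rewrite tE mem_rcons inE => /orP[/eqP->|/mapP[i _ ->]]; first exact: (Zk_pluecker hs).
  apply: (Zk_forms is_ hs); apply: trmx_inj; rewrite trmx_mul trmxK trmx0 -row_mul WM.
  by rewrite row0.
split.
- exact/eqP.
- rewrite plueckerE.
  have XX i j : ('X_i * 'X_j : P) \is 2.-homog.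
    by apply: (dhomogM (d := 1) (e := 1)); rewrite dhomogX /= mdeg1.
  by apply: rpredD; [apply: rpredB|]; apply: XX.
- move=> p; split=> -[n h]; exists n => i.
    exact: (in_ideal_min (in_ideal_is_ideal t) s_in_t (h i)).
  exact: (in_ideal_min (in_ideal_is_ideal s) t_in_s (h i)).
move=> x [i0 xi0] hx; pose xr : 'rV[F]_6 := \row_i x i.
have mx p : p.@[x] = p.@[fun i => xr 0 i] by apply: meval_eq => i; rewrite mxE.
have xr0 : xr != 0 by apply/rV0Pn; exists i0; rewrite mxE.
have xM : M *m xr^T = 0.
  apply/row_matrixP => i; rewrite row0 row_mul; apply/ev_eq0.
  have evC (p c : 'rV[F]_6) : ev p c = ev c p.
    by rewrite /ev mxE [RHS]mxE; apply: eq_bigr => l _; rewrite !mxE mulrC.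
  by have := hx _ (tM i); rewrite mx meval_lf -/(ev xr _) evC.
have xW : (xr <= W)%MS.
  have : (xr <= kermx M^T)%MS by apply/sub_kermxP; rewrite -[xr]trmxK -trmx_mul xM trmx0.
  move/submx_trans; apply; have sub : (W <= kermx M^T)%MS.
    by apply/sub_kermxP; rewrite -[W]trmxK -trmx_mul WM trmx0.
  by have := mxrank_leqif_sup sub => -[_ <-]; rewrite mxrank_ker mxrank_tr (eqP Mf) r3.
set Jac := \matrix_(i, j) _.
have JE : Jac = col_mx M (xr *m B6_mx F) :> 'M_(3 + 1, 6).
  apply/matrixP => i j; rewrite mxE tE nth_rcons size_map size_enum_ord.
  case: (split_ordP i) => i' ->.
    have lt : (lshift 1 i' < 3)%N by exact: ltn_ord i'.
    have nE : nth i' (enum 'I_3) (lshift 1 i') = i' by exact: nth_ord_enum.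
    rewrite col_mxEu (nth_map i') ?size_enum_ord // nE mderiv_lf mevalC.
    by rewrite mxE.
  have e3 : (rshift 3 i' : nat) = 3%N by rewrite /= ord1.
  by rewrite col_mxEd ?e3 ?ltnn ?eqxx mderiv_pluecker !ord1.
suff Jf : row_free (col_mx M (xr *m B6_mx F)) by rewrite JE; exact/eqP.
apply: contraT => /(row_free_col_mx Mf)/submxP[y yE].
have Bx q : (q <= W)%MS -> B6 xr q = 0.
  move=> /submxP[z ->]; rewrite -B6_mxE yE trmx_mul mulmxA -(mulmxA y) WM.
  by rewrite mulmx0 mul0mx mxE.
have [[l0W mW l1W] [h00 h11 h01] [h0m hm1 hmm]] := cb.
have [a [b [c xE]]] := indep3_span (conic_basis_indep cb) l0W mW l1W r3 xW.
have two : (2 : F) != 0 by rewrite pnatr_eq0.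
case/eqP: xr0; have := Bx _ l0W; have := Bx _ mW; have := Bx _ l1W.
rewrite xE !(B6D, B6Z) h00 h11 h01 h0m hm1 hmm (B6C m) h0m (B6C l1 l0) h01 (B6C l1 m) hm1.
rewrite !(mulr0, mulr1, addr0, add0r) => -> /eqP.
by rewrite mulf_eq0 oppr_eq0 (negPf two) orbF => /eqP-> ->; rewrite !scale0r !addr0.
Qed.
End ZkDimension.

(** * Cohomology of line bundles *)

Section MpolyCoefficients.
Variables (F : fieldType) (n : nat).
Local Notation S := {mpoly F[n]}.

Lemma mcoeff_mulX (p : S) u m : (p * 'X_[u])@_(m + u)%MM = p@_m.
Proof.
rewrite {1}(mpolyE p) big_distrl /= raddf_sum /=.
under eq_bigr do rewrite -scalerAl -mpolyXD mcoeffZ mcoeffX eqm_add2r.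
have [mp|mp] := boolP (m \in msupp p).
  rewrite (bigD1_seq m) //= eqxx mulr1 big1 ?addr0 // => i /negPf->.
  by rewrite mulr0.
rewrite (memN_msupp_eq0 mp) big_seq big1 // => i ip.
by case: eqP ip => [->|_]; [rewrite (negPf mp)|rewrite mulr0].
Qed.

Lemma mcoeff_mulX0 (p : S) u m : ~~ (u <= m)%MM -> (p * 'X_[u])@_m = 0.
Proof.
move=> um; rewrite {1}(mpolyE p) big_distrl /= raddf_sum /= big1 // => i _.
rewrite -scalerAl -mpolyXD mcoeffZ mcoeffX; case: eqP => [e|_]; last by rewrite mulr0.
by case/negP: um; rewrite -e lem_addl.
Qed.

Lemma mpoly_Xexp (i : 'I_n) M : ('X_i : S) ^+ M = 'X_[U_(i) *+ M].
Proof. by rewrite mpolyXn. Qed.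

Lemma mnm_Xexp (i j : 'I_n) M : (U_(i) *+ M)%MM j = ((i == j) * M)%N.
Proof. by rewrite mulmnE mnm1E. Qed.

Lemma mcoeff_Xexp0 (p : S) (i : 'I_n) M (m : 'X_{1..n}) : (m i < M)%N -> (p * 'X_i ^+ M)@_m = 0.
Proof.
move=> mi; rewrite mpoly_Xexp mcoeff_mulX0 //; apply/mnm_lepP => /(_ i).
by rewrite mnm_Xexp eqxx mul1n leqNgt mi.
Qed.

Lemma Xexp_split (p : S) (i : 'I_n) M : exists q r, p = q * 'X_i ^+ M + r /\
  forall m, r@_m = if (M <= m i)%N then 0 else p@_m.
Proof.
pose q : S := \sum_(m <- msupp p | (M <= m i)%N) p@_m *: 'X_[m - U_(i) *+ M].
pose r : S := \sum_(m <- msupp p | ~~ (M <= m i)%N) p@_m *: 'X_[m].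
exists q, r; split.
  rewrite {1}(mpolyE p) (bigID (fun m : 'X_{1..n} => (M <= m i)%N)) /=; congr (_ + _).
  rewrite /q big_distrl /=; apply: eq_bigr => m mi.
  rewrite -scalerAl mpoly_Xexp -mpolyXD submK //; apply/mnm_lepP => j.
  by rewrite mnm_Xexp; case: eqP => [<-|_]; rewrite ?mul1n.
move=> m; rewrite /r raddf_sum /=.
under eq_bigr do rewrite mcoeffZ mcoeffX.
case: ifP => [mi|/negbT mi].
  rewrite big1 // => m' m'i; case: eqP => [e|_]; last by rewrite mulr0.
  by rewrite e mi in m'i.
have [mp|mp] := boolP (m \in msupp p).
  rewrite -big_filter (bigD1_seq m) /= ?filter_uniq ?msupp_uniq ?mem_filter ?mi //.
  by rewrite eqxx mulr1 big1 ?addr0 // => i' /negPf->; rewrite mulr0.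
rewrite (memN_msupp_eq0 mp) big_seq_cond big1 // => m' /andP[m'p _].
by case: eqP m'p => [->|_]; [rewrite (negPf mp)|rewrite mulr0].
Qed.

(** Powers of two variables form a regular sequence: the part of p with exponents of X_i below M
    keeps these exponents when multiplied by a power of X_j. *)
Lemma Xexp_regular2 (p q : S) (i j : 'I_n) M M' : i != j ->
  p * 'X_j ^+ M' = q * 'X_i ^+ M -> exists q', p = q' * 'X_i ^+ M.
Proof.
move=> ij pq; have [q1 [r [pE rE]]] := Xexp_split p i M.
exists q1; rewrite [LHS]pE; suff -> : r = 0 by rewrite addr0.
apply/mpolyP => m; rewrite mcoeff0; have [mi|mi] := leqP M (m i); first by rewrite rE mi.
have e : r * 'X_j ^+ M' = (q - q1 * 'X_j ^+ M') * 'X_i ^+ M.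
  by rewrite mulrBl -pq pE; ring.

rewrite -(mcoeff_mulX r (U_(j) *+ M')) -mpoly_Xexp e mcoeff_Xexp0 //.
by rewrite mnmDE mnm_Xexp eq_sym (negPf ij) addn0.
Qed.

Lemma Xexp_regular3 (p a b : S) (i j l : 'I_n) M M' : i != l -> j != l ->
  p * 'X_l ^+ M' = a * 'X_i ^+ M + b * 'X_j ^+ M ->
  exists a' b', p = a' * 'X_i ^+ M + b' * 'X_j ^+ M.
Proof.
move=> il jl pE; have [q [r [pq rE]]] := Xexp_split p i M.
have [q' [r' [rq r'E]]] := Xexp_split r j M.
exists q, q'; rewrite [LHS]pq rq addrA; suff -> : r' = 0 by rewrite addr0.
apply/mpolyP => m; rewrite mcoeff0.
have [mj|mj] := leqP M (m j); first by rewrite r'E mj.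
have [mi|mi] := leqP M (m i); first by rewrite r'E leqNgt mj /= rE mi.
have e : r' * 'X_l ^+ M' = (a - q * 'X_l ^+ M') * 'X_i ^+ M + (b - q' * 'X_l ^+ M') * 'X_j ^+ M.
  have -> : r' = p - q * 'X_i ^+ M - q' * 'X_j ^+ M by rewrite pq rq; ring.
  by rewrite !mulrBl pE; ring.
rewrite -(mcoeff_mulX r' (U_(l) *+ M')) -mpoly_Xexp e mcoeffD !mcoeff_Xexp0 ?addr0 //;
by rewrite mnmDE mnm_Xexp eq_sym ?(negPf il) ?(negPf jl) addn0.
Qed.

Lemma pihomogM e d (q f : S) : f \is d.-homog ->
  pihomog mdeg (e + d) (q * f) = pihomog mdeg e q * f.
Proof.
move=> fd; have [K hK] := ubnP (maxn (mmeasure mdeg q) e.+1).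
have qE := @pihomog_partitionE _ _ mdeg K q (leq_trans (leq_maxl _ _) (ltnW hK)).
have eK : (e < K)%N by apply: leq_trans (leq_maxr _ _) (ltnW hK).
rewrite {1}qE big_distrl raddf_sum (bigD1 (Ordinal eK)) //= pihomog_dE; last first.
  by apply: dhomogM => //; apply: pihomogP.
rewrite big1 ?addr0 // => i ie; apply: (@pihomog_ne0 _ _ mdeg (i + d)%N).
  by rewrite eqn_add2r; apply: contraNneq ie => ie; apply/eqP/val_inj.
by apply: dhomogM => //; apply: pihomogP.
Qed.

Lemma dhomog_divisor e d (q f : S) : f != 0 -> f \is d.-homog -> q * f \is e.-homog ->
  (forall c, e = (c + d)%N -> q \is c.-homog) /\ ((e < d)%N -> q = 0).
Proof.
move=> f0 fd qf.
have comp c : (c + d)%N != e -> pihomog mdeg c q = 0.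
  move=> ce; have := pihomogM c q fd; rewrite (pihomog_ne0 _ qf); last by rewrite eq_sym.
  by move=> /esym/eqP; rewrite mulf_eq0 (negPf f0) orbF => /eqP.
have qE := @pihomog_partitionE _ _ mdeg (mmeasure mdeg q) q (leqnn _).
split=> [c ec|ed].
  rewrite qE; apply: rpred_sum => i _; have [ci|ci] := eqVneq (i : nat) c.
    by rewrite -ci; apply: pihomogP.
  by rewrite comp ?rpred0 // ec eqn_add2r.
rewrite qE big1 // => i _; apply: comp; lia.
Qed.

Lemma radical_sum (I : Type) (Q : S -> Prop) (r : seq I) (g : I -> S) :
  Q 0 -> (forall p q, Q p -> Q q -> Q (p + q)) -> (forall p q, Q q -> Q (p * q)) ->
  (forall i, exists N, Q (g i ^+ N)) -> exists N, Q ((\sum_(i <- r) g i) ^+ N).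
Proof.
move=> Q0 QD QM Qg; elim: r => [|i r [N2 h2]].
  by exists 1%N; rewrite big_nil.
have [N1 h1] := Qg i; rewrite big_cons; set x := g i in h1 *; set y := \sum_(j <- r) _ in h2 *.
exists (N1 + N2)%N; rewrite exprDn; apply: big_ind => // -[j hj] _ /=.
rewrite -mulr_natr mulrC; apply: (QM).
have [l1|l1] := leqP N2 j.
  by apply: (QM); rewrite -(subnK l1) exprD; apply: (QM).
rewrite mulrC; apply: (QM).
have l2 : (N1 <= N1 + N2 - j)%N by lia.
by rewrite -(subnK l2) exprD; apply: (QM).
Qed.
End MpolyCoefficients.

Lemma clear_denominators (K : fieldType) (a b x y : K) : x != 0 -> y != 0 ->
  a * y + b * x = x * y * (a / x - - (b / y)).
Proof. by move=> x0 y0; field; rewrite x0 y0. Qed.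

Lemma quotient_of_cross (K : fieldType) (p q q' x y z : K) :
  z != 0 -> x != 0 -> y != 0 -> q * (x * z) - q' * (y * z) = p * (x * y) ->
  p / z = q / y - q' / x.
Proof.
move=> z0 x0 y0 e; apply: (mulIf (mulf_neq0 x0 y0)).
by rewrite mulrAC -e; field; rewrite x0 y0 z0.
Qed.

(** * Global sections and first cohomology on the charts *)

Section CechO.
Variable F : fieldType.
Local Notation S := {mpoly F[4]}.
Local Notation K := {fraction {mpoly F[4]}}.

Lemma toKD (p q : S) : toK (p + q) = toK p + toK q. Proof. exact: tofracD. Qed.
Lemma toKN (p : S) : toK (- p) = - toK p. Proof. exact: tofracN. Qed.
Lemma toKB (p q : S) : toK (p - q) = toK p - toK q. Proof. exact: tofracB. Qed.
Lemma toKM (p q : S) : toK (p * q) = toK p * toK q. Proof. exact: tofracM. Qed.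
Lemma toKX (p : S) n : toK (p ^+ n) = toK p ^+ n. Proof. exact: tofracXn. Qed.
Lemma toK0 : toK (0 : S) = 0. Proof. exact: tofrac0. Qed.
Lemma toK1 : toK (1 : S) = 1. Proof. exact: tofrac1. Qed.
Lemma toK_eq0 (p : S) : (toK p == 0) = (p == 0). Proof. exact: tofrac_eq0. Qed.
Lemma toK_inj : injective (@toK F).
Proof. by move=> p q /eqP; rewrite /toK tofrac_eq => /eqP. Qed.
Lemma toK_neq0 (p : S) : p != 0 -> toK p != 0. Proof. by rewrite toK_eq0. Qed.

Definition is_poly (x : K) := exists p : S, x = toK p.

Lemma is_polyD x y : is_poly x -> is_poly y -> is_poly (x + y).
Proof. by move=> [p ->] [q ->]; exists (p + q); rewrite toKD. Qed.
Lemma is_polyM x y : is_poly x -> is_poly y -> is_poly (x * y).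
Proof. by move=> [p ->] [q ->]; exists (p * q); rewrite toKM. Qed.
Lemma is_poly_toK p : is_poly (toK p). Proof. by exists p. Qed.
Lemma is_polyN x : is_poly x -> is_poly (- x).
Proof. by move=> [p ->]; exists (- p); rewrite toKN. Qed.

Definition in_loc (f : S) (x : K) := exists N, is_poly (toK f ^+ N * x).

Lemma in_loc_mono f x N M : (N <= M)%N -> is_poly (toK f ^+ N * x) ->
  is_poly (toK f ^+ M * x).
Proof.
move=> NM h; rewrite -(subnK NM) exprD -mulrA -toKX; apply: is_polyM => //.
exact: is_poly_toK.
Qed.

Lemma in_locD f x y : in_loc f x -> in_loc f y -> in_loc f (x + y).
Proof.
move=> [N hx] [M hy]; exists (maxn N M); rewrite mulrDr.
by apply: is_polyD; [apply: in_loc_mono (leq_maxl _ _) hx|apply: in_loc_mono (leq_maxr _ _) hy].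
Qed.
Lemma in_locN f x : in_loc f x -> in_loc f (- x).
Proof. by move=> [N hx]; exists N; rewrite mulrN; apply: is_polyN. Qed.
Lemma in_locM f p x : is_poly p -> in_loc f x -> in_loc f (p * x).
Proof. by move=> hp [N hx]; exists N; rewrite mulrCA; apply: is_polyM. Qed.
Lemma in_loc_sum f I (r : seq I) (g : I -> K) :
  (forall i, in_loc f (g i)) -> in_loc f (\sum_(i <- r) g i).
Proof.
move=> h; apply: big_ind => //; first by exists 0%N; rewrite mulr0; exists 0; rewrite toK0.
exact: in_locD.
Qed.

Lemma loc_in_loc f n x : f != 0 -> loc f n x -> in_loc f x.
Proof.
move=> f0 [N [d [e [p [_ _ _ ->]]]]]; exists N.
by rewrite toKX mulrC divfK ?expf_neq0 ?toK_neq0 //; apply: is_poly_toK.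
Qed.

Lemma X_neq0 (i : 'I_4) : ('X_i : S) != 0.
Proof. by rewrite -msupp_eq0 msuppX. Qed.

(** Poles confined to X_i = X_j = 0, of codimension 2, do not exist. *)
Lemma poly_of_two (x : K) (i j : 'I_4) M M' : i != j ->
  is_poly (toK 'X_i ^+ M * x) -> is_poly (toK 'X_j ^+ M' * x) -> is_poly x.
Proof.
move=> ij [p pE] [q qE].
have e : p * 'X_j ^+ M' = q * 'X_i ^+ M.
  by apply: toK_inj; rewrite !toKM !toKX -pE -qE; ring.
have [p' p'E] := Xexp_regular2 ij e; exists p'.
apply: (mulfI (expf_neq0 M (toK_neq0 (X_neq0 i)))).
by rewrite pE p'E toKM toKX mulrC.
Qed.

Variable E : bundle2 F.
Local Notation I := 'I_(ncharts E).
Local Notation f := (@fchart F E).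

Lemma ncharts_gt0 : (0 < ncharts E)%N.
Proof.
rewrite lt0n; apply/eqP => n0; have [N [g]] := fchart_cover E ord0.
rewrite big1 => [|a _]; last by suff : (a < 0)%N by []; rewrite -[X in (_ < X)%N]n0 ltn_ord.
by move/eqP; rewrite expf_eq0 (negPf (X_neq0 _)) andbF.
Qed.

Definition chart0 : I := Ordinal ncharts_gt0.

(** The radical of an ideal containing powers of all chart equations contains these equations, hence
    a power of each variable by the covering condition. *)
Lemma cover_power (Q : S -> Prop) i : Q 0 -> (forall p q, Q p -> Q q -> Q (p + q)) ->
  (forall p q, Q q -> Q (p * q)) -> (forall a, exists N, Q (f a ^+ N)) ->
  exists M, Q ('X_i ^+ M).
Proof.
move=> Q0 QD QM Qf; have [N [g gE]] := fchart_cover E i.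
have [|M hM] := @radical_sum F 4 I Q (index_enum _) (fun a => g a * f a) Q0 QD QM.
  by move=> a; have [M hM] := Qf a; exists M; rewrite exprMn; apply: QM.
by exists (N * M)%N; rewrite exprM gE.
Qed.

Lemma poly_of_charts x : (forall a, in_loc (f a) x) -> is_poly x.
Proof.
move=> h; pose Q (g : S) := is_poly (toK g * x).
have Qi i : exists M, Q ('X_i ^+ M).
  apply: cover_power.
  - by rewrite /Q toK0 mul0r; exists 0; rewrite toK0.
  - by move=> p q hp hq; rewrite /Q toKD mulrDl; apply: is_polyD.
  - by move=> p q hq; rewrite /Q toKM -mulrA; apply: is_polyM hq; apply: is_poly_toK.
  by move=> a; have [N hN] := h a; exists N; rewrite /Q toKX.
have [M hM] := Qi 0; have [M' hM'] := Qi 1.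
by apply: (@poly_of_two x 0 1 M M'); rewrite // -toKX.
Qed.

Lemma loc_poly (g : S) n p : g != 0 -> loc g n (toK p) ->
  (forall d, n = d%:Z -> p \is d.-homog) /\ (n < 0 -> p = 0).
Proof.
move=> g0 [N [d [e [q [gd qe en pE]]]]].
have gN : g ^+ N != 0 by apply: expf_neq0.
have pq : p * g ^+ N = q.
  by apply: toK_inj; rewrite toKM pE divfK // toK_neq0.
have gNd : g ^+ N \is (d * N).-homog by apply: dhomogMn.
have pqe : p * g ^+ N \is e.-homog by rewrite pq.
have [h1 h2] := dhomog_divisor gN gNd pqe.
split=> [c nc|n0]; first by apply: h1; move: en; rewrite nc; lia.
by apply: h2; move: en n0; lia.
Qed.

Lemma sections_poly n x : (forall a, loc (f a) n x) -> exists p,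
  [/\ x = toK p, forall d, n = d%:Z -> p \is d.-homog & n < 0 -> p = 0].
Proof.
move=> h; have [p pE] : is_poly x.
  by apply: poly_of_charts => a; apply: loc_in_loc (h a); apply: fchart_neq0.
exists p; have := h chart0; rewrite pE => /(loc_poly (fchart_neq0 _)) [h1 h2].
by split.
Qed.

Lemma loc_homog_part (g : S) d N (q : S) : (0 < d)%N -> g \is d.-homog ->
  loc g 0 (toK (pihomog mdeg (d * N) q) / toK (g ^+ N)).
Proof.
move=> d0 gd; exists N, d, (d * N)%N, (pihomog mdeg (d * N) q); split=> //.
  exact: pihomogP.
by rewrite add0r mulnC.
Qed.

(* Vanishing of [H^1(O)] for the cover by the charts. *)
Lemma H1_O (h : I -> I -> K) : (forall a b, loc (f a * f b) 0 (h a b)) ->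
  (forall a b c, h a c = h a b + h b c) ->
  exists t : I -> K, (forall a, loc (f a) 0 (t a)) /\ forall a b, h a b = t b - t a.
Proof.
move=> hloc hcoc; have f0 a : f a != 0 by apply: fchart_neq0.
have haa a : h a a = 0 by have := hcoc a a a => /eqP; rewrite eq_sym -subr_eq0 addrK => /eqP.
have hloc' c a : exists N, in_loc (f a) (toK (f c) ^+ N * h c a).
  have [N hN] := loc_in_loc (mulf_neq0 (f0 c) (f0 a)) (hloc c a).
  by exists N, N; rewrite mulrA [_ * _ ^+ N]mulrC -exprMn -toKM.
have [N hN] : exists N, forall c a, in_loc (f a) (toK (f c) ^+ N * h c a).
  have [n nP] := choice (fun ca : I * I => hloc' ca.1 ca.2).
  exists (\max_(ca : I * I) n ca) => c a; have := nP (c, a) => /= hc.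
  rewrite -(subnK (leq_bigmax (c, a))) exprD -mulrA -toKX; apply: in_locM hc.
  exact: is_poly_toK.
(* A partition of unity on the open set where X_i is nonzero, with enough powers of the [f c] to
   absorb the poles of the cocycle. *)
have cov i : exists M (e : I -> S), 'X_i ^+ M = \sum_c e c * f c ^+ N.
  have [||||M [e eE]] := @cover_power (fun g => exists e : I -> S, g = \sum_c e c * f c ^+ N) i.
  - by exists (fun=> 0); rewrite big1 // => c _; rewrite mul0r.
  - move=> p q [e ->] [e' ->]; exists (fun c => e c + e' c).
    by rewrite -big_split; apply: eq_bigr => c _; rewrite mulrDl.
  - move=> p q [e ->]; exists (fun c => p * e c); rewrite big_distrr.
    by apply: eq_bigr => c _; rewrite /= mulrA.
  - move=> a; exists N, (fun c => (c == a)%:R).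
    rewrite (bigD1 a) //= eqxx mul1r big1 ?addr0 // => c /negPf->; by rewrite mul0r.
  by exists M, e.
pose Xk i : K := toK 'X_i.
have XM i m : Xk i ^+ m != 0 by apply/expf_neq0/toK_neq0/X_neq0.
(* On this open set averaging the cocycle makes it the coboundary of [H i]; on chart a the only new
   poles are along X_i. *)
have [H [M [HD HL]]] : exists (H : 'I_4 -> I -> K) M,
    (forall i a b, H i b - H i a = h a b) /\
    (forall i a, in_loc (f a) (Xk i ^+ M * H i a)).
  have [m mP] := choice cov; have [e eE] := choice mP.
  pose H i a := (\sum_c toK (e i c) * (toK (f c) ^+ N * h c a)) / Xk i ^+ m i.
  exists H, (\max_i m i)%N; split.
    move=> i a b; rewrite -mulrBl -sumrB.
    rewrite (eq_bigr (fun c => toK (e i c * f c ^+ N) * h a b)); last first.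
      by move=> c _; rewrite (hcoc c a b) toKM toKX; ring.
    rewrite -big_distrl /= (_ : \sum_c _ = toK ('X_i ^+ m i)); last first.
      by rewrite eE; elim/big_rec2: _ => [|c x y _ ->]; rewrite ?toK0 ?toKD.
    by rewrite toKX -/(Xk i) mulrAC divff ?mul1r.
  move=> i a; rewrite -(subnK (leq_bigmax i)) exprD -mulrA.
  rewrite /H [_ ^+ m i * _]mulrC divfK // -toKX; apply: in_locM.
    exact: is_poly_toK.
  by apply: in_loc_sum => c; apply: in_locM; [apply: is_poly_toK|apply: hN].
(* Two such primitives differ by a quantity independent of the chart, whose poles lie along X_i and
   X_j only: the question has moved to the standard cover. *)
pose a0 := chart0; pose D i j := H i a0 - H j a0.
have DE i j a : D i j = H i a - H j a.
  apply/eqP; rewrite /D -subr_eq0.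
  have -> : H i a0 - H j a0 - (H i a - H j a) = (H i a0 - H i a) - (H j a0 - H j a) by ring.
  by rewrite !HD subrr.
have Dp i j : is_poly (Xk i ^+ M * Xk j ^+ M * D i j).
  apply: poly_of_charts => a; rewrite (DE i j a) mulrBr; apply: in_locD.
    by rewrite [Xk i ^+ M * _]mulrC -mulrA -toKX; apply: in_locM (HL i a); apply: is_poly_toK.
  apply: in_locN; rewrite -mulrA -toKX; apply: in_locM (HL j a).
  exact: is_poly_toK.
have [i0 [i1 [i2 [n01 n12 n02]]]] : exists i0 i1 i2 : 'I_4, [/\ i0 != i1, i1 != i2 & i0 != i2].
  by exists (inord 0), (inord 1), (inord 2); rewrite -!val_eqE /= !inordK.
have [P01 E01] := Dp i0 i1; have [P02 E02] := Dp i0 i2; have [P21 E21] := Dp i2 i1.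
have PE : P01 * 'X_i2 ^+ M = P02 * 'X_i1 ^+ M + P21 * 'X_i0 ^+ M.
  apply: toK_inj; rewrite toKD !toKM !toKX -E01 -E02 -E21 /D -!/(Xk _); ring.
(* Regularity of the powers of three variables splits the difference into [G0], with poles along the
   first variable, and [G1], along the second; correcting by them gives one primitive without poles
   on the charts. *)
have [A' [B' AB]] := Xexp_regular3 n12 n02 PE.
pose G0 := toK A' / Xk i0 ^+ M; pose G1 := - (toK B' / Xk i1 ^+ M).

have DG : D i0 i1 = G0 - G1.
  apply: (mulfI (mulf_neq0 (XM i0 M) (XM i1 M))); rewrite E01 AB toKD !toKM !toKX -!/(Xk _).
  by rewrite /G0 /G1 clear_denominators.
pose t a := H i0 a - G0.
have tE a : t a = H i1 a - G1.
  apply/eqP; rewrite /t -subr_eq0.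
  have -> : H i0 a - G0 - (H i1 a - G1) = (H i0 a - H i1 a) - (G0 - G1) by ring.
  by rewrite -DE DG subrr.
have ht a b : h a b = t b - t a by rewrite -(HD i0 a b) /t; ring.
have tloc a : in_loc (f a) (t a).
  have l0 : in_loc (f a) (Xk i0 ^+ M * t a).
    rewrite mulrBr; apply: in_locD (HL i0 a) _; apply: in_locN; rewrite /G0 mulrC divfK //.
    by exists 0%N; rewrite mul1r; apply: is_poly_toK.
  have l1 : in_loc (f a) (Xk i1 ^+ M * t a).
    rewrite tE mulrBr; apply: in_locD (HL i1 a) _; apply: in_locN; rewrite /G1 mulrN.
    rewrite [_ * (_ / _)]mulrC divfK //; apply: in_locN.
    by exists 0%N; rewrite mul1r; apply: is_poly_toK.
  have [n0 h0] := l0; have [n1 h1] := l1; exists (maxn n0 n1).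
  apply: (poly_of_two n01); rewrite mulrCA.
    exact: in_loc_mono (leq_maxl _ _) h0.
  exact: in_loc_mono (leq_maxr _ _) h1.
have [n hn] : exists n, forall a, is_poly (toK (f a) ^+ n * t a).
  have [m mP] := choice tloc; exists (\max_a m a)%N => a.
  exact: in_loc_mono (leq_bigmax a) (mP a).
have [q qE] := choice hn.
have hd a : exists d, (0 < d)%N /\ f a \is d.-homog.
  by have [d d0 dh] := fchart_homog a; exists d.
have [d dP] := choice hd.
(* The primitive [t] need not be homogeneous; since the cocycle has degree 0, its degree 0 part is
   still a primitive. *)
exists (fun a => toK (pihomog mdeg (d a * n) (q a)) / toK (f a ^+ n)); split.
  by move=> a; have [da0 dah] := dP a; apply: loc_homog_part.
move=> a b; have [Mh [dd [e [p [ddh pe eM hE]]]]] := hloc a b.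
have [[_ fa] [_ fb]] := (dP a, dP b).
have ddE : dd = (d a + d b)%N.
  by apply: (dhomog_uniq (mulf_neq0 (f0 a) (f0 b)) ddh); apply: dhomogM.
have faN m : f a ^+ m \is (d a * m).-homog by apply: dhomogMn.
have fbN m : f b ^+ m \is (d b * m).-homog by apply: dhomogMn.
have abN : (f a * f b) ^+ Mh \is (dd * Mh).-homog by apply: dhomogMn.
have Kf a' m : toK (f a') ^+ m != 0 by rewrite expf_neq0 ?toK_neq0.
have ident : q b * (f a ^+ n * (f a * f b) ^+ Mh) - q a * (f b ^+ n * (f a * f b) ^+ Mh)
    = p * (f a ^+ n * f b ^+ n).
  apply: toK_inj; rewrite toKB !toKM !toKX !toKM -!qE.
  have -> : toK p = h a b * toK ((f a * f b) ^+ Mh).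
    by rewrite hE divfK // toK_neq0 // expf_neq0 // mulf_neq0.
  by rewrite ht toKX toKM; ring.
(* The common degree in which the cleared identity [ident] is compared: the right side is
   homogeneous of degree T, and the left side selects the degree 0 parts. *)
pose T := (d a * n + (d b * n + dd * Mh))%N.
have := congr1 (pihomog mdeg T) ident; rewrite raddfB /=.
rewrite {2}/T pihomogM; last exact: dhomogM.
have -> : T = (d b * n + (d a * n + dd * Mh))%N by rewrite /T; lia.
rewrite pihomogM; last exact: dhomogM.
rewrite [pihomog _ _ (p * _)]pihomog_dE; last first.
  have -> : (d b * n + (d a * n + dd * Mh) = e + (d a * n + d b * n))%N.
    by move: eM; rewrite add0r => -[->]; lia.
  by apply: dhomogM => //; apply: dhomogM.
move=> /(congr1 (@toK F)); rewrite toKB !toKM => id2.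
have Kn a' m : toK (f a' ^+ m) != 0 by rewrite toKX Kf.
have Kz : toK ((f a * f b) ^+ Mh) != 0.
  by apply: toK_neq0; apply: expf_neq0; apply: mulf_neq0; apply: f0.
rewrite hE; exact: (quotient_of_cross Kz (Kn a n) (Kn b n) id2).
Qed.
End CechO.

(** * Calculus of homogeneous localizations *)

Section LocClosure.
Variable F : fieldType.
Local Notation S := {mpoly F[4]}.
Local Notation K := {fraction {mpoly F[4]}}.
Variables (f : S) (d : nat).
Hypothesis f0 : f != 0.
Hypothesis fd : f \is d.-homog.

(* With the degree of [f] fixed, membership in S_f is decided by one numerator. *)
Lemma locP n x : loc f n x <-> exists N e p,
  [/\ p \is e.-homog, e%:Z = n + (N * d)%:Z & toK f ^+ N * x = toK p].
Proof.
have fN N : toK (f ^+ N) != 0 by apply/toK_neq0/expf_neq0.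
split=> [[N [d' [e [p [fd' pe en ->]]]]]|[N [e [p [pe en xE]]]]].
  exists N, e, p; rewrite (dhomog_uniq f0 fd fd'); split=> //.
  by rewrite -toKX mulrC divfK.
exists N, d, e, p; split=> //; apply: (mulfI (fN N)).
by rewrite mulrC [RHS]mulrC divfK // -xE toKX mulrC.
Qed.

Lemma loc0 n : (0 < d)%N -> loc f n 0.
Proof.
move=> d0; apply/locP; exists (absz n), (absz (n + (absz n * d)%N%:Z)), 0; split.
- exact: rpred0.
- by rewrite gez0_abs //; nia.
by rewrite mulr0 toK0.
Qed.

Lemma locD n x y : loc f n x -> loc f n y -> loc f n (x + y).
Proof.
move=> /locP[N [e [p [pe en xE]]]] /locP[M [e' [q [qe em yE]]]]; apply/locP.
exists (N + M)%N, (e + d * M)%N, (p * f ^+ M + q * f ^+ N); split.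
- apply: rpredD; first by apply: dhomogM => //; apply: dhomogMn.
  have -> : (e + d * M = e' + d * N)%N by lia.
  by apply: dhomogM => //; apply: dhomogMn.
- by lia.
rewrite toKD !toKM !toKX -xE -yE exprD; move: (toK f ^+ N) (toK f ^+ M) => a b.
by rewrite mulrDr; congr (_ + _); rewrite [RHS]mulrC !mulrA // [b * a]mulrC.
Qed.

Lemma locM n m x y : loc f n x -> loc f m y -> loc f (n + m) (x * y).
Proof.
move=> /locP[N [e [p [pe en xE]]]] /locP[M [e' [q [qe em yE]]]]; apply/locP.
exists (N + M)%N, (e + e')%N, (p * q); split; first exact: dhomogM.
  by lia.
by rewrite toKM -xE -yE exprD mulrACA.
Qed.

Lemma loc_poly_homog e p : p \is e.-homog -> loc f e%:Z (toK p).
Proof. by move=> pe; apply/locP; exists 0%N, e, p; rewrite mul1r mul0n addr0. Qed.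

Lemma loc_cst c : loc f 0 (cstK c).
Proof. by apply: (@loc_poly_homog 0%N); rewrite -[c%:MP]mulr1 mul_mpolyC rpredZ // dhomog1. Qed.

Lemma locN n x : loc f n x -> loc f n (- x).
Proof.
move=> /locP[N [e [p [pe en xE]]]]; apply/locP; exists N, e, (- p); split=> //.
  by rewrite rpredN.
by rewrite mulrN xE toKN.
Qed.

Lemma loc_sum n I (r : seq I) (g : I -> K) : (0 < d)%N ->
  (forall i, loc f n (g i)) -> loc f n (\sum_(i <- r) g i).
Proof. by move=> d0 h; apply: big_ind => //; [apply: loc0|apply: locD]. Qed.

Lemma mloc_mul p q r n m (X : 'M[K]_(p, q)) (Y : 'M[K]_(q, r)) : (0 < d)%N ->
  mloc f n X -> mloc f m Y -> mloc f (n + m) (X *m Y).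
Proof. by move=> d0 hX hY i j; rewrite mxE; apply: loc_sum => // l; apply: locM. Qed.

Lemma mlocD p q n (X Y : 'M[K]_(p, q)) : mloc f n X -> mloc f n Y -> mloc f n (X + Y).
Proof. by move=> hX hY i j; rewrite mxE; apply: locD. Qed.

Lemma mlocB p q n (X Y : 'M[K]_(p, q)) : mloc f n X -> mloc f n Y -> mloc f n (X - Y).
Proof. by move=> hX hY i j; rewrite !mxE; apply: locD => //; apply: locN. Qed.

Lemma mloc0 p q n : (0 < d)%N -> mloc f n (0 : 'M[K]_(p, q)).
Proof. by move=> d0 i j; rewrite mxE; apply: loc0. Qed.

Lemma mlocZ p q n c (X : 'M[K]_(p, q)) : mloc f n X -> mloc f n (cstK c *: X).
Proof. by move=> hX i j; rewrite mxE -[n]add0r; apply: locM => //; apply: loc_cst. Qed.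

Lemma mloc_cst p q (X : 'M[F]_(p, q)) : mloc f 0 (map_mx (@cstK F) X).
Proof. by move=> i j; rewrite mxE; apply: loc_cst. Qed.
End LocClosure.

Section LocOverlap.
Variable F : fieldType.
Local Notation S := {mpoly F[4]}.
Local Notation K := {fraction {mpoly F[4]}}.
Variables (f g : S) (d c : nat).
Hypothesis f0 : f != 0.
Hypothesis fd : f \is d.-homog.
Hypothesis g0 : g != 0.
Hypothesis gc : g \is c.-homog.

Let fg0 : f * g != 0. Proof. exact: mulf_neq0. Qed.
Let fgd : f * g \is (d + c).-homog. Proof. exact: dhomogM. Qed.

Lemma loc_mulr n x : loc f n x -> loc (f * g) n x.
Proof.
move=> /(locP f0 fd)[N [e [p [pe en xE]]]]; apply/(locP fg0 fgd).
exists N, (e + c * N)%N, (p * g ^+ N); split.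
- by apply: dhomogM => //; apply: dhomogMn.
- by lia.
by rewrite !toKM toKX exprMn -xE mulrAC.
Qed.

(** A section over the overlap extends to the chart of f after multiplication by a power of g, each
    factor raising the twist by [c]. Allowing all large exponents lets one power serve all entries
    of a column. *)
Lemma loc_shift n x : loc (f * g) n x ->
  exists N, forall M, (N <= M)%N -> loc f (n + (M * c)%:Z) (toK g ^+ M * x).
Proof.
move=> /(locP fg0 fgd)[N [e [p [pe en xE]]]]; exists N => M NM; apply/(locP f0 fd).
exists N, (e + c * (M - N))%N, (p * g ^+ (M - N)); split.
- by apply: dhomogM => //; apply: dhomogMn.
- by nia.
by rewrite toKM toKX -xE toKM exprMn -[in LHS](subnK NM) exprD; ring.
Qed.

Lemma mloc_shift p n (x : 'cV[K]_p) : mloc (f * g) n x ->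
  exists N, forall M, (N <= M)%N -> mloc f (n + (M * c)%:Z) (toK g ^+ M *: x).
Proof.
move=> h; have [N hN] := choice (fun i => loc_shift (h i 0)).
exists (\max_i N i)%N => M NM i j; rewrite mxE ord1; apply: hN.
exact: leq_trans (leq_bigmax i) NM.
Qed.
End LocOverlap.

(** * Constant matrices and quadratic forms over the function field *)

Section MonadMatrices.
Variable F : numClosedFieldType.
Local Notation S := {mpoly F[4]}.
Local Notation K := {fraction {mpoly F[4]}}.
Local Notation cK := (map_mx (@cstK F)).

Lemma cstKM a b : cstK (a * b) = cstK a * cstK b :> K.
Proof. by rewrite /cstK mpolyCM toKM. Qed.
Lemma cstKD a b : cstK (a + b) = cstK a + cstK b :> K.
Proof. by rewrite /cstK mpolyCD toKD. Qed.
Lemma cstK0 : cstK 0 = 0 :> K. Proof. by rewrite /cstK mpolyC0 toK0. Qed.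
Lemma cstK1 : cstK 1 = 1 :> K. Proof. by rewrite /cstK mpolyC1 toK1. Qed.
Lemma cstK_sum I (r : seq I) (g : I -> F) :
  cstK (\sum_(i <- r) g i) = \sum_(i <- r) cstK (g i) :> K.
Proof. exact: (big_morph _ cstKD cstK0). Qed.

Lemma cKM m n p (X : 'M[F]_(m, n)) (Y : 'M[F]_(n, p)) : cK (X *m Y) = cK X *m cK Y.
Proof.
apply/matrixP => i j; rewrite !mxE cstK_sum; apply: eq_bigr => l _.
by rewrite cstKM !mxE.
Qed.
Lemma cKD m n (X Y : 'M[F]_(m, n)) : cK (X + Y) = cK X + cK Y.
Proof. by apply/matrixP => i j; rewrite !mxE cstKD. Qed.
Lemma cKZ m n c (X : 'M[F]_(m, n)) : cK (c *: X) = cstK c *: cK X.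
Proof. by apply/matrixP => i j; rewrite !mxE cstKM. Qed.
Lemma cK0 m n : cK (0 : 'M[F]_(m, n)) = 0.
Proof. by apply/matrixP => i j; rewrite !mxE cstK0. Qed.
Lemma cK1 n : cK (1%:M : 'M[F]_n) = 1%:M.
Proof. by apply/matrixP => i j; rewrite !mxE; case: eqP; rewrite ?cstK1 ?cstK0. Qed.

Lemma two_neq0 : (2 : K) != 0.
Proof.
have -> : (2 : K) = cstK (2 : F) by rewrite (_ : 2 = 1 + 1) // cstKD cstK1.
by apply: toK_neq0; rewrite mpolyC_eq0 pnatr_eq0.
Qed.

Lemma mulr2_eq0_K m n (M : 'M[K]_(m, n)) : M + M = 0 -> M = 0.
Proof.
rewrite -mulr2n -scaler_nat => /eqP; rewrite scaler_eq0 (negPf two_neq0) /=.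
by move/eqP.
Qed.

(** Vanishing at all points gives, by polarization, only [M i j + M j i = 0]; the generic form is
    then killed by adding it to itself with i and j exchanged and dividing by 2. *)
Lemma quadratic_form_eq0 p q (M : 'I_4 -> 'I_4 -> 'M[F]_(p, q)) :
  \sum_i \sum_j (toK 'X_i * toK 'X_j) *: cK (M i j) = 0 <->
  forall x : 'rV[F]_4, \sum_i \sum_j (x 0 i * x 0 j) *: M i j = 0.
Proof.
split=> h.
  move=> x; apply/matrixP => u v; rewrite mxE.
  pose P : S := \sum_i \sum_j (M i j u v)%:MP * ('X_i * 'X_j).
  have P0 : P = 0.
    apply: toK_inj; rewrite toK0; have /matrixP/(_ u v) := h; rewrite mxE => e.
    rewrite -[RHS]e summxE /P (big_morph _ (@toKD F) (@toK0 F)); apply: eq_bigr => i _.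
    rewrite summxE (big_morph _ (@toKD F) (@toK0 F)); apply: eq_bigr => j _.
    by rewrite !mxE !toKM mulrC.
  have := congr1 (fun p : S => p.@[fun i => x 0 i]) P0.
  rewrite meval0 => e; rewrite -[RHS]e raddf_sum summxE; apply: eq_bigr => i _.
  rewrite raddf_sum summxE; apply: eq_bigr => j _.
  by rewrite /= !mevalM mevalC !mevalXU mxE mulrC.
pose g x := \sum_i \sum_j (x 0 i * x 0 j) *: M i j.
have sym i j : M i j + M j i = 0.
  have gd (a b : 'I_4) : \sum_i0 \sum_j0 ((delta_mx 0 a : 'rV[F]_4) 0 i0
      * (delta_mx 0 b : 'rV[F]_4) 0 j0) *: M i0 j0 = M a b.
    rewrite (bigD1 a) //= (bigD1 b) //= !mxE !eqxx mulr1 scale1r.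
    rewrite big1 => [|j' /negPf j'b]; last by rewrite mxE j'b mulr0 scale0r.
    rewrite addr0 big1 ?addr0 // => i' /negPf i'a; rewrite big1 // => j' _.
    by rewrite !mxE i'a mul0r scale0r.
  have := h (delta_mx 0 i + delta_mx 0 j).
  have := h (delta_mx 0 i); have := h (delta_mx 0 j); rewrite !gd => hj hi.
  rewrite (eq_bigr (fun i0 => \sum_j0 ((delta_mx 0 i : 'rV[F]_4) 0 i0 * (delta_mx 0 i : 'rV[F]_4) 0 j0) *: M i0 j0
    + \sum_j0 ((delta_mx 0 j : 'rV[F]_4) 0 i0 * (delta_mx 0 j : 'rV[F]_4) 0 j0) *: M i0 j0
    + \sum_j0 ((delta_mx 0 i : 'rV[F]_4) 0 i0 * (delta_mx 0 j : 'rV[F]_4) 0 j0) *: M i0 j0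
    + \sum_j0 ((delta_mx 0 j : 'rV[F]_4) 0 i0 * (delta_mx 0 i : 'rV[F]_4) 0 j0) *: M i0 j0)); last first.
    move=> i0 _; rewrite -!big_split; apply: eq_bigr => j0 _; rewrite /= -!scalerDl.
    by congr (_ *: _); rewrite !mxE; ring.
  by rewrite !big_split /= !gd hi hj !add0r.
apply: mulr2_eq0_K; rewrite {2}exchange_big -big_split big1 // => i _.
rewrite -big_split big1 //= => j _; rewrite [toK 'X_j * _]mulrC -scalerDr -cKD sym cK0 scaler0 //.
Qed.
End MonadMatrices.

(** * Sections of E(1) through the monad *)

Section LinearForms.
Variable F : fieldType.
Local Notation S := {mpoly F[4]}.
Local Notation K := {fraction {mpoly F[4]}}.

Lemma dhomog1_coeff (p : S) : p \is 1.-homog -> p = \sum_i p@_U_(i) *: 'X_i.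
Proof.
move=> ph; apply/mpolyP => m; rewrite raddf_sum /=.
under eq_bigr => i _ do rewrite mcoeffZ mcoeffX.
have [/mdeg1P[i /eqP->]|m1] := boolP (mdeg m == 1%N).
  rewrite (bigD1 i) //= eqxx mulr1 big1 ?addr0 // => j /negPf ji.
  by rewrite eq_mnm1 ji mulr0.
rewrite (dhomog_nemf_coeff ph m1) big1 // => i _; case: eqP => [e|_]; last by rewrite mulr0.
by move: m1; rewrite -e mdeg1.
Qed.

Lemma dhomog0_const (p : S) : p \is 0.-homog -> p = (p@_0)%:MP.
Proof.
move=> ph; apply/mpolyP => m; rewrite mcoeffC.
have [->|m0] := eqVneq m 0%MM; first by rewrite mulr1.
by rewrite mulr0; apply: (dhomog_nemf_coeff ph); rewrite /= mdeg_eq0.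
Qed.

Lemma toK_scale c (p : S) : toK (c *: p) = cstK c * toK p.
Proof. by rewrite -mul_mpolyC toKM. Qed.

Lemma toK_sum I (r : seq I) (g : I -> S) :
  toK (\sum_(i <- r) g i) = \sum_(i <- r) toK (g i).
Proof. exact: (big_morph _ (@toKD F) (@toK0 F)). Qed.

Lemma linear_form_eq0 (c : 'I_4 -> F) : \sum_i toK 'X_i * cstK (c i) = 0 :> K ->
  forall i, c i = 0.
Proof.
move=> h i; have P0 : \sum_i c i *: ('X_i : S) = 0.
  apply: toK_inj; rewrite toK0 -[RHS]h toK_sum; apply: eq_bigr => j _.
  by rewrite toK_scale mulrC.
have := congr1 (mcoeff U_(i)) P0; rewrite mcoeff0 raddf_sum (bigD1 i) //= big1 ?addr0.
  by rewrite mcoeffZ mcoeffX eqxx mulr1.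
by move=> j /negPf ji; rewrite mcoeffZ mcoeffX eq_mnm1 ji mulr0.
Qed.
End LinearForms.

Section GoodDenominators.
Variable F : fieldType.
Local Notation S := {mpoly F[4]}.
Local Notation K := {fraction {mpoly F[4]}}.

Definition good_den (g : S) := g != 0 /\ exists2 d : nat, (0 < d)%N & g \is d.-homog.

Variable g : S.
Hypothesis gg : good_den g.

Lemma good_mul p q r n m (X : 'M[K]_(p, q)) (Y : 'M[K]_(q, r)) :
  mloc g n X -> mloc g m Y -> mloc g (n + m) (X *m Y).
Proof. by have [g0 [d d0 gd]] := gg; apply: (mloc_mul g0 gd). Qed.
Lemma good_add p q n (X Y : 'M[K]_(p, q)) : mloc g n X -> mloc g n Y -> mloc g n (X + Y).
Proof. by have [g0 [d d0 gd]] := gg; apply: (mlocD g0 gd). Qed.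
Lemma good_sub p q n (X Y : 'M[K]_(p, q)) : mloc g n X -> mloc g n Y -> mloc g n (X - Y).
Proof. by have [g0 [d d0 gd]] := gg; apply: (mlocB g0 gd). Qed.
Lemma good0 p q n : mloc g n (0 : 'M[K]_(p, q)).
Proof. by have [g0 [d d0 gd]] := gg; apply: (mloc0 g0 gd). Qed.
Lemma goodZ p q n c (X : 'M[K]_(p, q)) : mloc g n X -> mloc g n (cstK c *: X).
Proof. by have [g0 [d d0 gd]] := gg; apply: (mlocZ g0 gd). Qed.
Lemma good_cst p q (X : 'M[F]_(p, q)) : mloc g 0 (map_mx (@cstK F) X).
Proof. by have [g0 [d d0 gd]] := gg; apply: (mloc_cst g0 gd). Qed.

Lemma good_form p q (X : 'I_4 -> 'M[F]_(p, q)) :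
  mloc g 1 (\sum_i toK 'X_i *: map_mx (@cstK F) (X i)).
Proof.
have [g0 [d d0 gd]] := gg; move=> u v; rewrite summxE.
apply: (loc_sum g0 gd) => // i; rewrite mxE.
apply: (@locM _ _ _ g0 gd 1 0); last by rewrite mxE; apply: (loc_cst g0 gd).
by apply: (@loc_poly_homog _ _ _ g0 gd 1%N); rewrite dhomogX /= mdeg1.
Qed.
End GoodDenominators.

Lemma good_denM (F : fieldType) (f g : {mpoly F[4]}) :
  good_den f -> good_den g -> good_den (f * g).
Proof.
move=> [f0 [d d0 fd]] [g0 [c c0 gc]]; split; first exact: mulf_neq0.
by exists (d + c)%N; [rewrite addn_gt0 d0|apply: dhomogM].
Qed.

Lemma good_mulr (F : fieldType) (f g : {mpoly F[4]}) p q n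
    (X : 'M[{fraction {mpoly F[4]}}]_(p, q)) :
  good_den f -> good_den g -> mloc f n X -> mloc (f * g) n X.
Proof.
move=> [f0 [d d0 fd]] [g0 [c c0 gc]] h i j; exact: (loc_mulr f0 fd g0 gc (h i j)).
Qed.

(** * The monad as an isotropic family *)

Section MonadAlgebra.
Variable F : numClosedFieldType.
Local Notation S := {mpoly F[4]}.
Local Notation K := {fraction {mpoly F[4]}}.
Local Notation cK := (map_mx (@cstK F)).
Variables (k : nat) (A : 'I_4 -> 'M[F]_(k, 2 * k + 2)) (J : 'M[F]_(2 * k + 2)).
Hypothesis Jskew : J^T = - J.
Hypothesis Junit : J \in unitmx.
Hypothesis complex : monad_snd A *m monad_fst A J = 0.
Hypothesis Arank : forall x : 'rV[F]_4, x != 0 -> \rank (\sum_i x 0 i *: A i)%R = k.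
Local Notation N := (2 * k + 2)%N.
Local Notation B := (monad_snd A).
Local Notation P := (monad_fst A J).

Lemma cK_inj0 m n (X : 'M[F]_(m, n)) : cK X = 0 -> X = 0.
Proof.
move=> /matrixP h; apply/matrixP => i j; have := h i j; rewrite !mxE => /eqP.
by rewrite /cstK toK_eq0 mpolyC_eq0 => /eqP.
Qed.

Lemma lin_delta m n (M : 'I_4 -> 'M[F]_(m, n)) i : lin M (delta_mx 0 i) = M i.
Proof.
rewrite /lin (bigD1 i) //= mxE !eqxx scale1r big1 ?addr0 // => j /negPf ji.
by rewrite mxE ji andbF scale0r.
Qed.

Lemma snd_mul n (Y : 'I_4 -> 'M[F]_(N, n)) :
  B *m (\sum_j toK 'X_j *: cK (Y j)) = \sum_i \sum_j (toK 'X_i * toK 'X_j) *: cK (A i *m Y j).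
Proof.
rewrite /monad_snd mulmx_suml; apply: eq_bigr => i _; rewrite mulmx_sumr.
by apply: eq_bigr => j _; rewrite -scalemxAl -scalemxAr scalerA cKM.
Qed.

Lemma fstE : P = \sum_i toK 'X_i *: cK (J *m (A i)^T).
Proof.
rewrite /monad_fst /monad_snd linear_sum mulmx_sumr; apply: eq_bigr => i _.
by rewrite linearZ /= -scalemxAr cKM map_trmx.
Qed.

Lemma lin_mul n (Y : 'I_4 -> 'M[F]_(N, n)) (x y : 'rV[F]_4) :
  lin A x *m (\sum_j y 0 j *: Y j) = \sum_i \sum_j (x 0 i * y 0 j) *: (A i *m Y j).
Proof.
rewrite /lin mulmx_suml; apply: eq_bigr => i _; rewrite mulmx_sumr.
by apply: eq_bigr => j _; rewrite -scalemxAl -scalemxAr scalerA.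
Qed.

Lemma snd_mul_eq0 n (Y : 'I_4 -> 'M[F]_(N, n)) :
  B *m (\sum_j toK 'X_j *: cK (Y j)) = 0 <->
  forall x : 'rV[F]_4, lin A x *m (\sum_j x 0 j *: Y j) = 0.
Proof.
rewrite snd_mul; split=> [/quadratic_form_eq0 h x|h]; first by rewrite lin_mul h.
by apply/quadratic_form_eq0 => x; rewrite -lin_mul h.
Qed.

Lemma monad_isotropic x y :
  lin A x *m J *m (lin A y)^T + lin A y *m J *m (lin A x)^T = 0.
Proof.
have q (z : 'rV[F]_4) : lin A z *m J *m (lin A z)^T = 0.
  have := complex; rewrite fstE => /snd_mul_eq0 /(_ z); rewrite -mulmxA => e.
  rewrite -[RHS]e; congr (_ *m _); rewrite /lin linear_sum mulmx_sumr.
  by apply: eq_bigr => i _; rewrite linearZ /= -scalemxAr.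
have tE : (lin A (x + y))^T = (lin A x)^T + (lin A y)^T by rewrite linD linearD.
have := q (x + y); rewrite tE linD !mulmxDl !mulmxDr !q add0r addr0 addrC.
by [].
Qed.

Lemma monad_free x : x != 0 -> row_free (lin A x).
Proof. by move=> x0; rewrite /row_free /lin Arank. Qed.

(** With R a right inverse of A at one point, the determinant of B R is a polynomial equal to 1 at
    that point, so B R is invertible over the function field. *)
Lemma snd_cancel m (w : 'M[K]_(m, k)) : w *m B = 0 -> w = 0.
Proof.
move=> wB; pose e0 : 'rV[F]_4 := delta_mx 0 0.
have e00 : e0 != 0.
  by apply/eqP => /matrixP/(_ 0 0); rewrite !mxE !eqxx => /eqP; rewrite oner_eq0.
have e0E i : e0 0 i = (i == 0)%:R by rewrite mxE eqxx.
have /row_freeP[R AR] := monad_free e00; rewrite lin_delta in AR.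
pose M : 'M[S]_k := \matrix_(u, v) \sum_i (A i *m R) u v *: 'X_i.
have ME : map_mx (@tofrac S) M = B *m cK R.
  rewrite /monad_snd mulmx_suml; apply/matrixP => u v; rewrite !mxE summxE.
  rewrite -/(toK _) toK_sum; apply: eq_bigr => i _; rewrite toK_scale mulrC.
  by rewrite -scalemxAl -cKM [in RHS]mxE [cK _ _ _]mxE.
have dM : \det M != 0.
  apply/eqP => d0; have := det_map_mx (meval (fun i => e0 0 i)) M.
  rewrite d0 raddf0; set M' := map_mx _ _; have -> : M' = 1%:M.
    rewrite -AR; apply/matrixP => u v; rewrite !mxE raddf_sum (bigD1 0) //=.
    rewrite mevalZ mevalXU e0E eqxx mulr1 big1 ?addr0 ?mxE //= => i /negPf i0.
    by rewrite mevalZ mevalXU e0E i0 mulr0.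
  by move/eqP; rewrite det1 oner_eq0.
have u : B *m cK R \in unitmx.
  by rewrite -ME unitmxE unitfE det_map_mx -/(toK _) toK_eq0.
by rewrite -(mulmxK u w) mulmxA wB !mul0mx.
Qed.

Lemma fst_inj m (y : 'M[K]_(k, m)) : P *m y = 0 -> y = 0.
Proof.
move=> h; have JV : cK (invmx J) *m cK J = 1%:M by rewrite -cKM mulVmx // cK1.
apply: trmx_inj; rewrite trmx0; apply: snd_cancel.
have : B^T *m y = 0.
  rewrite -[B^T *m y]mul1mx -JV -mulmxA (mulmxA (cK J) B^T) -/(monad_fst A J) h.
  by rewrite mulmx0.
by move/(congr1 trmx); rewrite trmx_mul trmxK trmx0.
Qed.

Lemma good_fst g : good_den g -> mloc g 1 P.
Proof. by move=> gg; rewrite fstE; apply: good_form. Qed.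

(** The global section J (x sg)^t of O(1)^N at the generic x. The factor J makes its image under the
    monad the isotropy expression of [is_sec], and sends trivial sections into the image of the
    first map. *)
Definition sec_vec (sg : 'M[F]_(4, N)) : 'cV[K]_N :=
  \sum_i toK 'X_i *: cK (J *m (row i sg)^T).

Lemma sec_vecD s1 s2 : sec_vec (s1 + s2) = sec_vec s1 + sec_vec s2.
Proof.
rewrite /sec_vec -big_split; apply: eq_bigr => i _ /=; rewrite -scalerDr -cKD.
have -> : row i (s1 + s2) = row i s1 + row i s2 by apply/rowP => j; rewrite !mxE.
have tE (a b : 'rV[F]_N) : (a + b)^T = a^T + b^T by rewrite linearD.
by rewrite tE mulmxDr.
Qed.

Lemma sec_vecZ c s : sec_vec (c *: s) = cstK c *: sec_vec s.
Proof.
rewrite /sec_vec scaler_sumr; apply: eq_bigr => i _.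
have -> : row i (c *: s) = c *: row i s by apply/rowP => j; rewrite !mxE.
by rewrite linearZ /= -scalemxAr cKZ !scalerA mulrC.
Qed.

Lemma sec_vec_triv w : sec_vec (triv_sec A w) = P *m cK w^T.
Proof.
rewrite fstE mulmx_suml; apply: eq_bigr => i _; rewrite -scalemxAl -cKM; congr (_ *: cK _).
have -> : row i (triv_sec A w) = w *m A i by rewrite rowK.
by rewrite trmx_mul mulmxA.
Qed.

Lemma sec_vec_snd s : B *m sec_vec s = 0 <-> is_sec J A s.
Proof.
have e (x : 'rV[F]_4) : lin A x *m (\sum_j x 0 j *: (J *m (row j s)^T))
    = lin A x *m J *m (x *m s)^T.
  rewrite -mulmxA; congr (_ *m _); rewrite mulmx_sum_row linear_sum mulmx_sumr.
  by apply: eq_bigr => i _; rewrite linearZ /= -scalemxAr.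
split=> [/snd_mul_eq0 h x|h]; first by rewrite -e h.
by apply/snd_mul_eq0 => x; rewrite e h.
Qed.

Lemma sec_vec_inj0 s : sec_vec s = 0 -> s = 0.
Proof.
move=> h; apply/row_matrixP => i; rewrite row0.
have Ji : J *m (row i s)^T = 0.
  apply/matrixP => u v; rewrite ord1 [RHS]mxE.
  apply: (@linear_form_eq0 F (fun i => (J *m (row i s)^T) u 0)).
  have /matrixP/(_ u 0) := h; rewrite summxE mxE => e; rewrite -[RHS]e.
  by apply: eq_bigr => j _; rewrite [in RHS]mxE [cK _ _ _]mxE.
by apply: trmx_inj; rewrite trmx0 -(mulKmx Junit (row i s)^T) Ji mulmx0.
Qed.

Lemma sec_vec_surj (c : 'cV[K]_N) : (forall j, exists2 p : S, c j 0 = toK p & p \is 1.-homog) ->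
  exists s, sec_vec s = c.
Proof.
move=> h; have h' j : exists p : S, c j 0 = toK p /\ p \is 1.-homog.
  by have [p e ph] := h j; exists p.
have [p pE] := choice h'.
pose g : 'M[F]_(4, N) := \matrix_(i, j) (p j)@_U_(i).
exists (g *m (invmx J)^T); apply/colP => j; have [-> ph] := pE j.
rewrite summxE (dhomog1_coeff ph) toK_sum; apply: eq_bigr => i _.
rewrite row_mul trmx_mul trmxK mulmxA mulmxV // mul1mx mxE toK_scale mulrC.
by congr (_ * _); rewrite !mxE.
Qed.
End MonadAlgebra.

(** * Lifting and gluing sections of E(1) *)

Section MonadSections.
Variable F : numClosedFieldType.
Local Notation S := {mpoly F[4]}.
Local Notation K := {fraction {mpoly F[4]}}.
Local Notation cK := (map_mx (@cstK F)).
Variables (k : nat) (A : 'I_4 -> 'M[F]_(k, 2 * k + 2)) (J : 'M[F]_(2 * k + 2)).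
Local Notation N := (2 * k + 2)%N.
Local Notation B := (monad_snd A).
Local Notation P := (monad_fst A J).
Variable E : bundle2 F.
Local Notation I := 'I_(ncharts E).
Local Notation f := (@fchart F E).
Local Notation V := {ffun I -> 'cV[K]_2}.
Hypothesis Jskew : J^T = - J.
Hypothesis Junit : J \in unitmx.
Hypothesis complex : B *m P = 0.
Hypothesis Arank : forall x : 'rV[F]_4, x != 0 -> \rank (\sum_i x 0 i *: A i)%R = k.
Variable L : I -> 'M[K]_(N, 2).
Hypothesis Lker : forall a, mloc (f a) 0 (L a) /\ B *m L a = 0.
Hypothesis Ltrans : forall a b, exists2 W : 'M[K]_(k, 2),
  mloc (f a * f b) (-1) W & L b = L a *m trans a b + P *m W.
Hypothesis Llift : forall a n (v : 'cV[K]_N), mloc (f a) n v -> B *m v = 0 ->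
  exists! sw : 'cV[K]_2 * 'cV[K]_k,
    [/\ mloc (f a) n sw.1, mloc (f a) (n - 1) sw.2 & v = L a *m sw.1 + P *m sw.2].
Hypothesis h0 : has_h0 E 0 0.

Let fst0 m (y : 'M[K]_(k, m)) : P *m y = 0 -> y = 0.
Proof. exact: (fst_inj Junit Arank). Qed.

Lemma chart_good a : good_den (f a).
Proof. by split; [apply: fchart_neq0|apply: fchart_homog]. Qed.
Let cg := chart_good.
Let cg2 a b : good_den (f a * f b). Proof. by apply: good_denM. Qed.

Lemma mloc_l a b p q n (X : 'M[K]_(p, q)) : mloc (f a) n X -> mloc (f a * f b) n X.
Proof. exact: good_mulr. Qed.
Lemma mloc_r a b p q n (X : 'M[K]_(p, q)) : mloc (f b) n X -> mloc (f a * f b) n X.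
Proof. by rewrite mulrC; apply: good_mulr. Qed.

(* Multiplying by a power of [f b] moves a relation over the overlap to chart [a]. *)
Lemma lift_overlap_inj a b n (x : 'cV[K]_2) (y : 'cV[K]_k) :
  mloc (f a * f b) n x -> mloc (f a * f b) (n - 1) y ->
  L a *m x + P *m y = 0 -> x = 0 /\ y = 0.
Proof.
move=> hx hy e; have [f0 [d d0 fd]] := cg a; have [g0 [c c0 gc]] := cg b.
have [N1 h1] := mloc_shift f0 fd g0 gc hx; have [N2 h2] := mloc_shift f0 fd g0 gc hy.
pose M := maxn N1 N2; pose z : K := toK (f b) ^+ M.
have z0 : z != 0 by apply/expf_neq0/toK_neq0.
have B0 : B *m (0 : 'cV[K]_N) = 0 by rewrite mulmx0.
have [sw [_ uniq]] := Llift (@good0 F (f a) (cg a) N 1 (n + (M * c)%N%:Z)) B0.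
have e0 : sw = (0, 0).
  by apply: uniq; split; [apply: good0|apply: good0|rewrite /= !mulmx0 addr0].
have : sw = (z *: x, z *: y).
  apply: uniq; split=> /=.
  - by apply: h1; apply: leq_maxl.
  - have -> : n + (M * c)%N%:Z - 1 = n - 1 + (M * c)%N%:Z by rewrite addrAC.
    by apply: h2; apply: leq_maxr.
  by rewrite -!scalemxAr -scalerDr e scaler0.
rewrite e0 => -[/esym/eqP zx /esym/eqP zy].
by move: zx zy; rewrite !scaler_eq0 (negPf z0) /= => /eqP -> /eqP ->.
Qed.

(** Two local decompositions of the same [c], written in one frame by [Ltrans], differ by a relation
    between the columns of [L a] and [P], which is trivial on the overlap. *)
Lemma glue_sections n (c : 'cV[K]_N) (s : V) (t : I -> 'cV[K]_k) :
  (forall a, [/\ mloc (f a) n (s a), mloc (f a) (n - 1) (t a) & c = L a *m s a + P *m t a]) ->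
  is_section n s.
Proof.
move=> h; split=> [a|a b]; first by have [] := h a.
have [sa ta ca] := h a; have [sb tb cb] := h b; have [W Wl LE] := Ltrans a b.
have : L a *m (s a - trans a b *m s b) + P *m (t a - (t b + W *m s b)) = 0.
  apply/eqP; rewrite !mulmxBr addrACA -opprD -ca subr_eq0 cb LE mulmxDl mulmxDr.
  by rewrite !mulmxA -!addrA [P *m W *m _ + _]addrC.
case/(@lift_overlap_inj a b n) => [||/eqP + _]; last by rewrite subr_eq0 => /eqP.
  apply: good_sub => //; first exact: mloc_l.
  by rewrite -[n]add0r; apply: good_mul => //; [apply: trans_loc|apply: mloc_r].
apply: good_sub => //; first exact: mloc_l.
apply: good_add => //; first exact: mloc_r.
by rewrite addrC; apply: good_mul => //; apply: mloc_r.
Qed.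

Lemma lift_kernel n (c : 'cV[K]_N) : (forall a, mloc (f a) n c) -> B *m c = 0 ->
  exists (s : V) t, forall a,
    [/\ mloc (f a) n (s a), mloc (f a) (n - 1) (t a) & c = L a *m s a + P *m t a].
Proof.
move=> cl c0; have ex a : exists sw : 'cV[K]_2 * 'cV[K]_k,
    [/\ mloc (f a) n sw.1, mloc (f a) (n - 1) sw.2 & c = L a *m sw.1 + P *m sw.2].
  by have [sw [h _]] := Llift (cl a) c0; exists sw.
have [sw swP] := choice ex; exists [ffun a => (sw a).1], (fun a => (sw a).2) => a.
by rewrite ffunE; apply: swP.
Qed.

(** The first map is injective over the function field, so the local [t a] coincide and are global
    sections of O(n - 1). *)
Lemma image_of_fst n (c : 'cV[K]_N) (t : I -> 'cV[K]_k) :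
  (forall a, mloc (f a) (n - 1) (t a)) -> (forall a, c = P *m t a) ->
  exists y : 'cV[K]_k, c = P *m y /\ forall j, exists p : S,
    [/\ y j 0 = toK p, forall d, n - 1 = d%:Z -> p \is d.-homog & n - 1 < 0 -> p = 0].
Proof.
move=> tl tE; exists (t (chart0 E)); split=> // j; apply: sections_poly => a.
have -> : t (chart0 E) = t a.
  by apply/eqP; rewrite -subr_eq0; apply/eqP/fst0; rewrite mulmxBr -!tE subrr.
exact: tl.
Qed.

(** Such a v is a constant section of the kernel of the monad. Its image in H^0(E) is zero, so it
    comes from H^0(O(-1)^k), which is zero too. *)
Lemma monad_joint (v : 'rV[F]_N) : (forall x, lin A x *m J *m v^T = 0) -> v = 0.
Proof.
move=> h; pose c := cK (J *m v^T).
have Bc : B *m c = 0.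
  rewrite /monad_snd mulmx_suml big1 // => i _; rewrite -scalemxAl -cKM.
  by rewrite mulmxA -(lin_delta A) h cK0 scaler0.
have [|s [t st]] := @lift_kernel 0 c _ Bc; first by move=> a; apply: good_cst.
have s0 : s = 0.
  have sec := glue_sections st; have [b [_ /(_ _ sec) [? [+ _]]]] := h0.
  by rewrite big_ord0 subr0.
have [||y [cE yp]] := @image_of_fst 0 c t; first by move=> a; have [] := st a.
  by move=> a; have [_ _ ->] := st a; rewrite s0 ffunE mulmx0 add0r.
have y0 : y = 0.
  apply/colP => j; have [p [-> _ p0]] := yp j.
  by rewrite p0 // toK0 mxE.
have : J *m v^T = 0 by apply: cK_inj0; rewrite -/c cE y0 mulmx0.
by move=> Jv; apply: trmx_inj; rewrite trmx0 -(mulKmx Junit v^T) Jv mulmx0.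
Qed.

Local Notation C := (@sec_vec F k J).

(* The section [s] of E(1) is induced by the linear forms [sg]. *)
Definition induces (sg : 'M[F]_(4, N)) (s : V) := exists t : I -> 'cV[K]_k, forall a,
  [/\ mloc (f a) 1 (s a), mloc (f a) (1 - 1) (t a) & C sg = L a *m s a + P *m t a].

Lemma inducesD sg sg' s s' : induces sg s -> induces sg' s' -> induces (sg + sg') (s + s').
Proof.
move=> [t h] [t' h']; exists (fun a => t a + t' a) => a.
have [sa ta ca] := h a; have [sa' ta' ca'] := h' a; rewrite ffunE; split.
- exact: good_add.
- exact: good_add.
by rewrite sec_vecD !mulmxDr addrACA -ca -ca'.
Qed.

Lemma inducesZ c sg s : induces sg s -> induces (c *: sg) (cstK c *: s).
Proof.
move=> [t h]; exists (fun a => cstK c *: t a) => a; have [sa ta ca] := h a.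
rewrite ffunE; split; [exact: goodZ|exact: goodZ|].
by rewrite sec_vecZ ca -!scalemxAr scalerDr.
Qed.

Lemma induces_section sg s : induces sg s -> is_section 1 s.
Proof. by move=> [t h]; apply: glue_sections h. Qed.

Lemma is_sec_induces sg : is_sec J A sg -> exists2 s, induces sg s & is_section 1 s.
Proof.
move=> /sec_vec_snd h; have [|s [t st]] := @lift_kernel 1 (C sg) _ h.
  by move=> a; apply: good_form.
by exists s; [exists t|apply: glue_sections st].
Qed.

Lemma induces_zero sg : induces sg 0 -> exists w, sg = triv_sec A w.
Proof.
move=> [t h]; have [||y [cE yp]] := @image_of_fst 1 (C sg) t.
- by move=> a; have [] := h a.
- by move=> a; have [_ _ ->] := h a; rewrite ffunE mulmx0 add0r.
have yc j : exists c : F, y j 0 = cstK c.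
  have [p [-> ph _]] := yp j; have p0 : p \is 0.-homog by apply: ph.
  by rewrite (dhomog0_const p0); exists p@_0.
have [c cP] := choice yc; exists (\row_j c j); apply/eqP; rewrite -subr_eq0; apply/eqP.
apply: (sec_vec_inj0 Junit); rewrite -scaleN1r sec_vecD sec_vecZ sec_vec_triv.
have -> : cstK (-1 : F) = -1 by rewrite /cstK mpolyCN toKN mpolyC1 toK1.
rewrite scaleN1r cE -mulmxBr; set z := y - _; have -> : z = 0; last by rewrite mulmx0.
by apply/colP => j; rewrite /z !mxE cP subrr.
Qed.

Lemma triv_induces w s : induces (triv_sec A w) s -> s = 0.
Proof.
move=> [t h]; apply/ffunP => a; rewrite [RHS]ffunE; have [sa ta] := h a.
rewrite sec_vec_triv => e.
have : L a *m s a + P *m (t a - cK w^T) = 0 by rewrite mulmxBr addrA -e subrr.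
case/(@lift_overlap_inj a a 1) => //; first exact: mloc_l.
by apply: mloc_l; apply: good_sub => //; apply: good_cst.
Qed.

(** The obstruction to lifting s to a global section of the kernel is the cocycle [h] with values in
    O^k, a coboundary by [H1_O]. The corrected lift is global of degree 1, hence a column of linear
    forms. *)
Lemma section_induced s : is_section 1 s -> exists2 sg, induces sg s & is_sec J A sg.
Proof.
move=> [sl sE].
have [W WP] : {W : I * I -> 'M[K]_(k, 2) & forall ab, mloc (f ab.1 * f ab.2) (-1) (W ab)
    /\ L ab.2 = L ab.1 *m trans ab.1 ab.2 + P *m W ab}.
  have ex (ab : I * I) : exists W : 'M[K]_(k, 2), mloc (f ab.1 * f ab.2) (-1) W
    /\ L ab.2 = L ab.1 *m trans ab.1 ab.2 + P *m W.
    by have [W] := Ltrans ab.1 ab.2; exists W.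
  exact: (choice ex).
pose h a b := W (a, b) *m s b.
have hE a b : L b *m s b = L a *m s a + P *m h a b.
  have [_ /= ->] := WP (a, b); rewrite mulmxDl -[_ *m trans a b *m _]mulmxA -sE.
  by rewrite -[P *m _ *m _]mulmxA.
have hl a b : mloc (f a * f b) 0 (h a b).
  have [Wl _] := WP (a, b).
  by apply: (@good_mul _ _ (cg2 a b) _ _ _ (-1) 1) => //; apply: mloc_r.
have hc a b c : h a c = h a b + h b c.
  apply/eqP; rewrite -subr_eq0; apply/eqP/fst0; rewrite mulmxBr mulmxDr.
  apply/eqP; rewrite subr_eq0; apply/eqP/(addrI (L a *m s a)).
  by rewrite -hE addrA -hE -hE.
have ex j : exists t : I -> K, (forall a, loc (f a) 0 (t a)) /\
    forall a b, h a b j 0 = t b - t a.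
  by apply: H1_O => [a b|a b c]; [apply: hl|rewrite (hc a b c) mxE].
have [t tP] := choice ex; pose T a : 'cV[K]_k := \col_j t j a.
have Tl a : mloc (f a) 0 (T a) by move=> i j; rewrite mxE; have [+ _] := tP i; apply.
have hT a b : h a b = T b - T a.
  by apply/colP => j; have [_ ->] := tP j; rewrite !mxE.
pose c := L (chart0 E) *m s (chart0 E) - P *m T (chart0 E).
have cE a : c = L a *m s a - P *m T a.
  rewrite (hE (chart0 E) a) hT mulmxBr /c -!addrA; congr (_ + _).
  by rewrite addrC subrK.
have cl a : mloc (f a) 1 c.
  rewrite (cE a); apply: good_sub => //; have [Ll _] := Lker a.
    exact: (@good_mul _ _ (cg a) _ _ _ 0 1).
  by apply: (@good_mul _ _ (cg a) _ _ _ 1 0) => //; apply: good_fst.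
have [|sg sgE] := @sec_vec_surj F k J Junit c.
  move=> j; have [|p [pE ph _]] := @sections_poly F E 1 (c j 0); first by move=> a; apply: cl.
  by exists p => //; apply: ph.
exists sg.
  exists (fun a => - T a) => a; rewrite sgE mulmxN -cE; split=> //.
  by rewrite -[- T a]add0r; apply: good_sub => //; apply: good0.
apply/sec_vec_snd; rewrite sgE /c mulmxBr (mulmxA B (L _)) (mulmxA B P) complex mul0mx subr0.
by have [_ ->] := Lker (chart0 E); rewrite mul0mx.
Qed.

Lemma induces_comb c1 c2 s1 s2 z1 z2 : induces s1 z1 -> induces s2 z2 ->
  induces (c1 *: s1 + c2 *: s2) (cstK c1 *: z1 + cstK c2 *: z2).
Proof. by move=> h1 h2; apply: inducesD; apply: inducesZ. Qed.

Lemma inducesB s s' z z' : induces s z -> induces s' z' -> induces (s - s') (z - z').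
Proof.
move=> h /(inducesZ (-1)); have -> : cstK (-1 : F) = -1 by rewrite /cstK mpolyCN toKN mpolyC1 toK1.
by rewrite !scaleN1r; apply: inducesD.
Qed.

Lemma sum2 (U : zmodType) (g : 'I_2 -> U) : \sum_i g i = g 0 + g 1.
Proof. by rewrite !big_ord_recl big_ord0 addr0; congr (_ + g _); apply/val_inj. Qed.

Lemma special_section_basis : special E <-> exists s1 s2, section_basis J A s1 s2.
Proof.
split.
  move=> [b [bs bu]]; have [s1 i1 h1] := section_induced (bs 0).
  have [s2 i2 h2] := section_induced (bs 1); exists s1, s2; split=> //.
    move=> c1 c2 w e; have := induces_comb c1 c2 i1 i2; rewrite e => /triv_induces z0.
    have sz : is_section 1 (0 : V).
      have := induces_section (inducesZ 0 i1).
      by rewrite (_ : cstK (0 : F) = 0) ?scale0r //; apply: cstK0.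
    have [c [_ uc]] := bu _ sz; pose d : 'rV[F]_2 := \row_i (if i == 0 then c1 else c2).
    have : c = d by apply: uc; rewrite sum2 !mxE /= z0 subr0.
    have : c = 0 by apply: uc; rewrite sum2 !mxE cstK0 !scale0r addr0 subr0.
    move=> -> /esym/rowP d0; have := d0 0; have := d0 1; by rewrite !mxE /= => -> ->.
  move=> s /is_sec_induces[z iz sz]; have [c [zc _]] := bu z sz.
  move: zc; rewrite sum2 => zc; exists (c 0 0), (c 0 1); have := inducesB iz (induces_comb (c 0 0) (c 0 1) i1 i2).
  rewrite zc => /induces_zero[w e]; exists w.
  by rewrite -e addrC subrK.
move=> [s1 [s2 [h1 h2 ind gen]]].
have [z1 i1 sz1] := is_sec_induces h1; have [z2 i2 sz2] := is_sec_induces h2.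
exists (fun i => if i == 0 then z1 else z2); split; first by move=> i; case: ifP.
move=> z /section_induced[s is_ hs]; have [c1 [c2 [w e]]] := gen s hs.
have zE : z - (cstK c1 *: z1 + cstK c2 *: z2) = 0.
  apply: (@triv_induces w); rewrite -[triv_sec A w](addKr (c1 *: s1 + c2 *: s2)) -e addrC.
  by apply: inducesB => //; apply: induces_comb.
exists (\row_i (if i == 0 then c1 else c2)); split; first by rewrite sum2 !mxE /= zE.
move=> d; rewrite sum2 /= => dE.
have : induces ((c1 - d 0 0) *: s1 + (c2 - d 0 1) *: s2) 0.
  have := inducesB (induces_comb c1 c2 i1 i2) (induces_comb (d 0 0) (d 0 1) i1 i2).
  rewrite (_ : _ - _ = 0 :> V); last first.
    apply/eqP; rewrite subr_eq0; apply/eqP; move/eqP: zE; rewrite subr_eq0 => /eqP <-.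
    by move/eqP: dE; rewrite subr_eq0 => /eqP.
  by rewrite opprD addrACA -!scalerBl.
move=> /induces_zero[w' /ind [/eqP + /eqP]]; rewrite !subr_eq0 => /eqP e1 /eqP e2.
apply/rowP => i; rewrite mxE; case: eqP => [->|i0]; first by rewrite e1.
have -> : i = 1; last by rewrite e2.
by apply/val_inj; case: i i0 => -[|[|//]] lt i0 //; case: i0; apply/val_inj.
Qed.
End MonadSections.

Theorem corollary2p9 (R : realType) (k : nat) (hk : (2 <= k)%N)
    (E : bundle2 R[i]) (hE : instanton k E)
    (A : 'I_4 -> 'M[R[i]]_(k, 2 * k + 2)) (J : 'M[R[i]]_(2 * k + 2))
    (hAJ : monad_of A J E) :
  [/\ dim_le (Zk A J) 1,
      special E <-> dim_eq (Zk A J) 1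
    & special E -> smooth_conic (Zk A J)].
Proof.
have [[Jskew Junit] complex Arank [L [Lker Ltrans Llift]]] := hAJ; have [_ h0 _] := hE.
have Aiso := monad_isotropic complex; have Afree := monad_free Arank.
have Ajoint := monad_joint Junit Arank Ltrans Llift h0.
have sb := special_section_basis Junit complex Arank Lker Ltrans Llift.
have rk3 : special E -> \rank (jump_space J A) = 3%N.
  move=> /sb[s1 [s2 bas]].
  have fr := special_frame Jskew Junit (erefl _) hk Aiso Afree Ajoint bas.
  apply/eqP; rewrite eqn_leq (frame_rank Aiso fr) andbT.
  exact: (rank_jump_space Jskew Junit (erefl _) hk Aiso Afree).
split; first exact: (Zk_dim_le1 Jskew Junit hk Aiso Afree).
  split=> [/rk3|] /(dim_eq1_rank3 Jskew Junit hk Aiso Afree) // r3.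
  have [l0 [m [l1 cb]]] := exists_conic_basis Jskew Junit (erefl _) hk Aiso Afree r3.
  apply/sb; apply: (frame_section_basis Jskew Junit (erefl _) hk Aiso Afree Ajoint).
  exact: (conic_basis_frame Aiso cb).
by move=> /rk3; apply: (Zk_smooth_conic Jskew Junit hk Aiso Afree).
Qed.
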